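(* Let $M$ be a compact connected manifold of dimension $n\ge2$, possibly with boundary. (i) There exist a family of Riemannian metrics $g_\varepsilon$, $\varepsilon\in(0,1)$, of volume $1$ on $M$ and a constant $A>0$ (independent of $\varepsilon$) such that, for all $\varepsilon\in(0,1)$, $\lambda_1(M,g_\varepsilon)\le\varepsilon$ while $\mu_1^*(M,g_\varepsilon)\ge A$. (ii) There exist a family of Riemannian metrics $g_\varepsilon$, $\varepsilon\in(0,1)$, of volume $1$ on $M$ and a constant $A>0$ (independent of $\varepsilon$) such that $\lambda_1(M,g_\varepsilon)\to0$ as $\varepsilon\to0$ while $\mu_1^{**}(M,g_\varepsilon)\ge A$ for all $\varepsilon\in(0,1)$.
   Context: $v_g$ is the Riemannian volume element and $|M|_g$ the volume of $M$ with respect to $g$. For positive functions $\rho,\sigma$ on $M$ and $k\ge0$, $$\mu_k^g(\rho,\sigma)=\inf_{E\in S_{k+1}}\sup_{u\in E\setminus\{0\}}\frac{\int_M|\nabla u|^2\sigma\,v_g}{\int_Mu^2\rho\,v_g},$$ where $S_k$ is the set of $k$-dimensional vector subspaces of $H^1(M)$, and $\lambda_k(M,g)=\mu_k^g(1,1)$ (Laplace eigenvalues, Neumann if $\partial M\ne\emptyset$; numbering starts at $0$). The extremal eigenvalues are $\mu_k^*(M,g)=\sup_\rho\mu_k^g(\rho,1)$ and $\mu_k^{**}(M,g)=\sup_\sigma\mu_k^g(1,\sigma)$, the suprema being over positive continuous functions $\rho$, resp. $\sigma$, on $M$ with $\frac1{|M|_g}\int_M\rho\,v_g=1$, resp. $\frac1{|M|_g}\int_M\sigma\,v_g=1$.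 *)

(* Defs.v *)
From HB Require Import structures.
From mathcomp Require Import all_boot all_order all_algebra.
From mathcomp Require Import all_classical all_reals all_analysis.

Set Implicit Arguments.
Unset Strict Implicit.
Unset Printing Implicit Defensive.

Import Order.TTheory GRing.Theory Num.Theory.
Import numFieldNormedType.Exports.

Local Open Scope classical_set_scope.
Local Open Scope ring_scope.

Section Euclidean.
Context {R : realType}.

(* The condition bears on the first coordinate; quantifying over [i] only
   avoids assuming that [n] is a successor. *)
Definition half_space n : set 'rV[R]_n :=
  [set x | forall i : 'I_n, i = 0%N :> nat -> 0 <= x 0 i].

Fixpoint Ck (k n : nat) (W : normedModType R) (U : set 'rV[R]_n)
    (F : 'rV[R]_n -> W) : Prop :=
  (forall x, U x -> {for x, continuous F}) /\
  if k is k'.+1 then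
    forall i : 'I_n, (forall x, U x -> derivable F x (delta_mx 0 i)) /\
      Ck k' U (fun x => 'D_(delta_mx 0 i) F x)
  else True.

(* C^infinity on an arbitrary subset [A] of R^n: local existence of
   C^infinity extensions to open subsets of R^n. *)
Definition smooth_on n (W : normedModType R) (A : set 'rV[R]_n)
    (f : 'rV[R]_n -> W) : Prop :=
  forall x, A x -> exists (U : set 'rV[R]_n) (F : 'rV[R]_n -> W),
    [/\ open U, U x, forall k, Ck k U F & forall y, A y -> U y -> f y = F y].

(* Partial derivative of a smooth function on a relatively open subset of the
   half-space. The increment is taken on the right so that x + h e_i stays in
   the half-space; the value is the partial derivative at x of any smooth
   extension, at boundary points as well. *)
Definition partial n (i : 'I_n) (f : 'rV[R]_n -> R) (x : 'rV[R]_n) : R :=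
  lim (h^-1 * (f (x + h *: delta_mx 0 i) - f x) @[h --> 0^'+]).

Definition quad n (A : 'M[R]_n) (v : 'rV[R]_n) : R := (v *m A *m v^T) 0 0.

(* Lebesgue integral over R^n of a nonnegative Borel function, as an iterated
   integral (Tonelli). *)
Fixpoint lebesgue_int n : ('rV[R]_n -> \bar R) -> \bar R :=
  match n with
  | 0 => fun f => f 0
  | n'.+1 => fun f => (\int[lebesgue_measure]_(t in [set: R])
      lebesgue_int (fun y : 'rV[R]_n' => f (row_mx (t%:M : 'rV_1) y)))%E
  end.

End Euclidean.

Section Manifold.
Context (R : realType) (n : nat) (M : topologicalType).

Record chart := Chart {
  dom : set M;
  fwd : M -> 'rV[R]_n;
  bwd : 'rV[R]_n -> M;
  dom_open : open dom;
  img_open : exists2 V : set 'rV[R]_n,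
    open V & fwd @` dom = V `&` @half_space R n;
  fwdK : forall p, dom p -> bwd (fwd p) = p;
  fwd_continuous : {within dom, continuous fwd};
  bwd_continuous : {within fwd @` dom, continuous bwd}
}.

(* A smooth n-manifold with (possibly empty) boundary is a Hausdorff space with
   such an atlas; second countability is automatic for compact spaces. *)
Record atlas := Atlas {
  charts : set chart;
  charts_cover : forall p, exists c, charts c /\ dom c p;
  charts_smooth : forall c c', charts c -> charts c' ->
    smooth_on (fwd c @` (dom c `&` dom c')) (fwd c' \o bwd c)
}.

Definition chart_at (S : atlas) (p : M) : chart :=
  sval (cid (charts_cover S p)).

(* Jacobian matrix at [p] of the change of coordinates from [c] to [c'], for
   row vectors: a tangent vector with components [v] in [c] has components
   [v *m jac c c' p] in [c']. *)
Definition jac (c c' : chart) (p : M) : 'M[R]_n :=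
  \matrix_(i, j) partial i (fun x => fwd c' (bwd c x) 0 j) (fwd c p).

(* [gmat c p] is the Gram matrix at [p] of the coordinate frame of [c]; it is
   relevant only when [c] is in the atlas and [p] in its domain. *)
Record metric (S : atlas) := Metric {
  gmat :> chart -> M -> 'M[R]_n;
  gmat_sym : forall c p, charts S c -> dom c p -> (gmat c p)^T = gmat c p;
  gmat_pos : forall c p, charts S c -> dom c p ->
    forall v, v != 0 -> 0 < quad (gmat c p) v;
  gmat_smooth : forall c, charts S c ->
    smooth_on (fwd c @` dom c) (gmat c \o bwd c);
  gmat_coherent : forall c c' p, charts S c -> charts S c' ->
    dom c p -> dom c' p ->
    gmat c p = jac c c' p *m gmat c' p *m (jac c c' p)^T
}.

Definition smooth_fun (S : atlas) (f : M -> R) : Prop :=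
  forall c, charts S c ->
    smooth_on (W := R^o) (fwd c @` dom c) (f \o bwd c).

(* Components in each chart of a family of tangent vectors. *)
Definition vfield := chart -> M -> 'rV[R]_n.

Definition gradient (S : atlas) (g : metric S) (f : M -> R) : vfield :=
  fun c p =>
    (\row_i partial i (f \o bwd c) (fwd c p)) *m invmx (g c p).

Definition sqnorm (S : atlas) (g : metric S) (X : vfield) (p : M) : R :=
  let c := chart_at S p in quad (g c p) (X c p).

End Manifold.

Definition borel (M : ptopologicalType) := g_sigma_algebraType (@open M).

Section Riemannian.
Context (R : realType) (n : nat) (M : ptopologicalType).
Variable S : atlas R n M.
Local Notation meas := {measure set (borel M) -> \bar R}.

Definition measurable_vfield (X : vfield R n M) : Prop :=
  (forall c i, charts S c ->
     measurable_fun (dom c : set (borel M)) (fun p => X c p 0 i)) /\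
  (forall c c' p, charts S c -> charts S c' -> dom c p -> dom c' p ->
     X c' p = X c p *m jac c c' p).

Variable g : metric S.

Definition is_volume (mu : meas) : Prop :=
  forall c (B : set (borel M)), charts S c -> measurable B -> B `<=` dom c ->
    mu B = lebesgue_int (fun x =>
      (\1_(fwd c @` B) x * Num.sqrt (\det (g c (bwd c x))))%:E).

(* The Riemannian volume: on a second countable manifold there is exactly one
   measure satisfying [is_volume], so the second branch is never reached. *)
Definition volume : meas :=
  match pselect (exists mu, is_volume mu) with
  | left e => sval (cid e)
  | right _ => mzero
  end.

(* [u] belongs to H^1(M), the completion of the smooth functions on M for the
   norm (|u|_{L^2}^2 + |grad u|_{L^2}^2)^{1/2}, and its gradient is [X]. *)
Definition H1_gradient (u : M -> R) (X : vfield R n M) : Prop :=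
  [/\ measurable_fun [set: borel M] u,
      measurable_vfield X &
      exists phi : nat -> M -> R,
        [/\ forall j, smooth_fun S (phi j),
            (\int[volume]_p ((phi j p - u p) ^+ 2)%:E)%E @[j --> \oo]
              --> 0%E &
            (\int[volume]_p
               (sqnorm g (fun c q => gradient g (phi j) c q - X c q) p)%:E)%E
              @[j --> \oo] --> 0%E]].

Definition H1 : set (M -> R) := [set u | exists X, H1_gradient u X].

(* Elements of H^1(M) are represented by functions, equality in H^1(M) being
   almost everywhere equality. *)
Definition H1_subspace (k : nat) (E : set (M -> R)) : Prop :=
  exists b : 'I_k -> M -> R,
    [/\ forall i, H1 (b i),
        forall a : 'I_k -> R,
          {ae volume, forall p, \sum_i a i * b i p = 0} -> forall i, a i = 0 &
        E = [set u | H1 u /\ exists a : 'I_k -> R,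
          {ae volume, forall p, u p = \sum_i a i * b i p}]].

Definition rayleigh_values (rho sigma : M -> R) (E : set (M -> R)) :
    set (\bar R) :=
  [set r | exists (u : M -> R) (X : vfield R n M),
    [/\ E u, ~ {ae volume, forall p, u p = 0}, H1_gradient u X &
      r = ((\int[volume]_p (sqnorm g X p * sigma p)) /
           (\int[volume]_p (u p ^+ 2 * rho p)))%:E]].

Definition mu_k (k : nat) (rho sigma : M -> R) : \bar R :=
  ereal_inf [set ereal_sup (rayleigh_values rho sigma E) |
             E in H1_subspace k.+1].

Definition lambda_k (k : nat) : \bar R := mu_k k (fun=> 1) (fun=> 1).

Definition normalized_density (rho : M -> R) : Prop :=
  [/\ continuous rho, forall p, 0 < rho p &
      (fine (volume [set: M]))^-1 * (\int[volume]_p rho p) = 1].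

Definition mu_star (k : nat) : \bar R :=
  ereal_sup [set mu_k k rho (fun=> 1) | rho in normalized_density].

Definition mu_star2 (k : nat) : \bar R :=
  ereal_sup [set mu_k k (fun=> 1) sigma | sigma in normalized_density].

End Riemannian.

(* Main.v *)
From HB Require Import structures.
Require Import Defs.
From mathcomp Require Import all_boot all_order all_algebra.
From mathcomp Require Import all_classical all_reals all_analysis.
From mathcomp Require Import measurable_realfun ring lra.

(** All the metrics are deformations of one metric [g] on [M]. Around a
    point choose a bump function [h] and a cutoff [k] vanishing where [dh] does
    not, and equal to [1] outside a neighbourhood of the annulus carrying [dh].
    Rescale [G_eta = (eta + (1 - eta) k)^2 g + dh dh] to volume 1. The summand
    [dh dh] gives [|dh| <= 1], while the annulus has volume [O(eta^(n-1))], so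
    [h] is a test function showing [lambda_1 = O(eta)]; this uses [n >= 2].
    On the other hand [G_eta <= C g] and the volume densities satisfy
    [v_(G_eta) <= C v_g], hence the Dirichlet energy for [g] is controlled by
    the energies for [G_eta] weighted by [v_g / v_(G_eta)]: with that weight as
    [sigma], the Poincare inequality for [g] bounds [mu_1(1, sigma)] from below.
    For [rho], take a bump concentrated on a small ball where [G_eta] is a fixed
    multiple of [g], plus a small constant: only the Poincare inequality on that
    ball matters in the limit. Poincare inequalities are stated for the double
    integral of [(u x - u y)^2], which makes them easy to chain over
    overlapping sets. *)

Set Implicit Arguments.
Unset Strict Implicit.
Unset Printing Implicit Defensive.

Import Order.TTheory GRing.Theory Num.Theory.
Import numFieldNormedType.Exports.

Local Open Scope classical_set_scope.
Local Open Scope ring_scope.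

(** * Smooth functions *)

Section Calculus.
Context {R : realType}.

(** An eigenvalue here is an infimum over subspaces of a supremum over pairs of an $H^1$ function
    and a gradient for it. A lower bound needs one good pair in each plane, so inequalities for
    smooth functions suffice, up to a factor lost in the limit. The upper bound on lambda_1 is the
    delicate one: the supremum runs over every field that is a limit of gradients of approximations
    of a test function, so that the gradient must first be shown not to depend on the approximation.
    Likewise the volume is only specified by its values in charts, and its existence rests on the
    change of variables formula. Boundary points need no separate argument: a coordinate cube cut by
    the half-space is still a product of intervals, the calculus takes place on segments inside it,
    and the boundary face is a null set. No constant is sharp, only its independence of eta matters.
    In particular the factor normalising the volume is bounded above and below because the unscaled
    density is bounded by a constant and is at least 1 on a fixed open set. *)

Lemma open_ball_sub n (U : set 'rV[R]_n) x : open U -> U x ->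
  exists2 e : R, 0 < e & ball x e `<=` U.
Proof.
move=> oU Ux; have /nbhs_ballP[e /= e0 h] : nbhs x U by apply: open_nbhs_nbhs.
by exists e.
Qed.

Lemma mx_normP m n (A : 'M[R]_(m, n)) e : 0 <= e ->
  reflect (forall i j, `|A i j| <= e) (`|A| <= e).
Proof.
move=> e0; rewrite [ `|A|]/Num.norm /= mx_normrE; apply: (iffP (bigmax_leP _ _ _ _)).
  by move=> [_ h] i j; apply: (h (i, j)).
by move=> h; split=> // -[i j] _; exact: h.
Qed.

Lemma mx_norm_coord m n (A : 'M[R]_(m, n)) i j : `|A i j| <= `|A|.
Proof. by have /mx_normP := lexx `|A|; apply. Qed.

Lemma continuous_coordP (T : topologicalType) m n (F : T -> 'M[R]_(m, n)) x :
  {for x, continuous F} <-> forall i j, {for x, continuous (fun y => F y i j)}.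
Proof.
split=> [h i j|h].
  exact: (continuous_comp h (@coord_continuous _ _ _ i j (F x))).
apply/cvgrPdist_le => /= e e0; near=> y; apply/mx_normP; first exact: ltW.
move=> i j; rewrite !mxE; move: i j; near: y.
apply: filter_forall => i; apply: filter_forall => j.
exact: ((cvgrPdist_le _ _).1 (h i j)).
Unshelve. all: by end_near. Qed.

Lemma near_open (T : topologicalType) (U : set T) x (P : T -> Prop) :
  open U -> U x -> (forall y, U y -> P y) -> \forall y \near x, P y.
Proof. by move=> oU Ux h; apply: filterS h _; exact: open_nbhs_nbhs. Qed.

Lemma continuous_eq_open (T W : topologicalType) (U : set T) (f g : T -> W) x :
  open U -> U x -> (forall y, U y -> f y = g y) ->
  {for x, continuous f} -> {for x, continuous g}.
Proof.
move=> oU Ux fg cf; rewrite /prop_for /continuous_at -fg//.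
by apply: cvg_trans cf; apply: near_eq_cvg; exact: (near_open oU).
Qed.

Lemma derivable_eq_open n (W : normedModType R) (U : set 'rV[R]_n)
    (f g : 'rV[R]_n -> W) x v :
  open U -> U x -> (forall y, U y -> f y = g y) ->
  derivable f x v -> derivable g x v.
Proof. by move=> oU Ux fg; apply: near_eq_derivable; exact: (near_open oU). Qed.

Lemma derive_eq_open n (W : normedModType R) (U : set 'rV[R]_n)
    (f g : 'rV[R]_n -> W) x v :
  open U -> U x -> (forall y, U y -> f y = g y) -> 'D_v f x = 'D_v g x.
Proof. by move=> oU Ux fg; apply: near_eq_derive; exact: (near_open oU). Qed.

Section Ck_local.
Variables (n : nat) (U : set 'rV[R]_n).

Lemma Ck_sub k (W : normedModType R) (U' : set 'rV[R]_n) (f : 'rV[R]_n -> W) :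
  U' `<=` U -> Ck k U f -> Ck k U' f.
Proof.
move=> sU; elim: k f => [|k IH] f [cf h]; split => //.
- by move=> x /sU; exact: cf.
- by move=> x /sU; exact: cf.
- by move=> i; have [df /IH ?] := h i; split => // x /sU; exact: df.
Qed.

Lemma Ck_pred k (W : normedModType R) (f : 'rV[R]_n -> W) :
  Ck k.+1 U f -> Ck k U f.
Proof.
elim: k f => [|k IH] f [cf h]; split => //.
by move=> i; have [df /IH ?] := h i.
Qed.

Lemma Ck_continuous k (W : normedModType R) (f : 'rV[R]_n -> W) x :
  Ck k U f -> U x -> {for x, continuous f}.
Proof. by case: k => [|k] [h _]; exact: h. Qed.

Hypothesis oU : open U.

Lemma Ck_eq k (W : normedModType R) (f g : 'rV[R]_n -> W) :
  (forall x, U x -> f x = g x) -> Ck k U f -> Ck k U g.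
Proof.
elim: k f g => [|k IH] f g fg [cf h]; split => //.
- by move=> x Ux; apply: (continuous_eq_open oU Ux fg); exact: cf.
- by move=> x Ux; apply: (continuous_eq_open oU Ux fg); exact: cf.
- move=> i; have [df h'] := h i; split.
    by move=> x Ux; apply: (derivable_eq_open oU Ux fg); exact: df.
  by apply: IH h' => x Ux; exact: (derive_eq_open _ oU Ux fg).
Qed.

Lemma Ck_mxP k p q (F : 'rV[R]_n -> 'M[R]_(p, q)) :
  Ck k U F <-> forall i j, Ck (W := R) k U (fun x => F x i j).
Proof.
elim: k F => [|k IH] F.
  split=> [[cF _] i j|h].
    by split=> // x Ux; exact: ((continuous_coordP F x).1 (cF x Ux) i j).
  by split=> // x Ux; apply: (continuous_coordP F x).2 => i j; have [+ _] := h i j; apply.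
split=> [[cF h] a b|h].
  split; first by move=> x Ux; exact: ((continuous_coordP F x).1 (cF x Ux) a b).
  move=> i; have [df /IH h'] := h i; split; first by move=> x Ux; exact: ((derivable_mxP _ _ _).1 (df x Ux) a b).
  by apply: Ck_eq (h' a b) => x Ux; rewrite derive_mx ?mxE//; exact: df.
have dF i x : U x -> derivable F x (delta_mx 0 i).
  by move=> Ux; apply/derivable_mxP => a b; have [_ /(_ i)[+ _]] := h a b; apply.
split; first by move=> x Ux; apply: (continuous_coordP F x).2 => a b;
  have [+ _] := h a b; apply.
move=> i; split; first exact: dF.
apply/IH => a b; have [_ /(_ i)[_]] := h a b.
by apply: Ck_eq => x Ux; rewrite derive_mx ?mxE//; exact: dF.
Qed.

Lemma Ck_cst k (W : normedModType R) (a : W) : Ck k U (fun=> a).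
Proof.
elim: k a => [|k IH] a; (split; first by move=> x _; exact: cst_continuous) => //.
move=> i; split; first by move=> x _; exact: derivable_cst.
by apply: Ck_eq (IH 0) => x _; rewrite derive_cst.
Qed.

Implicit Types f g : 'rV[R]_n -> R.

Lemma Ck_add k f g : Ck k U f -> Ck k U g -> Ck k U (fun x => f x + g x).
Proof.
elim: k f g => [|k IH] f g [cf hf] [cg hg]; split => //.
- by move=> x Ux; apply: (@continuousD _ _ _ f g); [exact: cf|exact: cg].
- by move=> x Ux; apply: (@continuousD _ _ _ f g); [exact: cf|exact: cg].
- move=> i; have [df hf'] := hf i; have [dg hg'] := hg i; split.
    by move=> x Ux; apply: (@derivableD _ _ _ f g); [exact: df|exact: dg].
  apply: Ck_eq (IH _ _ hf' hg') => x Ux; rewrite -deriveD//.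
    exact: df.
  exact: dg.
Qed.

Lemma Ck_mul k f g : Ck k U f -> Ck k U g -> Ck k U (fun x => f x * g x).
Proof.
elim: k f g => [|k IH] f g.
  move=> [cf hf] [cg hg]; split => // x Ux.
  by apply: (@continuousM _ _ f g); [exact: cf|exact: cg].
move=> Cf Cg; have [cf hf] := Cf; have [cg hg] := Cg; split.
  by move=> x Ux; apply: (@continuousM _ _ f g); [exact: cf|exact: cg].
move=> i; have [df hf'] := hf i; have [dg hg'] := hg i; split.
  by move=> x Ux; apply: (@derivableM _ _ f g); [exact: df|exact: dg].
apply: Ck_eq (Ck_add (IH _ _ (Ck_pred Cf) hg') (IH _ _ (Ck_pred Cg) hf')).
move=> x Ux; rewrite (@deriveM _ _ f g)//; first exact: df.
exact: dg.
Qed.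

Lemma Ck_sum k (I : Type) (r : seq I) (P : pred I) (f : I -> 'rV[R]_n -> R) :
  (forall i, Ck k U (f i)) -> Ck k U (fun x => \sum_(i <- r | P i) f i x).
Proof.
move=> h; elim: r => [|i r IH].
  by apply: Ck_eq (Ck_cst k 0) => x _; rewrite big_nil.
case: (boolP (P i)) => Pi; last by apply: Ck_eq IH => x _; rewrite big_cons (negPf Pi).
by apply: Ck_eq (Ck_add (h i) IH) => x _; rewrite big_cons Pi.
Qed.

Lemma Ck_opp k f : Ck k U f -> Ck k U (fun x => - f x).
Proof.
move=> Cf; apply: Ck_eq (Ck_mul (Ck_cst k (-1 : R)) Cf) => x _.
by rewrite mulN1r.
Qed.

(** Induction on k: the derivative -(1/f)^2 f' is a product of C^k functions, because 1/f is C^k by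
    the induction hypothesis. *)
Lemma Ck_inv k f : (forall x, U x -> f x != 0) -> Ck k U f ->
  Ck k U (fun x => (f x)^-1).
Proof.
move=> f0; elim: k => [|k IH].
  by move=> [cf _]; split => // x Ux; exact: (continuousV (f0 x Ux) (cf x Ux)).
move=> Cf; have [cf hf] := Cf; split.
  by move=> x Ux; exact: (continuousV (f0 x Ux) (cf x Ux)).
move=> i; have [df hf'] := hf i; split.
  by move=> x Ux; exact: (derivableV (f0 x Ux) (df x Ux)).
have Ci := IH (Ck_pred Cf).
apply: Ck_eq (Ck_mul (Ck_opp (Ck_mul Ci Ci)) hf') => x Ux.
rewrite (deriveV (f0 x Ux) (df x Ux)).
by rewrite -expr2 -exprVn.
Qed.

Lemma Ck_coord k i : Ck k U (fun x : 'rV[R]_n => x 0 i).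
Proof.
have dc x v : is_derive x v (fun y : 'rV[R]_n => y 0 i) (v 0 i).
  have dx : derivable (@id 'rV[R]_n) x v by exact: derivable_id.
  split; first by move/derivable_mxP : dx; apply.
  by have := derive_mx dx; rewrite derive_id => /rowP/(_ i); rewrite mxE.
case: k => [|k]; (split; first by move=> x _; exact: coord_continuous) => //.
move=> j; split; first by move=> x _; case: (dc x (delta_mx 0 j)).
by apply: Ck_eq (Ck_cst k ((delta_mx 0 j : 'rV[R]_n) 0 i)) => x _; rewrite (@derive_val _ _ _ _ _ _ _ (dc _ _)).
Qed.

End Ck_local.
End Calculus.

(** * Continuous partial derivatives give differentiability *)

Section Differentiable.
Context {R : realType}.

Lemma is_derive_line (V W : normedModType R) (f : V -> W) (y v : V) (s : R) :
  derivable f (y + s *: v) v ->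
  is_derive s (1 : R) (fun s : R => f (y + s *: v)) ('D_v f (y + s *: v)).
Proof.
move=> df; have E : (fun h : R => h^-1 *: (((fun s : R => f (y + s *: v)) \o
    shift s) (h *: 1) - f (y + s *: v))) =
    (fun h => h^-1 *: ((f \o shift (y + s *: v)) (h *: v) - f (y + s *: v))).
  apply/funext => h /=; congr (_ *: (f _ - _)).
  by rewrite [h *: 1]mulr1 scalerDl addrCA.
by split; rewrite ?/derivable ?/derive E.
Qed.

(** The hypothesis is symmetric about 0 so that one lemma covers increments in both directions of a
    coordinate line. *)
Lemma MVT_le (phi dphi : R -> R) (t e : R) :
  (forall s, `|s| <= `|t| -> is_derive s (1 : R) phi (dphi s) /\ `|dphi s| <= e) ->
  `|phi t - phi 0| <= e * `|t|.
Proof.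
move=> h.
have cphi s : `|s| <= `|t| -> {for s, continuous phi}.
  move=> /h[[dphis _] _]; apply: differentiable_continuous.
  exact/derivable1_diffP.
have [t0|/ltW t0] := leP 0 t.
  have itvt s : s \in `[0, t] -> `|s| <= `|t|.
    by rewrite in_itv /= => /andP[s0 st]; rewrite !ger0_norm.
  have [||c cI ->] := @MVT_segment R phi dphi _ _ t0.
  - by move=> s /subset_itv_oo_cc /itvt /h[].
  - apply: continuous_in_subspaceT => s; rewrite inE => /itvt; exact: cphi.
  - by rewrite subr0 normrM ler_wpM2r//; case: (h _ (itvt _ cI)).
have itvt s : s \in `[t, 0] -> `|s| <= `|t|.
  by rewrite in_itv /= => /andP[st s0]; rewrite !ler0_norm// lerN2.
have [||c cI] := @MVT_segment R phi dphi _ _ t0.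
- by move=> s /subset_itv_oo_cc /itvt /h[].
- apply: continuous_in_subspaceT => s; rewrite inE => /itvt; exact: cphi.
- move=> E; rewrite distrC E sub0r mulrN normrN normrM ler_wpM2r//.
  by case: (h _ (itvt _ cI)).
Qed.

Lemma continuous_sum_fun (T : topologicalType) (I : Type) (r : seq I) (P : pred I)
    (f : I -> T -> R) x : (forall i, {for x, continuous (f i)}) ->
  {for x, continuous (fun y => \sum_(i <- r | P i) f i y)}.
Proof.
move=> h; elim: r => [|i r IH].
  rewrite (_ : (fun y => _) = cst 0); first exact: cst_continuous.
  by apply/funext => y; rewrite big_nil.
rewrite (_ : (fun y => _) = if P i
    then (fun y => f i y + \sum_(i <- r | P i) f i y)
    else (fun y => \sum_(i <- r | P i) f i y)); last first.
  by apply/funext => y; rewrite big_cons; case: (P i).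
by case: (P i) => //; apply: (@continuousD _ _ _ (f i)) => //; exact: h.
Qed.

(** The differential ['d f x] is an abstractly chosen map; the linear form with coefficients [a] is
    identified with it by uniqueness of the first-order expansion. *)
Lemma differentiable_approx n (f : 'rV[R]_n -> R) (x : 'rV[R]_n) (a : 'I_n -> R) :
  (forall e : R, 0 < e -> \forall h \near (0 : 'rV[R]_n),
    `|f (h + x) - f x - \sum_i h 0 i * a i| <= e * `|h|) ->
  differentiable f x.
Proof.
move=> H; pose d (h : 'rV[R]_n) : R := \sum_i h 0 i * a i.
have lin_d : linear d.
  move=> k u v; rewrite /d scaler_sumr -big_split; apply: eq_bigr => i _ /=.
  by rewrite !mxE mulrDl /GRing.scale /= mulrA.
pose dM := GRing.isLinear.Build _ _ _ _ _ lin_d.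
pose dL : {linear 'rV[R]_n -> R} := HB.pack d dM.
have cd : continuous dL.
  move=> y; apply: continuous_sum_fun => i.
  apply: (@continuousM _ _ (fun h : 'rV[R]_n => h 0 i) (cst (a i))).
    exact: coord_continuous.
  exact: cst_continuous.
have key : f \o shift x = cst (f x) + dL +o_ (0 : 'rV[R]_n) id.
  apply/eqaddoP => e e0; have := H e e0; apply: filterS => h.
  by move=> hh; rewrite /= /d in hh *; rewrite [X in `|X|](_ : _ = f (h + x) - f x - \sum_i h 0 i * a i)// /d opprD addrA.
have E : 'd f x = dL :> ('rV[R]_n -> R) by exact: diff_unique.
by apply/diff_locallyP; rewrite E; split.
Qed.

Lemma is_derive_mulr (c s : R) : is_derive s (1 : R) (fun s : R => s * c) c.
Proof.
have := is_deriveM (is_derive_id s (1 : R)) (is_derive_cst c s (1 : R)).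
by move=> /is_derive_eq; apply; rewrite scaler0 add0r /GRing.scale /= mulr1.
Qed.

(** Stages of the path from 0 to [h] that switches the coordinates on one at a time, each stage
    moving along a coordinate line. *)
Let trunc n (h : 'rV[R]_n) k := \row_(j < n) (if (j < k)%N then h 0 j else 0).

(** The increment of f telescopes along the path [trunc]. On each leg the mean value inequality is
    applied to f minus its linear part, whose derivative is small by continuity of the partial
    derivative. *)
Lemma Ck1_differentiable n (U : set 'rV[R]_n) (f : 'rV[R]_n -> R) x :
  open U -> Ck 1 U f -> U x -> differentiable f x.
Proof.
move=> oU [_ h] Ux; pose D i := 'D_(delta_mx 0 i) f.
have df i z : U z -> derivable f z (delta_mx 0 i) by move=> Uz; have [+ _] := h i; apply.
have cD i : {for x, continuous (D i)} by have [_ [+ _]] := h i; apply.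
apply: (@differentiable_approx _ _ _ (fun i => D i x)) => e e0.
(* There are n legs, each contributing this much; n.+1 instead of n keeps dimension 0 harmless. *)
have e'0 : 0 < e / n.+1%:R by rewrite divr_gt0.
have : \forall z \near x, U z /\ forall i, `|D i z - D i x| <= e / n.+1%:R.
  near=> z; split; first by near: z; exact: open_nbhs_nbhs.
  near: z; apply: filter_forall => i.
  by have /cvgrPdist_le /(_ _ e'0) := cD i; apply: filterS => z; rewrite distrC.
case/nbhs_ballP => d /= d0 B; apply/nbhs_ballP; exists d => //= y.
rewrite -ball_normE /= sub0r normrN => yd.
have tr j k : `|(trunc y k) 0 j| <= `|y|.
  by rewrite mxE; case: ifP => _; [exact: mx_norm_coord|rewrite normr0].
have Bz (k : 'I_n) s : `|s| <= `|y 0 k| ->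
    ball x d ((x + trunc y k) + s *: delta_mx 0 k).
  move=> sk; rewrite -ball_normE /= opprD addrA opprD addrA subrr sub0r.
  rewrite -opprD normrN; apply: le_lt_trans yd; apply/mx_normP => // i j.
  rewrite ord1 !mxE eqxx /=; case: (eqVneq j k) => [->|jk].
    by rewrite ltnn add0r mulr1 (le_trans sk)// mx_norm_coord.
  by rewrite mulr0 addr0; case: ifP => _; rewrite ?normr0// mx_norm_coord.
have step (k : 'I_n) : `|f (x + trunc y k.+1) - f (x + trunc y k) - y 0 k * D k x|
    <= (e / n.+1%:R) * `|y|.
  pose phi s := f ((x + trunc y k) + s *: delta_mx 0 k) - s * D k x.
  have -> : f (x + trunc y k.+1) - f (x + trunc y k) - y 0 k * D k x =
      phi (y 0 k) - phi 0.
    rewrite /phi scale0r addr0 mul0r subr0 addrAC; congr (f _ - _ - _).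
    rewrite -addrA; congr (_ + _); apply/rowP => j; rewrite !mxE eqxx /=.
    rewrite ltnS leq_eqVlt; case: (eqVneq j k) => [->|jk].
      by rewrite eqxx ltnn add0r mulr1.
    by have /= -> : (val j == val k) = false := negPf jk; rewrite mulr0 addr0.
  apply: le_trans (@MVT_le phi (fun s => D k ((x + trunc y k) + s *: delta_mx 0 k)
      - D k x) _ (e / n.+1%:R) _) _; last first.
    by rewrite ler_wpM2l ?mx_norm_coord// ltW.
  move=> s /Bz /B [Uz Dz]; split; last exact: Dz.
  apply: is_deriveB.
    exact/is_derive_line/df.
  exact: is_derive_mulr.
have -> : f (y + x) - f x = \sum_(k < n) (f (x + trunc y k.+1) - f (x + trunc y k)).
  rewrite -(big_mkord xpredT (fun k => f (x + trunc y k.+1) - f (x + trunc y k))).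
  rewrite telescope_sumr//; congr (f _ - f _).
    by rewrite addrC; congr (_ + _); apply/rowP => j; rewrite mxE ltn_ord.
  by rewrite -[LHS]addr0; congr (_ + _); apply/rowP => j; rewrite !mxE.
rewrite -sumrB (le_trans (ler_norm_sum _ _ _))//.
apply: le_trans (ler_sum _ (fun k _ => step k)) _.
rewrite sumr_const card_ord -[leLHS]mulr_natl mulrA ler_wpM2r//.
by rewrite mulrCA ger_pMr// ler_pdivrMr// mul1r ler_nat.
Unshelve. all: by end_near. Qed.

End Differentiable.

(** * Chain rule, smoothness on arbitrary subsets, partial derivatives up to the boundary *)

Section Smooth.
Context {R : realType}.

Lemma derive_sum_delta n (f : 'rV[R]_n -> R) y v : differentiable f y ->
  'D_v f y = \sum_j v 0 j * 'D_(delta_mx 0 j) f y.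
Proof.
move=> df; rewrite deriveE// {1}[v]row_sum_delta linear_sum.
by apply: eq_bigr => j _; rewrite linearZ /= deriveE.
Qed.

(** G is only assumed derivable in the direction v. Its restriction c to the line through x is a
    curve, for which derivability is differentiability, so the chain rule for differentials applies
    to F \o c at 0. *)
Lemma is_derive_comp (V W Z : normedModType R) (F : W -> Z) (G : V -> W) x v :
  differentiable F (G x) -> derivable G x v ->
  is_derive x v (F \o G) ('D_('D_v G x) F (G x)).
Proof.
move=> dF dG; pose c (h : R) := G (h *: v + x).
have E (T : normedModType R) (k : V -> T) :
    (fun h : R => h^-1 *: (((fun h : R => k (h *: v + x)) \o shift 0) (h *: 1)
       - k (0 *: v + x))) =
    (fun h => h^-1 *: ((k \o shift x) (h *: v) - k x)).
  by apply/funext => h /=; rewrite addr0 scale0r add0r [h *: 1]mulr1.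
have c0 : c 0 = G x by rewrite /c scale0r add0r.
have dc : differentiable c 0.
  by apply/derivable1_diffP; rewrite /derivable /c (E _ G).
have cv : 'd c 0 1 = 'D_v G x by rewrite -deriveE// /derive /c (E _ G).
have dF0 : differentiable F (c 0) by rewrite c0.
have dFc : differentiable (F \o c) 0 by exact: differentiable_comp.
have dFc1 : derivable (F \o c) 0 1 by exact/derivable1_diffP.
have val : 'D_1 (F \o c) 0 = 'D_('D_v G x) F (G x).
  by rewrite deriveE// diff_comp//= cv c0 (deriveE _ dF).
move: dFc1 val; rewrite /derivable /derive /comp /c (E _ (F \o G)) => d1 v1.
by split; [exact: d1|exact: v1].
Qed.

Lemma open_preimage_on (T T' : topologicalType) (U : set T) (W : set T')
    (f : T -> T') : open U -> open W -> (forall x, U x -> {for x, continuous f}) ->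
  open (U `&` f @^-1` W).
Proof.
move=> oU oW cf; rewrite openE => x [Ux Wfx]; apply: filterI.
  by apply: open_nbhs_nbhs.
by apply: (cf x Ux); apply: open_nbhs_nbhs.
Qed.

(** Induction on k with F and G general: by the chain rule a partial derivative of F \o G is a sum
    of products of a derivative of G and a derivative of F composed with G. *)
Lemma Ck_comp m n k (U : set 'rV[R]_n) (W : set 'rV[R]_m)
    (G : 'rV[R]_n -> 'rV[R]_m) (F : 'rV[R]_m -> R) :
  open U -> open W -> (forall x, U x -> W (G x)) ->
  Ck k U G -> Ck k W F -> Ck k U (F \o G).
Proof.
move=> oU oW GUW; elim: k F G GUW => [|k IH] F G GUW CG CF.
  split => // x Ux; apply: continuous_comp; first exact: (Ck_continuous CG).
  by apply: (Ck_continuous CF); exact: GUW.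
split=> [x Ux|i].
  apply: continuous_comp; first exact: (Ck_continuous CG).
  by apply: (Ck_continuous CF); exact: GUW.
have CF1 : Ck 1 W F.
  by case: (CF) => cF h; split => // j; have [dF /Ck_continuous h'] := h j;
     split => //; split => // x; exact: h'.
have dG x : U x -> derivable G x (delta_mx 0 i).
  by case: CG => _ /(_ i)[+ _]; apply.
have D x : U x -> is_derive x (delta_mx 0 i) (F \o G)
    (\sum_j 'D_(delta_mx 0 i) G x 0 j * 'D_(delta_mx 0 j) F (G x)).
  move=> Ux; have dF : differentiable F (G x).
    by apply: (Ck1_differentiable oW CF1); exact: GUW.
  by rewrite -derive_sum_delta//; apply: is_derive_comp => //; exact: dG.
split; first by move=> x /D [].
apply: (@Ck_eq _ _ _ oU _ _
  (fun x => \sum_j 'D_(delta_mx 0 i) G x 0 j * 'D_(delta_mx 0 j) F (G x))).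
  by move=> x /D[].
apply: (Ck_sum oU) => j; apply: (Ck_mul oU).
  by move: j; case: CG => _ /(_ i)[_ +] j; move=> /(Ck_mxP oU) /(_ 0 j).
apply: (IH ('D_(delta_mx 0 j) F) G) => //; first exact: Ck_pred.
by case: CF => _ /(_ j)[].
Qed.

Section smooth_on_theory.
Variables (n : nat).
Implicit Types (A B : set 'rV[R]_n) (f g : 'rV[R]_n -> R).

Lemma smooth_on_eq (W : normedModType R) A (f g : 'rV[R]_n -> W) :
  (forall x, A x -> f x = g x) -> smooth_on A f -> smooth_on A g.
Proof.
move=> fg h x Ax; have [U [F [oU Ux CF fF]]] := h x Ax.
by exists U, F; split => // y Ay Uy; rewrite -fg// fF.
Qed.

Lemma smooth_on_sub (W : normedModType R) A B (f : 'rV[R]_n -> W) :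
  B `<=` A -> smooth_on A f -> smooth_on B f.
Proof.
move=> BA h x Bx; have [U [F [oU Ux CF fF]]] := h x (BA _ Bx).
by exists U, F; split => // y By Uy; apply: fF => //; exact: BA.
Qed.

Lemma smooth_on_local (W : normedModType R) A (f : 'rV[R]_n -> W) :
  (forall x, A x -> exists2 U, open U /\ U x & smooth_on (A `&` U) f) ->
  smooth_on A f.
Proof.
move=> h x Ax; have [U [oU Ux] s] := h x Ax.
have [V [F [oV Vx CF fF]]] := s x (conj Ax Ux).
exists (V `&` U), F; split => //; first exact: openI.
  by move=> k; apply: Ck_sub (CF k) => y [].
by move=> y Ay [Vy Uy]; apply: fF.
Qed.

Lemma smooth_on_cst (W : normedModType R) A (a : W) : smooth_on A (fun=> a).
Proof.
move=> x Ax; exists setT, (fun=> a); split => //; first exact: openT.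
by move=> k; exact: (Ck_cst openT).
Qed.

Lemma smooth_on_Ck (W : normedModType R) A U (f : 'rV[R]_n -> W) :
  open U -> A `<=` U -> (forall k, Ck k U f) -> smooth_on A f.
Proof. by move=> oU AU Cf x Ax; exists U, f; split => //; exact: AU. Qed.

Lemma smooth_on_add A f g :
  smooth_on A f -> smooth_on A g -> smooth_on A (fun x => f x + g x).
Proof.
move=> hf hg x Ax; have [U [F [oU Ux CF fF]]] := hf x Ax.
have [V [G [oV Vx CG gG]]] := hg x Ax.
exists (U `&` V), (fun x => F x + G x); have oUV := openI oU oV; split => //.
  move=> k; apply: (Ck_add oUV).
    by apply: Ck_sub (CF k) => y [].
  by apply: Ck_sub (CG k) => y [].
by move=> y Ay [Uy Vy]; rewrite fF// gG.
Qed.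

Lemma smooth_on_mul A f g :
  smooth_on A f -> smooth_on A g -> smooth_on A (fun x => f x * g x).
Proof.
move=> hf hg x Ax; have [U [F [oU Ux CF fF]]] := hf x Ax.
have [V [G [oV Vx CG gG]]] := hg x Ax.
exists (U `&` V), (fun x => F x * G x); have oUV := openI oU oV; split => //.
  move=> k; apply: (Ck_mul oUV).
    by apply: Ck_sub (CF k) => y [].
  by apply: Ck_sub (CG k) => y [].
by move=> y Ay [Uy Vy]; rewrite fF// gG.
Qed.

Lemma smooth_on_sum A (I : Type) (r : seq I) (P : pred I)
    (f : I -> 'rV[R]_n -> R) : (forall i, smooth_on A (f i)) ->
  smooth_on A (fun x => \sum_(i <- r | P i) f i x).
Proof.
move=> h; elim: r => [|i r IH].
  by apply: smooth_on_eq (smooth_on_cst 0) => x _; rewrite big_nil.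
case: (boolP (P i)) => Pi; last first.
  by apply: smooth_on_eq IH => x _; rewrite big_cons (negPf Pi).
by apply: smooth_on_eq (smooth_on_add (h i) IH) => x _; rewrite big_cons Pi.
Qed.

Lemma smooth_on_mxP p q A (F : 'rV[R]_n -> 'M[R]_(p, q)) :
  smooth_on A F <-> forall i j, smooth_on (W := R) A (fun x => F x i j).
Proof.
split=> [h i j x Ax|h x Ax].
  have [U [G [oU Ux CG FG]]] := h x Ax; exists U, (fun x => G x i j); split => //.
    by move=> k; exact: ((Ck_mxP oU k G).1 (CG k) i j).
  by move=> y Ay Uy; rewrite FG.
have /choice[UG hUG] (ij : 'I_p * 'I_q) : exists UG : set 'rV[R]_n * ('rV[R]_n -> R),
    [/\ open UG.1, UG.1 x, forall k, Ck k UG.1 UG.2 &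
     forall y, A y -> UG.1 y -> F y ij.1 ij.2 = UG.2 y].
  by have [U [G [oU Ux CG FG]]] := h ij.1 ij.2 x Ax; exists (U, G).
(* The extensions of the entries live on different neighbourhoods of x; there are finitely many, so
   their intersection still contains x in its interior. *)
pose U0 := [set y | forall ij, (UG ij).1 y].
have oU : open U0°%classic by exact: open_interior.
exists U0°%classic, (fun y => \matrix_(i, j) (UG (i, j)).2 y); split => //.
- have : \forall y \near x, forall ij, (UG ij).1 y.
    near=> y => ij; move: ij; near: y; apply: filter_forall => ij.
    by have [oUij Uijx _ _] := hUG ij; apply: open_nbhs_nbhs.
  by [].
- move=> k; apply/(Ck_mxP oU) => i j; have [_ _ C _] := hUG (i, j).
  apply: (Ck_eq oU _ (Ck_sub _ (C k))) => [y _|y /interior_subset]; last exact.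
  by rewrite mxE.
- move=> y Ay /interior_subset Uy; apply/matrixP => i j; rewrite mxE.
  by have [_ _ _ /(_ y Ay (Uy _)) <-] := hUG (i, j).
Unshelve. all: by end_near. Qed.

End smooth_on_theory.

Lemma smooth_on_comp m n (A : set 'rV[R]_n) (B : set 'rV[R]_m)
    (G : 'rV[R]_n -> 'rV[R]_m) (F : 'rV[R]_m -> R) :
  (forall x, A x -> B (G x)) -> smooth_on A G -> smooth_on B F ->
  smooth_on A (F \o G).
Proof.
move=> GAB hG hF x Ax; have [U [G' [oU Ux CG GG]]] := hG x Ax.
have [W [F' [oW Wx CF FF]]] := hF _ (GAB _ Ax).
have oU' : open (U `&` G' @^-1` W).
  by apply: open_preimage_on => // y Uy; exact: (Ck_continuous (CG 0%N)).
exists (U `&` G' @^-1` W), (F' \o G'); split => //.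
- by split => //; rewrite /= -GG.
- move=> k; apply: (Ck_comp oU' oW _ _ (CF k)) => [y []//|].
  by apply: Ck_sub (CG k) => y [].
- by move=> y Ay [Uy Wy]; rewrite /= -(GG y Ay Uy); apply: FF; [exact: GAB|rewrite GG].
Qed.

Section half_space_partial.
Variable n : nat.
Implicit Types (f : 'rV[R]_n -> R) (V : set 'rV[R]_n).
Local Notation H := (@half_space R n).

Lemma half_space_delta x (i : 'I_n) (h : R) : H x -> 0 <= h ->
  H (x + h *: delta_mx 0 i).
Proof.
move=> Hx h0 j j0; rewrite !mxE eqxx /= addr_ge0//; first exact: Hx.
by rewrite mulr_ge0.
Qed.

Lemma near_at_right_line V x (v : 'rV[R]_n) : open V -> V x ->
  \forall h \near (0 : R)^'+, V (x + h *: v).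
Proof.
move=> oV Vx; have c : (fun h : R => x + h *: v) @ (0 : R)^'+ --> x.
  apply: cvg_at_right_filter; rewrite -[X in _ --> X]addr0 -(scale0r v).
  apply: cvgD; first exact: cvg_cst.
  by apply: cvgZr_tmp; exact: cvg_id.
by apply: c; exact: open_nbhs_nbhs.
Qed.

(** For h > 0 the point x + h e_i stays in the half-space, where f and its extension F agree; the
    two-sided limit for F then restricts to the right. *)
Lemma partialE V f F x i : open V -> V x -> H x ->
  derivable F x (delta_mx 0 i) -> (forall y, V y -> H y -> f y = F y) ->
  partial i f x = 'D_(delta_mx 0 i) F x.
Proof.
move=> oV Vx Hx dF fF; apply: cvg_lim => //.
have : (fun h : R => h^-1 *: (F (h *: delta_mx 0 i + x) - F x)) @ 0^'+ -->
    'D_(delta_mx 0 i) F x.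
  by apply: cvg_dnbhs_at_right; exact: dF.
apply: cvg_trans; apply: near_eq_cvg.
have h0 : \forall h \near (0 : R)^'+, (0 : R) < h by exact: nbhs_right_gt.
near=> h; rewrite /= [h *: _ + x]addrC !fF//.
  by near: h; exact: near_at_right_line.
by apply: half_space_delta => //; apply: ltW; near: h.
Unshelve. all: by end_near. Qed.

End half_space_partial.
End Smooth.

(** * Smoothness of partial derivatives and a smooth step function *)

Section SmoothPartial.
Context {R : realType}.

Section ext.
Variables (n : nat) (V : set 'rV[R]_n).
Hypothesis oV : open V.
Local Notation H := (@half_space R n).
Local Notation A := (V `&` H).

Lemma smooth_on_ext (W : normedModType R) (f : 'rV[R]_n -> W) x :
  smooth_on A f -> A x -> exists (U : set 'rV[R]_n) (F : 'rV[R]_n -> W),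
    [/\ open U, U `<=` V, U x, forall k, Ck k U F & forall y, U y -> H y -> f y = F y].
Proof.
move=> sf Ax; have [U [F [oU Ux CF fF]]] := sf x Ax.
exists (U `&` V), F; split.
- exact: openI.
- by move=> y [].
- by split=> //; case: Ax.
- by move=> k; apply: Ck_sub (CF k) => y [].
- by move=> y [Uy Vy] Hy; apply: fF.
Qed.

Lemma Ck_derivable k (W : normedModType R) (U : set 'rV[R]_n) (F : 'rV[R]_n -> W) x i :
  Ck k.+1 U F -> U x -> derivable F x (delta_mx 0 i).
Proof. by move=> [_ /(_ i)[h _]]; exact: h. Qed.

Lemma smooth_on_partial (f : 'rV[R]_n -> R) i :
  smooth_on A f -> smooth_on (W := R) A (partial i f).
Proof.
move=> sf x Ax; have [U [F [oU UV Ux CF fF]]] := smooth_on_ext sf Ax.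
exists U, ('D_(delta_mx 0 i) F); split => //.
  by move=> k; have [_ /(_ i)[]] := CF k.+1.
move=> y [Vy Hy] Uy. by apply: (partialE oU Uy Hy (Ck_derivable (CF 1%N) Uy)).
Qed.

End ext.

(** Both maps are replaced by smooth extensions to open sets, where the interior chain rule holds,
    and [partialE] translates back, boundary points included. *)
Lemma partial_comp m n (V : set 'rV[R]_n) (W : set 'rV[R]_m)
    (G : 'rV[R]_n -> 'rV[R]_m) (f : 'rV[R]_m -> R) x i :
  open V -> open W ->
  (forall y, (V `&` @half_space R n) y -> (W `&` @half_space R m) (G y)) ->
  smooth_on (V `&` @half_space R n) G -> smooth_on (W `&` @half_space R m) f ->
  (V `&` @half_space R n) x ->
  partial i (f \o G) x = \sum_j partial i (fun y => G y 0 j) x * partial j f (G x).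
Proof.
move=> oV oW GVW sG sf Ax.
have [U [G' [oU UV Ux CG GG]]] := smooth_on_ext oV sG Ax.
have [U' [F' [oU' UW Ux' CF FF]]] := smooth_on_ext oW sf (GVW _ Ax).
have Hx : half_space x by case: Ax.
have oP : open (U `&` G' @^-1` U').
  by apply: open_preimage_on => // y; exact: (Ck_continuous (CG 0%N)).
have Gx : G x = G' x by rewrite GG.
have Px : (U `&` G' @^-1` U') x by split => //; rewrite /= -Gx.
have dG : derivable G' x (delta_mx 0 i) by exact: (Ck_derivable (CG 1%N) Ux).
have dF : differentiable F' (G' x).
  by apply: (Ck1_differentiable oU' (CF 1%N)); rewrite -Gx.
have dFG := is_derive_comp dF dG.
rewrite (@partialE _ _ _ (f \o G) (F' \o G') x i oP Px Hx); last 2 first.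
- by case: dFG.
- move=> y [Uy U'y] Hy; rewrite /= GG//; apply: FF => //.
  by rewrite -GG//; case: (GVW y (conj (UV _ Uy) Hy)).
rewrite (@derive_val _ _ _ _ _ _ _ dFG) derive_sum_delta//.
apply: eq_bigr => j _; congr (_ * _).
  rewrite derive_mx// mxE (@partialE _ _ _ _ (fun y => G' y 0 j) x i oU Ux Hx)//.
    exact: ((derivable_mxP _ _ _).1 dG 0 j).
  by move=> y Uy Hy; rewrite GG.
rewrite Gx (@partialE _ _ _ _ F' (G' x) j oU')//.
- by rewrite -Gx.
- by rewrite -Gx; case: (GVW _ Ax).
- by apply: (Ck_derivable (CF 1%N)); rewrite -Gx.
Qed.

(* The extra power [m] makes the family stable under derivation, up to linear
   combinations. *)
Definition flat (m : nat) (t : R) : R :=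
  if 0 < t then t^-1 ^+ m * expR (- t^-1) else 0.

(** With u = 1/t, the exponential series gives u^(m+2) / (m+2)! <= e^u. The two spare powers of t
    make the difference quotient at 0 tend to 0. *)
Lemma flat_bound m (t : R) : 0 < t -> flat m t <= (m.+2)`!%:R * t ^+ 2.
Proof.
move=> t0; rewrite /flat t0 expRN.
have u0 : 0 < t^-1 by rewrite invr_gt0.
have tn : t != 0 by rewrite gt_eqF.
have f0 : (m.+2)`!%:R != 0 :> R by rewrite pnatr_eq0 -lt0n fact_gt0.
have h : t^-1 ^+ m.+2 / (m.+2)`!%:R <= expR t^-1.
  by apply: le_trans (expR_ge1Dxn m.+1 (ltW u0)); rewrite lerDr.
rewrite ler_pdivrMr ?expR_gt0//.
have N0 : 0 <= (m.+2)`!%:R * t ^+ 2 by rewrite mulr_ge0// exprn_ge0// ltW.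
apply: le_trans (ler_wpM2l N0 h); rewrite le_eqVlt; apply/orP; left; apply/eqP.
rewrite (exprSr _ m.+1) (exprSr _ m); set a := t^-1 ^+ m.
by field; rewrite f0 tn.
Qed.

Lemma flat_ge0 m t : 0 <= flat m t.
Proof.
rewrite /flat; case: ifPn => // t0.
by rewrite mulr_ge0 ?expR_ge0// exprn_ge0// invr_ge0 ltW.
Qed.

Lemma is_derive_flat m (t : R) :
  is_derive t (1 : R) (flat m) (flat m.+2 t - m%:R * flat m.+1 t).
Proof.
have [t0|t0|t0] := ltgtP 0 t; last subst t.
- have tn : t != 0 by rewrite gt_eqF.
  have du : is_derive t (1 : R) (fun t : R => t^-1) (- t ^- 2).
    have d1 : derivable (@id R) t 1 by exact: derivable_id.
    split; first exact: (@derivableV _ _ id).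
    by rewrite (@deriveV _ _ id)//= derive_id [_ *: 1]mulr1.
  have de : is_derive t (1 : R) (fun t : R => expR (- t^-1))
      (t ^- 2 * expR (- t^-1)).
    have := @is_derive1_comp R expR (fun t : R => - t^-1) t _ _
      (is_derive_expR (- t^-1)) (is_deriveN du).
    by rewrite opprK mulrC.
  have D := is_deriveM (is_deriveX m du) de.
  apply: near_eq_is_derive (is_derive_eq D _).
    have : nbhs t [set s : R | 0 < s] by apply: open_nbhs_nbhs; split => //; exact: open_gt.
    by apply: filterS => s /= s0; rewrite /flat s0 /= mulrfctE exprfctE.
  rewrite /flat t0 /GRing.scale /= !fctE.
  by case: m {D} => [|m] /=; rewrite -!exprVn !exprS !expr0; ring.
- have : {near t, cst 0 =1 flat m}.
    have : nbhs t [set s : R | s < 0] by apply: open_nbhs_nbhs; split => //; exact: open_lt.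
    by apply: filterS => s /= s0; rewrite /flat ltNge ltW.
  move=> /near_eq_is_derive; apply; apply: is_derive_eq.
  by rewrite /flat ltNge ltW//= mulr0 subr0.
- rewrite [flat m.+2 0]/flat [flat m.+1 0]/flat ltxx mulr0 subr0.
  (* At 0 the difference quotient vanishes on the left and is at most (m+2)! h on the right. *)
  have c0 : (fun h : R => h^-1 *: ((flat m \o shift 0) (h *: 1) - flat m 0)) @ 0^'
     --> (0 : R).
    apply/cvgrPdist_le => /= e e0; near=> h.
    rewrite sub0r normrN addr0 [h *: 1]mulr1 [flat m 0]/flat ltxx subr0.
    have [h0|h0] := ltP 0 h; last by rewrite /flat ltNge h0 /= scaler0 normr0 ltW.
    rewrite ger0_norm ?mulr_ge0 ?flat_ge0 ?invr_ge0 ?(ltW h0)//.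
    rewrite /GRing.scale /= ler_pdivrMl//; apply: le_trans (flat_bound m h0) _.
    rewrite expr2 mulrCA ler_pM2l// -ler_pdivlMl ?ltr0n ?fact_gt0//.
    apply: ltW; rewrite -(gtr0_norm h0); near: h.
    apply: dnbhs0_lt; rewrite mulr_gt0// invr_gt0 ltr0n fact_gt0//.
  by split; [apply/cvg_ex; exists 0|exact: cvg_lim c0].
Unshelve. all: by end_near. Qed.

Lemma Ck_flat n (U : set 'rV[R]_n) (f : 'rV[R]_n -> R) k m : open U ->
  (forall k, Ck k U f) -> Ck (W := R) k U (flat m \o f).
Proof.
move=> oU Cf; elim: k m => [|k IH] m.
  split => // x Ux; apply: continuous_comp; first exact: (Ck_continuous (Cf 0%N)).
  apply: differentiable_continuous; apply/derivable1_diffP.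
  by case: (is_derive_flat m (f x)).
split.
  move=> x Ux; apply: continuous_comp; first exact: (Ck_continuous (Cf 0%N)).
  apply: differentiable_continuous; apply/derivable1_diffP.
  by case: (is_derive_flat m (f x)).
move=> i.
have D x : U x -> is_derive x (delta_mx 0 i) (flat m \o f)
   ((flat m.+2 (f x) - m%:R * flat m.+1 (f x)) * 'D_(delta_mx 0 i) f x).
  move=> Ux; have df : derivable f x (delta_mx 0 i) := Ck_derivable (Cf 1%N) Ux.
  have [d1 v1] := is_derive_flat m (f x).
  have dF : differentiable (flat m) (f x) by exact/derivable1_diffP.
  apply: is_derive_eq (is_derive_comp dF df) _.
  rewrite deriveE// -[X in 'd _ _ X]mulr1 -[_ * 1]/(_ *: 1) linearZ /= -deriveE// v1.
  by rewrite /GRing.scale /= mulrC.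
split; first by move=> x /D[].
apply: (@Ck_eq _ _ _ oU _ _ (fun x =>
  (flat m.+2 (f x) + (- m%:R) * flat m.+1 (f x)) * 'D_(delta_mx 0 i) f x)).
  by move=> x /D[_ ->]; rewrite mulNr.
apply: (Ck_mul oU); last by have [_ /(_ i)[]] := Cf k.+1.
by apply: (Ck_add oU); [exact: IH|apply: (Ck_mul oU); [exact: Ck_cst|exact: IH]].
Qed.

(** The usual cutoff, dropping from 1 to 0 on the interval from 1 to 2; the denominator is positive
    because 2 - t and t - 1 are never both nonpositive. *)
Definition smooth_step (t : R) : R :=
  flat 0 (2 - t) * (flat 0 (2 - t) + flat 0 (t - 1))^-1.

Lemma flat_gt0 m t : 0 < t -> 0 < flat m t.
Proof. by move=> t0; rewrite /flat t0 mulr_gt0 ?expR_gt0// exprn_gt0// invr_gt0. Qed.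

Lemma flat_eq0 m t : t <= 0 -> flat m t = 0.
Proof. by move=> t0; rewrite /flat ltNge t0. Qed.

Lemma smooth_step_den t : 0 < flat 0 (2 - t) + flat 0 (t - 1).
Proof.
have [t1|t1] := ltP 1 t.
  by rewrite ltr_wpDl ?flat_ge0// flat_gt0// subr_gt0.
by rewrite ltr_pwDl ?flat_ge0// flat_gt0//; lra.
Qed.

Lemma smooth_step1 t : t <= 1 -> smooth_step t = 1.
Proof.
move=> t1; rewrite /smooth_step [flat 0 (t - 1)]flat_eq0 ?subr_le0// addr0.
by rewrite divff// gt_eqF// flat_gt0//; lra.
Qed.

Lemma smooth_step0 t : 2 <= t -> smooth_step t = 0.
Proof. by move=> t2; rewrite /smooth_step flat_eq0 ?mul0r// subr_le0. Qed.

Lemma smooth_step_ge0 t : 0 <= smooth_step t.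
Proof. by rewrite mulr_ge0 ?flat_ge0// invr_ge0 ltW// smooth_step_den. Qed.

Lemma smooth_step_le1 t : smooth_step t <= 1.
Proof.
by rewrite /smooth_step ler_pdivrMr ?smooth_step_den// mul1r lerDl flat_ge0.
Qed.

Lemma smooth_step_gt0 t : t < 2 -> 0 < smooth_step t.
Proof.
by move=> t2; rewrite mulr_gt0 ?invr_gt0 ?smooth_step_den// flat_gt0// subr_gt0.
Qed.

Lemma Ck_smooth_step n (U : set 'rV[R]_n) (f : 'rV[R]_n -> R) k : open U ->
  (forall k, Ck k U f) -> Ck (W := R) k U (smooth_step \o f).
Proof.
move=> oU Cf.
have C1 j : Ck (W := R) j U (flat 0 \o (fun x => 2 + - f x)).
  by apply: Ck_flat => // l; apply: (Ck_add oU); [exact: Ck_cst|exact: Ck_opp].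
have C2 j : Ck (W := R) j U (flat 0 \o (fun x => f x + -1)).
  by apply: Ck_flat => // l; apply: (Ck_add oU) => //; exact: Ck_cst.
apply: (Ck_mul oU) => //; apply: (Ck_inv oU); last exact: (Ck_add oU).
by move=> x _; rewrite gt_eqF// smooth_step_den.
Qed.

End SmoothPartial.

(** * Lebesgue measure and change of variables in R^n *)

Import HBNNSimple.

(** * Measures with densities, pushforwards, Borel maps *)

Section MeasureTools.
Local Open Scope ereal_scope.

Section ind.
Context d (T : measurableType d) (R : realType).

(** The standard machine: a property that holds for indicators and is stable under scaling, sums and
    increasing limits holds for all nonnegative measurable functions, since these are increasing
    limits of simple functions. *)
Lemma ge0_fun_ind (P : (T -> \bar R) -> Prop) :
  (forall A, measurable A -> P (fun x => (\1_A x)%:E)) ->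
  (forall (k : R) (f : T -> \bar R), (0 <= k)%R -> measurable_fun setT f -> (forall x, 0 <= f x) ->
     P f -> P (fun x => k%:E * f x)) ->
  (forall f g : T -> \bar R, measurable_fun setT f -> (forall x, 0 <= f x) ->
     measurable_fun setT g -> (forall x, 0 <= g x) ->
     P f -> P g -> P (fun x => f x + g x)) ->
  (forall f_ : nat -> T -> \bar R, (forall n, measurable_fun setT (f_ n)) ->
     (forall n x, 0 <= f_ n x) -> (forall x, nondecreasing_seq (f_ ^~ x)) ->
     (forall n, P (f_ n)) -> P (fun x => limn (f_ ^~ x))) ->
  forall f : T -> \bar R, measurable_fun setT f -> (forall x, 0 <= f x) -> P f.
Proof.
move=> Pi PZ PD Pl f mf f0.
have P0 : P (fun=> 0).
  by have := Pi _ measurable0; under eq_fun do rewrite indic0.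
have Ps (h : {nnsfun T >-> R}) : P (fun x => (h x)%:E).
  have E : (fun x => (h x)%:E) = fun x =>
      \sum_(y <- finmap.enum_fset (fset_set (range h))) (y * \1_(h @^-1` [set y]) x)%:E.
    by apply/funext => x; rewrite fimfunE fsbig_finite//= sumEFin.
  pose S s x := \sum_(y <- s) (y * \1_(h @^-1` [set y]) x)%:E.
  have key (s : seq R) : [/\ measurable_fun setT (S s), (forall x, 0 <= S s x)
      & P (S s)].
    elim: s => [|y s [mS S0 PS]].
      have -> : S [::] = cst 0 by apply/funext => x; rewrite /S big_nil.
      by split => //; exact: measurable_cst.
    have my : measurable (h @^-1` [set y]) by exact: measurable_funPTI.
    have m1 : measurable_fun setT (fun x => (y * \1_(h @^-1` [set y]) x)%:E).
      apply/measurable_EFinP; apply: measurable_funM; first exact: measurable_cst.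
      exact: measurable_indic.
    have g1 x : 0 <= (y * \1_(h @^-1` [set y]) x)%:E by exact: nnfun_muleindic_ge0.
    have -> : S (y :: s) = fun x => (y * \1_(h @^-1` [set y]) x)%:E + S s x.
      by apply/funext => x; rewrite /S big_cons.
    split.
    - exact: emeasurable_funD.
    - by move=> x; rewrite adde_ge0.
    - apply: PD => //.
      have [y0|y0] := leP 0%R y.
        under eq_fun do rewrite EFinM; apply: PZ => //; last exact: Pi.
        by apply/measurable_EFinP; exact: measurable_indic.
      (* For y < 0 the term is nonpositive, and it is nonnegative because h does not take negative
         values; hence it vanishes. *)
      rewrite (_ : (fun x => _) = fun=> 0)//; apply/funext => x.
      apply/eqP; rewrite eq_le g1 andbT lee_fin.
      by rewrite mulr_le0_ge0// ltW.
  by rewrite E; case: (key (finmap.enum_fset (fset_set (range h)))).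
pose g := nnsfun_approx measurableT mf.
rewrite (_ : f = fun x => limn (EFin \o g ^~ x)).
  apply: (Pl (fun n x => (g n x)%:E)) => //.
  - by move=> n; exact/measurable_EFinP.
  - by move=> n x; rewrite lee_fin.
  - by move=> x m n mn; rewrite lee_fin; exact/lefP/nd_nnsfun_approx.
apply/funext => x; apply/esym/cvg_lim => //.
exact: (cvg_nnsfun_approx _ _ (fun x _ => f0 x)).
Qed.

End ind.

Section dens.
Context d (T : measurableType d) (R : realType) (mu : {measure set T -> \bar R}).
Variable w : T -> R.
Hypotheses (mw : measurable_fun setT w) (w0 : forall x, (0 <= w x)%R).

(** The two properties of [w] are arguments so that the measure structure can be attached to
    [dens mu mw w0]. *)
Definition dens of measurable_fun setT w & (forall x, (0 <= w x)%R) :=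
  fun A : set T => \int[mu]_(x in A) (w x)%:E.

Local Notation nu := (dens mw w0).

Let nu0 : nu set0 = 0. Proof. by rewrite /dens integral_set0. Qed.
Let nu_ge0 A : 0 <= nu A. Proof. by apply: integral_ge0 => x _; rewrite lee_fin. Qed.
Let nu_sigma : semi_sigma_additive nu.
Proof.
move=> F mF tF mUF; rewrite /dens ge0_integral_bigcup//.
- by apply: is_cvg_nneseries => n _ _; exact: nu_ge0.
- by apply: measurable_funTS; exact/measurable_EFinP.
- by move=> x _; rewrite lee_fin.
Qed.

HB.instance Definition _ := isMeasure.Build _ _ _ nu nu0 nu_ge0 nu_sigma.

End dens.

Section dens_theory.
Context d (T : measurableType d) (R : realType) (mu : {measure set T -> \bar R}).
Variable w : T -> R.
Hypotheses (mw : measurable_fun setT w) (w0 : forall x, (0 <= w x)%R).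

Lemma ge0_integral_densT (g : T -> \bar R) : measurable_fun setT g ->
  (forall x, 0 <= g x) -> \int[dens mu mw w0]_x g x = \int[mu]_x (g x * (w x)%:E).
Proof.
have w0' x : 0 <= (w x)%:E by rewrite lee_fin.
have mw' : measurable_fun setT (EFin \o w) by exact/measurable_EFinP.
move: g; apply: (@ge0_fun_ind _ T R).
- move=> A mA; rewrite integral_indic// setIT /= /dens integral_mkcond.
  apply: eq_integral => x _; rewrite patchE indicE; case: ifPn => xA.
    by rewrite mul1e.
  by rewrite mul0e.
- move=> k g k0 mg g0 IH; rewrite ge0_integralZl_EFin//.
  rewrite IH -ge0_integralZl_EFin//.
  + by apply: eq_integral => x _; rewrite muleA.
  + by move=> x _; rewrite mule_ge0.
  + exact: emeasurable_funM.
- move=> g h mg g0 mh h0 Ig Ih; rewrite ge0_integralD// Ig Ih -ge0_integralD//.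
  + by apply: eq_integral => x _; rewrite ge0_muleDl.
  + by move=> x _; rewrite mule_ge0.
  + exact: emeasurable_funM.
  + by move=> x _; rewrite mule_ge0.
  + exact: emeasurable_funM.
- move=> g mg g0 ndg IH; rewrite monotone_convergence//.
  under eq_fun do rewrite IH.
  rewrite -monotone_convergence//.
  + apply: eq_integral => x _; rewrite limeMr//.
    exact/ereal_nondecreasing_is_cvgn/ndg.
  + by move=> n; exact: emeasurable_funM.
  + by move=> n x _; rewrite mule_ge0.
  + by move=> x _ m n mn; rewrite lee_wpmul2r//; exact: ndg.
Qed.

Lemma ge0_integral_dens D (g : T -> \bar R) : measurable D -> measurable_fun D g ->
  (forall x, D x -> 0 <= g x) ->
  \int[dens mu mw w0]_(x in D) g x = \int[mu]_(x in D) (g x * (w x)%:E).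
Proof.
move=> mD mg g0; rewrite [LHS]integral_mkcond ge0_integral_densT.
- rewrite [RHS]integral_mkcond; apply: eq_integral => x _.
  by rewrite !patchE; case: ifPn => // _; rewrite mul0e.
- exact/(measurable_restrictT _ _).1.
- by move=> x; rewrite patchE; case: ifPn => // xD; exact/g0/set_mem.
Qed.

End dens_theory.

Section borel_maps.
Local Close Scope ereal_scope.

Lemma borel_open (M : ptopologicalType) (O : set (borel M)) :
  open (O : set M) -> measurable O.
Proof. by move=> oO; exact: sub_sigma_algebra. Qed.

Lemma borel_closed (M : ptopologicalType) (O : set (borel M)) :
  closed (O : set M) -> measurable O.
Proof.
move=> cO; rewrite -(setCK O); apply: measurableC; apply: borel_open.
exact: closed_openC.
Qed.

Lemma within_open_preimage (M N : topologicalType) (D : set M) (f : M -> N) (O : set N) :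
  {within D, continuous f} -> open O -> exists2 V : set M, open V &
    D `&` f @^-1` O = D `&` V.
Proof.
move=> /continuousP cf oO; have [V oV E] := (open_subspaceP D _).1 (cf O oO).
by exists V => //; rewrite [LHS]setIC [RHS]setIC E.
Qed.

Lemma within_continuous_borel (M N : ptopologicalType) (D : set (borel M))
    (f : borel M -> borel N) : measurable D ->
  {within (D : set M), continuous (f : M -> N)} -> measurable_fun D f.
Proof.
move=> mD cf; apply: (@measurability _ _ (borel M) (borel N) D f (@open N)) => //.
move=> _ [W oW <-]; have [V oV ->] := within_open_preimage cf oW.
by apply: measurableI => //; exact: borel_open.
Qed.

Lemma within_continuous_borelR (R : realType) (M : ptopologicalType)
    (D : set (borel M)) (f : borel M -> R) : measurable D ->
  {within (D : set M), continuous (f : M -> R)} -> measurable_fun D f.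
Proof.
move=> mD cf; apply: (measurability _ (RGenOpens.measurableE R)).
move=> _ [_ [a [b ->] <-]].
have [V oV ->] := within_open_preimage cf (@interval_open R (BSide false a) (BSide true b) erefl erefl).
by apply: measurableI => //; exact: borel_open.
Qed.

Lemma continuous_borelR (R : realType) (M : ptopologicalType) (f : borel M -> R) :
  continuous (f : M -> R) -> measurable_fun setT f.
Proof.
move=> cf; apply: within_continuous_borelR => //.
exact: continuous_subspaceT.
Qed.

Lemma continuous_borel (M N : ptopologicalType) (f : borel M -> borel N) :
  continuous (f : M -> N) -> measurable_fun setT f.
Proof.
move=> cf; apply: within_continuous_borel => //.
exact: continuous_subspaceT.
Qed.

End borel_maps.
End MeasureTools.

Section Pushforward.
Context d1 d2 (T1 : measurableType d1) (T2 : measurableType d2) (R : realType).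

Definition pushm (m : {measure set T1 -> \bar R}) (f : T1 -> T2)
    (mf : measurable_fun setT f) : {measure set T2 -> \bar R} :=
  measure_function_pushforward__canonical__measure_function_Measure m mf.

Lemma pushmE m f (mf : measurable_fun setT f) A : pushm m mf A = m (f @^-1` A).
Proof. by []. Qed.

Lemma ge0_integral_pushm m f (mf : measurable_fun setT f) (D : set T2)
    (g : T2 -> \bar R) : measurable D -> measurable_fun D g ->
  (forall y, D y -> 0 <= g y)%E ->
  (\int[pushm m mf]_(y in D) g y = \int[m]_(x in f @^-1` D) g (f x))%E.
Proof.
move=> mD mg g0; apply: (ge0_integral_pushforward mf m mD mg).
by move=> y /set_mem; exact: g0.
Qed.

End Pushforward.

Section SigmaFinite.
Context d (T : measurableType d) (R : realType).

(* An alias of [mu], on which the hypothesis can be found as an instance. *)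
Definition sfin (mu : {measure set T -> \bar R}) of sigma_finite setT mu :
  set T -> \bar R := mu.

Variables (mu : {measure set T -> \bar R}) (sf : sigma_finite setT mu).

HB.instance Definition _ := isMeasure.Build _ _ _ (sfin sf)
  (measure0 mu) (measure_ge0 mu) (@measure_semi_sigma_additive _ _ _ mu).

HB.instance Definition _ := Measure_isSigmaFinite.Build _ _ _ (sfin sf) sf.

End SigmaFinite.

(** * Construction of Lebesgue measure on row vectors *)

Section BorelRV.
Context {R : realType}.
Local Notation BV n := (borel 'rV[R]_n).

Lemma mx_norm_lt m n (A : 'M[R]_(m, n)) e : 0 < e ->
  (forall i j, `|A i j| < e) -> `|A| < e.
Proof.
move=> e0 h; rewrite [ `|A|]/Num.norm /= mx_normrE; apply/bigmax_ltP; split=> //.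
Qed.

Definition box n (a b : 'rV[R]_n) : set 'rV[R]_n :=
  [set x | forall i, a 0 i < x 0 i < b 0 i].

Lemma box_open n (a b : 'rV[R]_n) : open (box a b).
Proof.
rewrite openE => x xab; have e0 : \forall y \near x, forall i, a 0 i < (y : 'rV[R]_n) 0 i < b 0 i.
  near=> y => i; move: i; near: y; apply: filter_forall => i.
  have c : (fun y : 'rV[R]_n => y 0 i) @ x --> x 0 i by exact: coord_continuous.
  have o : open [set t : R | a 0 i < t < b 0 i].
    rewrite (_ : [set t | _] = `]a 0 i, b 0 i[%classic).
      exact: interval_open.
    by apply/seteqP; split => t; rewrite /= in_itv.
  apply: (c [set t : R | a 0 i < t < b 0 i]); apply: open_nbhs_nbhs.
  by split => //; exact: xab.
exact: e0.
Unshelve. all: by end_near. Qed.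

Lemma boxI n (a b c d : 'rV[R]_n) : box a b `&` box c d =
  box (\row_i Num.max (a 0 i) (c 0 i)) (\row_i Num.min (b 0 i) (d 0 i)).
Proof.
apply/seteqP; split => x.
  move=> [ab cd] i; rewrite !mxE gt_max lt_min.
  by have /andP[h1 h2] := ab i; have /andP[h3 h4] := cd i; rewrite h1 h2 h3 h4.
by move=> h; split=> i; have := h i; rewrite !mxE gt_max lt_min;
  case/andP => /andP[h1 h2] /andP[h3 h4]; rewrite ?h1 ?h2 ?h3 ?h4.
Qed.

(** Boxes with rational corners, enumerated through the encoding of a countable type: a countable
    basis of the topology. Indices that encode nothing give the empty set. *)
Definition rbox n (k : nat) : set 'rV[R]_n :=
  if @unpickle ('rV[rat]_n * 'rV[rat]_n)%type k is Some ab
  then box (map_mx ratr ab.1) (map_mx ratr ab.2) else set0.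

Lemma rbox_open n k : open (@rbox n k).
Proof. by rewrite /rbox; case: unpickle => [ab|]; [exact: box_open|exact: open0]. Qed.

Lemma rbox_basis n (O : set 'rV[R]_n) x : open O -> O x ->
  exists2 k, rbox k x & rbox k `<=` O.
Proof.
move=> oO Ox; have [e e0 eO] := open_ball_sub oO Ox.
have /choice[a ha] (i : 'I_n) : exists q : rat, x 0 i - e < ratr q < x 0 i.
  by have [q] := @rat_in_itvoo R (x 0 i - e) (x 0 i) ltac:(by rewrite ltrBlDr ltrDl);
    rewrite in_itv /=; exists q.
have /choice[b hb] (i : 'I_n) : exists q : rat, x 0 i < ratr q < x 0 i + e.
  by have [q] := @rat_in_itvoo R (x 0 i) (x 0 i + e) ltac:(by rewrite ltrDl);
    rewrite in_itv /=; exists q.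
exists (pickle (\row_i a i, \row_i b i)); rewrite /rbox pickleK /=.
  by move=> i; rewrite !mxE; have /andP[_ h1] := ha i; have /andP[h2 _] := hb i; rewrite h1 h2.
move=> y hy; apply: eO; rewrite -ball_normE /=; apply: mx_norm_lt => // i j.
rewrite ord1 !mxE ltr_norml; have := hy j; rewrite !mxE.
move: (ha j) (hb j) => /andP[h1 h2] /andP[h3 h4] /andP[h5 h6].
by apply/andP; split; lra.
Qed.

Lemma open_rbox n (O : set 'rV[R]_n) : open O ->
  O = \bigcup_(k in [set k | rbox k `<=` O]) rbox k.
Proof.
move=> oO; apply/seteqP; split => x; last by move=> [k kO xk]; exact: kO.
by move=> Ox; have [k kx kO] := rbox_basis oO Ox; exists k.
Qed.

Lemma measurable_fun_rV d (T : measurableType d) n (f : T -> BV n) :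
  (forall i, measurable_fun setT (fun x => f x 0 i : R)) -> measurable_fun setT f.
Proof.
move=> mf; apply: (@measurability _ _ T (BV n) setT f (@open 'rV[R]_n)) => //.
move=> _ [W oW <-]; rewrite setTI (open_rbox oW) preimage_bigcup.
apply: bigcup_measurable => k _; rewrite /rbox; case: unpickle => [[a b]|]; last first.
  by rewrite preimage_set0.
rewrite (_ : _ @^-1` _ = \bigcap_(i in [set: 'I_n])
   (setT `&` (fun x => f x 0 i : R) @^-1` `](map_mx ratr a) 0 i, (map_mx ratr b) 0 i[)).
  apply: fin_bigcap_measurable => [|i _]; first exact: finite_finset.
  exact: mf.
apply/seteqP; split => x /= h i; first by move=> _; split => //=; rewrite in_itv; exact: h.
by have [_ /=] := h i I; rewrite in_itv.
Qed.

Lemma measurable_coord n i : measurable_fun setT (fun x : BV n => x 0 i : R).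
Proof. by apply: continuous_borelR; exact: coord_continuous. Qed.

Lemma measurable_box n a b : measurable (box a b : set (BV n)).
Proof. by apply: borel_open; exact: box_open. Qed.

(** Boxes are stable under intersection, generate the Borel sets because every open set is a
    countable union of rational ones, and exhaust the space by cubes of finite measure. *)
Lemma measure_eq_box n (m1 m2 : {measure set (BV n) -> \bar R}) :
  (forall a b, m1 (box a b) = m2 (box a b)) ->
  (forall a b, (m1 (box a b) < +oo)%E) ->
  forall A, measurable A -> m1 A = m2 A.
Proof.
move=> m12 fin; pose g (k : nat) := box (const_mx (- k%:R)) (const_mx k%:R) : set (BV n).
apply: (@measure_unique _ _ (BV n) [set A | exists a b, A = box a b] g).
- apply/seteqP; split; last first.
    apply: smallest_sub; first exact: sigma_algebra_measurable.
    by move=> _ [a [b ->]]; exact: measurable_box.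
  apply: smallest_sub; first exact: smallest_sigma_algebra.
  move=> W oW; rewrite (open_rbox oW).
  rewrite bigcup_mkcond; apply: sigma_algebra_bigcup => k; case: ifPn => _; last exact: sigma_algebra0.
  rewrite /rbox; case: unpickle => [ab|]; last exact: sigma_algebra0.
  by apply: sub_sigma_algebra; eexists; eexists.
- by move=> _ _ [a [b ->]] [c [d ->]]; rewrite boxI; eexists; eexists.
- by move=> k; eexists; eexists.
- apply/seteqP; split => // x _; have [k kx] : exists k : nat, `|x| < k%:R.
    by exists (Num.truncn `|x|).+1; rewrite truncnS_gt.
  exists k => // i; rewrite !mxE -ltr_norml; apply: le_lt_trans kx; exact: mx_norm_coord.
- by move=> _ [a [b ->]]; exact: m12.
- by move=> k; exact: fin.
Qed.

(** The same splitting of a vector as in the recursion of [lebesgue_int], so that slices of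
    integrals match that definition. *)
Definition cons_rv n (t : R) (y : 'rV[R]_n) : 'rV[R]_n.+1 := row_mx (t%:M : 'rV_1) y.
Definition behead_rv n (x : 'rV[R]_n.+1) : 'rV[R]_n := \row_j x 0 (lift ord0 j).

Lemma cons_rv0 n t (y : 'rV[R]_n) : cons_rv t y 0 ord0 = t.
Proof.
have := row_mxEl (t%:M : 'M[R]_1) y 0 ord0; rewrite [X in _ = X]mxE eqxx mulr1n.
by move=> h; rewrite -[RHS]h; congr (row_mx _ _ _ _); apply: val_inj.
Qed.

Lemma cons_rvS n t (y : 'rV[R]_n) j : cons_rv t y 0 (lift ord0 j) = y 0 j.
Proof.
by rewrite -(row_mxEr (t%:M : 'M[R]_1) y 0 j); congr (row_mx _ _ _ _); apply: val_inj.
Qed.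

Lemma behead_consK n t (y : 'rV[R]_n) : behead_rv (cons_rv t y) = y.
Proof. by apply/rowP => j; rewrite mxE cons_rvS. Qed.

Lemma cons_beheadK n (x : 'rV[R]_n.+1) : cons_rv (x 0 ord0) (behead_rv x) = x.
Proof.
apply/rowP => i; case: (unliftP ord0 i) => [j|] ->; last by rewrite cons_rv0.
by rewrite cons_rvS mxE.
Qed.

Lemma box_cons n (a b : 'rV[R]_n.+1) t y : box a b (cons_rv t y) <->
  a 0 ord0 < t < b 0 ord0 /\ box (behead_rv a) (behead_rv b) y.
Proof.
split=> [h|[h1 h2] i].
  split; first by have := h ord0; rewrite cons_rv0.
  by move=> j; rewrite !mxE; have := h (lift ord0 j); rewrite cons_rvS.
case: (unliftP ord0 i) => [j|] ->; last by rewrite cons_rv0.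
by rewrite cons_rvS; have := h2 j; rewrite !mxE.
Qed.

Lemma measurable_cons_rv n : measurable_fun setT
  ((fun p : R * BV n => cons_rv p.1 p.2) : R * BV n -> BV n.+1).
Proof.
apply: measurable_fun_rV => i; case: (unliftP ord0 i) => [j|] ->.
  rewrite (_ : (fun x => _) = (fun y : BV n => y 0 j : R) \o (@snd R (BV n))); last first.
    by apply/funext => p; exact: (cons_rvS p.1 p.2 j).
  by apply: measurableT_comp; [exact: measurable_coord|exact: measurable_snd].
rewrite (_ : (fun x => _) = (@fst R (BV n))); last by apply/funext => p; exact: (cons_rv0 p.1 p.2).
exact: measurable_fst.
Qed.

Local Open Scope ereal_scope.

(** The first clause ties the measure to the iterated integral through which volumes are specified.
    The second gives sigma-finiteness, hence Tonelli in the inductive step, and identifies the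
    measure through [measure_eq_box]. *)
Definition is_leb n (mu : {measure set (BV n) -> \bar R}) :=
  (forall f : BV n -> \bar R, measurable_fun setT f -> (forall x, 0 <= f x) ->
    \int[mu]_x f x = lebesgue_int (f : 'rV[R]_n -> \bar R)) /\
  forall a b : 'rV[R]_n, (forall i, a 0%R i <= b 0%R i)%R ->
    mu (box a b) = (\prod_i (b 0%R i - a 0%R i))%:E.

Lemma finite_box_sigma_finite n (mu : {measure set (BV n) -> \bar R}) :
  (forall a b, mu (box a b) < +oo) -> sigma_finite setT mu.
Proof.
move=> fin; exists (fun k : nat => box (const_mx (- k%:R)%R) (const_mx k%:R)).
  apply/esym/seteqP; split => // x _; have [k kx] : exists k : nat, (`|x| < k%:R)%R.
    by exists (Num.truncn `|x|).+1; rewrite truncnS_gt.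
  exists k => // i; rewrite !mxE -ltr_norml; apply: le_lt_trans kx; exact: mx_norm_coord.
by move=> k; split; [exact: measurable_box|exact: fin].
Qed.

Lemma is_leb_box_fin n (mu : {measure set (BV n) -> \bar R}) : is_leb mu ->
  forall a b, mu (box a b) < +oo.
Proof.
move=> [_ h] a b; have s : box a b `<=` box (\row_i Num.min (a 0%R i) (b 0%R i)) b.
  by move=> x xab i; rewrite mxE gt_min; case/andP: (xab i) => -> ->.
apply: (le_lt_trans (le_measure mu (mem_set (measurable_box _ _))
  (mem_set (measurable_box _ _)) s)).
apply: le_lt_trans (ltry _); rewrite le_eqVlt; apply/orP; left; apply/eqP.
by apply: h => i; rewrite mxE ge_min lexx orbT.
Qed.

(** The product with the one-dimensional Lebesgue measure, transported by [cons_rv]; Tonelli in this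
    order is the recursion of [lebesgue_int]. *)
Lemma is_leb_step n (mu : {sigma_finite_measure set (BV n) -> \bar R}) :
  is_leb mu -> is_leb (pushm (@lebesgue_measure R \x mu) (@measurable_cons_rv n)).
Proof.
move=> Hmu; split=> [f mf f0|a b ab].
  rewrite ge0_integral_pushm//.
  rewrite preimage_setT fubini_tonelli1//; last first.
    exact: (measurableT_comp mf (@measurable_cons_rv n)).
  apply: eq_integral => t _; rewrite /fubini_F /=.
  have [h _] := Hmu; rewrite (h (fun y => f (cons_rv t y)))//.
  exact: (measurableT_comp mf (measurableT_comp (@measurable_cons_rv n)
    (@pair1_measurable _ _ R (BV n) t))).
rewrite pushmE (_ : _ @^-1` _ =
  `]a 0%R ord0, b 0%R ord0[%classic `*` (box (behead_rv a) (behead_rv b) : set (BV n))).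
  have E := product_measure1E (@lebesgue_measure R) mu
    (measurable_itv `]a 0%R ord0, b 0%R ord0[)
    (measurable_box (behead_rv a) (behead_rv b)).
  apply: etrans E _.
  have [_ /(_ (behead_rv a) (behead_rv b))h] := Hmu.
  have {}h := h (fun i => ltac:(by rewrite !mxE)).
  transitivity (@lebesgue_measure R `]a 0%R ord0, b 0%R ord0[%classic *
      (\prod_i (behead_rv b 0%R i - behead_rv a 0%R i))%:E); first by congr (_ * _).
  rewrite lebesgue_measure_itv /= lte_fin big_ord_recl.
  case: ltP => [_|ba].
    rewrite -EFinB -EFinM; congr (_ * _)%:E.
    by apply: eq_bigr => i _; rewrite !mxE.
  have -> : a 0%R ord0 = b 0%R ord0 by apply/eqP; rewrite eq_le ba ab.
  by rewrite subrr mul0r mul0e.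
apply/seteqP; split => -[t y] /=.
  by move=> /box_cons[h1 h2]; split=> //=; rewrite in_itv.
by move=> [h1 h2]; apply/box_cons; split => //; move: h1; rewrite /= in_itv.
Qed.

Lemma lebn_exists n : exists mu : {measure set (BV n) -> \bar R}, is_leb mu.
Proof.
elim: n => [|n [mu Hmu]].
  exists (dirac (0%R : BV 0)); split => [f mf f0|a b _].
    by rewrite integral_dirac// diracT mul1e.
  by rewrite big_ord0 /= /dirac indicE mem_set// => -[].
have sf := finite_box_sigma_finite (is_leb_box_fin Hmu).
pose muS : {sigma_finite_measure set (BV n) -> \bar R} := sfin sf.
have h : is_leb muS by exact: Hmu.
exists (pushm (@lebesgue_measure R \x muS) (@measurable_cons_rv n)).
exact: is_leb_step.
Qed.

Definition leb n : {measure set (BV n) -> \bar R} := sval (cid (lebn_exists n)).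

Lemma lebP n : is_leb (leb n).
Proof. exact: (svalP (cid (lebn_exists n))). Qed.

End BorelRV.

(** * Lebesgue measure under translations and invertible linear maps *)

Section LebLinear.
Context {R : realType}.
Local Notation BV n := (borel 'rV[R]_n).
Local Notation leb := (@leb R).
Local Open Scope ereal_scope.

Lemma leb_box n (a b : 'rV[R]_n) : (forall i, a 0%R i <= b 0%R i)%R ->
  leb n (box a b) = (\prod_i (b 0%R i - a 0%R i))%:E.
Proof. by have [_ h] := lebP (R := R) n; exact: h. Qed.

Lemma leb_box_fin n (a b : 'rV[R]_n) : leb n (box a b) < +oo.
Proof. exact: (is_leb_box_fin (lebP (R := R) n)). Qed.

Lemma leb_sigma_finite n : sigma_finite setT (leb n).
Proof. by apply: finite_box_sigma_finite => a b; exact: leb_box_fin. Qed.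

Lemma integral_leb n (f : BV n -> \bar R) : measurable_fun setT f ->
  (forall x, 0 <= f x) -> \int[leb n]_x f x = lebesgue_int (f : 'rV[R]_n -> \bar R).
Proof. by have [h _] := lebP (R := R) n; exact: h. Qed.

Lemma lebS n (A : set (BV n.+1)) : measurable A ->
  leb n.+1 A = pushm (@lebesgue_measure R \x (sfin (leb_sigma_finite n)))
     (@measurable_cons_rv R n) A.
Proof.
apply: measure_eq_box => a b; last exact: leb_box_fin.
have h : is_leb (sfin (leb_sigma_finite n)) by exact: lebP.
have [h1 h2] := is_leb_step h.
have [ab|nab] := pselect (forall i, a 0%R i <= b 0%R i)%R.
  by rewrite leb_box//; apply/esym; exact: h2.
have E : box a b = set0.
  rewrite -subset0 => x xab; apply: nab => i.
  by have /andP[h3 h4] := xab i; rewrite ltW// (lt_trans h3).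
by rewrite E !measure0.
Qed.

Lemma measurable_slice n (A : set (BV n.+1)) t : measurable A ->
  measurable ([set y | A (cons_rv t y)] : set (BV n)).
Proof.
move=> mA; have := measurableT_comp (@measurable_cons_rv R n)
    (@pair1_measurable _ _ R (BV n) t).
by move=> /(_ measurableT A mA); rewrite setTI.
Qed.

Lemma measurable_cslice n (A : set (BV n.+1)) y : measurable A ->
  measurable ([set t | A (cons_rv t y)] : set R).
Proof.
move=> mA; have := measurableT_comp (@measurable_cons_rv R n)
    (@pair2_measurable _ _ R (BV n) y).
by move=> /(_ measurableT A mA); rewrite setTI.
Qed.

Lemma leb_fubini1 n (A : set (BV n.+1)) : measurable A ->
  leb n.+1 A = \int[@lebesgue_measure R]_t leb n [set y | A (cons_rv t y)].
Proof.
move=> mA; rewrite lebS// pushmE /= /product_measure1; apply: eq_integral => t _.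
rewrite /=; congr (leb n _); apply/seteqP; split => y.
  by rewrite /xsection /= inE.
by rewrite /xsection /= inE.
Qed.

Lemma leb_fubini2 n (A : set (BV n.+1)) : measurable A ->
  leb n.+1 A = \int[leb n]_y @lebesgue_measure R [set t | A (cons_rv t y)].
Proof.
move=> mA; rewrite leb_fubini1//.
pose f (p : R * BV n) : \bar R := (\1_A (cons_rv p.1 p.2))%:E.
have mf : measurable_fun setT f.
  apply/measurable_EFinP; apply: (measurableT_comp (f := (\1_A : BV n.+1 -> R))).
    exact: measurable_indic.
  exact: measurable_cons_rv.
have f0 p : 0 <= f p by rewrite lee_fin.
have := @fubini_tonelli _ _ _ (BV n) R (@lebesgue_measure R)
  (sfin (leb_sigma_finite n)) f mf f0.
rewrite /fubini_F /fubini_G => E.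
transitivity (\int[@lebesgue_measure R]_x \int[leb n]_y f (x, y)).
  apply: eq_integral => t _; rewrite /f /=.
  rewrite -[X in leb n X]setIT -integral_indic//.
  exact: measurable_slice.
rewrite E; apply: eq_integral => y _; rewrite /f /=.
rewrite -[X in lebesgue_measure X]setIT -integral_indic//.
exact: measurable_cslice.
Qed.

Lemma measurable_translate n (v : 'rV[R]_n) :
  measurable_fun setT ((fun x => x + v)%R : BV n -> BV n).
Proof.
have c : continuous (fun x : 'rV[R]_n => x + v)%R.
  by move=> x; apply: (@continuousD _ _ _ id (cst v)); [|exact: cst_continuous].
exact: (continuous_borel c).
Qed.

Lemma leb_translate n (A : set (BV n)) (v : 'rV[R]_n) : measurable A ->
  leb n [set x | A (x + v)%R] = leb n A.
Proof.
have mv := measurable_translate v.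
have E a b : (fun x => x + v)%R @^-1` box a b = box (a - v)%R (b - v)%R.
  apply/seteqP; split => x h i; have := h i; rewrite !mxE => /andP[h1 h2];
    by apply/andP; split; lra.
apply: (@measure_eq_box R n (pushm (leb n) mv) (leb n)) => a b; last first.
  by rewrite pushmE E leb_box_fin.
rewrite pushmE E; have [ab|nab] := pselect (forall i, a 0%R i <= b 0%R i)%R.
  rewrite !leb_box// => [|i]; last by rewrite !mxE lerD2r.
  by congr (_%:E); apply: eq_bigr => i _; rewrite !mxE; ring.
have E0 (c d : 'rV[R]_n) : ~ (forall i, c 0%R i <= d 0%R i)%R -> box c d = set0.
  move=> ncd; rewrite -subset0 => x xab; apply: ncd => i.
  by have /andP[h3 h4] := xab i; rewrite ltW// (lt_trans h3).
rewrite !E0 ?measure0// => h; apply: nab => i; have := h i.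
by rewrite !mxE lerD2r.
Qed.

Lemma lebesgue_translate (A : set R) (s : R) : measurable A ->
  @lebesgue_measure R [set t | A (t + s)%R] = @lebesgue_measure R A.
Proof.
(* Translation invariance on the line is read off from row vectors of length 1, where boxes already
   gave it. *)
move=> mA; pose B : set (BV 1) := [set x | A (x 0%R ord0)].
have mB : measurable B.
  by have := @measurable_coord R 1 ord0 measurableT A mA; rewrite setTI.
have sl (C : set R) (mC : measurable [set x : BV 1 | C (x 0%R ord0)]) :
    leb 1 [set x | C (x 0%R ord0)] = lebesgue_measure C.
  rewrite leb_fubini2// [LHS](_ : _ = \int[leb 0]_y cst (lebesgue_measure C) y).
    rewrite integral_cst// [X in _ * X](_ : _ = 1) ?mule1//.
    rewrite (_ : setT = box (0%R : 'rV[R]_0) 0%R); first by rewrite leb_box ?big_ord0// => -[].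
    by apply/seteqP; split => // x _ [].
  apply: eq_integral => y _ /=; congr (lebesgue_measure _).
  by apply/seteqP; split => t /=; rewrite cons_rv0.
have mAs : measurable [set x : BV 1 | [set t | A (t + s)%R] (x 0%R ord0)].
  have := @measurable_translate 1 (const_mx s) measurableT B mB; rewrite setTI.
  by congr measurable; apply/seteqP; split => x; rewrite /B /= !mxE.
rewrite -(sl _ mAs) -(sl _ mB) -(@leb_translate 1 B (const_mx s))//.
by congr (leb 1 _); apply/seteqP; split => x; rewrite /B /= !mxE.
Qed.

(** Stated for preimages, which are measurable at once, hence the inverse determinant. The property
    is multiplicative, so it is enough to check elementary factors. *)
Definition scales n (L : 'M[R]_n) := forall A : set (BV n), measurable A ->
  leb n [set x | A (x *m L)%R] = (`|\det L|^-1)%:E * leb n A.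

Lemma measurable_mulmx n (L : 'M[R]_n) :
  measurable_fun setT ((fun x => x *m L)%R : BV n -> BV n).
Proof.
apply: continuous_borel => x; apply: (continuous_coordP _ _).2 => i j.
rewrite (_ : (fun y => _) = fun y : 'rV[R]_n => \sum_k y i k * L k j)%R; last first.
  by apply/funext => y; rewrite mxE.
apply: continuous_sum_fun => k.
apply: (@continuousM _ _ (fun h : 'rV[R]_n => h i k) (cst (L k j))).
  exact: coord_continuous.
exact: cst_continuous.
Qed.

Lemma measurable_mulmx_set n (L : 'M[R]_n) (A : set (BV n)) : measurable A ->
  measurable ([set x | A (x *m L)%R] : set (BV n)).
Proof. by move=> mA; have := measurable_mulmx L measurableT mA; rewrite setTI. Qed.

Lemma scalesM n (L K : 'M[R]_n) : scales L -> scales K -> scales (L *m K)%R.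
Proof.
move=> sL sK A mA; rewrite det_mulmx normrM invfM EFinM.
rewrite (_ : [set x | _] = [set x | [set y | A (y *m K)%R] (x *m L)%R]); last first.
  by apply/seteqP; split => x /=; rewrite mulmxA.
by rewrite sL ?sK ?muleA//; exact: measurable_mulmx_set.
Qed.

Lemma cons_block n (a : R) (v : 'rV[R]_n) (w : 'cV[R]_n) (S : 'M[R]_n) t y :
  (cons_rv t y *m (block_mx (a%:M : 'M[R]_1) v w S : 'M[R]_n.+1) =
   cons_rv (t * a + (y *m w) 0 0) (t *: v + y *m S))%R.
Proof.
rewrite /cons_rv (@mul_row_block _ 1 1 n 1 n); apply: (f_equal2 (@row_mx R 1 1 n)).
  by rewrite [in LHS](mx11_scalar (y *m w)) -scalar_mxM -raddfD.
by rewrite mul_scalar_mx.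
Qed.

Lemma det_block1 n (a : R) (v : 'rV[R]_n) (S : 'M[R]_n) :
  \det (block_mx (a%:M : 'M[R]_1) v 0 S : 'M[R]_n.+1) = (a * \det S)%R.
Proof. by rewrite (@det_ublock _ 1 n) det_scalar1. Qed.

Lemma measurable_slice_fun n (A : set (BV n.+1)) : measurable A ->
  measurable_fun setT (fun t : R => leb n [set y | A (cons_rv t y)]).
Proof.
move=> mA; pose f (p : R * BV n) : \bar R := (\1_A (cons_rv p.1 p.2))%:E.
have mf : measurable_fun setT f.
  apply/measurable_EFinP; apply: (measurableT_comp (f := (\1_A : BV n.+1 -> R))).
    exact: measurable_indic.
  exact: measurable_cons_rv.
have f0 p : 0 <= f p by rewrite lee_fin.
have := @measurable_fun_fubini_tonelli_F _ _ _ (BV n) R (sfin (leb_sigma_finite n)) f mf f0.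
apply: eq_measurable_fun => t _; rewrite /fubini_F /f /=.
rewrite -[X in _ = leb n X]setIT -integral_indic//.
exact: measurable_slice.
Qed.

Lemma scales_block n (S : 'M[R]_n) : scales S ->
  scales (block_mx (1%:M : 'M[R]_1) 0 0 S : 'M[R]_n.+1)%R.
Proof.
move=> sS A mA; rewrite det_block1 mul1r !leb_fubini1//; last exact: measurable_mulmx_set.
rewrite -ge0_integralZl_EFin//; last exact: (measurable_slice_fun mA).
apply: eq_integral => t _; rewrite -sS; last exact: measurable_slice.
congr (leb n _); apply/seteqP; split => y /=;
  by rewrite cons_block scaler0 add0r mulr1 mulmx0 mxE addr0.
Qed.

(** On the slice with first coordinate t the map is the translation by t v. For the lower shear
    below it is the first coordinate that is translated, at fixed y, which is why both orders of
    Tonelli are available. *)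
Lemma scales_ushear n (v : 'rV[R]_n) :
  scales (block_mx (1%:M : 'M[R]_1) v 0 1%:M : 'M[R]_n.+1)%R.
Proof.
move=> A mA; rewrite det_block1 mul1r det1 normr1 invr1 mul1e.
rewrite !leb_fubini1//; last exact: measurable_mulmx_set.
apply: eq_integral => t _; rewrite -[RHS](@leb_translate _ _ (t *: v)); last first.
  exact: measurable_slice.
congr (leb n _); apply/seteqP; split => y /=;
  by rewrite cons_block mulmx1 mulr1 mulmx0 mxE addr0 addrC.
Qed.

Lemma scales_lshear n (w : 'cV[R]_n) :
  scales (block_mx (1%:M : 'M[R]_1) 0 w 1%:M : 'M[R]_n.+1)%R.
Proof.
move=> A mA; rewrite (@det_lblock _ 1 n) det_scalar1 mul1r det1 normr1 invr1 mul1e.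
rewrite !leb_fubini2//; last exact: measurable_mulmx_set.
apply: eq_integral => y _.
rewrite -[RHS](@lebesgue_translate _ ((y *m w) 0 0)%R); last first.
  exact: measurable_cslice.
congr (lebesgue_measure _); apply/seteqP; split => t /=;
  by rewrite cons_block mulmx1 mulr1 scaler0 add0r.
Qed.

Lemma scaled_interval (s a b t : R) : (s != 0)%R -> (a <= b)%R ->
  (a < t * s < b)%R = (Num.min (a / s) (b / s) < t < Num.max (a / s) (b / s))%R.
Proof.
move=> s0 ab; have [s_gt0|s_le0] := ltP 0%R s.
  have h : (a / s <= b / s)%R by rewrite ler_pM2r ?invr_gt0.
  by rewrite (min_idPl h) (max_idPr h) ltr_pdivrMr// ltr_pdivlMr.
have s_lt0 : (s < 0)%R by rewrite lt_neqAle s0.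
have h : (b / s <= a / s)%R by rewrite ler_nM2r ?invr_lt0.
by rewrite (min_idPr h) (max_idPl h) ltr_ndivrMr// ltr_ndivlMr// andbC.
Qed.

Lemma scaled_length (s a b : R) : (s != 0)%R -> (a <= b)%R ->
  (Num.max (a / s) (b / s) - Num.min (a / s) (b / s) = `|s|^-1 * (b - a))%R.
Proof.
move=> s0 ab; have [s_gt0|s_le0] := ltP 0%R s.
  have h : (a / s <= b / s)%R by rewrite ler_pM2r ?invr_gt0.
  by rewrite (min_idPl h) (max_idPr h) gtr0_norm// -mulrBl mulrC.
have s_lt0 : (s < 0)%R by rewrite lt_neqAle s0.
have h : (b / s <= a / s)%R by rewrite ler_nM2r ?invr_lt0.
by rewrite (min_idPr h) (max_idPl h) ltr0_norm// -mulrBl invrN mulNr -mulrN opprB mulrC.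
Qed.

Lemma box_set0 n (a b : 'rV[R]_n) : ~ (forall i, a 0%R i <= b 0%R i)%R -> box a b = set0.
Proof.
move=> nab; rewrite -subset0 => x xab; apply: nab => i.
by have /andP[h3 h4] := xab i; rewrite ltW// (lt_trans h3).
Qed.

(** Preimages of boxes are boxes; for s < 0 the end points of the first side are exchanged, whence
    the minimum and maximum. *)
Lemma scales_diag n (s : R) : (s != 0)%R ->
  scales (block_mx (s%:M : 'M[R]_1) 0 0 1%:M : 'M[R]_n.+1)%R.
Proof.
move=> s0; set L := block_mx _ _ _ _.
have si : (0 <= `|s|^-1)%R by rewrite invr_ge0.
have detL : \det L = s by rewrite det_block1 det1 mulr1.
have pre (a b : 'rV[R]_n.+1) : (forall i, a 0%R i <= b 0%R i)%R ->
    [set x | box a b (x *m L)%R] =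
    box (cons_rv (Num.min (a 0 ord0 / s) (b 0 ord0 / s))%R (behead_rv a))
        (cons_rv (Num.max (a 0 ord0 / s) (b 0 ord0 / s))%R (behead_rv b)).
  move=> ab; apply/seteqP; split => x /=; rewrite -(cons_beheadK x) cons_block.
    rewrite scaler0 add0r mulmx1 mulmx0 mxE addr0 => /box_cons[].
    by rewrite scaled_interval// => h1 h2; apply/box_cons; rewrite !cons_rv0 !behead_consK.
  move=> /box_cons[]; rewrite !cons_rv0 !behead_consK -scaled_interval// => h1 h2.
  by rewrite scaler0 add0r mulmx1 mulmx0 mxE addr0; apply/box_cons.
move=> A mA; rewrite detL.
transitivity (mscale (NngNum si) (leb n.+1) A); last by [].
apply: (@measure_eq_box R n.+1 (pushm (leb n.+1) (measurable_mulmx L))) A mA => a b.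
  rewrite pushmE [RHS]/(mscale _ _ _) /=.
  have [ab|nab] := pselect (forall i, a 0%R i <= b 0%R i)%R; last first.
    by rewrite /mscale /= !box_set0// preimage_set0 !measure0 mule0.
  rewrite /mscale /= leb_box// -[_ @^-1` _]/[set x | box a b (x *m L)%R] pre// leb_box.
    rewrite -EFinM !big_ord_recl !cons_rv0 scaled_length// mulrA.
    by congr (_ * _)%:E; apply: eq_bigr => i _; rewrite !cons_rvS !mxE.
  move=> i; case: (unliftP ord0 i) => [j|] ->; first by rewrite !cons_rvS !mxE.
  by rewrite !cons_rv0 ge_min !le_max !lexx.
rewrite pushmE; have [ab|nab] := pselect (forall i, a 0%R i <= b 0%R i)%R; last first.
  by rewrite box_set0// preimage_set0 measure0.
by rewrite -[_ @^-1` _]/[set x | box a b (x *m L)%R] pre// leb_box_fin.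
Qed.

Local Close Scope ereal_scope.

(** Gaussian elimination with a nonzero pivot: L is a lower shear times its Schur complement block
    times an upper shear times a dilation of the first coordinate. *)
Lemma scales_pivot n (L : 'M[R]_n.+1) :
  (forall S : 'M[R]_n, S \in unitmx -> scales S) ->
  L 0 0 != 0 -> L \in unitmx -> scales L.
Proof.
move=> IH a0; rewrite -[L]/(L : 'M[R]_(1 + n)) -(@submxK _ 1 n 1 n L).
set a := L 0 0 in a0 *; have -> : ulsubmx (L : 'M[R]_(1 + n)) = a%:M.
  by rewrite [LHS]mx11_scalar /a; congr (_%:M); rewrite !mxE; congr (L _ _); exact: val_inj.
set v := ursubmx _; set w := dlsubmx _; set S0 := drsubmx _ => uL.
pose S : 'M[R]_n := (S0 - (a^-1 *: w) *m v)%R.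
have E : (block_mx a%:M v w S0 : 'M[R]_n.+1) =
   ((block_mx (1%:M : 'M[R]_1) 0 (a^-1 *: w) 1%:M : 'M[R]_n.+1) *m
    ((block_mx (1%:M : 'M[R]_1) 0 0 S : 'M[R]_n.+1) *m
    ((block_mx (1%:M : 'M[R]_1) v 0 1%:M : 'M[R]_n.+1) *m
      (block_mx (a%:M : 'M[R]_1) 0 0 1%:M : 'M[R]_n.+1))))%R.
  rewrite !(@mulmx_block _ 1 n 1 n 1 n) !(mul1mx, mulmx1, mul0mx, mulmx0, addr0, add0r).
  apply: (f_equal4 (@block_mx R 1 n 1 n)) => //; last by rewrite /S addrC subrK.
  by rewrite mul_mx_scalar scalerA divff// scale1r.
have uS : S \in unitmx.
  have D : \det (block_mx a%:M v w S0 : 'M[R]_n.+1) = (a * \det S)%R.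
    by rewrite E !det_mulmx (@det_lblock _ 1 n) !det_block1 !det1 !mulr1 !mul1r mulrC.
  by move: uL; rewrite !unitmxE D !unitfE mulf_eq0 negb_or => /andP[].
rewrite E; apply: scalesM; first exact: scales_lshear.
apply: scalesM; first exact/scales_block/IH.
by apply: scalesM; [exact: scales_ushear|exact: scales_diag].
Qed.

Lemma scales_unitmx n (L : 'M[R]_n) : L \in unitmx -> scales L.
Proof.
elim: n L => [|n IH] L uL.
  move=> A mA; rewrite det_mx00 normr1 invr1 mul1e; congr (leb 0 _).
  by apply/seteqP; split => x /=; rewrite (_ : (x *m L)%R = x)//; apply/rowP => -[].
have [L0|] := eqVneq (L 0 0) 0; last by move=> L0; exact: scales_pivot.
have [k Lk] : exists k : 'I_n, L (lift 0 k) 0 != 0.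
  apply: contrapT => /forallNP h; move: uL; rewrite unitmxE unitfE => /negP; apply.
  have c0 i : L i 0 = 0.
    by case: (unliftP 0 i) => [j|] ->//; apply/eqP/negPn/negP; exact: h.
  by rewrite (expand_det_col L 0) big1// => i _; rewrite c0 mul0r.
(* With a zero pivot, adding a row whose first entry is nonzero to the first row produces a pivot;
   this operation is itself an upper shear, undone by [e (-1)]. *)
pose e (s : R) : 'M[R]_n.+1 := block_mx (1%:M : 'M[R]_1) (s *: delta_mx 0 k)%R 0 1%:M.
have de s : \det (e s) = 1 by rewrite det_block1 mul1r det1.
have E : L = (e (-1) *m (e 1 *m L))%R.
  rewrite mulmxA (@mulmx_block _ 1 n 1 n 1 n) !(mul1mx, mulmx1, mul0mx, mulmx0, addr0, add0r).
  by rewrite scale1r scaleN1r subrr -[block_mx _ _ _ _]/(block_mx 1%:M 0 0 1%:M : 'M[R]_(1 + n))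
    -scalar_mx_block mul1mx.
rewrite E; apply: scalesM; first exact: scales_ushear.
apply: scales_pivot => //; last first.
  by rewrite unitmxE det_mulmx de mul1r -unitmxE.
rewrite mxE big_ord_recl L0 mulr0 add0r (bigD1 k)//= big1 => [|j jk].
  rewrite addr0 (_ : e 1 0 (lift ord0 k) = 1) ?mul1r//.
  rewrite (_ : lift ord0 k = rshift 1 k); last exact: val_inj.
  rewrite (_ : 0 = lshift n (0 : 'I_1)); last exact: val_inj.
  by rewrite (@block_mxEur _ 1 n 1 n) scale1r mxE !eqxx.
rewrite (_ : e 1 0 (lift ord0 j) = 0) ?mul0r//.
rewrite (_ : lift ord0 j = rshift 1 j); last exact: val_inj.
rewrite (_ : 0 = lshift n (0 : 'I_1)); last exact: val_inj.
by rewrite (@block_mxEur _ 1 n 1 n) scale1r mxE (negPf jk) andbF.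
Qed.

End LebLinear.

(** * Regularity of finite Borel measures, dyadic cells *)

Section Regularity.
Context {R : realType}.
Local Notation BV n := (borel 'rV[R]_n).
Local Open Scope ereal_scope.

Lemma cvge_exists_lt (u : nat -> \bar R) (l b : \bar R) :
  u @ \oo --> l -> l < b -> exists k, u k < b.
Proof.
move=> ul lb; apply: contrapT => /forallNP h.
have : b <= limn u.
  by apply: lime_ge; [exact: cvgP ul|apply: nearW => k; rewrite leNgt; exact/negP].
by rewrite (cvg_lim _ ul)// leNgt lb.
Qed.

Section finite.
Variables (n : nat) (mu : {measure set (BV n) -> \bar R}).
Hypothesis mufin : mu setT < +oo.

Let mu_lt A : measurable A -> mu A < +oo.
Proof. by move=> mA; apply: le_lt_trans mufin; apply: le_measure; rewrite ?inE. Qed.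

(** Approximation from both sides, unlike outer regularity alone, is visibly stable under
    complement, so that such sets form a sigma-algebra. *)
Definition two_sided (A : set (BV n)) := measurable A /\
  forall e : R, (0 < e)%R -> exists F V : set 'rV[R]_n,
    [/\ closed F, open V, F `<=` A, A `<=` V & mu (V `\` F) <= e%:E].

Lemma two_sided_open (V : set 'rV[R]_n) : open V -> two_sided V.
Proof.
move=> oO; split; first exact: borel_open.
(* The points of V at distance at least 1/(k+1) from its complement form closed sets increasing to
   V. *)
move=> e e0; pose F (k : nat) := ~` \bigcup_(y in ~` V) ball y (k.+1%:R^-1 : R).
have cF k : closed (F k).
  by apply: open_closedC; apply: bigcup_open => y _; exact: ball_open.
have FO k : F k `<=` V.
  move=> x Fx; apply: contrapT => Ox; apply: Fx; exists x => //.
  by apply: ballxx; rewrite invr_gt0.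
have ndF i j : (i <= j)%N -> F i `<=` F j.
  move=> ij; apply: subsetC => x [y Oy xy]; exists y => //; apply: le_ball xy.
  by rewrite lef_pV2 ?posrE// ler_nat.
have UF : \bigcap_k (V `\` F k) = set0.
  rewrite -subset0 => x h; have Ox : V x by have [] := h 0%N I.
  have [d d0 dO] := open_ball_sub oO Ox.
  have [k kd] : exists k : nat, (k.+1%:R^-1 < d :> R)%R.
    exists (Num.truncn d^-1); rewrite invf_plt ?posrE//; exact: truncnS_gt.
  have [_ /contrapT[y Oy yx]] := h k I; apply: Oy; apply: dO.
  by apply: ball_sym; apply: le_ball yx; exact: ltW.
have mD k : measurable (V `\` F k : set (BV n)).
  by apply: measurableD; [exact: borel_open|exact: borel_closed].
have c : mu \o (fun k => V `\` F k) @ \oo --> 0.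
  rewrite -(@measure0 _ _ _ mu) -UF; apply: nonincreasing_cvg_mu => //.
  - exact: mu_lt.
  - by rewrite UF.
  - by move=> i j ij; rewrite subsetEset => x [Ox Fx]; split => // Fi; apply/Fx/(ndF i).
have [k kl] : exists k, mu (V `\` F k) < e%:E by exact: (cvge_exists_lt c).
by exists (F k), V; split => //; exact: ltW.
Qed.

Lemma two_sidedC (A : set (BV n)) : two_sided A -> two_sided (~` A).
Proof.
move=> [mA h]; split; first exact: measurableC.
move=> e /h[F [V [cF oO FA AO le]]]; exists (~` V), (~` F); split.
- exact: open_closedC.
- exact: closed_openC.
- exact: subsetC.
- exact: subsetC.
- by rewrite setDE setCK setIC -setDE.
Qed.

Lemma two_sided_bigcup (A : nat -> set (BV n)) :
  (forall k, two_sided (A k)) -> two_sided (\bigcup_k A k).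
Proof.
move=> hA; split; first by apply: bigcupT_measurable => k; case: (hA k).
move=> e e0; have e20 : (0 < e / 2)%R by rewrite divr_gt0.
have /choice[FO hFO] k : exists FO : set 'rV[R]_n * set 'rV[R]_n,
    [/\ closed FO.1, open FO.2, FO.1 `<=` A k, A k `<=` FO.2
      & mu (FO.2 `\` FO.1) <= (e / 2 / (2 ^ k.+1)%:R)%:E].
  have [_ /(_ (e / 2 / (2 ^ k.+1)%:R)%R)[]] := hA k.
    by rewrite divr_gt0// ltr0n expn_gt0.
  by move=> F [V hFO]; exists (F, V).
(* The union of all the closed sets need not be closed: only finite unions are used. The total error
   is at most e/2, and continuity from above then provides an N with error below e. *)
pose V := \bigcup_k (FO k).2; pose F N := \big[setU/set0]_(k < N) (FO k).1.
have oO : open V by apply: bigcup_open => k _; have [] := hFO k.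
have cF N : closed (F N).
  by apply: closed_bigsetU => k _; have [] := hFO k.
have FFN N : F N = \bigcup_(k in `I_N) (FO k).1 by rewrite /F bigcup_mkord.
have mD N : measurable (V `\` F N : set (BV n)).
  by apply: measurableD; [exact: borel_open|exact: borel_closed].
have mk k : measurable ((FO k).2 `\` (FO k).1 : set (BV n)).
  by have [c o _ _ _] := hFO k; apply: measurableD; [exact: borel_open|exact: borel_closed].
have le : mu (\bigcap_N (V `\` F N)) <= (e / 2)%:E.
  apply: le_trans (_ : \sum_(k <oo) mu ((FO k).2 `\` (FO k).1) <= _).
    apply: measure_sigma_subadditive => //.
      by apply: bigcapT_measurable.
    move=> x h; have [[k _ Ok] _] := h 0%N I; exists k => //; split => // Fk.
    by have [_] := h k.+1 I; apply; rewrite FFN; exists k => /=.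
  apply: le_trans (epsilon_trick0 xpredT (ltW e20)).
  by apply: lee_nneseries => // k _; have [] := hFO k.
have c : mu \o (fun N => V `\` F N) @ \oo --> mu (\bigcap_N (V `\` F N)).
  apply: nonincreasing_cvg_mu => //.
  - exact: mu_lt.
  - exact: bigcapT_measurable.
  - move=> i j ij; rewrite subsetEset => x [Ox Fx]; split => //; apply: contra_not Fx.
    by rewrite !FFN => -[k /= ki Fk]; exists k => //=; exact: leq_trans ij.
have [|N lN] := cvge_exists_lt c (_ : _ < e%:E).
  by apply: le_lt_trans le _; rewrite lte_fin ltr_pdivrMr// ltr_pMr// ltr1n.
exists (F N), V; split => //.
- by rewrite FFN => x [k _ Fk]; exists k => //; have [_ _ + _ _] := hFO k; apply.
- by apply: subset_bigcup => k _; have [] := hFO k.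
- exact: ltW.
Qed.

Lemma outer_regular (A : set (BV n)) (e : R) : measurable A -> (0 < e)%R ->
  exists V : set 'rV[R]_n, [/\ open V, A `<=` V & mu V <= mu A + e%:E].
Proof.
move=> mA e0; have [_ /(_ e e0)[F [V [cF oO FA AO le]]]] : two_sided A.
  move: A mA; apply: smallest_sub; last by move=> V; exact: two_sided_open.
  split => [|A|]; [exact/two_sided_open/open0| |exact: two_sided_bigcup].
  by rewrite setTD; exact: two_sidedC.
exists V; split => //; have mO : measurable (V : set (BV n)) by exact: borel_open.
rewrite -(setDUK AO) measureU//; last 2 first.
- exact: measurableD.
- by rewrite setDE setICA setICr setI0.
rewrite leeD2l//; apply: le_trans le; apply: le_measure; rewrite ?inE.
- exact: measurableD.
- by apply: measurableD => //; exact: borel_closed.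
- by move=> x [Ox Ax]; split => // /FA.
Qed.

(** Only the larger measure has to be finite: outer regularity is applied to it alone. *)
Lemma measure_le_open (nu : {measure set (BV n) -> \bar R}) :
  (forall V : set 'rV[R]_n, open V -> nu V <= mu V) ->
  forall A, measurable A -> nu A <= mu A.
Proof.
move=> h A mA; apply/lee_addgt0Pr => e e0.
have [V [oO AO le]] := outer_regular mA e0; apply: le_trans le.
apply: le_trans (h V oO); apply: le_measure; rewrite ?inE//; exact: borel_open.
Qed.

End finite.

Section grid.
Local Close Scope ereal_scope.
Variable n : nat.

Definition cell (k : nat) (z : 'rV[int]_n) : set 'rV[R]_n :=
  [set x | forall i, (z 0 i)%:~R <= 2 ^+ k * x 0 i < (z 0 i)%:~R + 1]%R.

Definition cell_index (k : nat) (x : 'rV[R]_n) : 'rV[int]_n :=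
  (\row_i Num.floor (2 ^+ k * x 0 i))%R.

Lemma cellP k z x : cell k z x <-> cell_index k x = z.
Proof.
split=> [h|<- i]; last first.
  by rewrite mxE floor_le_tmp /= -intrD1 floorD1_gt.
apply/rowP => i; rewrite mxE; have /andP[h1 h2] := h i.
by apply: floor_def; rewrite h1 intrD.
Qed.

Lemma cell_dist k z x y i : cell k z x -> cell k z y ->
  (`|x 0 i - y 0 i| <= (2 ^+ k)^-1 :> R)%R.
Proof.
move=> /(_ i)/andP[h1 h2] /(_ i)/andP[h3 h4].
have k0 : (0 < 2 ^+ k :> R)%R by rewrite exprn_gt0.
rewrite -(ler_pM2l k0) divff ?gt_eqF// -{1}(gtr0_norm k0) -normrM mulrBr.
by rewrite ler_norml; apply/andP; split; lra.
Qed.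

Lemma cellS k x y : cell_index k.+1 y = cell_index k.+1 x ->
  cell_index k y = cell_index k x.
Proof.
move=> h; apply/cellP => i; have /cellP/(_ i)/andP[h1 h2] := h.
have /cellP/(_ i)/andP[h3 h4] := erefl (cell_index k x).
have /cellP/(_ i)/andP[h5 h6] := erefl (cell_index k.+1 x).
move: h1 h2 h3 h4 h5 h6; rewrite !exprS -!mulrA.
set z := cell_index k x 0 i; set w := cell_index k.+1 x 0 i.
set s := (2 ^+ k * x 0 i)%R; set t := (2 ^+ k * y 0 i)%R => h1 h2 h3 h4 h5 h6.
have zw : (2 * z <= w)%R.
  rewrite -ltzD1 -(ltr_int R) intrD intrM /=; lra.
have wz : (w + 1 <= 2 * (z + 1))%R.
  rewrite lezD1 -(ltr_int R) intrM intrD /=; lra.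
move: zw wz; rewrite -(ler_int R) -(ler_int R) !intrM !intrD /= => zw wz.
by apply/andP; split; lra.
Qed.

Lemma measurable_cell k z : measurable (cell k z : set (BV n)).
Proof.
rewrite (_ : cell k z = \bigcap_(i in [set: 'I_n])
   (setT `&` (fun x : BV n => 2 ^+ k * x 0 i)%R @^-1`
      `[(z 0 i)%:~R, (z 0 i)%:~R + 1[%classic)).
  apply: fin_bigcap_measurable => [|i _]; first exact: finite_finset.
  have mf : measurable_fun setT (fun x : BV n => 2 ^+ k * x 0 i : R).
    by apply: measurable_funM => //; exact: measurable_coord.
  exact: mf.
apply/seteqP; split => x /= h i; first by move=> _; split => //=; rewrite in_itv; exact: h.
by have [_ /=] := h i I; rewrite in_itv.
Qed.

Lemma leb_cell_ge k z : (((2 ^+ k)^-1 ^+ n)%:E <= leb n (cell k z))%E.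
Proof.
have k0 : (0 < 2 ^+ k :> R)%R by rewrite exprn_gt0.
pose a : 'rV[R]_n := (\row_i ((z 0 i)%:~R / 2 ^+ k))%R.
pose b : 'rV[R]_n := (\row_i (((z 0 i)%:~R + 1) / 2 ^+ k))%R.
apply: le_trans (_ : (leb n (box a b) <= _)%E); last first.
  apply: le_measure; rewrite ?inE; [exact: measurable_box|exact: measurable_cell|].
  move=> x h i; have := h i; rewrite !mxE ltr_pdivrMr// ltr_pdivlMr// mulrC.
  by move=> /andP[h1 h2]; rewrite ltW.
rewrite leb_box => [|i]; last by rewrite !mxE ler_pM2r ?invr_gt0// lerDl.
rewrite lee_fin (eq_bigr (fun=> (2 ^+ k)^-1)%R) => [|i _]; last first.
  by rewrite !mxE -mulrBl addrAC subrr add0r mul1r.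
by rewrite prodr_const card_ord.
Qed.

(** An open set is the increasing union, over the level k, of the disjoint union of the dyadic cells
    of level k that it contains. Monotonicity in k holds because cells are nested. *)
Lemma measure_le_cells (mu nu : {measure set (BV n) -> \bar R}) (V : set 'rV[R]_n) :
  open V -> (forall k z, cell k z `<=` V -> (nu (cell k z) <= mu (cell k z))%E) ->
  (nu V <= mu V)%E.
Proof.
move=> oO h; pose Ok k := \bigcup_(z in [set z | cell k z `<=` V]) cell k z.
pose D k (j : nat) := if @pickle_inv 'rV[int]_n j is Some z
  then (if `[< cell k z `<=` V >] then cell k z else set0) else set0.
have OkD k : Ok k = \bigcup_j D k j.
  apply/seteqP; split => x [].
    by move=> z zO xz; exists (pickle z) => //; rewrite /D pickleK_inv asboolT.
  by move=> j _; rewrite /D; case: pickle_inv => // z; case: asboolP => // zO xz; exists z.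
have mD k j : measurable (D k j : set (BV n)).
  by rewrite /D; case: pickle_inv => // z; case: asboolP => // _; exact: measurable_cell.
have tD k : trivIset setT (D k).
  move=> i j _ _ [x []]; rewrite /D.
  have hi := @pickle_invK 'rV[int]_n i; have hj := @pickle_invK 'rV[int]_n j.
  case: pickle_inv hi => [z /= <-|]//; case: asboolP => // _ /cellP <-.
  case: pickle_inv hj => [z' /= <-|]//; case: asboolP => // _ /cellP <-.
  by [].
have mOk k : measurable (Ok k : set (BV n)) by rewrite OkD; exact: bigcupT_measurable.
have OkO k : Ok k `<=` V by move=> x [z zO xz]; exact: zO.
have le k : (nu (Ok k) <= mu (Ok k))%E.
  rewrite OkD !measure_bigcup//; apply: lee_nneseries => // j _; rewrite /D.
  by case: pickle_inv => [z|]; rewrite ?measure0//; case: asboolP => [/h//|]; rewrite ?measure0.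
have nd : nondecreasing_seq Ok.
  apply/nondecreasing_seqP => k; rewrite subsetEset => x [z zO xz].
  exists (cell_index k.+1 x); last exact/cellP.
  move=> y /cellP/cellS yx; apply: zO; apply/cellP.
  by rewrite yx; apply/cellP.
have UO : \bigcup_k Ok k = V.
  apply/seteqP; split => [x [k _ /OkO]//|x Ox].
  have [e e0 eO] := open_ball_sub oO Ox.
  have [k kd] : exists k : nat, ((2 ^+ k)^-1 < e :> R)%R.
    exists (Num.truncn e^-1).+1; rewrite invf_plt ?posrE ?exprn_gt0//.
    apply: lt_le_trans (truncnS_gt _) _; rewrite -natrX ler_nat.
    exact/ltnW/ltn_expl.
  exists k => //; exists (cell_index k x); last exact/cellP.
  move=> y yx; apply: eO; rewrite -ball_normE /=; apply: mx_norm_lt => // i j.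
  rewrite ord1 !mxE; apply: le_lt_trans kd; apply: cell_dist yx.
  exact/cellP.
have mO : measurable (V : set (BV n)) by exact: borel_open.
have c : nu \o Ok @ \oo --> nu V.
  by rewrite -[in X in _ --> X]UO; apply: nondecreasing_cvg_mu => //; rewrite UO.
rewrite -(cvg_lim _ c)//; apply: lime_le; first exact: cvgP c.
apply: nearW => k /=; apply: le_trans (le k) _.
by apply: le_measure; rewrite ?inE.
Qed.

End grid.

(** The strict inequality leaves room to enclose S in an open box of side d', placed at the infimum
    of each coordinate minus half of the excess. *)
Lemma leb_diam n (S : set (BV n)) (d d' : R) : measurable S -> (0 <= d < d')%R ->
  (forall x y i, S x -> S y -> `|x 0%R i - y 0%R i| <= d)%R -> leb n S <= (d' ^+ n)%:E.
Proof.
move=> mS /andP[d0 dd'] h.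
have d'0 : (0 <= d')%R by exact: le_trans (ltW dd').
have [[p Sp]|S0] := pselect (S !=set0); last first.
  rewrite (_ : S = set0) ?measure0 ?lee_fin ?exprn_ge0//.
  by rewrite -subset0 => x Sx; apply: S0; exists x.
pose I i := [set (x : 'rV[R]_n) 0%R i | x in S].
have I0 i : I i !=set0 by exists (p 0%R i), p.
have lbI i : has_lbound (I i).
  exists (p 0%R i - d)%R => _ [x Sx <-]; have := h x p i Sx Sp.
  by rewrite ler_norml => /andP[h1 h2]; lra.
pose c : R := ((d' - d) / 2)%R; have c0 : (0 < c)%R by rewrite divr_gt0// subr_gt0.
pose a : 'rV[R]_n := (\row_i (inf (I i) - c))%R.
pose b : 'rV[R]_n := (\row_i (inf (I i) - c + d'))%R.
apply: le_trans (_ : leb n (box a b) <= _).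
  apply: le_measure; rewrite ?inE//; first exact: measurable_box.
  move=> x Sx i; rewrite !mxE.
  have h1 : (inf (I i) <= x 0 i)%R by apply: ge_inf => //; exists x.
  have h2 : (x 0 i - d <= inf (I i))%R.
    apply: lb_le_inf => // _ [y Sy <-]; have := h x y i Sx Sy.
    by rewrite ler_norml => /andP[h3 h4]; lra.
  by rewrite /c in c0 *; apply/andP; split; lra.
rewrite leb_box => [|i]; last by rewrite !mxE lerDl.
rewrite lee_fin (eq_bigr (fun=> d')) => [|i _]; last by rewrite !mxE addrAC subrr add0r.
by rewrite prodr_const card_ord.
Qed.
End Regularity.

(** * Change of variables between relatively open subsets of the half-space *)

Section ChangeOfVariables.
Context {R : realType}.
Local Notation BV n := (borel 'rV[R]_n).
Local Notation leb := (@leb R).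
Local Notation H n := (@half_space R n).

Lemma C1_lipschitz n (U : set 'rV[R]_n) (f : 'rV[R]_n -> R) x0 r e x y :
  open U -> Ck 1 U f -> ball x0 r `<=` U ->
  (forall z i, ball x0 r z -> `|'D_(delta_mx 0 i) f z| <= e) ->
  ball x0 r x -> ball x0 r y -> `|f x - f y| <= n%:R * e * `|x - y|.
Proof.
(* The segment is parametrised from its midpoint m by s between -1 and 1, as [MVT_le] wants an
   interval symmetric about 0. *)
move=> oU Cf BU De Bx By; pose v := 2^-1 *: (x - y); pose m := 2^-1 *: (x + y).
have e0 : 0 <= n%:R * e.
  case: n U f x0 x y oU Cf BU De Bx By @v @m => [|n] U f x0 x y oU Cf BU De Bx By v m.
    by rewrite mul0r.
  by rewrite mulr_ge0//; apply: le_trans (De x ord0 Bx).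
have Bs s : `|s| <= 1 -> ball x0 r (m + s *: v).
  rewrite ler_norml => /andP[s1 s2]; rewrite -ball_normE /=.
  have -> : x0 - (m + s *: v) = ((1 + s) / 2) *: (x0 - x) + ((1 - s) / 2) *: (x0 - y).
    by rewrite /m /v; apply/rowP => i; rewrite !mxE; field.
  move: Bx By; rewrite -ball_normE /= => Bx By.
  apply: le_lt_trans (ler_normD _ _) _; rewrite !normrZ.
  rewrite !ger0_norm ?divr_ge0//; [|lra|lra].
  have r0 : 0 < r by apply: le_lt_trans Bx.
  set p := `|x0 - x| in Bx *; set q := `|x0 - y| in By *.
  have [s1'|s1'] := ltP (-1) s; last first.
    have -> : s = -1 by apply/eqP; rewrite eq_le s1' s1.
    by rewrite subrr mul0r mul0r add0r opprK (_ : (1 + 1) / 2 = 1 :> R) ?mul1r//; field.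
  have : (1 + s) / 2 * p < (1 + s) / 2 * r by rewrite ltr_pM2l//; lra.
  have s0 : 0 <= (1 - s) / 2 by lra.
  have := ler_wpM2l s0 (ltW By).
  lra.
pose phi s := f (m + s *: v); pose dphi s := 'D_v f (m + s *: v).
have D (s : R) : `|s| <= 1 -> is_derive s (1 : R) phi (dphi s) /\ `|dphi s| <= n%:R * e * `|v|.
  move=> s1; have Bz := Bs s s1; have df := Ck1_differentiable oU Cf (BU _ Bz).
  split; first by apply: is_derive_line; exact: diff_derivable.
  rewrite /dphi derive_sum_delta// (le_trans (ler_norm_sum _ _ _))//.
  apply: (@le_trans _ _ (\sum_(j < n) `|v| * e)).
    by apply: ler_sum => j _; rewrite normrM ler_pM// ?De// mx_norm_coord.
  by rewrite sumr_const card_ord -[leLHS]mulr_natl mulrA mulrAC.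
have h1 := @MVT_le R phi dphi 1 _ (fun s hs => D s (le_trans hs (ltac:(by rewrite normr1)))).
have h2 := @MVT_le R phi dphi (-1) _ (fun s hs => D s (le_trans hs (ltac:(by rewrite normrN1)))).
have Ex : f x = phi 1 by rewrite /phi /m /v; congr f; apply/rowP => i; rewrite !mxE; field.
have Ey : f y = phi (-1) by rewrite /phi /m /v; congr f; apply/rowP => i; rewrite !mxE; field.
rewrite Ex Ey (_ : phi 1 - phi (-1) = (phi 1 - phi 0) - (phi (-1) - phi 0)); last by ring.
apply: le_trans (ler_normB _ _) _; apply: le_trans (lerD h1 h2) _.
by rewrite normrN1 normr1 mulr1 /v normrZ ger0_norm ?invr_ge0// -mulrDl; lra.
Qed.

Definition jacp n (F : 'rV[R]_n -> 'rV[R]_n) (x : 'rV[R]_n) : 'M[R]_n :=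
  \matrix_(i, j) partial i (fun y => F y 0 j) x.

Lemma smooth_on_prod n (A : set 'rV[R]_n) (I : Type) (r : seq I) (P : pred I)
    (f : I -> 'rV[R]_n -> R) : (forall i, smooth_on A (f i)) ->
  smooth_on A (fun x => \prod_(i <- r | P i) f i x).
Proof.
move=> h; elim: r => [|i r IH].
  by apply: smooth_on_eq (smooth_on_cst (W := R) 1) => x _; rewrite big_nil.
case: (boolP (P i)) => Pi; last first.
  by apply: smooth_on_eq IH => x _; rewrite big_cons (negPf Pi).
by apply: smooth_on_eq (smooth_on_mul (h i) IH) => x _; rewrite big_cons Pi.
Qed.

Lemma smooth_on_det n m (A : set 'rV[R]_n) (M : 'rV[R]_n -> 'M[R]_m) :
  smooth_on A M -> smooth_on (W := R) A (fun x => \det (M x)).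
Proof.
move=> /smooth_on_mxP sM; rewrite /determinant; apply: smooth_on_sum => s.
apply: smooth_on_mul; first exact: smooth_on_cst.
by apply: smooth_on_prod => i; exact: sM.
Qed.

Lemma smooth_on_jacp n (V : set 'rV[R]_n) (F : 'rV[R]_n -> 'rV[R]_n) : open V ->
  smooth_on (V `&` H n) F -> smooth_on (V `&` H n) (jacp F).
Proof.
move=> oV sF; apply/smooth_on_mxP => i j.
apply: (@smooth_on_eq _ _ _ _ (partial i (fun y => F y 0 j))).
  by move=> x _; rewrite mxE.
apply: smooth_on_partial => //.
exact: (((smooth_on_mxP (V `&` H n) F).1 sF) 0 j).
Qed.

Lemma smooth_on_within n (W : normedModType R) (A : set 'rV[R]_n) (f : 'rV[R]_n -> W) :
  smooth_on A f -> {within A, continuous f}.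
Proof.
move=> sf; apply/subspace_continuousP => x Ax.
have [U [F [oU Ux CF fF]]] := sf x Ax.
have cF : {for x, continuous F} := Ck_continuous (CF 0%N) Ux.
suff h : f @ within A (nbhs x) --> F x by move: h; rewrite -(fF x Ax Ux).
move=> P PFx; have h1 : \forall y \near x, P (F y) := cF P PFx.
have h2 : nbhs x U by apply: open_nbhs_nbhs.
by apply: filterS (filterI h1 h2) => y [PFy Uy] Ay /=; rewrite fF.
Qed.

Lemma measurable_half_space n : measurable (H n : set (BV n)).
Proof.
rewrite (_ : H n = \bigcap_(i in [set i : 'I_n | i = 0%N :> nat])
   (setT `&` (fun x : BV n => x 0 i : R) @^-1` `[0, +oo[)).
  apply: fin_bigcap_measurable => [|i _]; first exact: finite_finset.
  exact: (@measurable_coord R n i measurableT).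
apply/seteqP; split => x /= h i.
  by move=> i0; split => //=; rewrite in_itv /= andbT; exact: h.
by move=> i0; have [_ /=] := h i i0; rewrite in_itv /= andbT.
Qed.

Lemma measurable_relopen n (V : set 'rV[R]_n) : open V ->
  measurable (V `&` H n : set (BV n)).
Proof.
by move=> oV; apply: measurableI; [exact: borel_open|exact: measurable_half_space].
Qed.

Lemma partial_coord n (V : set 'rV[R]_n) (f : 'rV[R]_n -> R) x i j : open V ->
  (V `&` H n) x -> (forall y, (V `&` H n) y -> f y = y 0 j) ->
  partial i f x = (j == i)%:R.
Proof.
move=> oV [Vx Hx] fE.
have dx : derivable (@id 'rV[R]_n) x (delta_mx 0 i) by exact: derivable_id.
rewrite (@partialE _ _ V f (fun y => y 0 j) x i oV Vx Hx) //.
- by have := derive_mx dx; rewrite derive_id => /rowP/(_ j); rewrite !mxE eqxx /= => <-.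
- exact: ((derivable_mxP _ _ _).1 dx 0 j).
- by move=> y Vy Hy; rewrite fE.
Qed.

(** A Lindelöf argument: countably many rational boxes on which the comparison holds cover A; made
    disjoint, they cut E into pieces that are compared one by one. *)
Lemma measure_le_local n (nu mu : {measure set (BV n) -> \bar R}) (A : set (BV n)) :
  measurable A ->
  (forall x, A x -> exists N : set 'rV[R]_n, [/\ open N, N x &
     forall E : set (BV n), measurable E -> E `<=` N `&` A -> (nu E <= mu E)%E]) ->
  forall E, measurable E -> E `<=` A -> (nu E <= mu E)%E.
Proof.
move=> mA h E mE EA.
pose P k := forall E : set (BV n), measurable E -> E `<=` @rbox R n k `&` A -> (nu E <= mu E)%E.
pose F k : set (BV n) := if `[< P k >] then @rbox R n k else set0.
have mF k : measurable (F k).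
  by rewrite /F; case: asboolP => // _; apply: borel_open; exact: rbox_open.
have mD k : measurable (seqDU F k) by apply: measurableD => //; exact: bigsetU_measurable.
have AF : A `<=` \bigcup_k seqDU F k.
  rewrite -seqDU_bigcup_eq => x Ax; have [N [oN Nx hN]] := h x Ax.
  have [k kx kN] := rbox_basis oN Nx; exists k => //; rewrite /F asboolT//.
  by move=> E' mE' E'k; apply: hN => // y /E'k[/kN].
have EE : E = \bigcup_k (E `&` seqDU F k).
  by rewrite -setI_bigcupr; apply/esym/setIidl/(subset_trans EA).
have tD : trivIset setT (fun k => E `&` seqDU F k).
  exact/trivIset_setIl/trivIset_seqDU.
have mED k : measurable (E `&` seqDU F k) by exact: measurableI.
rewrite EE !measure_bigcup//; apply: lee_nneseries => // k _.
have [Pk|nPk] := pselect (P k).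
  apply: Pk; first exact: mED.
  move=> x [Ex [Fx _]]; split; last exact: EA.
  by move: Fx; rewrite /F; case: asboolP.
rewrite (_ : _ `&` _ = set0) ?measure0// -subset0 => x [_ [+ _]].
by rewrite /F asboolF.
Qed.

End ChangeOfVariables.

Section COV.
Context {R : realType}.
Local Notation BV n := (borel 'rV[R]_n).
Local Notation leb := (@leb R).
Local Notation H n := (@half_space R n).

Lemma exists_small_pow (n : nat) (b : R) : 1 < b ->
  exists2 e : R, 0 < e & (1 + 2 * e) ^+ n < b.
Proof.
move=> b1; have cf : {for 0, continuous (fun e : R => (1 + 2 * e) ^+ n)}.
  apply: (@continuous_comp _ _ _ (fun e : R => 1 + 2 * e) (fun t => t ^+ n)).
    apply: (@continuousD R _ _ (cst (1 : R)) (fun e : R => 2 * e)); first exact: cst_continuous.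
    exact: mulrl_continuous.
  exact: exprn_continuous.
have c : (fun e : R => (1 + 2 * e) ^+ n) @ (0 : R)^'+ --> ((1 + 2 * 0) ^+ n : R).
  by apply: cvg_at_right_filter; exact: cf.
rewrite mulr0 addr0 expr1n in c.
have /filter_ex[e [e0 eb]] : \forall e \near (0 : R)^'+, 0 < e /\ (1 + 2 * e) ^+ n < b.
  near=> e; split; first by [].
  near: e; apply: (c [set t : R | t < b]); apply: open_nbhs_nbhs; split => //.
by exists e.
Unshelve. all: by end_near. Qed.

Definition rel_diffeo n (V W : set 'rV[R]_n) (F G : 'rV[R]_n -> 'rV[R]_n) :=
  [/\ open V, open W,
      forall x, (V `&` H n) x -> (W `&` H n) (F x) /\ G (F x) = x,
      forall y, (W `&` H n) y -> (V `&` H n) (G y) /\ F (G y) = y &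
      smooth_on (V `&` H n) F /\ smooth_on (W `&` H n) G].

Lemma rel_diffeo_sym n V W (F G : 'rV[R]_n -> 'rV[R]_n) :
  rel_diffeo V W F G -> rel_diffeo W V G F.
Proof. by move=> [oV oW FG GF [sF sG]]; split. Qed.

Section fix_maps.
Variables (n : nat) (V W : set 'rV[R]_n) (F G : 'rV[R]_n -> 'rV[R]_n).
Hypothesis FG : rel_diffeo V W F G.
Let A : set (BV n) := V `&` H n.
Let B : set (BV n) := W `&` H n.

(** The chain rule applied to G \o F, which is the identity on the relatively open set. *)
Lemma jacpK x : (V `&` H n) x -> jacp F x *m jacp G (F x) = 1%:M.
Proof.
have [oV oW FGE GFE [sF sG]] := FG => Ax; apply/matrixP => i j; rewrite !mxE eq_sym.
rewrite -(@partial_coord R n V (fun y => G (F y) 0 j) x i j)//; last first.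
  by move=> y Ay; have [_ ->] := FGE y Ay.
have sGj : smooth_on (W := R) (W `&` H n) (fun y => G y 0 j).
  exact: (((smooth_on_mxP (W `&` H n) G).1 sG) 0 j).
rewrite (@partial_comp R n n V W F (fun y => G y 0 j))//; last first.
  by move=> y Ay; have [] := FGE y Ay.
by apply: eq_bigr => k _; rewrite !mxE.
Qed.

Lemma jacp_unit x : (V `&` H n) x -> jacp F x \in unitmx.
Proof. by move=> Ax; have [] := mulmx1_unit (jacpK Ax). Qed.

Let mA : measurable A. Proof. by apply: measurable_relopen; case: FG. Qed.
Let mB : measurable B. Proof. by apply: measurable_relopen; case: FG. Qed.

Lemma measurable_patch_inv : measurable_fun (setT : set (BV n))
  (patch (fun=> 0 : BV n) (W `&` H n : set (BV n)) (G : BV n -> BV n)).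
Proof.
have mGB : measurable_fun B (G : BV n -> BV n).
  apply: within_continuous_borel => //; apply: smooth_on_within.
  by case: FG => _ _ _ _ [].
move=> _ Y mY; rewrite setTI.
rewrite (_ : _ @^-1` _ = (B `&` G @^-1` Y) `|` (~` B `&` [set _ | Y 0])); last first.
  apply/seteqP; split => y; rewrite /= /patch; case: ifPn => [/set_mem By|/negP nBy].
  - by left.
  - by right; split => // /mem_set.
  - by move=> [[]//|[]].
  - by move=> [[/mem_set]//|[]].
apply: measurableU; first exact: mGB.
apply: measurableI; first exact: measurableC.
by have [Y0|Y0] := pselect (Y 0); [rewrite (_ : [set _ | _] = setT)//|rewrite (_ : [set _ | _] = set0)//];
  apply/seteqP; split.
Qed.

Let mG := measurable_patch_inv.

(* [image_leb E] is the Lebesgue measure of [F @` (A `&` E)]. *)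
Definition image_leb : {measure set (BV n) -> \bar R} := pushm (mrestr (leb n) mB) mG.

Lemma image_lebE E : image_leb E = leb n (B `&` G @^-1` E).
Proof.
rewrite /image_leb pushmE /mrestr; congr (leb n _).
apply/seteqP; split => y /=; rewrite /patch.
  by move=> [+ By]; rewrite mem_set.
by move=> [By Gy]; rewrite mem_set.
Qed.

Definition wjac (x : BV n) : R := if x \in A then `|\det (jacp F x)| else 0.

Lemma wjac_ge0 x : 0 <= wjac x. Proof. by rewrite /wjac; case: ifP. Qed.

Lemma measurable_wjac : measurable_fun setT wjac.
Proof.
have md : measurable_fun A (fun x : BV n => `|\det (jacp F x)|).
  apply: measurableT_comp => //; apply: within_continuous_borelR => //.
  apply: (smooth_on_within (W := R)); apply: smooth_on_det.
  by case: FG => oV _ _ _ [sF _]; exact: smooth_on_jacp.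
have := (measurable_restrictT _ mA).1 md; apply: eq_measurable_fun => x _.
by rewrite /wjac patchE.
Qed.

Local Notation dw := (dens (leb n) measurable_wjac wjac_ge0).

(** Near x0 the map F, composed with the inverse of its Jacobian L at x0, is close to the identity.
    The image of a dyadic cell of side s is then the image by L of a set of diameter at most (1 + e)
    s, whose measure is known up to a factor near 1. Cells give open sets, open sets give Borel
    sets. *)
Lemma image_leb_local (x0 : 'rV[R]_n) (eta : R) : A x0 -> 0 < eta ->
  exists N : set 'rV[R]_n, [/\ open N, N x0 &
     forall E : set (BV n), measurable E -> E `<=` N `&` A ->
       (image_leb E <= (1 + eta)%:E * dw E)%E].
Proof.
move=> Ax0 eta0; have [oV oW FGE GFE [sF sG]] := FG.
have [U [F' [oU UV Ux0 CF FF]]] := smooth_on_ext oV sF Ax0.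
have sD : smooth_on (W := R) A (fun x => \det (jacp F x)).
  by apply: smooth_on_det; exact: smooth_on_jacp.
have [U2 [D [oU2 U2V U2x0 CD DD]]] := smooth_on_ext oV sD Ax0.
pose L := jacp F x0; have uL : L \in unitmx := jacp_unit Ax0.
have dL : 0 < `|\det L| by rewrite normr_gt0 -unitfE -unitmxE.
have [_ Hx0] := Ax0.
(* The loss [1 + eta] is shared: up to b for the distortion of cells, the rest for the variation of
   the Jacobian determinant near x0. *)
pose b := 1 + eta / 2; have b1 : 1 < b by rewrite ltrDl divr_gt0.
have bb : b < 1 + eta by rewrite ltrD2l ltr_pdivrMr// ltr_pMr// ltr1n.
have [e e0 eb] := exists_small_pow n b1.
(* The deviation from the identity. It is built from the extension F', so it is defined on a full
   ball even when x0 is a boundary point; its derivative vanishes at x0. *)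
pose K j x := (F' x *m invmx L) 0 j - x 0 j.
have CK j k : Ck (W := R) k U (K j).
  apply: (Ck_add oU); last by apply: (Ck_opp oU); exact: Ck_coord.
  apply: (Ck_eq oU (f := fun x => \sum_l F' x 0 l * invmx L l j)).
    by move=> x _; rewrite mxE.
  apply: (Ck_sum oU) => l; apply: (Ck_mul oU); last exact: Ck_cst.
  exact: ((Ck_mxP oU k F').1 (CF k) 0 l).
have DK i j : 'D_(delta_mx 0 i) (K j) x0 = 0.
  have dF' : derivable F' x0 (delta_mx 0 i) := Ck_derivable (CF 1%N) Ux0.
  have dFl l : is_derive x0 (delta_mx 0 i) (fun x => F' x 0 l) (L i l).
    have dl := (derivable_mxP _ _ _).1 dF' 0 l; split => //.
    by rewrite /L mxE (@partialE _ _ U _ (fun x => F' x 0 l) x0 i oU Ux0 Hx0)// => y Uy Hy;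
      rewrite FF.
  have dS : is_derive x0 (delta_mx 0 i) (\sum_l (fun x => F' x 0 l * invmx L l j))
     (\sum_l L i l * invmx L l j).
    apply: is_derive_sum => l.
    have dM := is_deriveM (dFl l) (is_derive_cst (invmx L l j) x0 (delta_mx 0 i)).
    by apply: is_derive_eq dM _; rewrite scaler0 add0r /GRing.scale /= mulrC.
  have dc : is_derive x0 (delta_mx 0 i) (fun x : 'rV[R]_n => x 0 j) ((j == i)%:R).
    have dx : derivable (@id 'rV[R]_n) x0 (delta_mx 0 i) by exact: derivable_id.
    split; first exact: ((derivable_mxP _ _ _).1 dx 0 j).
    by have := derive_mx dx; rewrite derive_id => /rowP/(_ j); rewrite !mxE eqxx /= => <-.
  have dK := is_deriveB dS dc.
  have -> : K j = \sum_l (fun x => F' x 0 l * invmx L l j) - (fun x : 'rV[R]_n => x 0 j).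
    by apply/funext => x; rewrite /K mxE fct_sumE.
  rewrite (@derive_val _ _ _ _ _ _ _ dK).
  have -> : \sum_l L i l * invmx L l j = (L *m invmx L) i j by rewrite mxE.
  by rewrite mulmxV// mxE eq_sym subrr.
(* Compensates the factor n lost in [C1_lipschitz]. *)
pose e' := e / n.+1%:R; have e'0 : 0 < e' by rewrite divr_gt0.
have near1 : \forall z \near x0, [/\ U z, U2 z, `|\det L| * b / (1 + eta) < `|D z| &
    forall ij : 'I_n * 'I_n, `|'D_(delta_mx 0 ij.1) (K ij.2) z| <= e'].
  have n1 : \forall z \near x0, U z by exact: open_nbhs_nbhs.
  have n2 : \forall z \near x0, U2 z by exact: open_nbhs_nbhs.
  have n3 : \forall z \near x0, `|\det L| * b / (1 + eta) < `|D z|.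
    have cD : (fun z => `|D z|) @ x0 --> `|D x0|.
      have cD0 : D @ x0 --> D x0 := Ck_continuous (CD 0%N) U2x0.
      exact: (cvg_norm cD0).
    apply: (cD [set t | _ < t]); apply: open_nbhs_nbhs; split; first exact: open_gt.
    rewrite /= -(DD x0 U2x0 Hx0) -/L -mulrA gtr_pMr// ltr_pdivrMr ?mul1r//.
    by apply: lt_trans bb; apply: lt_trans b1.
  have n4 : \forall z \near x0, forall ij : 'I_n * 'I_n,
      `|'D_(delta_mx 0 ij.1) (K ij.2) z| <= e'.
    near=> z => ij; move: ij; near: z; apply: filter_forall => -[i j] /=.
    have cK : {for x0, continuous ('D_(delta_mx 0 i) (K j))}.
      by have [_ /(_ i)[_ [CK1 _]]] := CK j 1%N; exact: (CK1 x0 Ux0).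
    have /cvgrPdist_le/(_ _ e'0) := cK; apply: filterS => z.
    by rewrite DK sub0r normrN.
  by near=> z; split; near: z.
case/nbhs_ballP : near1 => r /= r0 Br.
pose N := ball x0 r; have oN : open N by exact: ball_open.
have Nx0 : N x0 by exact: ballxx.
have mN : measurable (N : set (BV n)) by exact: borel_open.
pose c := `|\det L| * (1 + 2 * e) ^+ n.
have c0 : 0 <= c by rewrite mulr_ge0// exprn_ge0// addr_ge0// mulr_ge0// ltW.
have est x y j : N x -> N y -> A x -> A y ->
    `|((F x - F y) *m invmx L) 0 j - (x - y) 0 j| <= e * `|x - y|.
  move=> Nx Ny Axx Ayy.
  have [[Ux _ _ _] [Uy _ _ _]] := (Br _ Nx, Br _ Ny).
  have [[_ Hx] [_ Hy]] := (Axx, Ayy).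
  have -> : ((F x - F y) *m invmx L) 0 j - (x - y) 0 j = K j x - K j y.
    by rewrite /K mulmxBl (FF x Ux Hx) (FF y Uy Hy) !mxE; ring.
  apply: le_trans (@C1_lipschitz R n U (K j) x0 r e' x y oU (CK j 1%N) _ _ Nx Ny) _.
  - by move=> z /Br[].
  - by move=> z i /Br[_ _ _ /(_ (i, j))].
  - by apply: ler_wpM2r => //; rewrite mulrCA ger_pMr// ler_pdivrMr// mul1r ler_nat.
have cellle k z : cell k z `<=` N ->
    (image_leb (cell k z) <= c%:E * leb n (cell k z))%E.
  move=> zN; rewrite image_lebE; set Q := cell k z.
  have k0 : 0 < (2 ^+ k)^-1 :> R by rewrite invr_gt0 exprn_gt0.
  set s : R := (2 ^+ k)^-1 in k0 *.
  have mS : measurable (B `&` G @^-1` Q).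
    have := @measurable_cell R n k z => mQ.
    have := mG measurableT mQ; rewrite setTI => mGQ.
    rewrite (_ : B `&` _ = B `&` (patch (fun=> 0) B G @^-1` Q)); first exact: measurableI.
    by apply/seteqP; split => y /= [By]; rewrite /patch mem_set.
  have -> : leb n (B `&` G @^-1` Q) =
      (`|\det L|%:E * leb n [set w | (B `&` G @^-1` Q) (w *m L)])%E.
    by rewrite (scales_unitmx uL mS) muleA -EFinM mulfV ?mul1e// gt_eqF.
  rewrite /c EFinM -muleA lee_pmul2l ?lte_fin//.
  (* The diameter is at most (1 + e) s; 1 + 2 e is the strict margin required by [leb_diam]. *)
  apply: le_trans (_ : ((((1 + 2 * e) * s) ^+ n)%:E <= _)%E).
    apply: (@leb_diam _ _ _ ((1 + e) * s)).
    - exact: measurable_mulmx_set.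
    - rewrite mulr_ge0 ?addr_ge0 ?(ltW e0) ?(ltW k0)//= ltr_pM2r// ltrD2l.
      by rewrite ltr_pMl// ltr1n.
    - move=> w w' j [Bw Qw] [Bw' Qw'].
      have [Aw Fw] := GFE _ Bw; have [Aw' Fw'] := GFE _ Bw'.
      have Nw := zN _ Qw; have Nw' := zN _ Qw'.
      have h := est _ _ j Nw Nw' Aw Aw'.
      rewrite Fw Fw' -mulmxBl mulmxK// in h.
      have hs i : `|(G (w *m L) - G (w' *m L)) 0 i| <= s.
        by rewrite !mxE; exact: cell_dist Qw Qw'.
      have hn : `|G (w *m L) - G (w' *m L)| <= s.
        by apply/mx_normP; [exact: ltW|move=> i0 i; rewrite ord1].
      have h2 := hs j; set q := (G (w *m L) - G (w' *m L)) 0 j in h h2.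
      have -> : w 0 j - w' 0 j = ((w - w') 0 j - q) + q by rewrite subrK !mxE.
      apply: le_trans (ler_normD _ _) _; rewrite mulrDl mul1r [leRHS]addrC.
      apply: lerD; last exact: h2.
      by apply: le_trans h _; rewrite ler_wpM2l//; exact: ltW.
  rewrite exprMn EFinM lee_wpmul2l//; last exact: leb_cell_ge.
  by rewrite lee_fin exprn_ge0// addr_ge0// mulr_ge0// ltW.
have nonneg_c : {nonneg R} := NngNum c0.
have lebNfin : (leb n N < +oo)%E.
  apply: le_lt_trans (leb_box_fin (x0 - const_mx r) (x0 + const_mx r)).
  apply: le_measure; rewrite ?inE//; first exact: measurable_box.
  move=> x; rewrite /N -ball_normE /= => xr i; rewrite !mxE.
  have : `|x0 0 i - x 0 i| < r.
    by apply: le_lt_trans xr; have := mx_norm_coord (x0 - x) 0 i; rewrite !mxE.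
  by rewrite ltr_norml => /andP[h1 h2]; apply/andP; split; lra.
have leN (E : set (BV n)) : measurable E -> E `<=` N ->
    (image_leb E <= c%:E * leb n E)%E.
  (* Both measures are restricted to the ball N, which makes the larger one finite, as outer
     regularity requires. *)
  move=> mE EN; pose mu1 := mscale (NngNum c0) (mrestr (leb n) mN).
  have fin1 : (mu1 setT < +oo)%E.
    by rewrite /mu1 /mscale /= /mrestr setTI; apply: lte_mul_pinfty.
  have hO (O : set 'rV[R]_n) : open O -> (mrestr image_leb mN O <= mu1 O)%E.
    move=> oO; rewrite /mu1 /mscale /= /mrestr.
    apply: (@measure_le_cells R n (mscale (NngNum c0) (leb n)) image_leb (O `&` N)).
      exact: openI.
    by move=> k z zON; apply: cellle => x /zON[].
  have h : (image_leb (E `&` N) <= c%:E * leb n (E `&` N))%E :=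
    measure_le_open fin1 hO mE.
  by rewrite (setIidl EN) in h.
exists N; split => // E mE ENA.
apply: le_trans (leN E mE _) _; first by move=> x /ENA[].
have mwE : measurable_fun E (fun x => (wjac x)%:E).
  by apply: measurable_funTS; apply/measurable_EFinP; exact: measurable_wjac.
have eta1 : 0 < 1 + eta by rewrite addr_gt0.
have wE x : (0 <= (wjac x)%:E)%E by rewrite lee_fin wjac_ge0.
have eta1' : 0 <= 1 + eta by exact: ltW.
rewrite /dens -ge0_integralZl_EFin// -integral_cst//.
have wE' x : E x -> (0 <= (1 + eta)%:E * (wjac x)%:E)%E by move=> _; rewrite mule_ge0.
have mwE' : measurable_fun E (fun x => (1 + eta)%:E * (wjac x)%:E)%E.
  exact: measurable_funeM.
apply: ge0_le_integral => //.
move=> x Ex; have [Nx Axx] := ENA x Ex; have [_ U2x hD _] := Br x Nx.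
rewrite -EFinM lee_fin /wjac mem_set//; have [_ Hx] := Axx.
rewrite (DD x U2x Hx) /c -ler_pdivrMl// mulrC; apply: ltW; apply: le_lt_trans hD.
by rewrite ler_wpM2r ?invr_ge0 ?(ltW eta1)// ler_wpM2l// ltW.
Unshelve. all: by end_near. Qed.

End fix_maps.
End COV.

(** * Comparison and restriction of integrals *)

Section IntegralTools.
Context d (T : measurableType d) (R : realType).
Local Open Scope ereal_scope.

Lemma le_measure_integral (m1 m2 : {measure set T -> \bar R}) (D : set T) (f : T -> \bar R) :
  measurable D -> (forall A, measurable A -> A `<=` D -> m1 A <= m2 A) ->
  measurable_fun setT f -> (forall x, 0 <= f x) ->
  \int[m1]_(x in D) f x <= \int[m2]_(x in D) f x.
Proof.
move=> mD h; move: f; apply: (@ge0_fun_ind _ T R).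
- move=> A mA; rewrite !integral_indic//; apply: h; first exact: measurableI.
  exact: subIsetr.
- move=> k f k0 mf f0 IH.
  rewrite !ge0_integralZl_EFin//; try exact: measurable_funTS.
  by apply: lee_wpmul2l; rewrite ?lee_fin.
- move=> f g mf f0 mg g0 If Ig.
  rewrite !ge0_integralD//; try exact: measurable_funTS.
  exact: leeD.
- move=> f mf f0 nd IH.
  have mfD k : measurable_fun D (f k) by exact: measurable_funTS.
  have ndD x : D x -> nondecreasing_seq (f ^~ x) by move=> _; exact: nd.
  have f0D k x : D x -> 0 <= f k x by [].
  rewrite !monotone_convergence//; apply: lee_lim.
  + apply: ereal_nondecreasing_is_cvgn => i j ij.
    by apply: ge0_le_integral => // x Dx; exact: nd.
  + apply: ereal_nondecreasing_is_cvgn => i j ij.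
    by apply: ge0_le_integral => // x Dx; exact: nd.
  + by apply: nearW => k; exact: IH.
Qed.

Lemma ge0_integral_mrestr (mu : {measure set T -> \bar R}) (D : set T)
    (mD : measurable D) (E : set T) (f : T -> \bar R) :
  measurable E -> measurable_fun E f -> (forall x, E x -> 0 <= f x) ->
  \int[mrestr mu mD]_(x in E) f x = \int[mu]_(x in E `&` D) f x.
Proof.
move=> mE mf f0.
have m1 : measurable_fun setT (\1_D : T -> R) by exact: measurable_indic.
have p1 x : (0 <= (\1_D : T -> R) x)%R by [].
rewrite [LHS](eq_measure_integral (dens mu m1 p1)); last first.
  by move=> A mA AE; rewrite /mrestr /= /dens integral_indic// setIC.
rewrite ge0_integral_dens// [RHS]integral_mkcondr.
apply: eq_integral => x _; rewrite patchE indicE; case: ifPn => _; last by rewrite mule0.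
by rewrite mule1.
Qed.

End IntegralTools.

Section COVEq.
Context {R : realType}.
Local Notation BV n := (borel 'rV[R]_n).
Local Notation leb := (@leb R).
Local Notation H n := (@half_space R n).
Variables (n : nat).

Lemma image_leb_le V W (F G : 'rV[R]_n -> 'rV[R]_n) (FG : rel_diffeo V W F G)
    (E : set (BV n)) : measurable E -> E `<=` V `&` H n ->
  (image_leb FG E <= dens (leb n) (measurable_wjac FG) (@wjac_ge0 _ _ V F) E)%E.
Proof.
move=> mE EA; have mV : measurable (V `&` H n : set (BV n)) by apply: measurable_relopen; case: (FG).
set d := dens _ _ _ E.
have [dfin|] := ltP d +oo%E; last by rewrite leye_eq => /eqP ->; rewrite leey.
have d0 : (0 <= d)%E by exact: measure_ge0.
apply/lee_addgt0Pr => e e0.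
have df : d \is a fin_num by rewrite ge0_fin_numE.
have f0 : 0 <= fine d by exact: fine_ge0.
(* Chosen so that eta d <= e, with no assumption that d is nonzero. *)
pose eta := e / (fine d + 1).
have eta0 : 0 < eta by rewrite divr_gt0// ltr_wpDl.
have eta1 : 0 <= 1 + eta by rewrite addr_ge0// ltW.
have h : (image_leb FG E <= (1 + eta)%:E * d)%E.
  apply: (@measure_le_local R n (image_leb FG) (mscale (NngNum eta1)
    (dens (leb n) (measurable_wjac FG) (@wjac_ge0 _ _ V F))) (V `&` H n)) => // x Ax.
  exact: image_leb_local.
apply: le_trans h _; rewrite EFinD ge0_muleDl ?lee_fin ?(ltW eta0)// mul1e leeD2l//.
rewrite -(fineK df) -EFinM lee_fin /eta mulrAC ler_pdivrMr ?ltr_wpDl//.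
by rewrite ler_wpM2l ?(ltW e0)// lerDl.
Qed.

Variables (V W : set 'rV[R]_n) (F G : 'rV[R]_n -> 'rV[R]_n).
Hypothesis FG : rel_diffeo V W F G.
Let A : set (BV n) := V `&` H n.
Let B : set (BV n) := W `&` H n.

Lemma measurable_image_set (E : set (BV n)) : measurable E ->
  measurable (B `&` G @^-1` E : set (BV n)).
Proof.
have [_ oW _ _ [_ sG]] := FG; move=> mE.
have mB : measurable B by exact: measurable_relopen.
by apply: (within_continuous_borel mB _ mB mE); exact: smooth_on_within.
Qed.

Lemma integral_image_leb (E : set (BV n)) (g : BV n -> \bar R) :
  measurable E -> measurable_fun setT g -> (forall x, 0 <= g x)%E ->
  (\int[image_leb FG]_(x in E) g x = \int[leb n]_(y in B `&` G @^-1` E) g (G y))%E.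
Proof.
move=> mE mg g0; have [oV oW FGE GFE [sF sG]] := FG.
rewrite /image_leb ge0_integral_pushm//; last exact: measurable_funTS.
rewrite ge0_integral_mrestr//; last 2 first.
- by have := measurable_patch_inv FG measurableT mE; rewrite setTI.
- by apply: measurable_funTS; apply: (measurableT_comp mg); exact: measurable_patch_inv FG.
rewrite (_ : _ `&` _ = B `&` G @^-1` E).
  apply: eq_integral => y; rewrite inE => -[By _].
  by rewrite /patch mem_set.
apply/seteqP; split => y /=; rewrite /patch.
  by move=> [+ By]; rewrite mem_set.
by move=> [By Gy]; rewrite mem_set.
Qed.

Lemma wjac_inv x : A x -> wjac W G (F x) = (wjac V F x)^-1.
Proof.
move=> Ax; have [oV oW FGE GFE [sF sG]] := FG; have [BFx _] := FGE x Ax.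
rewrite /wjac !mem_set//; have := congr1 determinant (jacpK FG Ax).
rewrite det_mulmx det1 => h; have d0 : \det (jacp F x) != 0.
  by apply/eqP => d0; move/eqP: h; rewrite d0 mul0r eq_sym oner_eq0.
rewrite -normrV ?unitfE//; congr `|_|; apply: (mulfI d0).
by rewrite h mulfV.
Qed.

(** The inequality [image_leb_le] is enough: applied to the inverse map it has the reciprocal
    Jacobian as weight, and integrating the Jacobian against it cancels the weight and yields the
    reverse inequality. *)
Theorem change_of_variables (E : set (BV n)) : measurable E -> E `<=` V `&` H n ->
  leb n (B `&` G @^-1` E) = (\int[leb n]_(x in E) (wjac V F x)%:E)%E.
Proof.
move=> mE EA; have [oV oW FGE GFE [sF sG]] := FG.
have mA : measurable A by exact: measurable_relopen.
apply/eqP; rewrite -(image_lebE FG) eq_le; apply/andP; split.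
  exact: (image_leb_le FG mE EA).
pose u := wjac W G \o patch (fun=> 0 : BV n) (V `&` H n : set (BV n)) (F : BV n -> BV n).
have mw : measurable_fun setT (wjac V F) := measurable_wjac FG.
have mu_ : measurable_fun setT u.
  apply: measurableT_comp; first exact: (measurable_wjac (rel_diffeo_sym FG)).
  exact: (measurable_patch_inv (rel_diffeo_sym FG)).
have u0 x : 0 <= u x by exact: wjac_ge0.
have uE x : A x -> u x = (wjac V F x)^-1.
  by move=> Ax; rewrite /u /= /patch mem_set// wjac_inv.
have wE x : A x -> 0 < wjac V F x.
  by move=> Ax; rewrite /wjac mem_set// normr_gt0 -unitfE -unitmxE; exact: (jacp_unit FG).
(* The inequality for G, transported back by F: Lebesgue measure is at most the image measure
   weighted by the reciprocal Jacobian. *)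
have le (E' : set (BV n)) : measurable E' -> E' `<=` E ->
    (leb n E' <= dens (image_leb FG) mu_ u0 E')%E.
  move=> mE' E'E; have E'A := subset_trans E'E EA.
  rewrite /dens integral_image_leb//; last exact/measurable_EFinP.
  have mS := measurable_image_set mE'.
  have := @image_leb_le W V G F (rel_diffeo_sym FG) (B `&` G @^-1` E') mS (@subIsetl _ _ _).
  rewrite image_lebE; set S := (X in leb n X); rewrite (_ : S = E'); last first.
    apply/seteqP; split => x /=.
      by move=> [/FGE[_ e]] [_]; rewrite /= e.
    by move=> E'x; have Ax := E'A x E'x; have [BF e] := FGE x Ax; split => //=; rewrite e.
  move=> /le_trans; apply; rewrite /dens le_eqVlt; apply/orP; left; apply/eqP.
  apply: eq_integral => y; rewrite inE => -[By _]; have [Ay e] := GFE y By.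
  by rewrite -[in LHS]e wjac_inv// uE.
apply: le_trans (le_measure_integral mE le _ _) _.
- exact/measurable_EFinP.
- by move=> x; rewrite lee_fin wjac_ge0.
rewrite ge0_integral_dens//; last first.
- by move=> x _; rewrite lee_fin wjac_ge0.
- by apply: measurable_funTS; exact/measurable_EFinP.
rewrite (eq_integral (cst 1%E)) ?integral_cst ?mul1e// => x; rewrite inE => Ex.
rewrite /= (uE _ (EA _ Ex)) -EFinM mulfV// gt_eqF// wE//; exact: EA.
Qed.

End COVEq.

(** * Smoothness of matrix operations *)

Section SmoothExtra.
Context {R : realType}.
Local Notation H n := (@half_space R n).

Lemma partial_eq n (V : set 'rV[R]_n) (f g : 'rV[R]_n -> R) x i : open V ->
  (V `&` H n) x -> (forall y, (V `&` H n) y -> f y = g y) ->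
  partial i f x = partial i g x.
Proof.
move=> oV [Vx Hx] fg.
have E : \forall h \near (0 : R)^'+, h^-1 * (f (x + h *: delta_mx 0 i) - f x) =
    h^-1 * (g (x + h *: delta_mx 0 i) - g x).
  have h0 : \forall h \near (0 : R)^'+, (0 : R) < h by exact: nbhs_right_gt.
  near=> h; rewrite (fg x)// fg//; split.
    by near: h; exact: near_at_right_line.
  by apply: half_space_delta => //; apply: ltW; near: h.
rewrite /partial; congr (lim _); apply/seteqP; split; apply: near_eq_cvg => //.
by apply: filterS E => h ->.
Unshelve. all: by end_near. Qed.

Lemma smooth_on_inv n (A : set 'rV[R]_n) (f : 'rV[R]_n -> R) :
  (forall x, A x -> f x != 0) -> smooth_on A f ->
  smooth_on (W := R) A (fun x => (f x)^-1).
Proof.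
move=> f0 sf x Ax; have [U [F [oU Ux CF fF]]] := sf x Ax.
have F0 : F x != 0 by rewrite -fF//; exact: f0.
have cF y : U y -> {for y, continuous F} := Ck_continuous (CF 0%N).
have oN : open [set t : R | t != 0].
  rewrite (_ : [set t | _] = ~` [set 0]); last by apply/seteqP; split => t /= /eqP.
  exact/closed_openC/accessible_closed_set1/hausdorff_accessible/Rhausdorff.
exists (U `&` F @^-1` [set t | t != 0]), (fun y => (F y)^-1).
have oW : open (U `&` F @^-1` [set t | t != 0]) by exact: open_preimage_on.
split => //.
  move=> k; apply: (Ck_inv oW); first by move=> y [].
  by apply: Ck_sub (CF k) => y [].
by move=> y Ay [Uy _]; rewrite fF.
Qed.

(** Cramer's formula: the entries of the inverse are cofactors divided by the determinant. *)
Lemma smooth_on_invmx n m (A : set 'rV[R]_n) (M : 'rV[R]_n -> 'M[R]_m) :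
  (forall x, A x -> M x \in unitmx) -> smooth_on A M ->
  smooth_on A (fun x => invmx (M x)).
Proof.
move=> uM sM; have sMij := (smooth_on_mxP A M).1 sM.
apply/smooth_on_mxP => i j.
have sE : smooth_on (W := R) A (fun x => (\det (M x))^-1 * cofactor (M x) j i).
  apply: smooth_on_mul.
    apply: smooth_on_inv; last exact: smooth_on_det.
    by move=> x /uM; rewrite unitmxE unitfE.
  rewrite /cofactor; apply: smooth_on_mul; first exact: smooth_on_cst.
  apply: smooth_on_det; apply/smooth_on_mxP => a b.
  by apply: smooth_on_eq (sMij (lift j a) (lift i b)) => x _; rewrite !mxE.
by apply: smooth_on_eq sE => x Ax; rewrite /invmx uM// !mxE.
Qed.

Lemma smooth_on_mulmx n p q r (A : set 'rV[R]_n) (M : 'rV[R]_n -> 'M[R]_(p, q))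
    (N : 'rV[R]_n -> 'M[R]_(q, r)) : smooth_on A M -> smooth_on A N ->
  smooth_on A (fun x => M x *m N x).
Proof.
move=> /smooth_on_mxP sM /smooth_on_mxP sN; apply/smooth_on_mxP => i j.
apply: (@smooth_on_eq _ _ _ _ (fun x => \sum_k M x i k * N x k j)).
  by move=> x _; rewrite mxE.
by apply: smooth_on_sum => k; apply: smooth_on_mul; [exact: sM|exact: sN].
Qed.

Lemma smooth_on_trmx n p q (A : set 'rV[R]_n) (M : 'rV[R]_n -> 'M[R]_(p, q)) :
  smooth_on A M -> smooth_on A (fun x => (M x)^T).
Proof.
move=> /smooth_on_mxP sM; apply/smooth_on_mxP => i j.
by apply: smooth_on_eq (sM j i) => x _; rewrite mxE.
Qed.

Lemma smooth_on_scalemx n p q (A : set 'rV[R]_n) (f : 'rV[R]_n -> R)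
    (M : 'rV[R]_n -> 'M[R]_(p, q)) : smooth_on (W := R) A f -> smooth_on A M ->
  smooth_on A (fun x => f x *: M x).
Proof.
move=> sf /smooth_on_mxP sM; apply/smooth_on_mxP => i j.
by apply: smooth_on_eq (smooth_on_mul sf (sM i j)) => x _; rewrite mxE.
Qed.

Lemma smooth_on_addmx n p q (A : set 'rV[R]_n) (M N : 'rV[R]_n -> 'M[R]_(p, q)) :
  smooth_on A M -> smooth_on A N -> smooth_on A (fun x => M x + N x).
Proof.
move=> /smooth_on_mxP sM /smooth_on_mxP sN; apply/smooth_on_mxP => i j.
by apply: smooth_on_eq (smooth_on_add (sM i j) (sN i j)) => x _; rewrite mxE.
Qed.

End SmoothExtra.

(** * Charts, bump functions and metrics *)

Section Charts.
Context (R : realType) (n : nat) (M : topologicalType).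
Local Notation H := (@half_space R n).
Implicit Types c : chart R n M.

Lemma fwd_image_sub c (B : set M) : B `<=` dom c ->
  fwd c @` B = (fwd c @` dom c) `&` bwd c @^-1` B.
Proof.
move=> Bc; apply/seteqP; split => x.
  by move=> [p Bp <-]; split; [exists p => //; exact: Bc|rewrite /= fwdK//; exact: Bc].
by move=> [[p cp <-]]; rewrite /= fwdK// => Bp; exists p.
Qed.

Lemma chart_img_open c (O : set M) : open O ->
  exists2 V : set 'rV[R]_n, open V & fwd c @` (dom c `&` O) = V `&` H.
Proof.
move=> oO; have [V oV cV] := img_open c.
have [V' oV' E] := within_open_preimage (@bwd_continuous _ _ _ c) oO.
exists (V `&` V'); first exact: openI.
rewrite (fwd_image_sub (@subIsetl _ (dom c) O)).
have -> : (fwd c @` dom c) `&` bwd c @^-1` (dom c `&` O) =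
    (fwd c @` dom c) `&` bwd c @^-1` O.
  apply/seteqP; split => x [h1 h2]; split => //; first by case: h2.
  by split => //; case: h1 => p cp <-; rewrite fwdK.
by rewrite E cV setIAC.
Qed.

Lemma chart_img_all c : exists2 V : set 'rV[R]_n, open V & fwd c @` dom c = V `&` H.
Proof. exact: img_open. Qed.

Lemma bwd_img c x : (fwd c @` dom c) x -> dom c (bwd c x) /\ fwd c (bwd c x) = x.
Proof. by move=> [p cp <-]; rewrite fwdK. Qed.

Variable S : atlas R n M.

Lemma chart_atP p : charts S (chart_at S p) /\ dom (chart_at S p) p.
Proof. by rewrite /chart_at; case: cid. Qed.

Lemma transition_img c c' (O : set M) x : (fwd c @` (dom c `&` (dom c' `&` O))) x ->
  (fwd c' @` (dom c' `&` (dom c `&` O))) (fwd c' (bwd c x)) /\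
  fwd c (bwd c' (fwd c' (bwd c x))) = x.
Proof. by move=> [p [cp [c'p Op]] <-]; rewrite !fwdK//; split => //; exists p. Qed.

Lemma transition_diffeo c c' (O : set M) : charts S c -> charts S c' -> open O ->
  exists V W : set 'rV[R]_n,
  [/\ fwd c @` (dom c `&` (dom c' `&` O)) = V `&` H,
      fwd c' @` (dom c' `&` (dom c `&` O)) = W `&` H &
      rel_diffeo V W (fwd c' \o bwd c) (fwd c \o bwd c')].
Proof.
move=> Sc Sc' oO.
have [V oV EV] := chart_img_open c (openI (dom_open c') oO).
have [W oW EW] := chart_img_open c' (openI (dom_open c) oO).
exists V, W; split => //; split => //.
- by move=> x; rewrite -EV -EW => /transition_img.
- by move=> x; rewrite -EV -EW => /transition_img.
- rewrite -EV -EW; split.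
    by apply: smooth_on_sub (charts_smooth Sc Sc') => x [p [cp [c'p _]] <-]; exists p.
  by apply: smooth_on_sub (charts_smooth Sc' Sc) => x [p [cp [c'p _]] <-]; exists p.
Qed.

Lemma jacE c c' p : jac c c' p = jacp (fwd c' \o bwd c) (fwd c p).
Proof. by []. Qed.

Lemma jacK c c' p : charts S c -> charts S c' -> dom c p -> dom c' p ->
  jac c c' p *m jac c' c p = 1%:M.
Proof.
move=> Sc Sc' cp c'p; have [V [W [EV EW D]]] := transition_diffeo Sc Sc' openT.
have Vp : (V `&` H) (fwd c p) by rewrite -EV; exists p.
by have := jacpK D Vp; rewrite /= fwdK.
Qed.

Lemma jac_unit c c' p : charts S c -> charts S c' -> dom c p -> dom c' p ->
  jac c c' p \in unitmx.
Proof. by move=> Sc Sc' cp c'p; have [] := mulmx1_unit (jacK Sc Sc' cp c'p). Qed.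

(** The open set O allows functions that are smooth only near p, such as the coordinates of a third
    chart in [jac_trans]. *)
Lemma partial_transition (f : M -> R) c c' (O : set M) p i : charts S c -> charts S c' ->
  open O -> O p -> dom c p -> dom c' p ->
  smooth_on (W := R) (fwd c' @` (dom c' `&` (dom c `&` O))) (f \o bwd c') ->
  partial i (f \o bwd c) (fwd c p) =
    \sum_j jac c c' p i j * partial j (f \o bwd c') (fwd c' p).
Proof.
move=> Sc Sc' oO Op cp c'p sf.
have [V [W [EV EW [oV oW FG GF [sF sG]]]]] := transition_diffeo Sc Sc' oO.
have Vp : (V `&` H) (fwd c p) by rewrite -EV; exists p.
rewrite (@partial_eq _ _ V _ ((f \o bwd c') \o (fwd c' \o bwd c)))//; last first.
  by move=> x; rewrite -EV => -[q [cq [c'q _]] <-]; rewrite /= !fwdK.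
rewrite (@partial_comp _ _ _ V W)//.
- by apply: eq_bigr => j _; rewrite !mxE /= fwdK.
- by move=> y /FG[].
- by rewrite -EW.
Qed.

Lemma jac_trans c c' c2 p : charts S c -> charts S c' -> charts S c2 ->
  dom c p -> dom c' p -> dom c2 p -> jac c c2 p = jac c c' p *m jac c' c2 p.
Proof.
move=> Sc Sc' Sc2 cp c'p c2p; apply/matrixP => i j; rewrite !mxE.
have := @partial_transition (fun q => fwd c2 q 0 j) c c' (dom c2) p i Sc Sc'
  (dom_open c2) c2p cp c'p.
move=> /(_ _)->; last first.
  have s := charts_smooth Sc' Sc2.
  have := (smooth_on_mxP _ _).1 s 0 j; apply: smooth_on_sub.
  by move=> x [q [c'q [cq c2q]] <-]; exists q.
by apply: eq_bigr => k _; rewrite !mxE.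
Qed.

Definition dform (f : M -> R) (c : chart R n M) (p : M) : 'rV[R]_n :=
  \row_i partial i (f \o bwd c) (fwd c p).

Lemma gradientE (g : metric S) f c p : gradient g f c p = dform f c p *m invmx (g c p).
Proof. by []. Qed.

Lemma dform_trans (f : M -> R) c c' p : smooth_fun S f -> charts S c -> charts S c' ->
  dom c p -> dom c' p -> dform f c p = dform f c' p *m (jac c c' p)^T.
Proof.
move=> sf Sc Sc' cp c'p; apply/rowP => i; rewrite !mxE.
rewrite (@partial_transition f c c' setT p i Sc Sc' openT)//; last first.
  by apply: smooth_on_sub (sf c' Sc') => x [q [c'q _] <-]; exists q.
by apply: eq_bigr => j _; rewrite !mxE mulrC.
Qed.

Lemma smooth_fun_cst (a : R) : smooth_fun S (fun=> a).
Proof. by move=> c Sc; exact: (smooth_on_cst (W := R)). Qed.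

Lemma smooth_fun_add f g : smooth_fun S f -> smooth_fun S g ->
  smooth_fun S (fun p => f p + g p).
Proof. by move=> sf sg c Sc; exact: (smooth_on_add (sf c Sc) (sg c Sc)). Qed.

Lemma smooth_fun_mul f g : smooth_fun S f -> smooth_fun S g ->
  smooth_fun S (fun p => f p * g p).
Proof. by move=> sf sg c Sc; exact: (smooth_on_mul (sf c Sc) (sg c Sc)). Qed.

Lemma smooth_fun_scale (a : R) f : smooth_fun S f -> smooth_fun S (fun p => a * f p).
Proof. exact/smooth_fun_mul/smooth_fun_cst. Qed.

Lemma smooth_on_dform f c : smooth_fun S f -> charts S c ->
  smooth_on (fwd c @` dom c) (dform f c \o bwd c).
Proof.
move=> sf Sc; have [V oV EV] := chart_img_all c; rewrite EV.
apply/smooth_on_mxP => i j; rewrite ord1.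
have := sf c Sc; rewrite EV => sfV; have := @smooth_on_partial R n V oV _ j sfV.
apply: smooth_on_eq => x; rewrite -EV => /bwd_img[cx xE].
by rewrite /= mxE xE.
Qed.

Lemma smooth_on_jac c c' : charts S c -> charts S c' ->
  smooth_on (fwd c @` (dom c `&` dom c')) (jac c c' \o bwd c).
Proof.
move=> Sc Sc'; have [V [W [EV EW [oV oW FG GF [sF sG]]]]] := transition_diffeo Sc Sc' openT.
rewrite setIT in EV; rewrite EV.
apply: smooth_on_eq (smooth_on_jacp oV sF) => x; rewrite -EV => -[p [cp c'p] <-].
by rewrite /= fwdK.
Qed.

Lemma smooth_fun_continuous f : smooth_fun S f -> continuous f.
Proof.
move=> sf p; have [Sc cp] := chart_atP p; set c := chart_at S p in Sc cp.
have wc := smooth_on_within (sf c Sc).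
have w : {within dom c, continuous ((f \o bwd c) \o fwd c)}.
  apply/subspace_continuousP => q cq.
  have h1 := (subspace_continuousP _ _).1 (@fwd_continuous _ _ _ c) q cq.
  have h2 := (subspace_continuousP _ _).1 wc (fwd c q) (ex_intro2 _ _ q cq erefl).
  move=> P hP; have h4 : \forall y \near q, dom c y -> (fwd c @` dom c) (fwd c y) ->
    P ((f \o bwd c) (fwd c y)) := h1 _ (h2 _ hP).
  apply: filterS h4 => y hy cy.
  by apply: hy => //; exists y.
have := w; rewrite (continuous_open_subspace _ (dom_open c)) => /(_ p).
rewrite inE => /(_ cp); apply: continuous_eq_open (dom_open c) cp _.
by move=> q cq; rewrite /= fwdK.
Unshelve. all: by end_near. Qed.

Lemma smooth_fun_local f :
  (forall p, exists (O : set M) (c : chart R n M), [/\ open O, O p, charts S c, O `<=` dom c &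
     smooth_on (W := R) (fwd c @` O) (f \o bwd c)]) -> smooth_fun S f.
Proof.
move=> h c Sc; apply: smooth_on_local => x [p cp <-].
have [Q [c' [oO Op Sc' Oc' sf]]] := h p.
have [V [W [EV EW D]]] := transition_diffeo Sc Sc' oO.
have [oV oW FG GF [sF sG]] := D.
have Vp : (V `&` H) (fwd c p) by rewrite -EV; exists p => //; split => //; split => //; exact: Oc'.
(* Near a point of the image of c, f read in c is f read in c' composed with the transition map. *)
exists V; first by split => //; case: Vp.
have [V0 oV0 EV0] := chart_img_all c.
apply: (@smooth_on_sub _ _ _ (V `&` H)).
  by move=> y [+ Vy]; rewrite EV0 => -[_ Hy].
apply: (@smooth_on_eq _ _ _ _ ((f \o bwd c') \o (fwd c' \o bwd c))).
  by move=> y; rewrite -EV => -[q [cq [c'q Oq]] <-]; rewrite /= !fwdK.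
apply: smooth_on_comp sF sf => y; rewrite -EV => -[q [cq [c'q Oq]] <-].
by rewrite /= fwdK//; exists q.
Qed.

End Charts.

(** * Bump functions supported in a chart *)

Section Bumps.
Context {R : realType}.

(** The Euclidean distance squared, because the matrix norm is the supremum norm and is not
    smooth. *)
Definition sqdist n (x0 x : 'rV[R]_n) : R := \sum_i (x 0 i - x0 0 i) ^+ 2.

Lemma sqdistxx n (x0 : 'rV[R]_n) : sqdist x0 x0 = 0.
Proof. by rewrite /sqdist big1// => i _; rewrite subrr expr0n. Qed.

Lemma sqdist_coord n (x0 x : 'rV[R]_n) i : (x 0 i - x0 0 i) ^+ 2 <= sqdist x0 x.
Proof.
rewrite /sqdist (bigD1 i)//= lerDl; apply: sumr_ge0 => j _; exact: sqr_ge0.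
Qed.

Lemma sqdist_norm n (x0 x : 'rV[R]_n) r : 0 <= r -> sqdist x0 x <= r ^+ 2 ->
  `|x - x0| <= r.
Proof.
move=> r0 h; apply/mx_normP => // i j; rewrite ord1 !mxE.
rewrite -(@ler_pXn2r _ 2) ?nnegrE// real_normK ?num_real//.
exact: le_trans (sqdist_coord _ _ _) h.
Qed.

Lemma sqdist_ball n (U : set 'rV[R]_n) x0 : open U -> U x0 ->
  exists2 r, 0 < r & forall x, sqdist x0 x <= r -> U x.
Proof.
move=> oU Ux; have [e e0 eU] := open_ball_sub oU Ux.
exists ((e / 2) ^+ 2); first by rewrite exprn_gt0// divr_gt0.
move=> x h; apply: eU; rewrite -ball_normE /= distrC.
apply: le_lt_trans (sqdist_norm _ h) _; first by rewrite divr_ge0// ltW.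
by rewrite ltr_pdivrMr// ltr_pMr// ltr1n.
Qed.

Lemma Ck_sqdist n (U : set 'rV[R]_n) x0 k : open U -> Ck (W := R) k U (sqdist x0).
Proof.
move=> oU; apply: (Ck_sum oU) => i.
have C : Ck (W := R) k U (fun x => x 0 i + - x0 0 i).
  by apply: (Ck_add oU); [exact: Ck_coord|exact: Ck_cst].
by apply: Ck_eq (Ck_mul oU C C) => // x _; rewrite expr2.
Qed.

Lemma closed_half_space n : closed (@half_space R n).
Proof.
rewrite (_ : half_space (n:=n) = \bigcap_(i in [set i : 'I_n | i = 0%N :> nat])
    (fun x : 'rV[R]_n => x 0 i) @^-1` [set t | 0 <= t]).
  apply: closed_bigI => i _; apply: closed_comp => [x _|]; last exact: closed_ge.
  exact: coord_continuous.
by apply/seteqP; split => x /= h i; exact: h.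
Qed.

Lemma compact_sqdist n (x0 : 'rV[R]_n) r : 0 < r ->
  compact (@half_space R n `&` [set x | sqdist x0 x <= r]).
Proof.
move=> r0; apply: bounded_closed_compact.
  exists (`|x0| + (r + 1)); split; first exact: num_real.
  move=> N hN x [_ /= h]; apply: le_trans (ltW hN).
  rewrite -[x](subrK x0) addrC; apply: le_trans (ler_normD _ _) _; rewrite lerD2l.
  apply: sqdist_norm; first by rewrite addr_ge0// ltW.
  by apply: le_trans h _; nra.
apply: closedI; first exact: closed_half_space.
apply: (@closed_comp _ _ (sqdist x0) [set t | t <= r]); last exact: closed_le.
by move=> x _; exact: (Ck_continuous (Ck_sqdist x0 0 openT)).
Qed.

Definition scaled_bump n (x0 : 'rV[R]_n) (t : R) (x : 'rV[R]_n) : R :=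
  smooth_step (t * sqdist x0 x).

Lemma Ck_scaled_bump n (x0 : 'rV[R]_n) t k : Ck (W := R) k setT (scaled_bump x0 t).
Proof.
apply: (Ck_smooth_step (f := fun x => t * sqdist x0 x)); first exact: openT.
by move=> j; apply: (Ck_mul openT); [apply: Ck_cst|apply: Ck_sqdist]; exact: openT.
Qed.

Context (n : nat) (M : ptopologicalType) (M_hausdorff : hausdorff_space M).
Variable S : atlas R n M.
Local Notation H := (@half_space R n).

Definition chart_ext (c : chart R n M) (k : 'rV[R]_n -> R) (q : M) : R :=
  if `[< dom c q >] then k (fwd c q) else 0.

Lemma chart_extE c k q : dom c q -> chart_ext c k q = k (fwd c q).
Proof. by move=> cq; rewrite /chart_ext asboolT. Qed.

Lemma chart_ext0 c k q : ~ dom c q -> chart_ext c k q = 0.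
Proof. by move=> cq; rewrite /chart_ext asboolF. Qed.

Lemma chart_sqdist c p (O : set M) : dom c p -> open O -> O p ->
  exists2 r, 0 < r & forall x, H x -> sqdist (fwd c p) x <= r ->
    (fwd c @` (dom c `&` O)) x.
Proof.
move=> cp oO Op; have [V oV EV] := chart_img_open c oO.
have [Vp Hp] : (V `&` H) (fwd c p) by rewrite -EV; exists p.
have [r r0 h] := sqdist_ball oV Vp; exists r => // x Hx /h Vx.
by rewrite EV.
Qed.

Section support.
Variables (c : chart R n M) (x0 : 'rV[R]_n) (r : R) (k : 'rV[R]_n -> R).
Hypotheses (Sc : charts S c) (r0 : 0 < r).
Hypothesis Kc : forall x, H x -> sqdist x0 x <= r -> (fwd c @` dom c) x.
Hypothesis k0 : forall x, r <= sqdist x0 x -> k x = 0.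

(** The support lies in the image of a compact piece of the half-space; in a Hausdorff space this
    image is closed, and its complement is the neighbourhood sought. *)
Lemma chart_ext_vanish q : ~ dom c q -> exists U : set M,
  [/\ open U, U q & forall q', U q' -> chart_ext c k q' = 0].
Proof.
move=> ncq; pose K := H `&` [set x | sqdist x0 x <= r].
have KI x : K x -> (fwd c @` dom c) x by move=> [Hx /= h]; exact: Kc.
have cK : compact (bwd c @` K).
  apply: continuous_compact; last exact: compact_sqdist.
  by apply: continuous_subspaceW (@bwd_continuous _ _ _ c).
exists (~` (bwd c @` K)); split.
- by apply: closed_openC; exact: compact_closed.
- by move=> [x /KI[p cp <-]]; rewrite fwdK// => pq; apply: ncq; rewrite -pq.
- move=> q' nKq'; have [cq'|] := pselect (dom c q'); last exact: chart_ext0.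
  rewrite chart_extE//; apply: k0; rewrite leNgt; apply/negP => lt; apply: nKq'.
  exists (fwd c q'); last exact: fwdK.
  split; last exact: ltW.
  by have [V oV EV] := chart_img_all c; have : (V `&` H) (fwd c q');
    [rewrite -EV; exists q'|case].
Qed.

Lemma chart_ext_smooth : (forall j, Ck (W := R) j setT k) -> smooth_fun S (chart_ext c k).
Proof.
move=> Ck_k; apply: smooth_fun_local => q.
have [cq|ncq] := pselect (dom c q).
  exists (dom c), c; split => //; first exact: dom_open.
  apply: (@smooth_on_eq _ _ _ _ k).
    by move=> x [p cp <-]; rewrite /= fwdK// chart_extE.
  exact: (smooth_on_Ck openT).
have [U [oU Uq U0]] := chart_ext_vanish ncq; have [Sc' c'q] := chart_atP S q.
exists (U `&` dom (chart_at S q)), (chart_at S q); split => //.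
- by apply: openI => //; exact: dom_open.
- apply: (@smooth_on_eq _ _ _ _ (fun=> 0)); last exact: (smooth_on_cst (W := R)).
  by move=> x [p [Up c'p] <-]; rewrite /= fwdK// U0.
Qed.

End support.

(** The last clause, vanishing near and not only at the points outside the chart, makes products of
    [b] with quantities defined in the chart smooth everywhere. *)
Lemma bump_exists c p (O : set M) : charts S c -> dom c p -> open O -> O p ->
  exists b : M -> R, [/\ smooth_fun S b, forall q, 0 <= b q <= 1, 0 < b p,
    forall q, ~ O q -> b q = 0 &
    forall q, ~ dom c q -> exists U : set M, [/\ open U, U q & forall q', U q' -> b q' = 0]].
Proof.
move=> Sc cp oO Op; have [r r0 rO] := chart_sqdist cp oO Op.
pose k := scaled_bump (fwd c p) (2 / r).
have Kc x : H x -> sqdist (fwd c p) x <= r -> (fwd c @` dom c) x.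
  by move=> Hx /(rO _ Hx)[q [cq _] <-]; exists q.
have k0 x : r <= sqdist (fwd c p) x -> k x = 0.
  by move=> h; rewrite /k /scaled_bump smooth_step0// mulrAC ler_pdivlMr// ler_pM2l.
exists (chart_ext c k); split.
- by apply: chart_ext_smooth Kc k0 _ => // j; exact: Ck_scaled_bump.
- move=> q; rewrite /chart_ext; case: asboolP => _; last by rewrite lexx ler01.
  by rewrite smooth_step_ge0 smooth_step_le1.
- by rewrite chart_extE// /k /scaled_bump sqdistxx mulr0 smooth_step_gt0.
- move=> q nOq; rewrite /chart_ext; case: asboolP => // cq; apply: k0.
  rewrite leNgt; apply/negP => lt; apply: nOq.
  have Hq : H (fwd c q).
    by have [V oV EV] := chart_img_all c; have : (V `&` H) (fwd c q);
      [rewrite -EV; exists q|case].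
  have [q' [cq' Oq'] e] := rO _ Hq (ltW lt).
  by rewrite -(fwdK cq) -e fwdK.
- by move=> q; apply: (chart_ext_vanish r0 Kc k0).
Qed.

End Bumps.

(** * Existence of a metric, and the warped metrics *)

Section Metrics.
Context (R : realType).

Lemma quadD n (A B : 'M[R]_n) v : quad (A + B) v = quad A v + quad B v.
Proof. by rewrite /quad mulmxDr mulmxDl mxE. Qed.

Lemma quadZ n a (A : 'M[R]_n) v : quad (a *: A) v = a * quad A v.
Proof. by rewrite /quad -scalemxAr -scalemxAl mxE. Qed.

Lemma quad_sum n (I : Type) (s : seq I) (A : I -> 'M[R]_n) v :
  quad (\sum_(i <- s) A i) v = \sum_(i <- s) quad (A i) v.
Proof.
elim: s => [|i s IH]; last by rewrite !big_cons quadD IH.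
by rewrite !big_nil /quad mulmx0 mul0mx mxE.
Qed.

Lemma quad_conj n m (A : 'M[R]_m) (J : 'M[R]_(n, m)) v :
  quad (J *m A *m J^T) v = quad A (v *m J).
Proof. by rewrite /quad trmx_mul !mulmxA. Qed.

Lemma quad_outer n (D v : 'rV[R]_n) : quad (D^T *m D) v = ((v *m D^T) 0 0) ^+ 2.
Proof.
rewrite /quad mulmxA -mulmxA mxE big_ord1 expr2; congr (_ * _).
by rewrite (_ : D *m v^T = (v *m D^T)^T) ?mxE// trmx_mul trmxK.
Qed.

Lemma dot_ge0 n (v : 'rV[R]_n) : 0 <= (v *m v^T) 0 0.
Proof. by rewrite mxE; apply: sumr_ge0 => i _; rewrite mxE -expr2 sqr_ge0. Qed.

Lemma dot_eq0 n (v : 'rV[R]_n) : ((v *m v^T) 0 0 == 0) = (v == 0).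
Proof.
apply/idP/eqP => [/eqP|->]; last by rewrite mul0mx mxE.
rewrite mxE => /eqP; rewrite psumr_eq0 => [/allP h|i _]; last by rewrite mxE -expr2 sqr_ge0.
apply/rowP => i; have := h i (mem_index_enum _); rewrite /= mxE -expr2 sqrf_eq0 mxE.
by move/eqP.
Qed.

Lemma quad_gram_ge0 n (J : 'M[R]_n) v : 0 <= quad (J *m J^T) v.
Proof. by rewrite -[J in J *m _]mulmx1 quad_conj /quad mulmx1 dot_ge0. Qed.

Lemma quad_gram_gt0 n (J : 'M[R]_n) v : J \in unitmx -> v != 0 -> 0 < quad (J *m J^T) v.
Proof.
move=> uJ v0; rewrite lt_neqAle quad_gram_ge0 andbT eq_sym.
rewrite -[J in J *m _]mulmx1 quad_conj /quad mulmx1 dot_eq0.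
by apply: contra_neq v0 => vJ; rewrite -(mulmxK uJ v) vJ mul0mx.
Qed.

Lemma posdef_unit n (A : 'M[R]_n) : (forall v, v != 0 -> 0 < quad A v) -> A \in unitmx.
Proof.
move=> h; rewrite -row_free_unit -kermx_eq0; apply/negPn/negP => /rowV0Pn[v /sub_kermxP vA v0].
by have := h v v0; rewrite /quad vA mul0mx mxE ltxx.
Qed.

Context (n : nat) (M : ptopologicalType) (M_hausdorff : hausdorff_space M).
Hypothesis M_compact : compact [set: M].
Variable S : atlas R n M.
Local Notation H := (@half_space R n).

Lemma gmat_unit (g : metric S) c p : charts S c -> dom c p -> g c p \in unitmx.
Proof. by move=> Sc cp; apply: posdef_unit; exact: gmat_pos. Qed.

Lemma finite_cover (O : M -> set M) : (forall p, open (O p)) -> (forall p, O p p) ->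
  exists s : seq M, forall q, exists2 p, p \in s & O p q.
Proof.
move=> oO Op; have : cover_compact [set: M] by rewrite -compact_cover.
move=> /(_ M setT O (fun p _ => oO p)) [].
  by move=> q _; exists q.
move=> D _ cov; exists (finmap.enum_fset D) => q.
by have [p /= pD Oq] := cov q I; exists p.
Qed.

(** Euclidean metrics are pulled back by charts and added with bump weights. The weights are
    nonnegative and one of them is positive at each point; a normalised partition of unity would
    bring nothing more. *)
Lemma metric_exists : inhabited (metric S).
Proof.
have /choice[b hb] p : exists b : M -> R, [/\ smooth_fun S b, forall q, 0 <= b q <= 1, 0 < b p,
    forall q, ~ setT q -> b q = 0 &
    forall q, ~ dom (chart_at S p) q -> exists U : set M,
      [/\ open U, U q & forall q', U q' -> b q' = 0]].
  by have [Sc cp] := chart_atP S p; exact: (bump_exists M_hausdorff Sc cp openT I).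
have oB p : open (b p @^-1` [set t | 0 < t]).
  have [sb _ _ _ _] := hb p; apply: open_comp; last exact: open_gt.
  by move=> q _; exact: (smooth_fun_continuous sb).
have [s hs] := finite_cover oB (fun p => ltac:(by have [_ _ h _ _] := hb p)).
pose ch := chart_at S.
have Sch p : charts S (ch p) by have [] := chart_atP S p.
have b0 p q : ~ dom (ch p) q -> b p q = 0.
  have [_ _ _ _ h] := hb p; move=> /h[U [_ Uq]]; exact.
pose gm (c : chart R n M) q : 'M[R]_n :=
  \sum_(p <- s) b p q *: (jac c (ch p) q *m (jac c (ch p) q)^T).
constructor; apply: (@Defs.Metric R n M S gm).
- move=> c q Sc cq; rewrite /gm linear_sum; apply: eq_bigr => p _.
  by rewrite linearZ /= trmx_mul trmxK.
- move=> c q Sc cq v v0; rewrite /gm quad_sum.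
  have t0 p : 0 <= quad (b p q *: (jac c (ch p) q *m (jac c (ch p) q)^T)) v.
    by have [_ /(_ q)/andP[bq _] _ _ _] := hb p; rewrite quadZ mulr_ge0// quad_gram_ge0.
  have [p ps /= bp] := hs q.
  rewrite (big_rem p)//= ltr_pwDl//; last by apply: sumr_ge0 => i _.
  have [cp|ncp] := pselect (dom (ch p) q); last by rewrite b0// ltxx in bp.
  by rewrite quadZ mulr_gt0// quad_gram_gt0//; exact: (@jac_unit _ _ _ S).
- move=> c Sc; apply/smooth_on_mxP => i j.
  have E x : (fwd c @` dom c) x -> (\sum_(p <- s)
      (b p (bwd c x) *: (jac c (ch p) (bwd c x) *m (jac c (ch p) (bwd c x))^T)) i j) =
      (gm c \o bwd c) x i j.
    by move=> _; rewrite /= /gm summxE.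
  apply: smooth_on_eq E _; apply: smooth_on_sum => p.
  apply: smooth_on_local => _ [q cq <-]; have [V0 oV0 EV0] := chart_img_all c.
  have [cp|ncp] := pselect (dom (ch p) q).
    have [V oV EV] := chart_img_open c (dom_open (ch p)).
    have Vq : (V `&` H) (fwd c q) by rewrite -EV; exists q.
    exists V; first by split => //; case: Vq.
    apply: (@smooth_on_sub _ _ _ (fwd c @` (dom c `&` dom (ch p)))).
      by rewrite EV0 EV => x [[_ Hx] Vx].
    suff : smooth_on (fwd c @` (dom c `&` dom (ch p))) (fun x =>
       b p (bwd c x) *: (jac c (ch p) (bwd c x) *m (jac c (ch p) (bwd c x))^T)).
      by move=> /smooth_on_mxP; exact.
    apply: smooth_on_scalemx.
      have [sb _ _ _ _] := hb p; apply: smooth_on_sub (sb c Sc) => x [q' [cq' _] <-].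
      by exists q'.
    have sJ := smooth_on_jac Sc (Sch p).
    by apply: smooth_on_mulmx => //; exact: smooth_on_trmx.
  have [_ _ _ _ /(_ q ncp)[U [oU Uq U0]]] := hb p.
  have [V oV EV] := chart_img_open c oU.
  have Vq : (V `&` H) (fwd c q) by rewrite -EV; exists q.
  exists V; first by split => //; case: Vq.
  apply: (@smooth_on_sub _ _ _ (fwd c @` (dom c `&` U))).
    by rewrite EV0 EV => x [[_ Hx] Vx].
  apply: (@smooth_on_eq _ _ _ _ (fun=> 0)); last exact: (smooth_on_cst (W := R)).
  by move=> x [q' [cq' Uq'] <-]; rewrite fwdK// U0// scale0r mxE.
- move=> c c' q Sc Sc' cq c'q; rewrite /gm mulmx_sumr mulmx_suml.
  apply: eq_bigr => p _; have [cp|ncp] := pselect (dom (ch p) q); last first.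
    by rewrite b0// !scale0r mulmx0 mul0mx.
  rewrite -scalemxAr -scalemxAl; congr (_ *: _).
  by rewrite (@jac_trans _ _ _ S c c' (ch p) q)// trmx_mul !mulmxA.
Qed.

Section warp.
Variables (g : metric S) (th h : M -> R).
Hypotheses (sth : smooth_fun S th) (th0 : forall p, 0 < th p) (sh : smooth_fun S h).

Definition warp_gmat (c : chart R n M) (p : M) : 'M[R]_n :=
  (th p ^+ 2) *: g c p + (dform h c p)^T *m dform h c p.

Lemma warp_sym c p : charts S c -> dom c p -> (warp_gmat c p)^T = warp_gmat c p.
Proof.
by move=> Sc cp; rewrite /warp_gmat linearD linearZ /= gmat_sym// trmx_mul trmxK.
Qed.

Lemma warp_pos c p : charts S c -> dom c p -> forall v, v != 0 -> 0 < quad (warp_gmat c p) v.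
Proof.
move=> Sc cp v v0; rewrite /warp_gmat quadD quadZ quad_outer.
by rewrite ltr_pwDl ?sqr_ge0// mulr_gt0 ?exprn_gt0//; exact: gmat_pos.
Qed.

Lemma warp_smooth c : charts S c -> smooth_on (fwd c @` dom c) (warp_gmat c \o bwd c).
Proof.
move=> Sc; apply: (@smooth_on_addmx _ _ _ _ _
  (fun x => (th (bwd c x) ^+ 2) *: g c (bwd c x))
  (fun x => (dform h c (bwd c x))^T *m dform h c (bwd c x))).
  apply: (smooth_on_scalemx (f := fun x => th (bwd c x) ^+ 2)); last exact: gmat_smooth.
  apply: smooth_on_eq (smooth_on_mul (sth Sc) (sth Sc)) => x _.
  by rewrite expr2.
have sd := smooth_on_dform sh Sc.
by apply: smooth_on_mulmx => //; exact: smooth_on_trmx.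
Qed.

Lemma warp_coherent c c' p : charts S c -> charts S c' -> dom c p -> dom c' p ->
  warp_gmat c p = jac c c' p *m warp_gmat c' p *m (jac c c' p)^T.
Proof.
move=> Sc Sc' cp c'p; rewrite /warp_gmat mulmxDr mulmxDl -scalemxAr -scalemxAl.
rewrite -gmat_coherent//; congr (_ + _).
by rewrite (dform_trans sh Sc Sc' cp c'p) trmx_mul trmxK !mulmxA.
Qed.

Definition warp : metric S  := @Defs.Metric R n M S warp_gmat warp_sym warp_pos warp_smooth warp_coherent.

End warp.
End Metrics.

(** * Positive definite matrices and rank one perturbations *)

Section QuadraticForms.
Context {R : realType}.

(** Along the segment from the identity to A all matrices are positive definite, so the determinant,
    a polynomial in t, does not vanish and keeps the sign it has at the identity. *)
Lemma posdef_det n (A : 'M[R]_n) : (forall v, v != 0 -> 0 < quad A v) -> 0 < \det A.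
Proof.
move=> A0; rewrite lt_neqAle eq_sym -unitfE -unitmxE posdef_unit//= leNgt.
apply/negP => An.
pose P : 'M[{poly R}]_n := (1 - 'X)%:M + 'X *: map_mx polyC A.
have PE t : (\det P).[t] = \det ((1 - t)%:M + t *: A).
  rewrite -horner_evalE -det_map_mx; congr (\det _); apply/matrixP => i j.
  by rewrite !mxE /= horner_evalE !hornerE hornerMn !hornerE.
have [|t /andP[t0 t1]] := @poly_ivt R (- \det P) 0 1 ler01.
  by rewrite !hornerN !PE scale0r subr0 addr0 subrr scale1r det1 oppr_le0 ler01
    raddf0 add0r oppr_ge0 ltW.
rewrite rootN /root PE => /eqP d0.
suff : (1 - t)%:M + t *: A \in unitmx by rewrite unitmxE d0 unitr0.
apply: posdef_unit => v v0; rewrite quadD quadZ.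
have vv : 0 < (v *m v^T) 0 0 by rewrite lt_neqAle eq_sym dot_eq0 v0 dot_ge0.
rewrite {1}/quad mul_mx_scalar -scalemxAl mxE.
have [->|tn0] := eqVneq t 0; first by rewrite mul0r addr0 subr0 mul1r.
have t0' : 0 < t by rewrite lt_neqAle eq_sym tn0.
by rewrite ltr_wpDl ?mulr_gt0 ?A0// mulr_ge0 ?subr_ge0// ltW.
Qed.

Lemma quad_invmx n (A : 'M[R]_n) D : A \in unitmx -> A^T = A ->
  quad A (D *m invmx A) = quad (invmx A) D.
Proof.
move=> uA sA; rewrite /quad trmx_mul trmx_inv sA mulmxA.
by rewrite -(mulmxA D) mulVmx// mulmx1.
Qed.

Lemma quad_invmx_ge0 n (A : 'M[R]_n) D : A^T = A ->
  (forall v, v != 0 -> 0 < quad A v) -> 0 <= quad (invmx A) D.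
Proof.
move=> sA pA; rewrite -quad_invmx ?posdef_unit//.
have [->|/pA/ltW//] := eqVneq (D *m invmx A) 0.
by rewrite /quad mul0mx mul0mx mxE.
Qed.

Lemma quad_scale n (A : 'M[R]_n) a v : quad A (a *: v) = a ^+ 2 * quad A v.
Proof. by rewrite /quad linearZ /= -!scalemxAl -scalemxAr scalerA mxE expr2. Qed.

Lemma quad_add n (A : 'M[R]_n) v w : A^T = A ->
  quad A (v + w) = quad A v + 2 * (v *m A *m w^T) 0 0 + quad A w.
Proof.
move=> sA; have E (X Y Z T : 'M[R]_1) : (X + Y + (Z + T)) 0 0 = X 0 0 + Y 0 0 + (Z 0 0 + T 0 0).
  by rewrite !mxE.
rewrite /quad linearD /= !mulmxDl !mulmxDr E.
have -> : (w *m A *m v^T) 0 0 = (v *m A *m w^T) 0 0.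
  have -> : w *m A *m v^T = (v *m A *m w^T)^T by rewrite !trmx_mul trmxK sA mulmxA.
  by rewrite mxE.
by ring.
Qed.

(* Expand [B (DB^-1 - C^-1 DA^-1) >= 0]. *)
Lemma quad_invmx_le n (A B : 'M[R]_n) C D : A^T = A -> B^T = B -> 0 < C ->
  (forall v, v != 0 -> 0 < quad A v) -> (forall v, v != 0 -> 0 < quad B v) ->
  (forall v, quad B v <= C * quad A v) ->
  quad (invmx A) D <= C * quad (invmx B) D.
Proof.
move=> sA sB C0 pA pB BA; have [uA uB] := (posdef_unit pA, posdef_unit pB).
set x := D *m invmx A; set y := D *m invmx B.
have := @ltW _ _ 0 (quad B (y + (- C^-1) *: x)).
have h0 : 0 <= quad B (y + (- C^-1) *: x).
  have [->|/pB/ltW//] := eqVneq (y + (- C^-1) *: x) 0.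
  by rewrite /quad mul0mx mul0mx mxE.
move=> _; move: h0; rewrite quad_add// quad_scale quad_invmx// linearZ /= -scalemxAr mxE.
have -> : (y *m B *m x^T) 0 0 = quad (invmx A) D.
  by rewrite /y mulmxKV// /x trmx_mul trmx_inv sA /quad mulmxA.
have := BA x; rewrite quad_invmx// sqrrN => h1 h2.
set a := quad (invmx A) D in h1 h2 *; set b := quad (invmx B) D in h2 *.
have : 0 <= b + 2 * (- C^-1 * a) + C^-1 ^+ 2 * (C * a).
  by apply: le_trans h2 _; rewrite lerD2l ler_wpM2l// sqr_ge0.
have -> : b + 2 * (- C^-1 * a) + C^-1 ^+ 2 * (C * a) = C^-1 * (C * b - a).
  by field; rewrite gt_eqF.
by rewrite pmulr_rge0 ?invr_gt0// subr_ge0.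
Qed.

(** Tested on v = D A^-1 the hypothesis reads a^2 <= a, where a is the left-hand side. *)
Lemma quad_invmx_le1 n (A : 'M[R]_n) D : A \in unitmx -> A^T = A ->
  (forall v, ((v *m D^T) 0 0) ^+ 2 <= quad A v) -> quad (invmx A) D <= 1.
Proof.
move=> uA sA /(_ (D *m invmx A)); rewrite quad_invmx// -/(quad _ _).
set a := quad _ _; have [//|a1 h] := lerP a 1.
by have : a ^+ 2 <= a := h; rewrite expr2 -{3}(mul1r a) ler_pM2r ?leNgt ?a1// (lt_trans ltr01).
Qed.

(** The determinant of the block matrix K is computed by eliminating either of its two diagonal
    blocks. *)
Lemma det_rank1 n (A : 'M[R]_n) D : A \in unitmx ->
  \det (A + D^T *m D) = (1 + quad (invmx A) D) * \det A.
Proof.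
move=> uA; pose K : 'M[R]_(1 + n) := block_mx 1%:M (- D) D^T A.
have E1 : block_mx 1%:M 0 (- D^T) 1%:M *m K = block_mx 1%:M (- D) 0 (A + D^T *m D).
  rewrite /K mulmx_block !mul1mx !mul0mx !mulmx1 !addr0 addNr.
  by rewrite mulmxN mulNmx opprK addrC.
have E2 : K *m block_mx 1%:M 0 (- (invmx A *m D^T)) 1%:M =
    block_mx (1%:M + D *m invmx A *m D^T) (- D) 0 A.
  rewrite /K mulmx_block !mulmx1 !mulmx0 !add0r mulmxN mulNmx opprK mulmxA.
  by rewrite mulmxN !mulmxA mulmxV// mul1mx subrr.
have := congr1 determinant E1; rewrite det_mulmx det_lblock !det1 !mul1r det_ublock det1 mul1r => <-.
have := congr1 determinant E2; rewrite det_mulmx det_lblock !det1 !mulr1 det_ublock => ->.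
have E (Y : 'M[R]_1) : (1%:M + Y) 0 0 = 1 + Y 0 0 by rewrite !mxE.
by rewrite det_mx11 E.
Qed.

(** The perturbation acts in one direction only: n - 1 directions keep the factor t^2. This exponent
    is what makes the neck small in volume. *)
Lemma det_warp n (A : 'M[R]_n) D t : (0 < n)%N -> A \in unitmx -> t != 0 ->
  \det (t ^+ 2 *: A + D^T *m D) =
    (t ^+ n.-1) ^+ 2 * (t ^+ 2 + quad (invmx A) D) * \det A.
Proof.
move=> n0 uA t0; have t20 : t ^+ 2 != 0 by rewrite expf_neq0.
have uT : t ^+ 2 *: A \in unitmx by rewrite unitmxZ// unitfE.
rewrite det_rank1// invmxZ// quadZ detZ.
have -> : (t ^+ 2) ^+ n = (t ^+ n.-1) ^+ 2 * t ^+ 2.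
  by rewrite -!exprM -exprD -mulSnr prednK// mulnC.
by field.
Qed.

End QuadraticForms.

(** * Gradients and their norms for two metrics *)

Section Energies.
Context (R : realType) (n : nat) (M : ptopologicalType).
Variable S : atlas R n M.

Definition coherent (X : vfield R n M) (p : M) := forall c c', charts S c -> charts S c' ->
  dom c p -> dom c' p -> X c' p = X c p *m jac c c' p.

Lemma sqnorm_chart (g : metric S) X c p : coherent X p -> charts S c -> dom c p ->
  sqnorm g X p = quad (g c p) (X c p).
Proof.
move=> hX Sc cp; have [Sc' c'p] := chart_atP S p; rewrite /sqnorm.
by rewrite (gmat_coherent g Sc Sc' cp c'p) quad_conj -hX.
Qed.

Lemma sqnorm_ge0 (g : metric S) X p : 0 <= sqnorm g X p.
Proof.
have [Sc cp] := chart_atP S p; rewrite /sqnorm.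
have [->|/(gmat_pos g Sc cp)/ltW//] := eqVneq (X (chart_at S p) p) 0.
by rewrite /quad mul0mx mul0mx mxE.
Qed.

Lemma coherent_gradient (g : metric S) f p : smooth_fun S f -> coherent (gradient g f) p.
Proof.
move=> sf c c' Sc Sc' cp c'p; rewrite !gradientE.
have u := gmat_unit g Sc cp; have u' := gmat_unit g Sc' c'p.
apply: (can_inj (mulmxK u')); rewrite mulmxKV//.
have uJ := jac_unit Sc Sc' cp c'p.
have uJT : (jac c c' p)^T \in unitmx by rewrite unitmx_tr.
apply: (can_inj (mulmxK uJT)).
by rewrite -(dform_trans sf Sc Sc' cp c'p) -!mulmxA (mulmxA (jac c c' p)) -gmat_coherent// mulVmx// mulmx1.
Qed.

Lemma coherent_comb X Y (a b : R) p : coherent X p -> coherent Y p ->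
  coherent (fun c q => a *: X c q + b *: Y c q) p.
Proof.
move=> hX hY c c' Sc Sc' cp c'p.
by rewrite (hX c c')// (hY c c')// !scalemxAl mulmxDl.
Qed.

Lemma dform_comb f1 f2 (a b : R) c p : smooth_fun S f1 -> smooth_fun S f2 ->
  charts S c -> dom c p ->
  dform (fun q => a * f1 q + b * f2 q) c p = a *: dform f1 c p + b *: dform f2 c p.
Proof.
move=> s1 s2 Sc cp; have [V oV EV] := chart_img_all c.
have Vp : (V `&` half_space (n:=n)) (fwd c p) by rewrite -EV; exists p.
have s1' := s1 c Sc; have s2' := s2 c Sc; rewrite EV in s1' s2'.
have [U1 [F1 [oU1 UV1 Ux1 CF1 fF1]]] := smooth_on_ext oV s1' Vp.
have [U2 [F2 [oU2 UV2 Ux2 CF2 fF2]]] := smooth_on_ext oV s2' Vp.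
have [_ Hx] := Vp; apply/rowP => i; rewrite !mxE.
have d1 : derivable F1 (fwd c p) (delta_mx 0 i) by have [_ /(_ i)[h _]] := CF1 1%N; exact: h.
have d2 : derivable F2 (fwd c p) (delta_mx 0 i) by have [_ /(_ i)[h _]] := CF2 1%N; exact: h.
rewrite (partialE oU1 Ux1 Hx d1 fF1) (partialE oU2 Ux2 Hx d2 fF2).
rewrite (@partialE _ _ (U1 `&` U2) _ (a *: F1 + b *: F2)).
- by rewrite deriveD; [rewrite !deriveZ|exact: derivableZ|exact: derivableZ].
- exact: openI.
- by split.
- exact: Hx.
- by apply: derivableD; exact: derivableZ.
- by move=> y [U1y U2y] Hy; have /= -> := fF1 y U1y Hy; have /= -> := fF2 y U2y Hy.
Qed.

Lemma gradient_comb (g : metric S) f1 f2 (a b : R) c p : smooth_fun S f1 -> smooth_fun S f2 ->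
  charts S c -> dom c p ->
  gradient g (fun q => a * f1 q + b * f2 q) c p = a *: gradient g f1 c p + b *: gradient g f2 c p.
Proof.
move=> s1 s2 Sc cp; by rewrite !gradientE !scalemxAl -mulmxDl (dform_comb _ _ s1 s2 Sc cp).
Qed.

Lemma sqnorm_gradient (g : metric S) f c p : smooth_fun S f -> charts S c -> dom c p ->
  sqnorm g (gradient g f) p = quad (invmx (g c p)) (dform f c p).
Proof.
move=> sf Sc cp; rewrite (sqnorm_chart _ (coherent_gradient g (p := p) sf) Sc cp).
by rewrite gradientE quad_invmx ?gmat_unit ?gmat_sym.
Qed.

Lemma smooth_sqnorm_gradient (g : metric S) f : smooth_fun S f ->
  smooth_fun S (sqnorm g (gradient g f)).
Proof.
move=> sf c Sc; have sd := smooth_on_dform sf Sc.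
have si : smooth_on (fwd c @` dom c) (fun x => invmx (g c (bwd c x))).
  by apply: smooth_on_invmx; [move=> _ [p cp <-]; rewrite fwdK// gmat_unit|exact: gmat_smooth].
have := smooth_on_mulmx (smooth_on_mulmx sd si) (smooth_on_trmx sd).
move=> /smooth_on_mxP /(_ 0 0) sq.
apply: smooth_on_eq sq => x Ax; have [cp e] := bwd_img Ax.
by rewrite /= (sqnorm_gradient g sf Sc cp).
Qed.

(** Gradients are measured by the inverse matrix, and inversion reverses the comparison of
    metrics. *)
Lemma sqnorm_gradient_le (g G : metric S) f p C : smooth_fun S f -> 0 < C ->
  (forall c, charts S c -> dom c p -> forall v, quad (G c p) v <= C * quad (g c p) v) ->
  sqnorm g (gradient g f) p <= C * sqnorm G (gradient G f) p.
Proof.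
move=> sf C0 h; have [Sc cp] := chart_atP S p.
rewrite !(sqnorm_gradient _ sf Sc cp); apply: quad_invmx_le => //; try exact: gmat_sym.
- exact: gmat_pos.
- exact: gmat_pos.
- exact: h.
Qed.

Section warp.
Variables (g : metric S) (th h : M -> R).
Hypotheses (sth : smooth_fun S th) (th0 : forall p, 0 < th p) (sh : smooth_fun S h).
Let G := warp g sth th0 sh.

(** The warped metric dominates dh dh, so dh has norm at most 1 for it, whatever [th] is. *)
Lemma sqnorm_gradient_warp p : sqnorm G (gradient G h) p <= 1.
Proof.
have [Sc cp] := chart_atP S p; rewrite (sqnorm_gradient _ sh Sc cp).
apply: quad_invmx_le1; [exact: gmat_unit|exact: gmat_sym|move=> v].
rewrite /G /= /warp_gmat quadD quad_outer quadZ lerDr mulr_ge0 ?sqr_ge0//.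
have [->|/(gmat_pos g Sc cp)/ltW//] := eqVneq v 0.
by rewrite /quad mul0mx mul0mx mxE.
Qed.

(* Cauchy-Schwarz: [(dh v)^2 <= |dh|_g^2 g(v, v)]. *)
Lemma quad_outer_le m (A : 'M[R]_m) D v : A^T = A ->
  (forall v, v != 0 -> 0 < quad A v) ->
  ((v *m D^T) 0 0) ^+ 2 <= quad (invmx A) D * quad A v.
Proof.
move=> sA pA; have uA := posdef_unit pA.
set b := (v *m D^T) 0 0; set a := quad (invmx A) D; set q := quad A v.
have pos t : 0 <= a + 2 * t * b + t ^+ 2 * q.
  have : 0 <= quad A (D *m invmx A + t *: v).
    have [->|/pA/ltW//] := eqVneq (D *m invmx A + t *: v) 0.
    by rewrite /quad mul0mx mul0mx mxE.
  rewrite quad_add// quad_scale quad_invmx// mulmxKV// linearZ /= -scalemxAr mxE.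
  have -> : (D *m v^T) 0 0 = b.
    by rewrite /b (_ : D *m v^T = (v *m D^T)^T) ?mxE// trmx_mul trmxK.
  by rewrite !mulrA.
have [v0|v0] := eqVneq v 0.
  by rewrite /b /q v0 mul0mx !mxE /quad mul0mx mul0mx mxE expr0n mulr0.
have q0 : 0 < q by exact: pA.
have := pos (- b / q).
have -> : a + 2 * (- b / q) * b + (- b / q) ^+ 2 * q = (a * q - b ^+ 2) / q.
  by field; rewrite gt_eqF.
by rewrite pmulr_lge0 ?invr_gt0// subr_ge0.
Qed.

Lemma quad_warp_le c p v : charts S c -> dom c p ->
  quad (G c p) v <= (th p ^+ 2 + sqnorm g (gradient g h) p) * quad (g c p) v.
Proof.
move=> Sc cp; rewrite /G /= /warp_gmat quadD quadZ quad_outer mulrDl lerD2l.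
rewrite (sqnorm_gradient _ sh Sc cp).
by apply: quad_outer_le; [exact: gmat_sym|exact: gmat_pos].
Qed.

Lemma sqrt_det_warp c p : (0 < n)%N -> charts S c -> dom c p ->
  Num.sqrt (\det (G c p)) =
    th p ^+ n.-1 * Num.sqrt (th p ^+ 2 + sqnorm g (gradient g h) p) * Num.sqrt (\det (g c p)).
Proof.
move=> n0 Sc cp; rewrite /G /= /warp_gmat det_warp ?gmat_unit ?gt_eqF//.
rewrite (sqnorm_gradient _ sh Sc cp); set a := quad _ _.
have a0 : 0 <= a by apply: quad_invmx_ge0; [exact: gmat_sym|exact: gmat_pos].
have ta : 0 <= th p ^+ 2 + a by rewrite addr_ge0 ?sqr_ge0.
set x := th p ^+ n.-1; set b := th p ^+ 2 + a in ta *.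
have x0 : 0 <= x by rewrite exprn_ge0// ltW.
transitivity (Num.sqrt (x ^+ 2 * (b * \det (g c p)))); first by rewrite mulrA.
by rewrite (sqrtrM _ (sqr_ge0 x)) sqrtr_sqr ger0_norm// sqrtrM// mulrA.
Qed.

End warp.

Lemma sqrt_det_gt0 (g : metric S) c p : charts S c -> dom c p -> 0 < Num.sqrt (\det (g c p)).
Proof. by move=> Sc cp; rewrite sqrtr_gt0; apply: posdef_det; exact: gmat_pos. Qed.

Hypothesis M_compact : compact [set: M].

Lemma continuous_bounded (f : M -> R) : continuous f -> exists2 K, 0 < K & forall p, `|f p| <= K.
Proof.
move=> cf; have : compact (f @` [set: M]).
  by apply: continuous_compact => //; exact: continuous_subspaceT.
move=> /(@compact_bounded R R)[K [_ hK]]; exists (Num.max 1 (K + 1)).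
  by rewrite lt_max ltr01.
move=> p; apply: hK; last by exists p.
by rewrite lt_max ltrDl ltr01 orbT.
Qed.

End Energies.

(** * The Riemannian volume *)

Section VolumeExists.
Context (R : realType) (n : nat) (M : ptopologicalType).
Hypothesis M_compact : compact [set: M].
Variable S : atlas R n M.
Local Notation H := (@half_space R n).
Local Notation BV := (borel 'rV[R]_n).
Local Notation BM := (borel M).

Lemma measurable_dom c : measurable (dom (c : chart R n M) : set BM).
Proof. by apply: borel_open; exact: dom_open. Qed.

Lemma measurable_img (c : chart R n M) : measurable (fwd c @` dom c : set BV).
Proof. by have [V oV ->] := chart_img_all c; exact: measurable_relopen. Qed.

Lemma within_chart (T : topologicalType) (c : chart R n M) (f : 'rV[R]_n -> T) :
  {within fwd c @` dom c, continuous f} -> {within dom c, continuous (f \o fwd c)}.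
Proof.
move=> cf; apply/subspace_continuousP => p cp.
have h1 := (subspace_continuousP _ _).1 (@fwd_continuous _ _ _ c) p cp.
have h2 := (subspace_continuousP _ _).1 cf (fwd c p) (ex_intro2 _ _ p cp erefl).
move=> P hP; have h4 : \forall y \near p, dom c y -> (fwd c @` dom c) (fwd c y) ->
  P (f (fwd c y)) := h1 _ (h2 _ hP).
apply: filterS h4 => y hy cy.
by apply: hy => //; exists y.
Qed.

(** The values of [bwd c] off the image of the chart are arbitrary; replacing them by [point] gives
    a map that is Borel on the whole space. *)
Definition tbwd (c : chart R n M) : BV -> BM :=
  patch (fun=> point : BM) (fwd c @` dom c : set BV) (bwd c : BV -> BM).

Lemma tbwdE c x : (fwd c @` dom c) x -> tbwd c x = bwd c x.
Proof. by move=> cx; rewrite /tbwd /patch mem_set. Qed.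

Lemma tbwdK c p : dom c p -> tbwd c (fwd c p) = p.
Proof. by move=> cp; rewrite tbwdE ?fwdK//; exists p. Qed.

Lemma measurable_tbwd c : measurable_fun setT (tbwd c).
Proof.
apply: (proj1 (measurable_restrictT (bwd c : BV -> BM) (measurable_img c))).
apply: within_continuous_borel; first exact: measurable_img.
exact: bwd_continuous.
Qed.

Lemma fwd_image_tbwd c (B : set M) : B `<=` dom c ->
  fwd c @` B = (fwd c @` dom c) `&` tbwd c @^-1` B.
Proof.
move=> Bc; apply/seteqP; split => x.
  move=> [p Bp <-]; have cp := Bc _ Bp; split; first by exists p.
  by rewrite /= tbwdK.
by move=> [[p cp <-]]; rewrite /= tbwdK// => Bp; exists p.
Qed.

Lemma measurable_fwd_image c (B : set BM) : measurable B -> B `<=` dom c ->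
  measurable (fwd c @` B : set BV).
Proof.
move=> mB Bc; rewrite fwd_image_tbwd//; apply: measurableI; first exact: measurable_img.
by rewrite -[X in measurable X]setTI; exact: (measurable_tbwd c).
Qed.

Variable g : metric S.

Definition vdens (c : chart R n M) (p : BM) : R :=
  patch (fun=> 0) (dom c `&` [set _ | charts S c]) (fun p => Num.sqrt (\det (g c p))) p.

Lemma vdensE c p : charts S c -> dom c p -> vdens c p = Num.sqrt (\det (g c p)).
Proof. by move=> Sc cp; rewrite /vdens /patch mem_set. Qed.

Lemma vdens_ge0 c p : 0 <= vdens c p.
Proof. by rewrite /vdens /patch; case: ifP => // _; exact: sqrtr_ge0. Qed.

Lemma measurable_vdens c : measurable_fun setT (vdens c).
Proof.
have [Sc|nSc] := pselect (charts S c); last first.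
  rewrite (_ : vdens c = fun=> 0); first exact: measurable_cst.
  by apply/funext => p; rewrite /vdens /patch; case: ifP => // /set_mem[].
have -> : vdens c = (fun p : BM => Num.sqrt (\det (g c p))) \_ (dom c : set BM).
  by apply/funext => p; rewrite /vdens /patch (_ : dom c `&` _ = dom c)//;
    apply/seteqP; split => q //= [].
apply: (proj1 (measurable_restrictT _ (measurable_dom c))).
have w := within_chart (smooth_on_within (smooth_on_det (gmat_smooth g Sc))).
pose f (p : BM) := Num.sqrt (\det (g c (bwd c (fwd c p)))).
apply: (@eq_measurable_fun _ _ BM R (dom c) f).
  by move=> p /set_mem cp; rewrite /f fwdK.
apply: within_continuous_borelR; first exact: measurable_dom.
by move=> p; apply: (continuous_comp (w p)); exact: sqrt_continuous.
Qed.

Lemma measurable_cdens c : measurable_fun setT (vdens c \o tbwd c).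
Proof. by apply: measurableT_comp; [exact: measurable_vdens|exact: measurable_tbwd]. Qed.

Lemma cdens_ge0 c x : 0 <= (vdens c \o tbwd c) x.
Proof. exact: vdens_ge0. Qed.

(** The volume of the part of M covered by one chart, as a measure on M: Lebesgue measure with
    density the square root of the determinant of the metric, restricted to the image of the chart
    and pushed to M. *)
Definition chart_vol (c : chart R n M) : {measure set BM -> \bar R} :=
  pushm (mrestr (dens (leb n) (measurable_cdens c) (cdens_ge0 c)) (measurable_img c))
    (measurable_tbwd c).

Lemma integral_chart_vol c (B : set BM) (f : BM -> \bar R) : measurable B -> B `<=` dom c ->
  measurable_fun setT f -> (forall p, 0 <= f p)%E ->
  (\int[chart_vol c]_(p in B) f p =
   \int[leb n]_(x in fwd c @` B) (f (tbwd c x) * (vdens c (tbwd c x))%:E))%E.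
Proof.
move=> mB Bc mf f0.
have mft : measurable_fun setT (f \o tbwd c) by apply: measurableT_comp mf (measurable_tbwd c).
have mtB : measurable (tbwd c @^-1` B).
  by rewrite -[X in measurable X]setTI; exact: (measurable_tbwd c).
have -> : fwd c @` B = tbwd c @^-1` B `&` (fwd c @` dom c) by rewrite fwd_image_tbwd// setIC.
have mfB : measurable_fun B f by exact: measurable_funTS.
have mftB : measurable_fun (tbwd c @^-1` B) (f \o tbwd c) by exact: measurable_funTS.
apply: (etrans (ge0_integral_pushm _ _ mB mfB (fun p _ => f0 p))).
apply: (etrans (ge0_integral_mrestr _ (measurable_img c) mtB mftB (fun x _ => f0 (tbwd c x)))).
have mI : measurable (tbwd c @^-1` B `&` fwd c @` dom c : set BV).
  by apply: measurableI => //; exact: measurable_img.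
have mfI : measurable_fun (tbwd c @^-1` B `&` fwd c @` dom c : set BV) (f \o tbwd c).
  exact: measurable_funTS.
apply: (etrans (@ge0_integral_dens _ _ _ (leb n) _ (measurable_cdens c) (cdens_ge0 c) _ _
  mI mfI (fun x _ => f0 (tbwd c x)))).
by [].
Qed.

Lemma chart_volE c (B : set BM) : measurable B -> B `<=` dom c ->
  chart_vol c B = (\int[leb n]_(x in fwd c @` B) (vdens c (tbwd c x))%:E)%E.
Proof.
move=> mB Bc; have := @integral_chart_vol c B (fun=> 1%E) mB Bc (measurable_cst _) (fun=> lee01).
rewrite integral_cst// mul1e => ->; apply: eq_integral => x _; exact: mul1e.
Qed.

(** Coherence of the metric multiplies the determinant by the square of the Jacobian determinant of
    the transition map, and change of variables absorbs its absolute value. *)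
Lemma chart_vol_eq c c' (E : set BM) : charts S c -> charts S c' -> measurable E ->
  E `<=` dom c `&` dom c' -> chart_vol c E = chart_vol c' E.
Proof.
move=> Sc Sc' mE Ecc.
have Ec : E `<=` dom c by move=> p /Ecc[].
have Ec' : E `<=` dom c' by move=> p /Ecc[].
rewrite !chart_volE//; have [V [W [EV EW FG]]] := transition_diffeo Sc Sc' openT.
rewrite !setIT in EV EW; pose A : set BV := fwd c @` E.
have mA : measurable (A : set BV) by exact: measurable_fwd_image.
have AV : A `<=` V `&` H by rewrite -EV => _ [p Ep <-]; exists p => //; exact: Ecc.
have EA : fwd c' @` E = (W `&` H) `&` (fwd c \o bwd c') @^-1` A.
  rewrite -EW; apply/seteqP; split => y.
    move=> [p Ep <-]; have [cp c'p] := Ecc _ Ep; split; first by exists p.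
    by rewrite /= fwdK//; exists p.
  move=> [[p [c'p cp] <-]]; rewrite /= fwdK// => -[q Eq e]; exists p => //.
  by rewrite -(fwdK cp) -e fwdK//; exact: Ec.
pose f (x : BV) := (vdens c' (tbwd c x))%:E.
have mf : measurable_fun setT f.
  apply/measurable_EFinP; apply: measurableT_comp; first exact: measurable_vdens.
  exact: measurable_tbwd.
have f0 x : (0 <= f x)%E by rewrite lee_fin vdens_ge0.
transitivity (\int[leb n]_(x in A) (f x * (wjac V (fwd c' \o bwd c) x)%:E))%E.
  apply: eq_integral => x /set_mem [p Ep <-]; have [cp c'p] := Ecc _ Ep.
  rewrite /f tbwdK// !vdensE// /wjac mem_set; last by apply: AV; exists p.
  rewrite -jacE -EFinM (gmat_coherent g Sc Sc' cp c'p) !det_mulmx det_tr.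
  congr (_%:E); rewrite mulrAC sqrtrM -?expr2 ?sqr_ge0// sqrtr_sqr mulrC.
  by rewrite mulrC.
have := @integral_image_leb _ _ _ _ _ _ FG A f mA mf f0; rewrite -EA.
rewrite [X in _ = X -> _](_ : _ = \int[leb n]_(x in fwd c' @` E) (vdens c' (tbwd c' x))%:E)%E.
  move=> <-; rewrite -(@ge0_integral_dens _ _ _ _ _ (measurable_wjac FG) (@wjac_ge0 _ _ V _))//.
    have eqm B : measurable B -> B `<=` A -> image_leb FG B =
        dens (leb n) (measurable_wjac FG) (@wjac_ge0 _ _ V (fwd c' \o bwd c)) B.
      by move=> mB BA; rewrite image_lebE; apply: change_of_variables => // x /BA/AV.
    by apply/eqP; rewrite eq_le; apply/andP; split; apply: le_measure_integral => // B mB BA;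
      rewrite eqm.
  exact: measurable_funTS.
apply: eq_integral => x /set_mem [p Ep <-]; have [cp c'p] := Ecc _ Ep.
by rewrite /f /= fwdK// !tbwdK.
Qed.

Lemma chart_cover_seq : exists (N : nat) (ch : nat -> chart R n M),
  (forall k, charts S (ch k)) /\ (forall p, exists2 k, (k < N)%N & dom (ch k) p).
Proof.
have [s hs] := finite_cover M_compact (fun p => dom_open (chart_at S p))
  (fun p => (chart_atP S p).2).
exists (size s), (fun k => chart_at S (nth point s k)); split.
  by move=> k; have [] := chart_atP S (nth point s k).
move=> p; have [q qs cp] := hs p; exists (index q s); first by rewrite index_mem.
by rewrite nth_index.
Qed.

Lemma chart_partition : exists (N : nat) (ch : nat -> chart R n M) (D : nat -> set BM),
  [/\ forall k, charts S (ch k), forall k, measurable (D k), forall k, D k `<=` dom (ch k),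
      trivIset setT D & \big[setU/set0]_(k < N) D k = setT].
Proof.
have [N [ch [Sch cov]]] := chart_cover_seq.
pose F k : set BM := dom (ch k).
have mF k : measurable (F k) by exact: measurable_dom.
exists N, ch, (seqDU F); split => //.
- by move=> k; apply: measurableD => //; exact: bigsetU_measurable.
- by move=> k p [].
- rewrite -bigsetU_seqDU -bigcup_mkord; apply/seteqP; split => // p _.
  by have [k kN cp] := cov p; exists k.
Qed.

Lemma measure_partition (m : {measure set BM -> \bar R}) N (D : nat -> set BM) (B : set BM) :
  (forall k, measurable (D k)) -> trivIset setT D -> \big[setU/set0]_(k < N) D k = setT ->
  measurable B -> m B = (\sum_(k < N) m (B `&` D k))%E.
Proof.
move=> mD tD UD mB; rewrite -{1}(setIT B) -UD big_distrr /=.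
apply: measure_bigsetU_ord.
  by move=> k; exact: measurableI.
by move=> i j _ _ [p [[_ Di] [_ Dj]]]; apply/val_inj/(tD _ _ I I); exists p.
Qed.

Lemma chart_vol_lebesgue c (B : set BM) : charts S c -> measurable B -> B `<=` dom c ->
  chart_vol c B = lebesgue_int (fun x =>
    (\1_(fwd c @` B) x * Num.sqrt (\det (g c (bwd c x))))%:E).
Proof.
move=> Sc mB Bc.
rewrite chart_volE// integral_mkcond -integral_leb.
- apply: eq_integral => x _; rewrite /restrict /patch; case: ifPn => [|/negP nx].
    move=> /set_mem Bx; have [p Bp e] := Bx; rewrite indicE mem_set// mul1r.
    by rewrite -e tbwdK ?fwdK ?vdensE//; exact: Bc.
  by rewrite indicE (negbTE (introN idP nx)) mul0r.
- have mi : measurable (fwd c @` B : set BV) by exact: measurable_fwd_image.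
  rewrite (_ : (fun x => _) = fun x : BV => (\1_(fwd c @` B) x * (vdens c \o tbwd c) x)%:E).
    apply/measurable_EFinP; apply: measurable_funM; last exact: measurable_cdens.
    exact: measurable_indic.
  apply/funext => x; congr (_%:E); rewrite indicE; case: (asboolP ((fwd c @` B) x)) => Bx.
    have [p Bp e] := Bx; rewrite mem_set// -e /= tbwdK ?fwdK ?vdensE//; exact: Bc.
  by rewrite memNset// !mul0r.
- by move=> x; rewrite lee_fin mulr_ge0// sqrtr_ge0.
Qed.

(** Finitely many charts cover M; cutting M into disjoint pieces inside them and adding the chart
    volumes of the pieces gives a measure that agrees with every chart volume by [chart_vol_eq]. *)
Lemma volume_exists : exists mu, is_volume g mu.
Proof.
have [N [ch [D [Sch mD Dch tD UD]]]] := chart_partition.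
pose m k : {measure set BM -> \bar R} := mrestr (chart_vol (ch k)) (mD k).
pose mu : {measure set BM -> \bar R} := msum m N.
exists mu => c B Sc mB Bc.
have -> : mu B = chart_vol c B.
  rewrite (measure_partition (chart_vol c) mD tD UD mB) /mu /= /msum; apply: eq_bigr => k _.
  rewrite /m /mrestr; apply: chart_vol_eq => //; first exact: measurableI.
  by move=> p [Bp Dp]; split; [exact: Dch Dp|exact: Bc].
exact: chart_vol_lebesgue.
Qed.

Lemma volumeP : is_volume g (volume g).
Proof.
rewrite /volume; case: pselect => [e|/(_ volume_exists)//].
by case: (cid e).
Qed.

End VolumeExists.

(** * Densities between volumes, and coordinate boxes *)

Section VolumeTheory.
Context (R : realType) (n : nat) (M : ptopologicalType).
Hypothesis M_compact : compact [set: M].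
Variable S : atlas R n M.
Local Notation H := (@half_space R n).
Local Notation BV := (borel 'rV[R]_n).
Local Notation BM := (borel M).

Lemma volume_chart_vol (g : metric S) c (B : set BM) : charts S c -> measurable B ->
  B `<=` dom c -> volume g B = chart_vol g c B.
Proof.
move=> Sc mB Bc; rewrite chart_vol_lebesgue//.
exact: (volumeP M_compact g).
Qed.

Lemma volume_chart (g : metric S) c (B : set BM) (f : BM -> \bar R) : charts S c ->
  measurable B -> B `<=` dom c -> measurable_fun setT f -> (forall p, 0 <= f p)%E ->
  (\int[volume g]_(p in B) f p =
   \int[leb n]_(x in fwd c @` B) (f (tbwd c x) * (vdens g c (tbwd c x))%:E))%E.
Proof.
move=> Sc mB Bc mf f0; rewrite -integral_chart_vol//.
have eqm A : measurable A -> A `<=` B -> volume g A = chart_vol g c A.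
  by move=> mA AB; apply: volume_chart_vol => // p /AB/Bc.
by apply/eqP; rewrite eq_le; apply/andP; split; apply: le_measure_integral => // A mA AB;
  rewrite eqm.
Qed.

Lemma measure_eq_charts (m1 m2 : {measure set BM -> \bar R}) :
  (forall c (B : set BM), charts S c -> measurable B -> B `<=` dom c -> m1 B = m2 B) ->
  forall B, measurable B -> m1 B = m2 B.
Proof.
move=> h B mB; have [N [ch [D [Sch mD Dch tD UD]]]] := chart_partition M_compact S.
rewrite (measure_partition m1 mD tD UD mB) (measure_partition m2 mD tD UD mB).
apply: eq_bigr => k _; apply: h (Sch k) _ _; first exact: measurableI.
by move=> p [_ /Dch].
Qed.

(** The ratio r of the densities is a function on M that no longer depends on the chart, so the two
    volumes can be compared chart by chart. *)
Lemma volume_density (g G : metric S) (r : BM -> R) :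
  measurable_fun setT r -> (forall p, 0 <= r p) ->
  (forall c p, charts S c -> dom c p ->
    Num.sqrt (\det (G c p)) = r p * Num.sqrt (\det (g c p))) ->
  forall (A : set BM) (f : BM -> \bar R), measurable A -> measurable_fun setT f ->
    (forall p, 0 <= f p)%E ->
  (\int[volume G]_(p in A) f p = \int[volume g]_(p in A) (f p * (r p)%:E))%E.
Proof.
move=> mr r0 hr A f mA mf f0.
have mfA : measurable_fun A f by exact: measurable_funTS.
apply: etrans (@ge0_integral_dens _ _ _ (volume g) _ mr r0 _ _ mA mfA (fun x _ => f0 x)).
have eqm B : measurable B -> volume G B = dens (volume g) mr r0 B.
  apply: measure_eq_charts => c {}B Sc mB Bc.
  rewrite (volume_chart_vol G Sc mB Bc) (chart_volE G mB Bc).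
  have mrE : measurable_fun setT (fun p => (r p)%:E) by exact/measurable_EFinP.
  have rE0 p : (0 <= (r p)%:E)%E by rewrite lee_fin.
  apply: esym; apply: etrans (volume_chart g Sc mB Bc mrE rE0) _.
  apply: eq_integral => x /set_mem[p Bp <-]; have cp := Bc _ Bp.
  by rewrite tbwdK// !vdensE// (hr c p Sc cp).
by apply/eqP; rewrite eq_le; apply/andP; split; apply: le_measure_integral => // B mB AB;
  rewrite eqm.
Qed.

Lemma fwd_half_space (c : chart R n M) p : dom c p -> H (fwd c p).
Proof.
move=> cp; have [V oV EV] := chart_img_all c.
by have : (fwd c @` dom c) (fwd c p); [exists p|rewrite EV => -[]].
Qed.

Lemma near_within (T U : topologicalType) (D : set T) (f : T -> U) x (O : set U) :
  {within D, continuous f} -> D x -> open O -> O (f x) ->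
  exists V : set T, [/\ open V, V x & forall y, D y -> V y -> O (f y)].
Proof.
move=> cf Dx oO Ofx; have [V oV E] := within_open_preimage cf oO.
exists V; split => //; first by have : (D `&` f @^-1` O) x by []; rewrite E => -[].
by move=> y Dy Vy; have : (D `&` V) y by []; rewrite -E => -[].
Qed.

Lemma quadE m (A : 'M[R]_m) v : quad A v = \sum_i \sum_j v 0 i * A i j * v 0 j.
Proof.
rewrite /quad mxE exchange_big /=; apply: eq_bigr => j _.
by rewrite mxE mulr_suml; apply: eq_bigr => i _; rewrite !mxE.
Qed.

Lemma quad_le_norm m (A : 'M[R]_m) v K : `|A| <= K ->
  quad A v <= m%:R * K * (v *m v^T) 0 0.
Proof.
move=> AK; have dE : (v *m v^T) 0 0 = \sum_i v 0 i ^+ 2.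
  by rewrite mxE; apply: eq_bigr => i _; rewrite mxE expr2.
have Aij i j : `|A i j| <= K.
  by have /mx_normP -> // := AK; exact: le_trans (normr_ge0 _) AK.
apply: (@le_trans _ _ (\sum_i \sum_j (K / 2 * (v 0 i ^+ 2) + K / 2 * v 0 j ^+ 2))).
  rewrite quadE; apply: ler_sum => i _; apply: ler_sum => j _.
  apply: le_trans (ler_norm _) _; rewrite !normrM mulrAC.
  apply: (@le_trans _ _ (`|v 0 i| * `|v 0 j| * K)); first by rewrite ler_wpM2l// mulr_ge0.
  have K0 : 0 <= K := le_trans (normr_ge0 _) (Aij i j).
  rewrite -(real_normK (num_real (v 0 i))) -(real_normK (num_real (v 0 j))).
  have := sqr_ge0 (`|v 0 i| - `|v 0 j|); set a := `|_|; set b := `|_| => h.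
  by nra.
under eq_bigr do rewrite big_split /= sumr_const card_ord.
rewrite big_split /= sumr_const card_ord sumrMnl -mulr_sumr -dE -mulr_natl.
by set d := _ 0 0; lra.
Qed.

(** An open cube cut by the half-space; at a boundary point it remains a product of intervals, one
    of them half-open. *)
Definition cbox (x0 : 'rV[R]_n) (r : R) : set 'rV[R]_n :=
  [set x | H x /\ forall i, `|x 0 i - x0 0 i| < r].

Lemma cbox_norm (x0 : 'rV[R]_n) r : 0 < r -> cbox x0 r = H `&` [set x | `|x - x0| < r].
Proof.
move=> r0; apply/seteqP; split => x [Hx h]; split => //.
  by apply: mx_norm_lt => // i j; rewrite ord1 !mxE.
move=> i; apply: le_lt_trans h.
by have := @mx_norm_coord _ _ _ (x - x0) 0 i; rewrite !mxE.
Qed.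

Lemma open_norm_lt (x0 : 'rV[R]_n) r : 0 < r -> open [set x : 'rV[R]_n | `|x - x0| < r].
Proof.
move=> r0; rewrite (_ : mkset _ = ball x0 r); first exact: ball_open.
by rewrite -ball_normE; apply/seteqP; split => x /=; rewrite distrC.
Qed.

Lemma measurable_cbox x0 r : 0 < r -> measurable (cbox x0 r : set BV).
Proof.
by move=> r0; rewrite cbox_norm// setIC; apply: measurable_relopen; exact: open_norm_lt.
Qed.

Lemma leb_cbox_fin x0 r : 0 < r -> (leb n (cbox x0 r : set BV) < +oo)%E.
Proof.
move=> r0; apply: le_lt_trans (leb_box_fin (x0 - const_mx r) (x0 + const_mx r)).
apply: le_measure; rewrite ?inE; [exact: measurable_cbox|exact: measurable_box|].
by move=> x [_ h] i; have := h i; rewrite !mxE ltr_distl.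
Qed.

Lemma leb_cbox_gt0 x0 r : H x0 -> 0 < r -> (0 < leb n (cbox x0 r : set BV))%E.
Proof.
(* The corner of the cube where all coordinates increase stays in the half-space. *)
move=> Hx0 r0; apply: (@lt_le_trans _ _ (leb n (box x0 (x0 + const_mx r)))).
  rewrite leb_box; last by move=> i; rewrite !mxE lerDl ltW.
  by rewrite lte_fin; apply: prodr_gt0 => i _; rewrite !mxE addrAC subrr add0r.
apply: le_measure; rewrite ?inE; [exact: measurable_box|exact: measurable_cbox|].
move=> x h; split => i.
  by move=> i0; have := h i; move=> /andP[/ltW + _]; apply: le_trans; exact: Hx0.
by have := h i; rewrite !mxE => /andP[h1 h2]; rewrite ltr_distl; apply/andP; split; lra.
Qed.

Variable g : metric S.

(** A single constant compares the metric, its inverse and its density with their Euclidean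
    counterparts near p, so that working in coordinates costs only powers of L. *)
Lemma chart_box p (O : set M) : open O -> O p -> exists c r L,
  [/\ charts S c, dom c p, 0 < r, 0 < L & forall x, cbox (fwd c p) r x ->
    [/\ (fwd c @` (dom c `&` O)) x,
        L^-1 <= vdens g c (bwd c x) <= L,
        forall v, quad (g c (bwd c x)) v <= L * (v *m v^T) 0 0 &
        forall v, quad (invmx (g c (bwd c x))) v <= L * (v *m v^T) 0 0]].
Proof.
move=> oO Op; have [Sc cp] := chart_atP S p; set c := chart_at S p in Sc cp.
have Dp : (fwd c @` dom c) (fwd c p) by exists p.
have [V oV EV] := chart_img_open c oO.
have Vp : V (fwd c p).
  have : (V `&` H) (fwd c p) by rewrite -EV; exists p.
  by case.
have sg := gmat_smooth g Sc.
have si : smooth_on (fwd c @` dom c) (fun x => invmx (g c (bwd c x))).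
  by apply: smooth_on_invmx sg; move=> _ [q cq <-]; rewrite /= fwdK// gmat_unit.
have oN (K : R) : open [set A : 'M[R]_n | `|A| < K].
  apply: (@open_comp _ _ (fun A : 'M[R]_n => `|A|) [set t | t < K]); last exact: open_lt.
  by move=> A _; exact: norm_continuous.
have lt1 (A : 'M[R]_n) : `|A| < `|A| + 1 by rewrite ltrDl.
have [V1 [oV1 V1p h1]] := near_within (smooth_on_within sg) Dp (oN _) (lt1 _).
have [V2 [oV2 V2p h2]] := near_within (smooth_on_within si) Dp (oN _) (lt1 _).
set w := fun x => Num.sqrt (\det (g c (bwd c x))).
have cw : {within fwd c @` dom c, continuous w}.
  move=> x; apply: (continuous_comp ((smooth_on_within (smooth_on_det sg)) x)).
  exact: sqrt_continuous.
have w0 : 0 < w (fwd c p) by rewrite /w fwdK// sqrt_det_gt0.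
have [||V3 [oV3 V3p h3]] := near_within cw Dp (O := [set t | w (fwd c p) / 2 < t < 2 * w (fwd c p)]).
- rewrite (_ : mkset _ = [set t | w (fwd c p) / 2 < t] `&` [set t | t < 2 * w (fwd c p)]).
    by apply: openI; [exact: open_gt|exact: open_lt].
  by apply/seteqP; split => t /= => [/andP[]|[-> ->]].
- by rewrite /=; apply/andP; split; lra.
have oVV : open (V `&` V1 `&` V2 `&` V3) by do 3 apply: openI => //.
have [r r0 hr] := open_ball_sub oVV (conj (conj (conj Vp V1p) V2p) V3p).
set K1 := `|_| + 1 in h1; set K2 := `|_| + 1 in h2.
have K10 : 0 <= K1 by rewrite addr_ge0. have K20 : 0 <= K2 by rewrite addr_ge0.
set W := w (fwd c p) in h3 w0.
pose L := n%:R * K1 + n%:R * K2 + 2 * W + 2 / W.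
have nK1 : 0 <= n%:R * K1 by rewrite mulr_ge0.
have nK2 : 0 <= n%:R * K2 by rewrite mulr_ge0.
have W2 : 0 < 2 / W by rewrite divr_gt0.
have L0 : 0 < L by rewrite /L; lra.
exists c, r, L; split => // x cx.
have := cx; rewrite cbox_norm// => -[Hx /= xr].
have [[[Vx V1x] V2x] V3x] : (V `&` V1 `&` V2 `&` V3) x.
  by apply: hr; rewrite -ball_normE /= distrC.
have Ix : (fwd c @` (dom c `&` O)) x by rewrite EV.
have Dx : (fwd c @` dom c) x by case: Ix => q [cq _] <-; exists q.
have [cbx _] := bwd_img Dx.
split => //.
- have /andP[a b] := h3 _ Dx V3x; rewrite vdensE// -/(w x).
  apply/andP; split; last by apply: le_trans (ltW b) _; rewrite /L; lra.
  apply: le_trans (ltW a); rewrite -[W / 2]invrK lef_pV2 ?posrE ?invr_gt0 ?divr_gt0//.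
  by rewrite invf_div /L; lra.
- move=> v; apply: le_trans (quad_le_norm v (ltW (h1 _ Dx V1x))) _.
  by rewrite ler_wpM2r ?dot_ge0// /L; lra.
- move=> v; apply: le_trans (quad_le_norm v (ltW (h2 _ Dx V2x))) _.
  by rewrite ler_wpM2r ?dot_ge0// /L; lra.
Qed.

Definition nbox (c : chart R n M) (p : M) (r : R) : set BM :=
  dom c `&` fwd c @^-1` cbox (fwd c p) r.

Section nbox.
Variables (c : chart R n M) (p : M) (r : R).
Hypotheses (r0 : 0 < r) (cp : dom c p).

Lemma nbox_center : nbox c p r p.
Proof.
split => //; split; last by move=> i; rewrite subrr normr0.
exact: fwd_half_space.
Qed.

Lemma nbox_open : open (nbox c p r : set M).
Proof.
have [V oV E] := within_open_preimage (@fwd_continuous _ _ _ c) (@open_norm_lt (fwd c p) r r0).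
rewrite (_ : nbox c p r = dom c `&` V); first by apply: openI => //; exact: dom_open.
rewrite -E /nbox cbox_norm//; apply/seteqP; split => q; first by move=> [cq [_ h]].
move=> [cq h]; split => //; split => //.
exact: fwd_half_space.
Qed.

Lemma nbox_sub : nbox c p r `<=` dom c. Proof. by move=> q []. Qed.

Lemma nbox_img : cbox (fwd c p) r `<=` fwd c @` dom c -> fwd c @` nbox c p r = cbox (fwd c p) r.
Proof.
move=> h; apply/seteqP; split => x; first by move=> [q [cq hq] <-].
by move=> bx; have [q cq e] := h _ bx; exists q => //; split => //; rewrite /= e.
Qed.

Lemma measurable_nbox : measurable (nbox c p r).
Proof. by apply: borel_open; exact: nbox_open. Qed.

End nbox.

Lemma volume_nbox_fin p : exists c r, [/\ charts S c, dom c p, 0 < r &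
  (volume g (nbox c p r) < +oo)%E].
Proof.
have [c [r [L [Sc cp r0 L0 h]]]] := chart_box openT (I : setT p).
have Ic : cbox (fwd c p) r `<=` fwd c @` dom c.
  by move=> x /h[[q [cq _] <-] _ _ _]; exists q.
exists c, r; split => //.
have mN := measurable_nbox c p r0.
have Nc : nbox c p r `<=` dom c by exact: nbox_sub.
rewrite (volume_chart_vol g Sc mN Nc) (chart_volE g mN Nc).
rewrite nbox_img//; apply: (@le_lt_trans _ _ (\int[leb n]_(x in cbox (fwd c p) r) L%:E)%E).
  apply: ge0_le_integral => //.
  - exact: measurable_cbox.
  - by move=> x _; rewrite lee_fin vdens_ge0.
  - by apply/measurable_EFinP; apply: measurable_funTS; exact: measurable_cdens.
  - by move=> x cx; rewrite lee_fin tbwdE; [have [_ /andP[] _] := h _ cx|exact: Ic].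
rewrite integral_cst; last exact: measurable_cbox.
by rewrite lte_mul_pinfty ?lee_fin ?ltW// leb_cbox_fin.
Qed.

Lemma volume_fin : (volume g [set: BM] < +oo)%E.
Proof.
have /choice[c /choice[r h]] := volume_nbox_fin.
have oN p : open (nbox (c p) p (r p) : set M) by have [_ _ r0 _] := h p; exact: nbox_open.
have Np p : nbox (c p) p (r p) p by have [_ cp r0 _] := h p; exact: nbox_center.
have [s hs] := finite_cover M_compact oN Np.
have mN p : measurable (nbox (c p) p (r p)).
  by have [_ _ r0 _] := h p; exact: measurable_nbox.
have mU (s' : seq M) : measurable (\big[setU/set0]_(p <- s') nbox (c p) p (r p)).
  by apply: bigsetU_measurable.
rewrite (_ : setT = \big[setU/set0]_(p <- s) nbox (c p) p (r p)); last first.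
  apply/seteqP; split => // q _; have [p ps qp] := hs q.
  by rewrite -bigcup_seq; exists p.
elim: (s) => [|p s' IH]; first by rewrite big_nil measure0.
rewrite big_cons; apply: le_lt_trans (measureU2 _ _ _) _; rewrite ?lte_add_pinfty//.
by have [] := h p.
Qed.

Lemma volume_open_gt0 (O : set M) p : open O -> O p -> (0 < volume g (O : set BM))%E.
Proof.
move=> oO Op; have [c [r [L [Sc cp r0 L0 h]]]] := chart_box oO Op.
have Ic : cbox (fwd c p) r `<=` fwd c @` dom c.
  by move=> x /h[[q [cq _] <-] _ _ _]; exists q.
have mN := measurable_nbox c p r0.
apply: (@lt_le_trans _ _ (volume g (nbox c p r))); last first.
  apply: le_measure; rewrite ?inE//; first exact: borel_open.
  move=> q [cq hq]; have [[q' [cq' Oq'] e] _ _ _] := h _ hq.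
  by rewrite -(fwdK cq) -e fwdK.
have Nc : nbox c p r `<=` dom c by exact: nbox_sub.
rewrite (volume_chart_vol g Sc mN Nc) (chart_volE g mN Nc).
rewrite nbox_img//; apply: (@lt_le_trans _ _ (\int[leb n]_(x in cbox (fwd c p) r) (L^-1)%:E)%E).
  rewrite integral_cst; last exact: measurable_cbox.
  by rewrite mule_gt0 ?lte_fin ?invr_gt0// leb_cbox_gt0//; have [_ []] := nbox_center r0 cp.
apply: ge0_le_integral => //.
- exact: measurable_cbox.
- by move=> x _; rewrite lee_fin invr_ge0 ltW.
- by apply/measurable_EFinP; apply: measurable_funTS; exact: measurable_cdens.
- by move=> x cx; rewrite lee_fin tbwdE; [have [_ /andP[]] := h _ cx|exact: Ic].
Qed.

Lemma measurable_sqnorm (X : vfield R n M) : measurable_vfield S X ->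
  measurable_fun [set: BM] (sqnorm g X).
Proof.
move=> [mX cX]; have [N [ch [Sch cov]]] := chart_cover_seq M_compact S.
have -> : [set: BM] = \bigcup_k (dom (ch k) : set BM).
  by apply/seteqP; split => // p _; have [k _ kp] := cov p; exists k.
apply/measurable_fun_bigcup; first by move=> k; exact: measurable_dom.
move=> k; set c := ch k; have Sc : charts S c := Sch k.
apply: (@eq_measurable_fun _ _ BM R (dom c)
  (fun p => \sum_i \sum_j X c p 0 i * g c p i j * X c p 0 j)).
  move=> p /set_mem cp; rewrite -quadE (sqnorm_chart g (c := c))//.
  by move=> c1 c2 S1 S2 c1p c2p; exact: cX.
apply: measurable_sum => i; apply: measurable_sum => j.
apply: measurable_funM; last exact: mX.
apply: measurable_funM; first exact: mX.
apply: (@eq_measurable_fun _ _ BM R (dom c) (fun p => g c (bwd c (fwd c p)) i j)).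
  by move=> p /set_mem cp; rewrite fwdK.
apply: within_continuous_borelR; first exact: measurable_dom.
apply: (within_chart (f := fun x => g c (bwd c x) i j)).
apply: smooth_on_within.
by have /smooth_on_mxP := gmat_smooth g Sc; exact.
Qed.

End VolumeTheory.

(** * Poincare inequalities *)

Section IntegralMono.
Context d (T : measurableType d) (R : realType) (m : {measure set T -> \bar R}).
Local Open Scope ereal_scope.

(** No measurability is asked for: the integral of a nonnegative function is a supremum over the
    simple functions below it. *)
Lemma integral_mono (D : set T) (f g : T -> \bar R) :
  (forall x, D x -> 0 <= f x) -> (forall x, D x -> f x <= g x) ->
  \int[m]_(x in D) f x <= \int[m]_(x in D) g x.
Proof.
move=> f0 fg; rewrite (integral_mkcond D f) (integral_mkcond D g).
have h x : 0 <= (f \_ D) x <= (g \_ D) x.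
  rewrite /restrict /patch; case: ifPn => [/set_mem Dx|_]; last by rewrite lexx.
  by rewrite f0// fg.
rewrite !ge0_integralTE; last 2 first.
- by move=> x; have /andP[a b] := h x; exact: le_trans b.
- by move=> x; have /andP[] := h x.
apply: ereal_sup_le => _ [k hk <-]; exists k => //.
by move=> x; apply: le_trans (hk x) _; have /andP[] := h x.
Qed.

Lemma integral_cst_le (D : set T) (f : T -> \bar R) (k l : \bar R) : measurable D ->
  0 <= k -> (forall x, D x -> 0 <= f x) -> (forall x, D x -> f x <= k) -> m D <= l ->
  \int[m]_(x in D) f x <= k * l.
Proof.
move=> mD k0 f0 fk Dl; apply: (@le_trans _ _ (\int[m]_(x in D) (cst k x))).
  exact: integral_mono.
by rewrite integral_cst//; apply: lee_wpmul2l.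
Qed.

Lemma ge0_integral_lin2 (D : set T) (f g : T -> \bar R) (a b : R) : measurable D ->
  (0 <= a)%R -> (0 <= b)%R -> measurable_fun D f -> measurable_fun D g ->
  (forall x, D x -> 0 <= f x) -> (forall x, D x -> 0 <= g x) ->
  \int[m]_(x in D) (a%:E * f x + b%:E * g x) =
    a%:E * \int[m]_(x in D) f x + b%:E * \int[m]_(x in D) g x.
Proof.
move=> mD a0 b0 mf mg f0 g0.
have maf : measurable_fun D (fun x => a%:E * f x) by exact: measurable_funeM.
have mbg : measurable_fun D (fun x => b%:E * g x) by exact: measurable_funeM.
rewrite ge0_integralD//; last 2 first.
- by move=> x Dx; rewrite mule_ge0 ?lee_fin ?f0.
- by move=> x Dx; rewrite mule_ge0 ?lee_fin ?g0.
by rewrite !ge0_integralZl_EFin.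
Qed.

Hypothesis sf : sigma_finite setT m.

Lemma measurable_dist_int (v : T -> R) (B : set T) : measurable B -> measurable_fun setT v ->
  measurable_fun setT (fun x => \int[m]_(y in B) ((v x - v y) ^+ 2)%:E).
Proof.
move=> mB mv; pose f (z : T * T) := ((v z.1 - v z.2) ^+ 2 * \1_B z.2)%:E.
have mf : measurable_fun setT f.
  apply/measurable_EFinP; apply: measurable_funM.
    apply: measurable_funX; apply: measurable_funB.
      by apply: measurableT_comp mv _; exact: measurable_fst.
    by apply: measurableT_comp mv _; exact: measurable_snd.
  by apply: measurableT_comp; [exact: measurable_indic|exact: measurable_snd].
have f0 z : 0 <= f z by rewrite lee_fin mulr_ge0 ?sqr_ge0.
have := @measurable_fun_fubini_tonelli_F _ _ T T R (sfin sf) f mf f0.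
congr (measurable_fun _ _); apply/funext => x; rewrite /fubini_F [RHS]integral_mkcond.
apply: eq_integral => y _; rewrite /f /restrict /patch indicE /=.
by case: ifP => _; rewrite ?mulr1 ?mulr0.
Qed.

End IntegralMono.

(** * Products of one-dimensional sets and slicing along a coordinate *)

Section Slices.
Context {R : realType}.
Local Notation BV n := (borel 'rV[R]_n).
Local Notation leb := (@leb R).
Local Notation leb1 := (@lebesgue_measure R).
Local Open Scope ereal_scope.

Definition prodI n (I : 'I_n -> set R) : set (BV n) := [set x | forall i, I i (x 0%R i)].

Lemma measurable_prodI n (I : 'I_n -> set R) : (forall i, measurable (I i)) ->
  measurable (prodI I).
Proof.
move=> mI; rewrite (_ : prodI I = \bigcap_(i in [set: 'I_n]) ((fun x : BV n => x 0%R i : R) @^-1` I i)).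
  apply: fin_bigcap_measurable; first exact: finite_finset.
  by move=> i _; rewrite -[X in measurable X]setTI; exact: measurable_coord.
by apply/seteqP; split => x h i; [move=> _; exact: h|exact: h].
Qed.

Definition upd n (x : 'rV[R]_n) (i : 'I_n) (t : R) : 'rV[R]_n :=
  (\row_j (if j == i then t else x 0 j))%R.

Lemma updE n (x : 'rV[R]_n) i t : upd x i t = (upd x i 0 + t *: delta_mx 0 i)%R.
Proof.
apply/rowP => j; rewrite !mxE eqxx /=; case: eqVneq => _; first by rewrite mulr1 add0r.
by rewrite mulr0 addr0.
Qed.

Lemma upd_coord n (x : 'rV[R]_n) i t : upd x i t 0%R i = t.
Proof. by rewrite mxE eqxx. Qed.

Lemma prodI_upd n (I : 'I_n -> set R) x i t : prodI I x -> I i t -> prodI I (upd x i t).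
Proof. by move=> Ix It j; rewrite mxE; case: eqVneq => [->|_]. Qed.

Lemma upd_cons0 n t s (y : 'rV[R]_n) : upd (cons_rv t y) ord0 s = cons_rv s y.
Proof.
apply/rowP => j; rewrite [LHS]mxE; case: (unliftP ord0 j) => [k|] ->.
  by rewrite lift_eqF !cons_rvS.
by rewrite eqxx cons_rv0.
Qed.

Lemma upd_consS n t s (y : 'rV[R]_n) i : upd (cons_rv t y) (lift ord0 i) s = cons_rv t (upd y i s).
Proof.
apply/rowP => j; rewrite [LHS]mxE; case: (unliftP ord0 j) => [k|] ->.
  by rewrite (inj_eq lift_inj) !cons_rvS mxE.
by rewrite eq_liftF !cons_rv0.
Qed.

Lemma prodI_cons n (I : 'I_n.+1 -> set R) t y :
  prodI I (cons_rv t y) <-> I ord0 t /\ prodI (I \o lift ord0) y.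
Proof.
split=> [h|[h0 h] i].
  by split=> [|i]; [have := h ord0; rewrite cons_rv0|have := h (lift ord0 i); rewrite cons_rvS].
by case: (unliftP ord0 i) => [j|] ->; rewrite ?cons_rv0// cons_rvS; exact: h.
Qed.

Lemma measurable_cons1 n t : measurable_fun setT ((fun y => cons_rv t y) : BV n -> BV n.+1).
Proof.
exact: (measurableT_comp (@measurable_cons_rv R n) (@measurable_pair1 _ _ R (BV n) t)).
Qed.

Section fubini.
Variables (n : nat) (I : 'I_n.+1 -> set R) (f : BV n.+1 -> \bar R).
Hypotheses (mI : forall i, measurable (I i)) (mf : measurable_fun setT f)
  (f0 : forall x, 0 <= f x).
Local Notation I' := (I \o lift ord0).

Let F (p : R * BV n) := (f \_ (prodI I)) (cons_rv p.1 p.2).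

Let mF : measurable_fun setT F.
Proof.
apply: (@measurableT_comp _ _ _ _ _ _ (f \_ (prodI I))); last exact: measurable_cons_rv.
apply: (proj1 (measurable_restrictT _ (measurable_prodI mI))); exact: measurable_funTS.
Qed.

Let F0 p : 0 <= F p.
Proof. by rewrite /F /restrict /patch; case: ifP. Qed.

Let FE t y : F (t, y) = if t \in I ord0 then ((fun y => f (cons_rv t y)) \_ (prodI I')) y else 0.
Proof.
rewrite /F /restrict /patch /=; case: ifPn => [/set_mem/prodI_cons[It Iy]|nI].
  by rewrite !mem_set.
case: ifPn => // /set_mem It; case: ifPn => // /set_mem Iy.
by case/negP: nI; rewrite mem_set//; apply/prodI_cons.
Qed.

Let FE2 t y : F (t, y) = if y \in prodI I' then ((fun t => f (cons_rv t y)) \_ (I ord0)) t else 0.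
Proof. by rewrite FE /restrict /patch; case: ifP; case: ifP. Qed.

Let total : \int[leb n.+1]_(x in prodI I) f x =
  \int[leb1 \x (sfin (leb_sigma_finite n))]_p F p.
Proof.
have mfI : measurable_fun setT (f \_ (prodI I)).
  by apply: (proj1 (measurable_restrictT _ (measurable_prodI mI))); exact: measurable_funTS.
have fI0 x : 0 <= (f \_ (prodI I)) x by rewrite /restrict /patch; case: ifP.
rewrite integral_mkcond.
rewrite -(@ge0_integral_pushm _ _ _ _ R (leb1 \x (sfin (leb_sigma_finite n))) _
  (@measurable_cons_rv R n) setT)//.
by apply/eqP; rewrite eq_le; apply/andP; split; apply: le_measure_integral => // A mA _;
  rewrite lebS.
Qed.

Lemma leb_prodI1 : \int[leb n.+1]_(x in prodI I) f x =
  \int[leb1]_(t in I ord0) \int[leb n]_(y in prodI I') f (cons_rv t y).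
Proof.
transitivity (\int[leb1]_t fubini_F (sfin (leb_sigma_finite n)) F t).
  by rewrite total; apply: fubini_tonelli1.
rewrite [RHS]integral_mkcond; apply: eq_integral => t _.
rewrite /fubini_F; under eq_integral do rewrite FE.
rewrite /restrict /patch; case: ifP => _; last by rewrite integral0.
by rewrite [RHS]integral_mkcond.
Qed.

Lemma leb_prodI2 : \int[leb n.+1]_(x in prodI I) f x =
  \int[leb n]_(y in prodI I') \int[leb1]_(t in I ord0) f (cons_rv t y).
Proof.
transitivity (\int[leb n]_y fubini_G leb1 F y).
  by rewrite total; apply: fubini_tonelli2.
rewrite [RHS]integral_mkcond; apply: eq_integral => y _.
rewrite /fubini_G; under eq_integral do rewrite FE2.
rewrite /restrict /patch; case: ifP => _; last by rewrite integral0.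
by rewrite [RHS]integral_mkcond.
Qed.

Lemma measurable_slice_int1 : measurable_fun (I ord0)
  (fun t => \int[leb n]_(y in prodI I') f (cons_rv t y)).
Proof.
apply: (@eq_measurable_fun _ _ R _ (I ord0) (fubini_F (sfin (leb_sigma_finite n)) F)).
  move=> t It; rewrite /fubini_F [RHS]integral_mkcond.
  by apply: eq_integral => y _; rewrite FE It.
by apply: measurable_funTS; exact: measurable_fun_fubini_tonelli_F.
Qed.

Lemma measurable_slice_int2 : measurable_fun (prodI I')
  (fun y => \int[leb1]_(t in I ord0) f (cons_rv t y)).
Proof.
apply: (@eq_measurable_fun _ _ (BV n) _ (prodI I') (fubini_G leb1 F)).
  move=> y Iy; rewrite /fubini_G [RHS]integral_mkcond.
  by apply: eq_integral => t _; rewrite FE2 Iy.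
by apply: measurable_funTS; exact: measurable_fun_fubini_tonelli_G.
Qed.

End fubini.

Lemma leb_prodI_fin n (I : 'I_n -> set R) : (forall i, measurable (I i)) ->
  (forall i, leb1 (I i) < +oo) -> leb n (prodI I) < +oo.
Proof.
elim: n I => [|n IH] I mI fI.
  apply: le_lt_trans (leb_box_fin (0 : 'rV[R]_0) 0); apply: le_measure; rewrite ?inE.
  - exact: measurable_prodI.
  - exact: measurable_box.
  - by move=> x _ [].
have := @leb_prodI1 n I (cst 1) mI (measurable_cst _) (fun=> lee01).
rewrite integral_cst ?mul1e; last exact: measurable_prodI.
have mP : measurable (prodI (I \o lift ord0)) by apply: measurable_prodI => i; exact: mI.
have h : leb n (prodI (I \o lift ord0)) < +oo.
  by apply: IH => i; [exact: mI|exact: fI].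
move=> ->; have E t : \int[leb n]_(y in prodI (I \o lift ord0)) cst 1 (cons_rv t y) =
    leb n (prodI (I \o lift ord0)).
  by rewrite -[RHS]mul1e -(integral_cst _ mP).
under eq_integral do rewrite E.
apply: (@le_lt_trans _ _ (leb n (prodI (I \o lift ord0)) * leb1 (I ord0))).
  by apply: integral_cst_le; [exact: mI|exact: measure_ge0|move=> *; exact: measure_ge0| |].
by apply: lte_mul_pinfty; rewrite ?measure_ge0// ge0_fin_numE.
Qed.

(** Tonelli peels off the first coordinates until the i-th is reached; there the comparison on lines
    is the hypothesis. *)
Lemma slice_le n (I : 'I_n -> set R) (f g : BV n -> \bar R) i :
  (forall j, measurable (I j)) -> measurable_fun setT f -> measurable_fun setT g ->
  (forall x, 0 <= f x) -> (forall x, 0 <= g x) ->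
  (forall x, prodI I x -> \int[leb1]_(t in I i) f (upd x i t) <=
                          \int[leb1]_(t in I i) g (upd x i t)) ->
  \int[leb n]_(x in prodI I) f x <= \int[leb n]_(x in prodI I) g x.
Proof.
elim: n I f g i => [|n IH] I f g i; first by case: i.
move=> mI mf mg f0 g0 h; case: (unliftP ord0 i) h => [j|] -> h.
  rewrite !leb_prodI1//; apply: integral_mono => t It; first exact: integral_ge0.
  apply: (IH (I \o lift ord0) (fun y => f (cons_rv t y)) (fun y => g (cons_rv t y)) j) => //.
  - by move=> k; exact: mI.
  - exact: (measurableT_comp mf (measurable_cons1 t)).
  - exact: (measurableT_comp mg (measurable_cons1 t)).
  move=> y Iy; have := h (cons_rv t y).
  have -> : (fun t0 => f (upd (cons_rv t y) (lift ord0 j) t0)) = (fun s => f (cons_rv t (upd y j s))).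
    by apply/funext => s; rewrite upd_consS.
  have -> : (fun t0 => g (upd (cons_rv t y) (lift ord0 j) t0)) = (fun s => g (cons_rv t (upd y j s))).
    by apply/funext => s; rewrite upd_consS.
  by apply; apply/prodI_cons.
rewrite !leb_prodI2//; apply: integral_mono => y Iy; first exact: integral_ge0.
(* The hypothesis is stated at points of the product, so some t0 is needed to complete y; without
   any, both integrals vanish. *)
have [I0|/set0P[t0 It0]] := eqVneq (I ord0) set0; last first.
  have := h (cons_rv t0 y).
  have -> : (fun t => f (upd (cons_rv t0 y) ord0 t)) = (fun t => f (cons_rv t y)).
    by apply/funext => s; rewrite upd_cons0.
  have -> : (fun t => g (upd (cons_rv t0 y) ord0 t)) = (fun t => g (cons_rv t y)).
    by apply/funext => s; rewrite upd_cons0.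
  by apply; apply/prodI_cons.
by rewrite I0 !integral_set0.
Qed.

(* The splitting [(u(t,x) - u(s,y))^2 <= 2 (u(t,x) - u(t,y))^2 + 2 (u(t,y) - u(s,y))^2]. *)
Lemma box_poincare n (I : 'I_n -> set R) : (forall i, measurable (I i)) ->
  (forall i, leb1 (I i) < +oo) -> exists2 C : R, (0 <= C)%R &
  forall (u : BV n -> R) (E : 'I_n -> BV n -> \bar R), measurable_fun setT u ->
  (forall i, measurable_fun setT (E i)) -> (forall i x, 0 <= E i x) ->
  (forall i x s t, prodI I x -> I i s -> I i t ->
    ((u (upd x i s) - u (upd x i t)) ^+ 2)%:E <= \int[leb1]_(r in I i) E i (upd x i r)) ->
  \int[leb n]_(x in prodI I) \int[leb n]_(y in prodI I) ((u x - u y) ^+ 2)%:E <=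
    C%:E * \int[leb n]_(x in prodI I) \sum_i E i x.
Proof.
elim: n I => [|n IH] I mI fI.
  exists 0%R => // u E _ _ _ _; rewrite mul0e.
  have z (x y : 'rV[R]_0) : ((u x - u y) ^+ 2)%:E = 0.
    by rewrite (_ : x = y) ?subrr ?expr0n//; apply/rowP => -[].
  by under eq_integral do (under eq_integral do rewrite z); rewrite !integral0_eq.
have mI' i : measurable ((I \o lift ord0) i) by exact: mI.
have [C' C'0 hC'] := IH (I \o lift ord0) mI' (fun i => fI _).
have finI0 : leb1 (I ord0) \is a fin_num by rewrite ge0_fin_numE.
have finP' : leb n (prodI (I \o lift ord0)) \is a fin_num.
  by rewrite ge0_fin_numE ?measure_ge0//; apply: leb_prodI_fin => i; [exact: mI|exact: fI].
pose l := fine (leb1 (I ord0)); pose m' := fine (leb n (prodI (I \o lift ord0))).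
have l0 : (0 <= l)%R by exact: fine_ge0.
have m'0 : (0 <= m')%R by exact: fine_ge0.
(* The first term comes from the inequality on the slices at fixed t, the second from the
   oscillation along the first coordinate; l is the length of the first side and m' the measure of
   the product of the others. *)
exists (2 * l * C' + 2 * l * (m' * l))%R.
  by rewrite addr_ge0 ?mulr_ge0.
move=> u E mu mE E0 h.
set I' := I \o lift ord0 in finP' m' m'0 mI' hC' *.
have mP' := measurable_prodI mI'; have mP := measurable_prodI mI.
pose K (y : BV n) := \int[leb1]_(r in I ord0) E ord0 (cons_rv r y).
have mK : measurable_fun (prodI I') K by exact: measurable_slice_int2.
have K0 y : 0 <= K y by apply: integral_ge0.
pose A (t : R) (x y : BV n) := ((u (cons_rv t x) - u (cons_rv t y)) ^+ 2)%:E.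
have mA t x : measurable_fun setT (A t x).
  apply/measurable_EFinP; apply: measurable_funX; apply: measurable_funB.
    exact: measurable_cst.
  exact: (measurableT_comp mu (measurable_cons1 t)).
have A0 t x y : 0 <= A t x y by rewrite lee_fin sqr_ge0.
have l2 : (0 <= 2 * l)%R by rewrite mulr_ge0.
have e2 : 0 <= 2%:E :> \bar R by rewrite lee_fin.
have mFt t : measurable_fun (prodI I') (fun x => \int[leb n]_(y in prodI I') A t x y).
  apply: measurable_funTS.
  exact: (measurable_dist_int (leb_sigma_finite n) mP' (measurableT_comp mu (measurable_cons1 t))).
pose S' t := \int[leb n]_(x in prodI I') \sum_j E (lift ord0 j) (cons_rv t x).
have mSE : measurable_fun setT (fun x => \sum_j E (lift ord0 j) x) by exact: emeasurable_sum.
have SE0 x : 0 <= \sum_j E (lift ord0 j) x by exact: sume_ge0.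
have mS' : measurable_fun (I ord0) S' by exact: (measurable_slice_int1 (I := I) mI mSE SE0).
have S'0 t : 0 <= S' t by exact: integral_ge0.
pose k0 := \int[leb n]_(y in prodI I') K y.
have k00 : 0 <= k0 by exact: integral_ge0.
have inner t x : I ord0 t -> prodI I' x ->
    \int[leb n.+1]_(y in prodI I) ((u (cons_rv t x) - u y) ^+ 2)%:E <=
    (2 * l)%:E * (\int[leb n]_(y in prodI I') A t x y) + (2 * l)%:E * k0.
  move=> It Ix; rewrite leb_prodI2//; last 2 first.
  - apply/measurable_EFinP; apply: measurable_funX; apply: measurable_funB => //.
  - by move=> y; rewrite lee_fin sqr_ge0.
  rewrite -ge0_integral_lin2//; last exact: measurable_funTS.
  apply: integral_mono => y Iy; first by apply: integral_ge0 => s _; rewrite lee_fin sqr_ge0.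
  have -> : (2 * l)%:E * A t x y + (2 * l)%:E * K y = (2%:E * A t x y + 2%:E * K y) * l%:E.
    rewrite ge0_muleDl; [|exact: mule_ge0|exact: mule_ge0].
    by rewrite EFinM [in RHS]muleAC (muleAC 2%:E (K y)).
  apply: integral_cst_le; [exact: mI|by apply: adde_ge0; exact: mule_ge0|
    by move=> s _; rewrite lee_fin sqr_ge0| |by rewrite /l fineK].
  (* The intermediate point (t, y): first x moves to y inside the slice, then t moves to s along a
     line. *)
  move=> s Is; apply: (@le_trans _ _ (2%:E * A t x y + 2%:E * ((u (cons_rv t y) - u (cons_rv s y)) ^+ 2)%:E)).
    rewrite /A -!EFinM -EFinD lee_fin.
    set a := u _; set b := u _; set c := u _; have := sqr_ge0 (a + b - 2 * c)%R; nra.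
  apply: leeD2l; apply: lee_wpmul2l; first by rewrite lee_fin.
  have := h ord0 (cons_rv t y) t s; under [X in _ -> _ -> _ -> _ <= X]eq_integral do rewrite upd_cons0.
  by rewrite !upd_cons0; apply => //; apply/prodI_cons.
rewrite leb_prodI1//; last 2 first.
- exact: (measurable_dist_int (leb_sigma_finite n.+1) mP mu).
- by move=> x; apply: integral_ge0 => y _; rewrite lee_fin sqr_ge0.
apply: (@le_trans _ _ (\int[leb1]_(t in I ord0)
    ((2 * l * C')%:E * S' t + (2 * l)%:E * (k0 * m'%:E)))).
  apply: integral_mono => t It.
    by apply: integral_ge0 => x _; apply: integral_ge0 => y _; rewrite lee_fin sqr_ge0.
  apply: (@le_trans _ _ (\int[leb n]_(x in prodI I')
     ((2 * l)%:E * (\int[leb n]_(y in prodI I') A t x y) + (2 * l)%:E * k0))).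
    apply: integral_mono => x Ix; last exact: inner.
    by apply: integral_ge0 => y _; rewrite lee_fin sqr_ge0.
  rewrite (@ge0_integral_lin2 _ _ _ _ _ _ (fun=> k0))//; last first.
    by move=> x _; apply: integral_ge0.
  rewrite integral_cst// /m' fineK//; apply: leeD2r.
  rewrite [(2 * l * C')%:E]EFinM -muleA; apply: lee_wpmul2l; first by rewrite lee_fin.
  apply: (hC' (fun y => u (cons_rv t y)) (fun j y => E (lift ord0 j) (cons_rv t y))) => //.
  - exact: (measurableT_comp mu (measurable_cons1 t)).
  - by move=> j; exact: (measurableT_comp (mE _) (measurable_cons1 t)).
  move=> j x s r Ix Is Ir; have := h (lift ord0 j) (cons_rv t x) s r.
  rewrite !upd_consS; under [X in _ -> _ -> _ -> _ <= X]eq_integral do rewrite upd_consS.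
  by apply => //; apply/prodI_cons.
have km0 : 0 <= k0 * m'%:E by apply: mule_ge0; rewrite // lee_fin.
have lin := @ge0_integral_lin2 _ _ _ leb1 (I ord0) S' (fun=> k0 * m'%:E) (2 * l * C') (2 * l)
  (mI ord0) (mulr_ge0 l2 C'0) l2 mS' (measurable_cst _) (fun x _ => S'0 x) (fun x _ => km0).
rewrite [leLHS]lin.
have -> : \int[leb1]_(t in I ord0) (fun=> k0 * m'%:E) t = k0 * m'%:E * l%:E.
  by rewrite /l (fineK finI0); exact: (integral_cst leb1 (mI ord0) (k0 * m'%:E)).
have -> : \int[leb1]_(t in I ord0) S' t = \int[leb n.+1]_(x in prodI I) \sum_j E (lift ord0 j) x.
  by rewrite leb_prodI1.
have -> : k0 = \int[leb n.+1]_(x in prodI I) E ord0 x by rewrite /k0 /K leb_prodI2.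
have msum : measurable_fun setT (fun x => \sum_i E i x) by exact: emeasurable_sum.
have le1 : \int[leb n.+1]_(x in prodI I) \sum_j E (lift ord0 j) x <=
    \int[leb n.+1]_(x in prodI I) \sum_i E i x.
  by apply: integral_mono => x _ //; rewrite big_ord_recl /= leeDr.
have le2 : \int[leb n.+1]_(x in prodI I) E ord0 x <= \int[leb n.+1]_(x in prodI I) \sum_i E i x.
  by apply: integral_mono => x _ //; rewrite big_ord_recl /= leeDl.
have c1 : 0 <= (2 * l * C')%:E by rewrite lee_fin !mulr_ge0.
have c2 : 0 <= (2 * l * (m' * l))%:E by rewrite lee_fin !mulr_ge0.
rewrite [(2 * l * C' + _)%:E]EFinD (ge0_muleDl _ c1 c2).
apply: leeD; first by apply: lee_wpmul2l => //; rewrite lee_fin !mulr_ge0.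
rewrite [(2 * l * (m' * l))%:E]EFinM -!muleA; apply: lee_wpmul2l; first by rewrite lee_fin.
rewrite [(m' * l)%:E]EFinM muleC; apply: lee_wpmul2l => //.
by rewrite -EFinM lee_fin mulr_ge0.
Qed.

End Slices.

(** * Smooth functions along coordinate segments *)

Section Lines.
Context {R : realType}.
Local Notation leb1 := (@lebesgue_measure R).

Lemma within_comp (T U V : topologicalType) (A : set T) (B : set U) (f : U -> V) (l : T -> U) :
  continuous l -> (forall x, A x -> B (l x)) -> {within B, continuous f} ->
  {within A, continuous (f \o l)}.
Proof.
move=> cl AB cf; apply/subspace_continuousP => x Ax.
have h := (subspace_continuousP _ _).1 cf (l x) (AB _ Ax).
move=> P hP; have h4 : \forall y \near x, B (l y) -> P (f (l y)) := cl x _ (h _ hP).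
apply: filterS h4 => y hy Ay.
by apply: hy; exact: AB.
Qed.

Lemma within_post (T U V : topologicalType) (A : set T) (f : T -> U) (k : U -> V) :
  {within A, continuous f} -> continuous k -> {within A, continuous (k \o f)}.
Proof. by move=> cf ck x; exact: (continuous_comp (cf x) (ck (f x))). Qed.

(** Cauchy-Schwarz in the form: the integral of (v' - m)^2 is nonnegative, where m is the mean
    slope. *)
Lemma ftc_sq (v v' : R -> R) (a b : R) : a < b -> {within `[a, b], continuous v'} ->
  derivable_oo_LRcontinuous v a b -> {in `]a, b[, v^`()%classic =1 v'} ->
  (((v b - v a) ^+ 2)%:E <= (b - a)%:E * \int[leb1]_(x in `[a, b]) (v' x ^+ 2)%:E)%E.
Proof.
move=> ab cv' dv vv'; have ftc := continuous_FTC2 ab cv' dv vv'.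
have ba : 0 < b - a by rewrite subr_gt0.
pose m := (v b - v a) / (b - a).
have iv : leb1.-integrable `[a, b] (EFin \o v').
  by apply: continuous_compact_integrable => //; exact: segment_compact.
have i2 : leb1.-integrable `[a, b] (EFin \o (fun x => v' x ^+ 2)).
  apply: continuous_compact_integrable; first exact: segment_compact.
  apply: (within_post (k := fun t : R => t ^+ 2) cv'); exact: exprn_continuous.
have i1 : leb1.-integrable `[a, b] (EFin \o (fun x => 2 * m * v' x)).
  apply: continuous_compact_integrable; first exact: segment_compact.
  apply: (within_post (k := fun t : R => 2 * m * t) cv'); exact: mulrl_continuous.
have ic : leb1.-integrable `[a, b] (EFin \o (fun=> m ^+ 2)).
  apply: continuous_compact_integrable; first exact: segment_compact.
  by move=> x; exact: cst_continuous.
have le : ((2 * m * (v b - v a) - m ^+ 2 * (b - a))%:E <= \int[leb1]_(x in `[a, b]) (v' x ^+ 2)%:E)%E.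
  apply: (@le_trans _ _ (\int[leb1]_(x in `[a, b]) (2 * m * v' x - m ^+ 2)%:E)%E).
    have e1 : (\int[leb1]_(x in `[a, b]) (2 * m * v' x)%:E = (2 * m)%:E * ((v b)%:E - (v a)%:E))%E.
      by rewrite -ftc -integralZl.
    have e2 : (\int[leb1]_(x in `[a, b]) (m ^+ 2)%:E = (m ^+ 2)%:E * (b - a)%:E)%E.
      apply: etrans (integral_cst leb1 (measurable_itv `[a, b]) (m ^+ 2)%:E) _.
      have h := @lebesgue_measure_itv R `[a, b]; rewrite /= lte_fin ab in h.
      by congr (_ * _)%E; exact: h.
    have e3 : (\int[leb1]_(x in `[a, b]) (2 * m * v' x - m ^+ 2)%:E =
        \int[leb1]_(x in `[a, b]) (2 * m * v' x)%:E - \int[leb1]_(x in `[a, b]) (m ^+ 2)%:E)%E.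
      by rewrite -integralB_EFin.
    by rewrite e3 e1 e2.
  apply: le_integral => //.
    apply: continuous_compact_integrable; first exact: segment_compact.
    apply: (within_post (k := fun t : R => 2 * m * t - m ^+ 2) cv') => t.
    by apply: cvgB; [exact: mulrl_continuous|exact: cvg_cst].
  by move=> x _; rewrite lee_fin; have := sqr_ge0 (v' x - m); nra.
apply: (@le_trans _ _ ((b - a)%:E * (2 * m * (v b - v a) - m ^+ 2 * (b - a))%:E)%E).
  rewrite -EFinM lee_fin /m le_eqVlt; apply/orP; left; apply/eqP.
  by field; rewrite gt_eqF.
by apply: lee_wpmul2l => //; rewrite lee_fin ltW.
Qed.

Variable n : nat.
Local Notation H := (@half_space R n).

Lemma continuous_upd (x : 'rV[R]_n) i : continuous (upd x i).
Proof.
move=> t; apply/continuous_coordP => k j; have E : (fun t => upd x i t k j) =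
   if j == i then id else fun=> x 0 j.
  by apply/funext => s; rewrite ord1 mxE; case: ifP.
rewrite E; case: ifP => _; [exact: cvg_id|exact: cvg_cst].
Qed.

Section smooth_line.
Variables (V : set 'rV[R]_n) (f : 'rV[R]_n -> R).
Hypotheses (oV : open V) (sf : smooth_on (W := R) (V `&` H) f).
Variables (x : 'rV[R]_n) (i : 'I_n) (a b : R).
Hypotheses (ab : a < b) (hl : forall t, `[a, b]%classic t -> (V `&` H) (upd x i t)).

Lemma line_continuous : {within `[a, b], continuous (f \o upd x i)}.
Proof.
apply: (@within_comp R 'rV[R]_n R _ (V `&` H) f (upd x i)).
- exact: continuous_upd.
- exact: hl.
- exact: smooth_on_within.
Qed.

Lemma line_partial_continuous : {within `[a, b], continuous (partial i f \o upd x i)}.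
Proof.
apply: (@within_comp R 'rV[R]_n R _ (V `&` H) (partial i f) (upd x i)).
- exact: continuous_upd.
- exact: hl.
- by apply: (smooth_on_within (W := R)); exact: smooth_on_partial.
Qed.

Lemma line_derive t : t \in `]a, b[ ->
  is_derive t (1 : R) (f \o upd x i) (partial i f (upd x i t)).
Proof.
move=> tab; have Ay : (V `&` H) (upd x i t).
  by apply: hl; apply: subset_itv_oo_cc.
have [U [F [oU UV Uy CF fF]]] := smooth_on_ext oV sf Ay.
have [_ Hy] := Ay.
have dF : derivable F (upd x i t) (delta_mx 0 i) := Ck_derivable (CF 1%N) Uy.
rewrite (partialE oU Uy Hy dF fF).
have := @is_derive_line _ _ _ F (upd x i 0) (delta_mx 0 i) t.
rewrite -updE => /(_ dF) D.
have E : \forall s \near t, F (upd x i 0 + s *: delta_mx 0 i) = (f \o upd x i) s.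
  have n1 : \forall s \near t, s \in `]a, b[ by exact: near_in_itvoo.
  have n2 : \forall s \near t, U (upd x i s).
    have nU : nbhs (upd x i t) U by exact: open_nbhs_nbhs.
    exact: (@continuous_upd x i t U nU).
  near=> s; rewrite -updE /= fF//; first by near: s.
  have sab : s \in `]a, b[ by near: s.
  have [] // := hl (t := s) _.
  exact: subset_itv_oo_cc.
split; first by apply: near_eq_derivable E _; case: D.
by rewrite -(near_eq_derive _ E); case: D.
Unshelve. all: by end_near. Qed.

Lemma line_derivable : derivable_oo_LRcontinuous (f \o upd x i) a b.
Proof.
have [_ h1 h2] := (continuous_within_itvP _ ab).1 line_continuous.
by split => // t tab; have [] := line_derive tab.
Qed.

Lemma line_derive1 : {in `]a, b[, (f \o upd x i)^`()%classic =1 partial i f \o upd x i}.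
Proof. by move=> t tab; rewrite derive1E; have [_] := line_derive tab. Qed.

End smooth_line.
End Lines.

(** * Poincare inequalities in double integral form *)

Section DoubleIntegrals.
Context d (T : measurableType d) (R : realType) (m : {measure set T -> \bar R}).
Local Open Scope ereal_scope.

Lemma integral_subset (D D' : set T) (f : T -> \bar R) : D `<=` D' ->
  (forall x, D' x -> 0 <= f x) -> \int[m]_(x in D) f x <= \int[m]_(x in D') f x.
Proof.
move=> DD' f0; rewrite (integral_mkcond D) (integral_mkcond D').
apply: integral_mono => x _; rewrite /restrict /patch.
  by case: ifPn => // /set_mem/DD'/f0.
case: ifPn => [/set_mem/DD' D'x|_]; first by rewrite mem_set.
by case: ifPn => // /set_mem/f0.
Qed.

Lemma integral_setU_le (A B : set T) (f : T -> \bar R) : measurable A -> measurable B ->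
  measurable_fun setT f -> (forall x, 0 <= f x) ->
  \int[m]_(x in A `|` B) f x <= \int[m]_(x in A) f x + \int[m]_(x in B) f x.
Proof.
move=> mA mB mf f0.
rewrite [leLHS]integral_mkcond (integral_mkcond A) (integral_mkcond B).
have mr D : measurable D -> measurable_fun setT (f \_ D).
  by move=> mD; apply: (proj1 (measurable_restrictT _ mD)); exact: measurable_funTS.
have r0 D x : 0 <= (f \_ D) x by rewrite /restrict /patch; case: ifP.
rewrite -ge0_integralD//; [|exact: mr|exact: mr].
apply: integral_mono => // x _; rewrite /restrict /patch in_setU.
by case: (x \in A); case: (x \in B) => /=; rewrite ?adde0 ?add0e ?leeDl.
Qed.

Hypothesis m_fin : m setT < +oo.

Lemma finite_sigma : sigma_finite setT m.
Proof.
exists (fun=> setT); first by rewrite bigcup_const.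
by move=> i; split.
Qed.

Lemma fin_meas A : measurable A -> m A \is a fin_num.
Proof.
move=> mA; rewrite ge0_fin_numE ?measure_ge0//; apply: le_lt_trans m_fin.
by apply: le_measure; rewrite ?inE.
Qed.

Definition dint (A B : set T) (u : T -> R) : \bar R :=
  \int[m]_(x in A) \int[m]_(y in B) ((u x - u y) ^+ 2)%:E.

Lemma dint_ge0 A B u : 0 <= dint A B u.
Proof. by apply: integral_ge0 => x _; apply: integral_ge0 => y _; rewrite lee_fin sqr_ge0. Qed.

Lemma dint_subset A B A' B' u : A `<=` A' -> B `<=` B' -> dint A B u <= dint A' B' u.
Proof.
move=> AA BB; apply: (@le_trans _ _ (dint A B' u)).
  apply: integral_mono => x _; first by apply: integral_ge0 => y _; rewrite lee_fin sqr_ge0.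
  by apply: integral_subset => // y _; rewrite lee_fin sqr_ge0.
apply: integral_subset => // x _.
by apply: integral_ge0 => y _; rewrite lee_fin sqr_ge0.
Qed.

(* Average [(u x - u y)^2 <= 2 (u x - u z)^2 + 2 (u y - u z)^2] over [z] in [Z]. *)
Lemma dint_chain A B Z u : measurable A -> measurable B -> measurable Z ->
  measurable_fun setT u ->
  m Z * dint A B u <= (2 * fine (m B))%:E * dint A Z u + (2 * fine (m A))%:E * dint B Z u.
Proof.
move=> mA mB mZ mu.
have [fA fB fZ] : [/\ m A \is a fin_num, m B \is a fin_num & m Z \is a fin_num].
  by split; exact: fin_meas.
have a0 : (0 <= 2 * fine (m A))%R by rewrite mulr_ge0 ?fine_ge0.
have b0 : (0 <= 2 * fine (m B))%R by rewrite mulr_ge0 ?fine_ge0.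
pose F x := \int[m]_(z in Z) ((u x - u z) ^+ 2)%:E.
have mF : measurable_fun setT F := measurable_dist_int finite_sigma mZ mu.
have F0 x : 0 <= F x by apply: integral_ge0 => y _; rewrite lee_fin sqr_ge0.
have sq x y : 0 <= ((u x - u y) ^+ 2)%:E by rewrite lee_fin sqr_ge0.
have msq x : measurable_fun setT (fun y => ((u x - u y) ^+ 2)%:E).
  by apply/measurable_EFinP; apply: measurable_funX; apply: measurable_funB.
have step x y : m Z * ((u x - u y) ^+ 2)%:E <= 2%:E * F x + 2%:E * F y.
  rewrite muleC -(integral_cst m mZ) -ge0_integral_lin2//; try exact: measurable_funTS.
  apply: integral_mono => z _ //=; rewrite -!EFinM -EFinD lee_fin.
  have := sqr_ge0 (u x + u y - 2 * u z)%R; set a := u x; set b := u y; set c := u z; nra.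
have mZE : m Z = (fine (m Z))%:E by rewrite fineK.
have z0 : (0 <= fine (m Z))%R by rewrite fine_ge0.
have step2 x : m Z * (\int[m]_(y in B) ((u x - u y) ^+ 2)%:E) <=
    (2 * fine (m B))%:E * F x + 2%:E * dint B Z u.
  rewrite mZE -ge0_integralZl_EFin//; last exact: measurable_funTS.
  apply: (@le_trans _ _ (\int[m]_(y in B) (2%:E * (cst (F x) y) + 2%:E * F y))).
    apply: integral_mono => y _; last by rewrite -mZE; exact: step.
    by rewrite mule_ge0// lee_fin.
  have Fx0 y : B y -> 0 <= cst (F x) y by move=> _; exact: F0.
  rewrite ge0_integral_lin2//; try exact: measurable_funTS.
  rewrite integral_cst// -(fineK fB) muleA muleAC -EFinM.
  by rewrite fineK.
have mG : measurable_fun setT (fun x => \int[m]_(y in B) ((u x - u y) ^+ 2)%:E).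
  exact: (measurable_dist_int finite_sigma mB mu).
have G0 t : 0 <= \int[m]_(y in B) ((u t - u y) ^+ 2)%:E by apply: integral_ge0.
rewrite {1}/dint mZE -ge0_integralZl_EFin//; last exact: measurable_funTS.
apply: (@le_trans _ _ (\int[m]_(x in A) ((2 * fine (m B))%:E * F x + 2%:E * (cst (dint B Z u) x)))).
  apply: integral_mono => x _; last by rewrite -mZE; exact: step2.
  by rewrite mule_ge0// lee_fin.
rewrite ge0_integral_lin2//; try exact: measurable_funTS; last by move=> *; exact: dint_ge0.
rewrite integral_cst// -{1}(fineK fA) EFinM.
by rewrite [2%:E * (fine (m A))%:E * _]muleAC muleA.
Qed.

Lemma dint_setU A B u : measurable A -> measurable B -> measurable_fun setT u ->
  dint (A `|` B) (A `|` B) u <= (dint A A u + dint A B u) + (dint B A u + dint B B u).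
Proof.
move=> mA mB mu.
pose F D x := \int[m]_(z in D) ((u x - u z) ^+ 2)%:E.
have mF D : measurable D -> measurable_fun setT (F D).
  by move=> mD; exact: (measurable_dist_int finite_sigma mD mu).
have F0 D x : 0 <= F D x by apply: integral_ge0 => y _; rewrite lee_fin sqr_ge0.
apply: (@le_trans _ _ (\int[m]_(x in A `|` B) (F A x + F B x))).
  apply: integral_mono => x _; first exact: F0.
  apply: integral_setU_le => //; last by move=> y; rewrite lee_fin sqr_ge0.
  by apply/measurable_EFinP; apply: measurable_funX; apply: measurable_funB.
have mFF : measurable_fun setT (fun x => F A x + F B x).
  by apply: emeasurable_funD; exact: mF.
have FF0 x : 0 <= F A x + F B x by rewrite adde_ge0.
apply: le_trans (integral_setU_le mA mB mFF FF0) _.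
have E D : measurable D -> \int[m]_(x in D) (F A x + F B x) =
    \int[m]_(x in D) F A x + \int[m]_(x in D) F B x.
  by move=> mD; apply: ge0_integralD => //; apply: measurable_funTS; exact: mF.
by rewrite !E.
Qed.

(* [P u e] says that [e] is the energy of [u]. *)
Variable P : (T -> R) -> \bar R -> Prop.
Hypothesis P_meas : forall u e, P u e -> measurable_fun setT u.
Hypothesis P_ge0 : forall u e, P u e -> 0 <= e.

Definition poincare (A : set T) := measurable A /\
  exists2 C : R, (0 <= C)%R & forall u e, P u e -> dint A A u <= C%:E * e.

(** The cross terms are chained through Z = A [&] B: [dint_chain] bounds them by the terms on A and
    on B multiplied by 1 / m Z, hence the assumption of positive measure. *)
Lemma poincareU A B : poincare A -> poincare B -> 0 < m (A `&` B) -> poincare (A `|` B).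
Proof.
move=> [mA [CA CA0 hA]] [mB [CB CB0 hB]] Z0; split; first exact: measurableU.
have mZ : measurable (A `&` B) by exact: measurableI.
have fZ := fin_meas mZ; set z := fine (m (A `&` B)).
have z0 : (0 < z)%R by rewrite fine_gt0// Z0 ltey_eq fZ.
pose a := (2 * fine (m A))%R; pose b := (2 * fine (m B))%R.
have a0 : (0 <= a)%R by rewrite mulr_ge0 ?fine_ge0.
have b0 : (0 <= b)%R by rewrite mulr_ge0 ?fine_ge0.
pose K := (z^-1 * (b * CA + a * CB))%R.
have K0 : (0 <= K)%R by rewrite mulr_ge0 ?addr_ge0 ?mulr_ge0 ?invr_ge0 ?(ltW z0).
exists (CA + K + (K + CB))%R; first by rewrite !addr_ge0.
move=> u e Pu; have mu := P_meas Pu; have e0 := P_ge0 Pu.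
have AZ : dint A (A `&` B) u <= CA%:E * e.
  by apply: le_trans (hA _ _ Pu); apply: dint_subset => // x [].
have BZ : dint B (A `&` B) u <= CB%:E * e.
  by apply: le_trans (hB _ _ Pu); apply: dint_subset => // x [].
have cross X : z%:E * X <= b%:E * (CA%:E * e) + a%:E * (CB%:E * e) -> X <= K%:E * e.
  move=> h; have -> : X = z^-1%:E * (z%:E * X).
    by rewrite muleA -EFinM mulVf ?mul1e// gt_eqF.
  rewrite /K EFinM -muleA; apply: lee_wpmul2l; first by rewrite lee_fin invr_ge0 ltW.
  apply: le_trans h _; rewrite EFinD ge0_muleDl ?lee_fin ?mulr_ge0//.
  by rewrite !EFinM !muleA.
have zE : m (A `&` B) = z%:E by rewrite /z fineK.
have AB : dint A B u <= K%:E * e.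
  apply: cross; rewrite -zE; apply: le_trans (dint_chain mA mB mZ mu) _.
  by apply: leeD; apply: lee_wpmul2l; rewrite ?lee_fin.
have BA : dint B A u <= K%:E * e.
  apply: cross; rewrite -zE; apply: le_trans (dint_chain mB mA mZ mu) _.
  by rewrite addeC; apply: leeD; apply: lee_wpmul2l; rewrite ?lee_fin.
apply: le_trans (dint_setU mA mB mu) _.
have spl (x y : R) : (0 <= x)%R -> (0 <= y)%R -> (x + y)%:E * e = x%:E * e + y%:E * e.
  by move=> x0 y0; rewrite EFinD ge0_muleDl// lee_fin.
rewrite spl; [|exact: addr_ge0|exact: addr_ge0].
rewrite spl// spl//; apply: leeD.
  by apply: leeD; [exact: hA|exact: AB].
by apply: leeD; [exact: BA|exact: hB].
Qed.

End DoubleIntegrals.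

(** * Local and global Poincare inequality for smooth functions *)

Section PoincareManifold.
Context (R : realType) (n : nat) (M : ptopologicalType).
Hypothesis M_compact : compact [set: M].
Variable S : atlas R n M.
Local Notation H := (@half_space R n).
Local Notation BV := (borel 'rV[R]_n).
Local Notation BM := (borel M).
Local Notation leb1 := (@lebesgue_measure R).

Definition cside (x0 : 'rV[R]_n) (r : R) (i : 'I_n) : set R :=
  `]x0 0 i - r, x0 0 i + r[%classic `&` [set t | i = 0%N :> nat -> 0 <= t].

Lemma cbox_prodI x0 r : cbox x0 r = prodI (cside x0 r).
Proof.
apply/seteqP; split => [x [Hx h] i|x h]; first split; last split.
- by rewrite /= in_itv /= -ltr_distl; exact: h.
- by move=> i0; exact: Hx.
- by move=> i i0; have [_] := h i; exact.
- by move=> i; have [+ _] := h i; rewrite /= in_itv /= -ltr_distl.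
Qed.

Lemma measurable_cside x0 r i : measurable (cside x0 r i).
Proof.
apply: measurableI; first exact: measurable_itv.
have [i0|i0] := eqVneq (i : nat) 0%N.
  rewrite (_ : mkset _ = `[0, +oo[%classic); first exact: measurable_itv.
  by apply/seteqP; split => t /=; rewrite in_itv /= andbT => // h; exact: h.
rewrite (_ : mkset _ = setT)//; apply/seteqP; split => // t _ /eqP.
by rewrite (negbTE i0).
Qed.

Lemma cside_fin x0 r i : 0 < r -> (leb1 (cside x0 r i) < +oo)%E.
Proof.
move=> r0; apply: (@le_lt_trans _ _ (leb1 `]x0 0 i - r, x0 0 i + r[%classic)).
  apply: le_measure; rewrite ?inE; [exact: measurable_cside|exact: measurable_itv|].
  by move=> t [].
have h := @lebesgue_measure_itv R `]x0 0 i - r, x0 0 i + r[.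
by rewrite h; case: ifP => _; rewrite ?ltry.
Qed.

Lemma cside_convex x0 r i s t q : cside x0 r i s -> cside x0 r i t -> s <= q <= t ->
  cside x0 r i q.
Proof.
move=> [/= + s0] [/= + t0] /andP[sq qt]; rewrite !in_itv /= => /andP[a1 a2] /andP[b1 b2].
split; last by move=> i0; exact: le_trans (s0 i0) sq.
by rewrite /= in_itv /= (lt_le_trans a1)// (le_lt_trans qt).
Qed.

Variable g : metric S.
Local Notation vol := (volume g).
Local Notation egrad u := (sqnorm g (gradient g u)).

Lemma measurable_smooth u : smooth_fun S u -> measurable_fun [set: BM] (u : BM -> R).
Proof. by move=> su; apply: continuous_borelR; exact: smooth_fun_continuous su. Qed.

Lemma measurable_egrad u : smooth_fun S u -> measurable_fun [set: BM] (egrad u : BM -> R).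
Proof. by move=> su; apply: measurable_smooth; exact: smooth_sqnorm_gradient. Qed.

Section box.
Variables (c : chart R n M) (p : M) (r L : R).
Hypotheses (Sc : charts S c) (cp : dom c p) (r0 : 0 < r) (L0 : 0 < L).
Hypothesis bI : cbox (fwd c p) r `<=` fwd c @` dom c.
Hypothesis bw : forall x, cbox (fwd c p) r x -> L^-1 <= vdens g c (bwd c x) <= L.
Local Notation Q := (cbox (fwd c p) r).
Local Notation A := (nbox c p r).

Lemma box_integral_le (f : BM -> \bar R) : measurable_fun setT f -> (forall q, 0 <= f q)%E ->
  (\int[vol]_(q in A) f q <= L%:E * \int[leb n]_(x in Q) f (tbwd c x))%E /\
  (\int[leb n]_(x in Q) f (tbwd c x) <= L%:E * \int[vol]_(q in A) f q)%E.
Proof.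
move=> mf f0; have mA := measurable_nbox c p r0.
have mQ := measurable_cbox (fwd c p) r0.
have mft : measurable_fun setT (fun x => f (tbwd c x)).
  by apply: measurableT_comp mf (measurable_tbwd c).
have mw : measurable_fun setT (fun x : BV => (vdens g c (tbwd c x))%:E).
  by apply/measurable_EFinP; exact: measurable_cdens.
rewrite (volume_chart M_compact g Sc mA (@nbox_sub _ _ _ c p r) mf f0) nbox_img//.
have wL x : Q x -> L^-1 <= vdens g c (tbwd c x) <= L.
  by move=> Qx; rewrite tbwdE; [exact: bw|exact: bI].
split.
  rewrite -ge0_integralZl_EFin//; [|exact: measurable_funTS|exact: ltW].
  apply: integral_mono => x Qx; first by rewrite mule_ge0 ?lee_fin ?vdens_ge0.
  by rewrite muleC; apply: lee_wpmul2r => //; rewrite lee_fin; have /andP[] := wL x Qx.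
have mfw : measurable_fun (Q : set BV) (fun x => f (tbwd c x) * (vdens g c (tbwd c x))%:E)%E.
  by apply: measurable_funTS; exact: emeasurable_funM.
have fw0 x : Q x -> (0 <= f (tbwd c x) * (vdens g c (tbwd c x))%:E)%E.
  by move=> _; rewrite mule_ge0 ?lee_fin ?vdens_ge0.
have L0' := ltW L0.
rewrite -ge0_integralZl_EFin//.
apply: integral_mono => // x Qx; have /andP[w1 _] := wL x Qx.
rewrite muleCA -EFinM -{1}(mule1 (f _)); apply: lee_wpmul2l => //.
by rewrite lee_fin -ler_pdivrMl// mulr1.
Qed.

Hypothesis bg : forall x, cbox (fwd c p) r x ->
  forall v, quad (g c (bwd c x)) v <= L * (v *m v^T) 0 0.

(** The metric is at most L times the Euclidean one, so on covectors the Euclidean norm is at most L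
    times that of g. *)
Lemma box_dform_le u x : smooth_fun S u -> Q x ->
  \sum_i (partial i (u \o bwd c) x) ^+ 2 <= L * egrad u (bwd c x).
Proof.
move=> su Qx; have [cx fx] := bwd_img (bI Qx).
rewrite (sqnorm_gradient g su Sc cx).
have -> : \sum_i partial i (u \o bwd c) x ^+ 2 = quad (invmx 1%:M) (dform u c (bwd c x)).
  rewrite invmx1 /quad mulmx1 mxE; apply: eq_bigr => i _.
  by rewrite !mxE fx expr2.
apply: quad_invmx_le => //; first by rewrite trmx1.
- exact: gmat_sym.
- by move=> v v0; rewrite /quad mulmx1 lt_neqAle eq_sym dot_eq0 v0 dot_ge0.
- exact: gmat_pos.
- by move=> v; rewrite {2}/quad mulmx1; exact: bg.
Qed.

Lemma box_partial_measurable u i : smooth_fun S u ->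
  measurable_fun (Q : set BV) (partial i (u \o bwd c)).
Proof.
move=> su; have [V oV EV] := chart_img_all c.
have su' := su c Sc; rewrite EV in su'.
have sp := smooth_on_partial oV i su'.
apply: within_continuous_borelR; first exact: measurable_cbox.
apply: continuous_subspaceW (smooth_on_within sp).
by rewrite -EV.
Qed.

Lemma box_segment x i s t : Q x -> cside (fwd c p) r i s -> cside (fwd c p) r i t ->
  forall q, `[s, t]%classic q -> Q (upd x i q).
Proof.
rewrite cbox_prodI => Qx Is It q /=; rewrite in_itv /= => sqt.
by apply: prodI_upd => //; exact: cside_convex sqt.
Qed.

Lemma local_poincare : exists2 C : R, 0 <= C & forall u, smooth_fun S u ->
  (dint vol A A u <= C%:E * \int[vol]_(q in A) (egrad u q)%:E)%E.
Proof.
have [C0 C00 hC0] := box_poincare (measurable_cside (fwd c p) r)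
  (fun i => cside_fin (fwd c p) i r0).
have mQ := measurable_cbox (fwd c p) r0.
rewrite -cbox_prodI in hC0.
have r2 : 0 <= 2 * r by rewrite mulr_ge0// ltW.
have L0' := ltW L0.
(* One L for each of the two volume integrations, C0 from [box_poincare], 2 r from the length of the
   segments, one L to pass from partial derivatives to the gradient of g and one to return to the
   volume. *)
exists (L * (L * (C0 * (2 * r * L * L)))); first by have r0' := ltW r0; rewrite !mulr_ge0.
move=> u su; have mu := measurable_smooth su.
have mA := measurable_nbox c p r0.
have vfin := volume_fin M_compact g.
have mut : measurable_fun setT (fun x => u (tbwd c x)).
  by apply: (measurableT_comp (f := u : BM -> R)) => //; exact: measurable_tbwd.
have sq0 (a b : R) : (0 <= ((a - b) ^+ 2)%:E)%E by rewrite lee_fin sqr_ge0.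
have msq (a : R) : measurable_fun [set: BM] (fun q => ((a - u q) ^+ 2)%:E).
  by apply/measurable_EFinP; apply: measurable_funX; apply: measurable_funB.
have mF : measurable_fun [set: BM] (fun q => \int[vol]_(q' in A) ((u q - u q') ^+ 2)%:E)%E.
  exact: (measurable_dist_int (finite_sigma vfin) mA mu).
apply: le_trans (box_integral_le mF (fun q => integral_ge0 _ (fun q' _ => sq0 _ _))).1 _.
rewrite EFinM -muleA; apply: lee_wpmul2l; first by rewrite lee_fin.
pose f := u \o bwd c.
(* The directional energies fed to [box_poincare]: by [ftc_sq] a squared increment on a segment
   shorter than 2 r is at most the integral of this. Off Q it is set to 0 to be globally
   measurable. *)
pose E i (x : BV) : \bar R := ((fun x => (2 * r * partial i f x ^+ 2)%:E) \_ Q) x.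
have E0 i x : (0 <= E i x)%E.
  by rewrite /E /restrict /patch; case: ifP => // _; rewrite lee_fin mulr_ge0 ?sqr_ge0.
have mE i : measurable_fun setT (E i).
  apply: (proj1 (measurable_restrictT _ mQ)); apply/measurable_EFinP.
  apply: measurable_funM; first exact: measurable_cst.
  by apply: measurable_funX; exact: box_partial_measurable.
have mutD : measurable_fun setT (fun x => \int[leb n]_(y in Q) ((u (tbwd c x) - u (tbwd c y)) ^+ 2)%:E)%E.
  exact: (measurable_dist_int (leb_sigma_finite n) mQ mut).
apply: (@le_trans _ _ (L%:E * \int[leb n]_(x in Q)
    \int[leb n]_(y in Q) ((u (tbwd c x) - u (tbwd c y)) ^+ 2)%:E)%E).
  have mutQ : measurable_fun (Q : set BV)
      (fun x => \int[leb n]_(y in Q) ((u (tbwd c x) - u (tbwd c y)) ^+ 2)%:E)%E.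
    exact: measurable_funTS.
  have nn x : Q x -> (0 <= \int[leb n]_(y in Q) ((u (tbwd c x) - u (tbwd c y)) ^+ 2)%:E)%E.
    by move=> _; apply: integral_ge0.
  rewrite -ge0_integralZl_EFin//.
  apply: integral_mono => x Qx; first by apply: integral_ge0.
  exact: (box_integral_le (msq _) (fun q => sq0 _ _)).1.
rewrite EFinM -muleA; apply: lee_wpmul2l; first by rewrite lee_fin.
apply: le_trans (hC0 (fun x => u (tbwd c x)) E mut mE E0 _) _.
  move=> i x s t Qx Is It.
  wlog st : s t Is It / s <= t.
    move=> h; have [st|/ltW ts] := lerP s t; first exact: h.
    by have := h t s It Is ts; rewrite -sqrrN opprB.
  have [->|st'] := eqVneq s t.
    by rewrite subrr expr0n; apply: integral_ge0.
  have {st'}st : s < t by rewrite lt_neqAle st'.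
  have [V oV EV] := chart_img_all c.
  have su' := su c Sc; rewrite EV in su'.
  have hl q : `[s, t]%classic q -> (V `&` H) (upd x i q).
    by move=> /(box_segment Qx Is It)/bI; rewrite EV.
  have ts q : `[s, t]%classic q -> f (upd x i q) = u (tbwd c (upd x i q)).
    by move=> /(box_segment Qx Is It)/bI h; rewrite tbwdE.
  have ss : `[s, t]%classic s by rewrite /= in_itv /= lexx ltW.
  have tt : `[s, t]%classic t by rewrite /= in_itv /= lexx ltW.
  rewrite -(ts s ss) -(ts t tt) -sqrrN opprB.
  apply: le_trans (ftc_sq st (line_partial_continuous oV su' hl)
    (line_derivable oV su' st hl) (line_derive1 oV su' hl)) _.
  have [/= + _] := Is; have [/= + _] := It.
  rewrite !in_itv /= => /andP[t1 t2] /andP[s1 s2].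
  have mpi : measurable_fun `[s, t] (fun q => (partial i (u \o bwd c) (upd x i q) ^+ 2)%:E).
    apply/measurable_EFinP; apply: measurable_funX.
    apply: subspace_continuous_measurable_fun; first exact: measurable_itv.
    exact: (line_partial_continuous oV su' hl).
  apply: (@le_trans _ _ ((2 * r)%:E * \int[leb1]_(q in `[s, t])
      (partial i (u \o bwd c) (upd x i q) ^+ 2)%:E)%E).
    apply: lee_wpmul2r; first by apply: integral_ge0 => q _; rewrite lee_fin sqr_ge0.
    by rewrite lee_fin; lra.
  rewrite -ge0_integralZl_EFin//; last by move=> q _; rewrite lee_fin sqr_ge0.
  apply: (@le_trans _ _ (\int[leb1]_(q in `[s, t]) E i (upd x i q))%E).
    apply: integral_mono => q hq; first by rewrite mule_ge0 ?lee_fin ?sqr_ge0.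
    by rewrite /E /restrict /patch mem_set//; exact: (box_segment Qx Is It).
  apply: integral_subset => // q; rewrite /= in_itv /=; exact: cside_convex.
rewrite EFinM -muleA; apply: lee_wpmul2l; first by rewrite lee_fin.
have meg : measurable_fun setT (fun q : BM => (egrad u q)%:E).
  by apply/measurable_EFinP; exact: measurable_egrad.
have eg0 (q : BM) : (0 <= (egrad u q)%:E)%E by rewrite lee_fin sqnorm_ge0.
rewrite EFinM -muleA.
apply: (@le_trans _ _ ((2 * r * L)%:E * \int[leb n]_(x in Q) (egrad u (tbwd c x))%:E)%E).
  rewrite -ge0_integralZl_EFin//; last 2 first.
  - apply: measurable_funTS; apply: (measurableT_comp (f := (fun q : BM => (egrad u q)%:E))) => //.
    exact: measurable_tbwd.
  - by rewrite mulr_ge0.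
  apply: integral_mono => x Qx; first exact: sume_ge0.
  rewrite -EFinM tbwdE; last exact: bI.
  under eq_bigr do rewrite /E /restrict /patch mem_set//.
  by rewrite sumEFin lee_fin -mulr_sumr -[2 * r * L * _]mulrA; apply: ler_wpM2l => //; exact: box_dform_le.
apply: lee_wpmul2l; first by rewrite lee_fin mulr_ge0.
exact: (box_integral_le meg eg0).2.
Qed.

End box.

Lemma poincare_nbhd p (O : set M) : open O -> O p -> exists (A : set M) (C : R),
  [/\ open A, A p, A `<=` O, 0 <= C & forall u, smooth_fun S u ->
    (dint vol A A u <= C%:E * \int[vol]_(q in A) (egrad u q)%:E)%E].
Proof.
move=> oO Op; have [c [r [L [Sc cp r0 L0 h]]]] := chart_box g oO Op.
have bI : cbox (fwd c p) r `<=` fwd c @` dom c by move=> x /h[[q [cq _] <-] _ _ _]; exists q.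
have [C C0 hC] := local_poincare Sc r0 L0 bI (fun x Qx => let: And4 _ a _ _ := h x Qx in a)
  (fun x Qx => let: And4 _ _ a _ := h x Qx in a).
exists (nbox c p r), C; split => //.
- exact: nbox_open.
- exact: nbox_center.
- move=> q [cq hq]; have [[q' [cq' Oq'] e] _ _ _] := h _ hq.
  by rewrite -(fwdK cq) -e fwdK.
Qed.

Definition energy u : \bar R := (\int[vol]_q (egrad u q)%:E)%E.

Hypothesis M_connected : connected [set: M].

(** Open sets satisfying the inequality can be merged when they meet, nonempty open sets having
    positive volume. The points joined to a base point by such a set form an open and closed set,
    hence everything by connectedness; compactness then gives one set equal to M. *)
Lemma global_poincare : exists2 C : R, 0 <= C & forall u, smooth_fun S u ->
  (dint vol setT setT u <= C%:E * energy u)%E.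
Proof.
pose P (u : BM -> R) (e : \bar R) := smooth_fun S u /\ e = energy u.
have P_meas u e : P u e -> measurable_fun setT u by move=> [su _]; exact: measurable_smooth.
have P_ge0 u e : P u e -> (0 <= e)%E.
  by move=> [su ->]; apply: integral_ge0 => q _; rewrite lee_fin sqnorm_ge0.
have vfin := volume_fin M_compact g.
have loc p : exists A : set M, [/\ open A, A p & poincare vol P A].
  have [A [C [oA Ap _ C0 hA]]] := poincare_nbhd openT (I : setT p).
  exists A; split => //; split; first exact: borel_open.
  exists C => // u _ [su ->]; apply: le_trans (hA u su) _.
  apply: lee_wpmul2l; first by rewrite lee_fin.
  by apply: integral_subset => // q _; rewrite lee_fin sqnorm_ge0.
have union A B q : open A -> open B -> A q -> B q -> poincare vol P A -> poincare vol P B ->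
    poincare vol P (A `|` B).
  move=> oA oB Aq Bq PA PB; apply: (poincareU vfin P_meas P_ge0) => //.
  by apply: (volume_open_gt0 M_compact g (p := q)); [exact: openI|split].
pose p0 : M := point.
pose W := [set q | exists A : set M, [/\ open A, A p0, A q & poincare vol P A]].
have WT : W = setT.
  apply: M_connected.
  - by exists p0; have [A [oA Ap PA]] := loc p0; exists A.
  - exists W; last by rewrite setTI.
    rewrite openE => q [A [oA Ap0 Aq PA]]; rewrite /interior.
    by apply: filterS (open_nbhs_nbhs (conj oA Aq)) => q' Aq'; exists A.
  - exists W; last by rewrite setTI.
    move=> q clq; have [B [oB Bq PB]] := loc q.
    have [q' [[A [oA Ap0 Aq' PA]] Bq']] := clq B (open_nbhs_nbhs (conj oB Bq)).
    exists (A `|` B); split; [exact: openU|by left|by right|exact: (union _ _ q')].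
have /choice[A hA] q : exists A : set M, [/\ open A, A p0, A q & poincare vol P A].
  by have : W q by rewrite WT.
have oA q : open (A q) by have [] := hA q.
have Aq q : A q q by have [] := hA q.
have [s hs] := finite_cover M_compact oA Aq.
(* All the sets A q contain p0, so each new one meets the union already formed. *)
pose U (s : seq M) : set M := foldr (fun q B => A q `|` B) (A p0) s.
have hU (s' : seq M) : [/\ open (U s'), U s' p0 & poincare vol P (U s')].
  elim: s' => [|q s' [oU Up PU]] /=; first by have [? ? ? ?] := hA p0.
  have [oq qp _ Pq] := hA q.
  by split; [exact: openU|left|exact: (union _ _ p0)].
have UT : U s = setT.
  apply/seteqP; split => // q _; have [p ps Apq] := hs q.
  elim: (s) ps => // a s' IH; rewrite inE => /orP[/eqP <-|/IH ?]; [by left|by right].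
have [_ _ [_ [C C0 hC]]] := hU s; exists C => // u su.
by have := hC u (energy u) (conj su erefl); rewrite UT.
Qed.

End PoincareManifold.

(** * The space H^1 *)

Section ZeroMean.
Context d (T : measurableType d) (R : realType) (m : {measure set T -> \bar R}).
Hypothesis m_fin : (m setT < +oo)%E.
Local Open Scope ereal_scope.

Lemma L2_integrable (u : T -> R) : measurable_fun setT u ->
  \int[m]_x ((u x) ^+ 2)%:E < +oo -> m.-integrable setT (EFin \o u).
Proof.
move=> mu u2.
have mu2 : measurable_fun setT (fun x => ((u x) ^+ 2)%:E).
  by apply/measurable_EFinP; exact: measurable_funX.
have ig : m.-integrable setT (fun x => 1 + ((u x) ^+ 2)%:E).
  apply: integrableD => //; first by apply/integrableP; split => //;
    rewrite (eq_integral (cst 1)) ?integral_cst ?mul1e// => x _; rewrite /= normr1.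
  apply/integrableP; split => //; apply: le_lt_trans u2.
  by apply: integral_mono => x _ //=; rewrite ger0_norm ?sqr_ge0.
apply: le_integrable ig => //; first exact/measurable_EFinP.
move=> x _ /=; rewrite lee_fin [leRHS]ger0_norm; last by rewrite addr_ge0 ?sqr_ge0.
by rewrite -(real_normK (num_real (u x))); have := sqr_ge0 (`|u x| - 1)%R; nra.
Qed.

(** Expanding the square, the cross term is the square of the mean. This turns a double integral
    inequality into a bound on the Rayleigh quotient. *)
Lemma dint_zero_mean (u : T -> R) : measurable_fun setT u ->
  \int[m]_x ((u x) ^+ 2)%:E < +oo -> \int[m]_x (u x)%:E = 0 ->
  dint m setT setT u = (2 * fine (m setT))%:E * \int[m]_x ((u x) ^+ 2)%:E.
Proof.
move=> mu u2 u0; have iu := L2_integrable mu u2.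
have fm : m setT \is a fin_num by exact: fin_meas.
set s := \int[m]_x _ in u2 *; have s0 : 0 <= s by apply: integral_ge0 => x _; rewrite lee_fin sqr_ge0.
have fs : s \is a fin_num by rewrite ge0_fin_numE.
have mu2 : measurable_fun setT (fun x => ((u x) ^+ 2)%:E).
  by apply/measurable_EFinP; exact: measurable_funX.
have i2 : m.-integrable setT (fun x => ((u x) ^+ 2)%:E).
  apply/integrableP; split => //; apply: le_lt_trans u2.
  by apply: integral_mono => x _ //=; rewrite ger0_norm ?sqr_ge0.
have icst (c : R) : m.-integrable setT (cst c%:E).
  apply/integrableP; split => //; rewrite (eq_integral (cst `|c|%:E))//.
  by rewrite integral_cst// lte_mul_pinfty.
have inner (c : R) : \int[m]_y ((c - u y) ^+ 2)%:E = (c ^+ 2)%:E * m setT + s.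
  have i1 : m.-integrable setT (fun y => (- 2 * c)%:E * (u y)%:E).
    exact: (integrableZl measurableT _ iu).
  rewrite (eq_integral (fun y => ((c ^+ 2)%:E + (- 2 * c)%:E * (u y)%:E) + ((u y) ^+ 2)%:E)).
    rewrite (integralD measurableT (f1 := fun y => (c ^+ 2)%:E + (- 2 * c)%:E * (u y)%:E)) //.
      rewrite (integralD measurableT (f1 := cst (c ^+ 2)%:E)) //.
      by rewrite integral_cst// (integralZl measurableT iu) u0 mule0 adde0.
    by apply: integrableD => //; exact: icst.
  by move=> y _; rewrite -EFinM -!EFinD; congr (_%:E); ring.
have mE : m setT = (fine (m setT))%:E by rewrite fineK.
have k0 : (0 <= fine (m setT))%R by exact: fine_ge0.
have E x : \int[m]_y ((u x - u y) ^+ 2)%:E = (fine (m setT))%:E * ((u x) ^+ 2)%:E + 1%:E * cst s x.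
  by rewrite inner mE muleC mul1e.
rewrite /dint; under eq_integral do rewrite E.
rewrite ge0_integral_lin2//; last by move=> x _; rewrite lee_fin sqr_ge0.
rewrite -/s mul1e integral_cst// mE -(fineK fs) -!EFinM -EFinD; congr (_%:E); ring.
Qed.

End ZeroMean.

(** * Lower bound for the first eigenvalue with weights *)

Section H1Theory.
Context (R : realType) (n : nat) (M : ptopologicalType).
Hypothesis M_compact : compact [set: M].
Variables (S : atlas R n M) (g : metric S).
Local Notation BM := (borel M).
Local Notation vol := (volume g).

Lemma measurable_gradient u : smooth_fun S u -> measurable_vfield S (gradient g u).
Proof.
move=> su; split; last by move=> c c' p; exact: (coherent_gradient g (p := p) su).
move=> c i Sc; have sd := smooth_on_dform su Sc.
have si : smooth_on (fwd c @` dom c) (fun x => invmx (g c (bwd c x))).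
  by apply: smooth_on_invmx; [move=> _ [p cp <-]; rewrite fwdK// gmat_unit|exact: gmat_smooth].
have /smooth_on_mxP /(_ 0 i) sX := smooth_on_mulmx sd si.
apply: (@eq_measurable_fun _ _ BM R (dom c)
  (fun p => ((dform u c \o bwd c) (fwd c p) *m invmx (g c (bwd c (fwd c p)))) 0 i)).
  by move=> p /set_mem cp; rewrite /= fwdK.
apply: within_continuous_borelR; first exact: measurable_dom.
exact: (within_chart (f := fun x => ((dform u c \o bwd c) x *m invmx (g c (bwd c x))) 0 i)
  (smooth_on_within sX)).
Qed.

Lemma measurable_vfield_comb (X Y : vfield R n M) (a b : R) : measurable_vfield S X ->
  measurable_vfield S Y -> measurable_vfield S (fun c p => a *: X c p + b *: Y c p).
Proof.
move=> [mX cX] [mY cY]; split.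
  move=> c i Sc; rewrite (_ : (fun p => _) = (fun p => a * X c p 0 i + b * Y c p 0 i)).
    by apply: measurable_funD; apply: measurable_funM => //; [exact: mX|exact: mY].
  by apply/funext => p; rewrite !mxE.
move=> c c' p Sc Sc' cp c'p.
exact: (@coherent_comb _ _ _ S X Y a b p (fun c1 c2 => cX c1 c2 p)
  (fun c1 c2 => cY c1 c2 p) c c' Sc Sc' cp c'p).
Qed.

Lemma quad_comb_le m (A : 'M[R]_m) (a b : R) v w : (forall v, 0 <= quad A v) ->
  quad A (a *: v + b *: w) <= 2 * a ^+ 2 * quad A v + 2 * b ^+ 2 * quad A w.
Proof.
move=> A0; have := A0 (a *: v - b *: w).
have E s t : quad A (s *: v + t *: w) = s ^+ 2 * quad A v + s * t * ((v *m A *m w^T) 0 0) +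
    s * t * ((w *m A *m v^T) 0 0) + t ^+ 2 * quad A w.
  have D (X Y Z T : 'M[R]_1) : (X + Y + (Z + T)) 0 0 = X 0 0 + Y 0 0 + (Z 0 0 + T 0 0).
    by rewrite !mxE.
  have sc (k : R) (X : 'M[R]_1) : (k *: X) 0 0 = k * X 0 0 by rewrite mxE.
  rewrite /quad linearD /= !linearZ /= !mulmxDl !mulmxDr -!scalemxAl -!scalemxAr D !sc.
  by ring.
by rewrite -scaleNr !E; lra.
Qed.

Lemma quad_gmat_ge0 c p v : charts S c -> dom c p -> 0 <= quad (g c p) v.
Proof.
move=> Sc cp; have [->|/(gmat_pos g Sc cp)/ltW//] := eqVneq v 0.
by rewrite /quad mul0mx mul0mx mxE.
Qed.

Lemma sqnorm_comb_le X Y (a b : R) p :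
  sqnorm g (fun c q => a *: X c q + b *: Y c q) p <=
    2 * a ^+ 2 * sqnorm g X p + 2 * b ^+ 2 * sqnorm g Y p.
Proof.
have [Sc cp] := chart_atP S p; rewrite /sqnorm.
by apply: quad_comb_le => v; exact: quad_gmat_ge0.
Qed.

Lemma sqnorm_sub_le X Y p :
  sqnorm g X p <= 2 * sqnorm g Y p + 2 * sqnorm g (fun c q => Y c q - X c q) p.
Proof.
have := sqnorm_comb_le Y (fun c q => Y c q - X c q) 1 (-1) p.
rewrite sqrrN expr1n !mulr1; congr (_ <= _).
by congr (sqnorm g _ p); apply/funext => c; apply/funext => q; rewrite scale1r scaleN1r opprB addrC subrK.
Qed.

Lemma H1_gradient_smooth u : smooth_fun S u -> H1_gradient g u (gradient g u).
Proof.
move=> su; split; [exact: measurable_smooth su|exact: measurable_gradient|].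
exists (fun=> u); split => //.
  rewrite (_ : (fun=> _) = fun=> 0%E); first exact: cvg_cst.
  by apply/funext => _; apply: integral0_eq => p _; rewrite subrr expr0n.
rewrite (_ : (fun=> _) = fun=> 0%E); first exact: cvg_cst.
apply/funext => _; apply: integral0_eq => p _; congr (_%:E).
by rewrite /sqnorm subrr /quad mul0mx mul0mx mxE.
Qed.

Lemma cvge0_le (x y : nat -> \bar R) : (forall j, 0 <= x j <= y j)%E ->
  y @ \oo --> 0%E -> x @ \oo --> 0%E.
Proof.
by move=> xy y0; apply: squeeze_cvge y0; [apply: nearW => j; exact: xy|exact: cvg_cst].
Qed.

Lemma cvge0_comb (x y : nat -> \bar R) (a b : R) : x @ \oo --> 0%E -> y @ \oo --> 0%E ->
  (fun j => a%:E * x j + b%:E * y j)%E @ \oo --> 0%E.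
Proof.
move=> x0 y0; rewrite -[X in _ --> X](adde0 0%E).
have hx : (fun j => a%:E * x j)%E @ \oo --> 0%E by rewrite -(mule0 a%:E); exact: cvgeZl.
have hy : (fun j => b%:E * y j)%E @ \oo --> 0%E by rewrite -(mule0 b%:E); exact: cvgeZl.
exact: cvgeD.
Qed.

Lemma measurable_diff_sqnorm phi X : smooth_fun S phi -> measurable_vfield S X ->
  measurable_fun setT (fun p : BM => (sqnorm g (fun c q => gradient g phi c q - X c q) p)%:E).
Proof.
move=> sphi mX; apply/measurable_EFinP; apply: (measurable_sqnorm M_compact).
have := measurable_vfield_comb 1 (-1) (measurable_gradient sphi) mX.
congr (measurable_vfield S _); apply/funext => c; apply/funext => q.
by rewrite scale1r scaleN1r.
Qed.

Lemma measurable_diff_sq (phi u : M -> R) : measurable_fun [set: BM] (phi : BM -> R) ->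
  measurable_fun [set: BM] (u : BM -> R) ->
  measurable_fun setT (fun p : BM => ((phi p - u p) ^+ 2)%:E).
Proof.
by move=> mp mu; apply/measurable_EFinP; apply: measurable_funX; exact: measurable_funB.
Qed.

Lemma H1_gradient_comb u v X Y (a b : R) : H1_gradient g u X -> H1_gradient g v Y ->
  H1_gradient g (fun p => a * u p + b * v p) (fun c p => a *: X c p + b *: Y c p).
Proof.
move=> [mu mX [phi [sphi phi0 phiX]]] [mv mY [psi [spsi psi0 psiY]]]; split.
- by apply: measurable_funD; apply: measurable_funM.
- exact: measurable_vfield_comb.
have c1 : 0 <= 2 * a ^+ 2 by rewrite mulr_ge0 ?sqr_ge0.
have c2 : 0 <= 2 * b ^+ 2 by rewrite mulr_ge0 ?sqr_ge0.
exists (fun j p => a * phi j p + b * psi j p); split.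
- move=> j; apply: smooth_fun_add; exact: smooth_fun_scale.
- apply: cvge0_le (cvge0_comb (2 * a ^+ 2) (2 * b ^+ 2) phi0 psi0) => j; apply/andP; split.
    by apply: integral_ge0 => p _; rewrite lee_fin sqr_ge0.
  have m1 := measurable_diff_sq (measurable_smooth (sphi j)) mu.
  have m2 := measurable_diff_sq (measurable_smooth (spsi j)) mv.
  have n1 (h k : M -> R) (p : BM) : [set: BM] p -> (0 <= ((h p - k p) ^+ 2)%:E)%E.
    by rewrite lee_fin sqr_ge0.
  rewrite -(ge0_integral_lin2 vol measurableT c1 c2 m1 m2 (n1 _ _) (n1 _ _)).
  apply: integral_mono => p _; first by rewrite lee_fin sqr_ge0.
  rewrite -!EFinM -EFinD lee_fin.
  by have := sqr_ge0 (a * (phi j p - u p) - b * (psi j p - v p)); nra.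
- apply: cvge0_le (cvge0_comb (2 * a ^+ 2) (2 * b ^+ 2) phiX psiY) => j; apply/andP; split.
    by apply: integral_ge0 => p _; rewrite lee_fin sqnorm_ge0.
  have m1 := measurable_diff_sqnorm (sphi j) mX.
  have m2 := measurable_diff_sqnorm (spsi j) mY.
  have n1 Z (p : BM) : [set: BM] p -> (0 <= (sqnorm g Z p)%:E)%E by rewrite lee_fin sqnorm_ge0.
  rewrite -(ge0_integral_lin2 vol measurableT c1 c2 m1 m2 (n1 _) (n1 _)).
  apply: integral_mono => p _; first by rewrite lee_fin sqnorm_ge0.
  rewrite -!EFinM -EFinD lee_fin.
  have := sqnorm_comb_le (fun c q => gradient g (phi j) c q - X c q)
    (fun c q => gradient g (psi j) c q - Y c q) a b p.
  congr (_ <= _); have [Sc cp] := chart_atP S p; rewrite /sqnorm; congr (quad _ _).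
  rewrite (gradient_comb g a b (sphi j) (spsi j) Sc cp) !scalerBr opprD.
  by rewrite addrACA.
Qed.

Section weights.
Variables (rho sigma : BM -> R) (B : R).
Hypotheses (mr : measurable_fun setT rho) (r0 : forall p, 0 <= rho p)
  (ms : measurable_fun setT sigma) (s0 : forall p, 0 <= sigma p).
Hypotheses (rB : forall p, rho p <= B) (sB : forall p, sigma p <= B).
Local Notation mrho := (dens vol mr r0).
Local Notation En X := (\int[vol]_p (sqnorm g X p * sigma p)%:E)%E.

Let B0 : 0 <= B. Proof. exact: le_trans (r0 point) (rB point). Qed.

Lemma dens_fin : (mrho setT < +oo)%E.
Proof.
have := integral_cst_le (m := vol) (D := setT) (f := fun p => (rho p)%:E) (k := B%:E)
  measurableT _ _ _ (lexx _).
move=> h; apply: (@le_lt_trans _ _ (B%:E * vol setT)%E).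
  by apply: h => //; rewrite ?lee_fin// => p _; rewrite lee_fin.
by rewrite lte_mul_pinfty ?lee_fin//; exact: volume_fin.
Qed.

Lemma dens_le (f : BM -> \bar R) : measurable_fun setT f -> (forall p, 0 <= f p)%E ->
  (\int[mrho]_p f p <= B%:E * \int[vol]_p f p)%E.
Proof.
move=> mf f0; rewrite ge0_integral_densT// -ge0_integralZl_EFin//.
apply: integral_mono => p _; first by rewrite mule_ge0 ?lee_fin.
by rewrite muleC; apply: lee_wpmul2r => //; rewrite lee_fin.
Qed.

Lemma En_le X : measurable_vfield S X -> (En X <= B%:E * \int[vol]_p (sqnorm g X p)%:E)%E.
Proof.
move=> mX.
have mX' : measurable_fun [set: BM] (fun p => (sqnorm g X p)%:E).
  by apply/measurable_EFinP; exact: measurable_sqnorm.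
have nn (p : BM) : [set: BM] p -> (0 <= (sqnorm g X p)%:E)%E by rewrite lee_fin sqnorm_ge0.
rewrite -ge0_integralZl_EFin//.
apply: integral_mono => p _; first by rewrite lee_fin mulr_ge0 ?sqnorm_ge0.
by rewrite -EFinM lee_fin mulrC ler_wpM2r ?sqnorm_ge0.
Qed.

Lemma smooth_fin phi : smooth_fun S phi ->
  (\int[vol]_p ((phi p) ^+ 2)%:E < +oo)%E /\
  (\int[vol]_p (sqnorm g (gradient g phi) p)%:E < +oo)%E.
Proof.
move=> sphi; have vf := volume_fin M_compact g.
have [K K0 hK] := continuous_bounded M_compact (smooth_fun_continuous sphi).
have [L L0 hL] := continuous_bounded M_compact
  (smooth_fun_continuous (smooth_sqnorm_gradient g sphi)).
split.
  apply: (@le_lt_trans _ _ ((K ^+ 2)%:E * vol setT)%E).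
    apply: integral_cst_le => //; rewrite ?lee_fin ?sqr_ge0// => p _; rewrite lee_fin ?sqr_ge0//.
    by have n0 := normr_ge0 (phi p); rewrite -real_normK ?num_real//; have := hK p; nra.
  by rewrite lte_mul_pinfty ?lee_fin ?sqr_ge0.
apply: (@le_lt_trans _ _ (L%:E * vol setT)%E).
  apply: integral_cst_le => //; rewrite ?lee_fin ?ltW// => p _; rewrite lee_fin ?sqnorm_ge0//.
  exact: le_trans (ler_norm _) (hL p).
by rewrite lte_mul_pinfty ?lee_fin ?ltW.
Qed.

Lemma H1_fin u X : H1_gradient g u X ->
  (\int[vol]_p ((u p) ^+ 2)%:E < +oo)%E /\ (\int[vol]_p (sqnorm g X p)%:E < +oo)%E.
Proof.
move=> [mu mX [phi [sphi phi0 phiX]]]; split.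
  have [j hj] := cvge_exists_lt phi0 (ltry 0).
  have mp := measurable_smooth (sphi j).
  apply: (@le_lt_trans _ _ (2%:E * \int[vol]_p ((phi j p) ^+ 2)%:E +
      2%:E * \int[vol]_p ((phi j p - u p) ^+ 2)%:E)%E).
    rewrite -ge0_integral_lin2//; try by move=> p _; rewrite lee_fin sqr_ge0.
    + apply: integral_mono => p _; first by rewrite lee_fin sqr_ge0.
      rewrite -!EFinM -EFinD lee_fin.
      by have := sqr_ge0 (2 * phi j p - u p); nra.
    + by apply/measurable_EFinP; exact: measurable_funX.
    + exact: measurable_diff_sq.
  have [f1 _] := smooth_fin (sphi j).
  by rewrite lte_add_pinfty// lte_mul_pinfty ?lee_fin.
have [j hj] := cvge_exists_lt phiX (ltry 0).
apply: (@le_lt_trans _ _ (2%:E * \int[vol]_p (sqnorm g (gradient g (phi j)) p)%:E +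
    2%:E * \int[vol]_p (sqnorm g (fun c q => gradient g (phi j) c q - X c q) p)%:E)%E).
  rewrite -ge0_integral_lin2//; try by move=> p _; rewrite lee_fin sqnorm_ge0.
  + apply: integral_mono => p _; first by rewrite lee_fin sqnorm_ge0.
    by rewrite -!EFinM -EFinD lee_fin; exact: sqnorm_sub_le.
  + by apply/measurable_EFinP; exact: measurable_egrad.
  + exact: measurable_diff_sqnorm.
have [_ f1] := smooth_fin (sphi j).
by rewrite lte_add_pinfty// lte_mul_pinfty ?lee_fin.
Qed.

(** Approximation by smooth functions, the weights being bounded. The factor 4 is 2 for splitting u
    into phi_j and an error, times 2 for splitting the gradient of phi_j in the same way; both
    errors tend to 0. *)
Lemma H1_dint u X (K : R) : 0 <= K ->
  (forall phi, smooth_fun S phi ->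
    dint mrho setT setT phi <= K%:E * En (gradient g phi))%E ->
  H1_gradient g u X -> (dint mrho setT setT u <= (4 * K)%:E * En X)%E.
Proof.
move=> K0 hK [mu mX [phi [sphi phi0 phiX]]].
have mfin := dens_fin; have fm := fin_meas mfin measurableT.
set m := fine (mrho setT); have m0 : 0 <= m by exact: fine_ge0.
have sq0 (a : R) : (0 <= (a ^+ 2)%:E)%E by rewrite lee_fin sqr_ge0.
have cmb := cvge0_comb (8 * m * B) (4 * K * B) phi0 phiX.
apply/lee_addgt0Pr => e e0.
have [j /ltW hj] := cvge_exists_lt cmb (e0 : (0 < e%:E)%E).
apply: le_trans (leeD (lexx _) hj).
have mp := measurable_smooth (sphi j).
have mf2 := measurable_diff_sq mp mu.
pose f p := phi j p - u p.
have mf : measurable_fun setT (f : BM -> R) by exact: measurable_funB.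
have mdi (v : BM -> R) : measurable_fun setT v ->
    measurable_fun setT (fun x => \int[mrho]_y ((v x - v y) ^+ 2)%:E)%E.
  by move=> mv; exact: (measurable_dist_int (finite_sigma mfin) measurableT mv).
have msq (v : BM -> R) (a : R) : measurable_fun setT v ->
    measurable_fun setT (fun y => ((a - v y) ^+ 2)%:E).
  by move=> mv; apply/measurable_EFinP; apply: measurable_funX; exact: measurable_funB.
have i0 (v : BM -> R) x : (0 <= \int[mrho]_y ((v x - v y) ^+ 2)%:E)%E by exact: integral_ge0.
have s1 : (dint mrho setT setT u <= 2%:E * dint mrho setT setT (phi j) + 2%:E * dint mrho setT setT f)%E.
  rewrite /dint -ge0_integral_lin2//; [|exact: mdi|exact: mdi].
  apply: integral_mono => x _ //.
  rewrite -ge0_integral_lin2//; [|exact: msq|exact: msq].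
  apply: integral_mono => y _ //; rewrite -!EFinM -EFinD lee_fin /f.
  have := sqr_ge0 ((phi j x - phi j y) + (phi j x - u x - (phi j y - u y))).
  by nra.
have s2 : (dint mrho setT setT f <= (4 * m)%:E * \int[mrho]_p (f p ^+ 2)%:E)%E.
  have mf2' : measurable_fun [set: BM] (fun p => (f p ^+ 2)%:E).
    by apply/measurable_EFinP; exact: measurable_funX.
  set F := (\int[mrho]_p (f p ^+ 2)%:E)%E; have F0 : (0 <= F)%E by exact: integral_ge0.
  have cstE (k : \bar R) : (\int[mrho]_y (cst k y) = k * m%:E)%E.
    by rewrite /m fineK//; exact: (integral_cst mrho measurableT).
  have m20 : 0 <= 2 * m by rewrite mulr_ge0.
  have cn (k : R) (y : BM) : [set: BM] y -> (0 <= cst (k ^+ 2)%:E y)%E by move=> _; exact: sq0.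
  have cF (y : BM) : [set: BM] y -> (0 <= cst F y)%E by move=> _; exact: F0.
  apply: (@le_trans _ _ (\int[mrho]_x ((2 * m)%:E * (f x ^+ 2)%:E + 2%:E * cst F x))%E).
    apply: integral_mono => x _ //.
    apply: (@le_trans _ _ (\int[mrho]_y (2%:E * cst (f x ^+ 2)%:E y + 2%:E * (f y ^+ 2)%:E))%E).
      apply: integral_mono => y _ //=; rewrite -!EFinM -EFinD lee_fin.
      by have := sqr_ge0 (f x + f y); nra.
    rewrite (ge0_integral_lin2 mrho measurableT (ler0n _ 2) (ler0n _ 2)
      (measurable_cst (f x ^+ 2)%:E) mf2' (cn (f x)) (fun y _ => sq0 (f y))).
    rewrite cstE -/F [X in (X + _ <= _)%E](_ : _ = (2 * m)%:E * (f x ^+ 2)%:E)%E; first exact: lexx.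
    by rewrite -!EFinM; congr (_%:E); ring.
  rewrite (ge0_integral_lin2 mrho measurableT m20 (ler0n _ 2) mf2' (measurable_cst F)
    (fun y _ => sq0 (f y)) cF).
  rewrite cstE -/F [X in (_ + X <= _)%E](_ : _ = (2 * m)%:E * F)%E; last first.
    by rewrite muleCA -EFinM muleC.
  rewrite -ge0_muleDl ?lee_fin// -EFinD (_ : 2 * m + 2 * m = 4 * m)//; ring.
have s3 : (En (gradient g (phi j)) <= 2%:E * En X +
    2%:E * (B%:E * \int[vol]_p (sqnorm g (fun c q => gradient g (phi j) c q - X c q) p)%:E))%E.
  have mD := measurable_diff_sqnorm (sphi j) mX.
  have e1 Y : (forall p, 0 <= (sqnorm g Y p * sigma p)%:E)%E.
    by move=> p; rewrite lee_fin mulr_ge0 ?sqnorm_ge0.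
  have mD' : measurable_fun setT (fun p : BM =>
      (sqnorm g (fun c q => gradient g (phi j) c q - X c q) p * sigma p)%:E).
    by apply/measurable_EFinP; apply: measurable_funM => //; exact/measurable_EFinP.
  have mX' : measurable_fun setT (fun p : BM => (sqnorm g X p * sigma p)%:E).
    by apply/measurable_EFinP; apply: measurable_funM => //; exact: measurable_sqnorm.
  apply: (@le_trans _ _ (2%:E * En X + 2%:E * En (fun c q => gradient g (phi j) c q - X c q))%E).
    rewrite -ge0_integral_lin2//; apply: integral_mono => p _ //.
    rewrite -!EFinM -EFinD lee_fin !mulrA -mulrDl; apply: ler_wpM2r => //.
    have := sqnorm_comb_le X (fun c q => gradient g (phi j) c q - X c q) 1 1 p.
    rewrite expr1n !mulr1; congr (_ <= _); congr (sqnorm g _ p).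
    by apply/funext => c; apply/funext => q; rewrite !scale1r addrC subrK.
  apply: leeD => //; apply: lee_wpmul2l; first by rewrite lee_fin.
  rewrite -ge0_integralZl_EFin//.
    apply: integral_mono => p _ //.
    by rewrite -EFinM lee_fin mulrC ler_wpM2r ?sqnorm_ge0.
  by move=> p _; rewrite lee_fin sqnorm_ge0.
apply: le_trans s1 _.
have i1 : (0 <= En X)%E by apply: integral_ge0 => p _; rewrite lee_fin mulr_ge0 ?sqnorm_ge0.
set q := (\int[vol]_p (sqnorm g (fun c q => gradient g (phi j) c q - X c q) p)%:E)%E in s3 *.
have q0 : (0 <= q)%E by apply: integral_ge0 => p _; rewrite lee_fin sqnorm_ge0.
set w := (\int[vol]_p ((phi j p - u p) ^+ 2)%:E)%E.
have s4 : (dint mrho setT setT (phi j) <= (2 * K)%:E * En X + (2 * K * B)%:E * q)%E.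
  apply: le_trans (hK _ (sphi j)) _.
  apply: le_trans (lee_wpmul2l _ s3) _; first by rewrite lee_fin.
  rewrite ge0_muleDr ?mule_ge0 ?lee_fin// !muleA -!EFinM.
  by rewrite (mulrC K 2).
have s5 : (dint mrho setT setT f <= (4 * m * B)%:E * w)%E.
  apply: le_trans s2 _; rewrite [in leRHS]EFinM -muleA; apply: lee_wpmul2l.
    by rewrite lee_fin mulr_ge0.
  exact: dens_le.
apply: le_trans (leeD (lee_wpmul2l _ s4) (lee_wpmul2l _ s5)) _; rewrite ?lee_fin//.
rewrite ge0_muleDr ?mule_ge0 ?lee_fin ?mulr_ge0// !muleA -!EFinM.
rewrite -addeA [X in (_ + X <= _)%E]addeC.
rewrite (_ : 2 * (2 * K) = 4 * K); last by ring.
rewrite (_ : 2 * (2 * K * B) = 4 * K * B); last by ring.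
by rewrite (_ : 2 * (4 * m * B) = 8 * m * B); last by ring.
Qed.

(** Every plane of $H^1$ contains a nonzero u of zero mean for rho. For it the double integral is 2
    m times the denominator of the quotient and at most 4 K times the numerator, hence m / (2 K). *)
Lemma mu1_ge (K : R) : 0 < K -> (forall p, 0 < rho p) ->
  (forall phi, smooth_fun S phi ->
    dint mrho setT setT phi <= K%:E * En (gradient g phi))%E ->
  ((fine (mrho setT) / (2 * K))%:E <= mu_k g 1 rho sigma)%E.
Proof.
move=> K0 rho0 hK; have mfin := dens_fin; have fm := fin_meas mfin measurableT.
set m := fine (mrho setT); have m0 : 0 <= m by exact: fine_ge0.
apply: le_ereal_inf_tmp => _ [E [b [hb indep EE]] <-].
have intb i : mrho.-integrable setT (EFin \o b i).
  have [X HX] := hb i; have [f2 _] := H1_fin HX; have [mb _ _] := HX.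
  apply: (L2_integrable mfin) => //.
  apply: le_lt_trans (dens_le _ _) _.
  - by apply/measurable_EFinP; exact: measurable_funX.
  - by move=> p; rewrite lee_fin sqr_ge0.
  - by rewrite lte_mul_pinfty ?lee_fin.
pose I (i : 'I_2) := fine (\int[mrho]_p (b i p)%:E)%E.
have IE i : (\int[mrho]_p (b i p)%:E)%E = (I i)%:E.
  by rewrite /I fineK//; exact: (integrable_fin_num measurableT (intb i)).
(* A linear form in two variables has a nontrivial zero; it is written out, with a separate choice
   when the second coefficient vanishes. *)
have [a [a0 aI]] : exists a : 'I_2 -> R, (exists i, a i != 0) /\ a ord0 * I ord0 + a ord_max * I ord_max = 0.
  have [I1|I1] := eqVneq (I ord_max) 0.
    exists (fun i => (i == ord_max)%:R); split; last by rewrite /= I1 mulr0 mul0r addr0.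
    by exists ord_max; rewrite eqxx oner_eq0.
  exists (fun i => if i == ord0 then I ord_max else - I ord0); split; first by exists ord0.
  by rewrite /= mulNr mulrC subrr.
pose u p := \sum_i a i * b i p.
have uE p : u p = a ord0 * b ord0 p + a ord_max * b ord_max p.
  by rewrite /u big_ord_recl big_ord1; congr (_ + a _ * b _ p); apply/val_inj.
have [X0 HX0] := hb ord0; have [X1 HX1] := hb ord_max.
have Hu : H1_gradient g u (fun c p => a ord0 *: X0 c p + a ord_max *: X1 c p).
  have := H1_gradient_comb (a ord0) (a ord_max) HX0 HX1; congr (H1_gradient g _ _).
  by apply/funext => p; rewrite uE.
set X := (fun c p => _) in Hu.
have nz : ~ {ae vol, forall p, u p = 0}.
  by move=> /indep h; have [i /eqP] := a0; apply; exact: h.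
have [mu mX _] := Hu; have [u2 X2] := H1_fin Hu.
pose num := (\int[vol]_p (sqnorm g X p * sigma p)) ; pose den := (\int[vol]_p (u p ^+ 2 * rho p)).
apply: (@le_trans _ _ (num / den)%:E); last first.
  apply: ereal_sup_ubound; exists u, X; split => //.
  rewrite EE; split; first by exists X.
  by exists a; apply: aeW.
have mu2 : measurable_fun [set: BM] (fun p => ((u p) ^+ 2)%:E).
  by apply/measurable_EFinP; exact: measurable_funX.
have sq0 (c : R) : (0 <= (c ^+ 2)%:E)%E by rewrite lee_fin sqr_ge0.
have r2 : (\int[mrho]_p ((u p) ^+ 2)%:E < +oo)%E.
  by apply: le_lt_trans (dens_le mu2 _) _ => //; rewrite lte_mul_pinfty ?lee_fin.
have E2 : (\int[mrho]_p ((u p) ^+ 2)%:E = \int[vol]_p ((u p) ^+ 2 * rho p)%:E)%E.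
  by rewrite ge0_integral_densT//; apply: eq_integral => p _; rewrite EFinM.
have denE : (den%:E = \int[vol]_p ((u p) ^+ 2 * rho p)%:E)%E.
  by rewrite /den /Rintegral fineK// -E2 ge0_fin_numE// integral_ge0.
have numE : (num%:E = En X)%E.
  rewrite /num /Rintegral fineK// ge0_fin_numE.
    by apply: le_lt_trans (En_le mX) _; rewrite lte_mul_pinfty ?lee_fin.
  by apply: integral_ge0 => p _; rewrite lee_fin mulr_ge0 ?sqnorm_ge0.
have mean0 : (\int[mrho]_p (u p)%:E = 0)%E.
  rewrite (eq_integral (fun p : BM => (a ord0)%:E * (b ord0 p)%:E + (a ord_max)%:E * (b ord_max p)%:E)%E).
    rewrite integralD//; [|exact: (integrableZl measurableT _ (intb _))..].
    rewrite !integralZl//; [|exact: intb..].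
    by rewrite !IE -!EFinM -EFinD aI.
  by move=> p _; rewrite uE -!EFinM -EFinD.
have den0 : 0 < den.
  have d0 : 0 <= den.
    by rewrite -lee_fin denE; apply: integral_ge0 => p _; rewrite lee_fin mulr_ge0 ?sqr_ge0.
  (* As rho is positive, a vanishing denominator would force u to vanish almost everywhere, against
     linear independence. *)
  rewrite lt_neqAle d0 andbT; apply/eqP => d00; apply: nz.
  have mur : measurable_fun [set: BM] (fun p => (u p ^+ 2 * rho p)%:E).
    by apply/measurable_EFinP; apply: measurable_funM => //; exact: measurable_funX.
  have : (\int[vol]_p `|(u p ^+ 2 * rho p)%:E| = 0)%E.
    rewrite (eq_integral (fun p : BM => (u p ^+ 2 * rho p)%:E)) -?denE -?d00// => p _.
    by rewrite gee0_abs// lee_fin mulr_ge0 ?sqr_ge0.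
  move=> /(ae_eq_integral_abs vol measurableT mur); apply: filterS => p /(_ Logic.I) /= [] /eqP.
  by rewrite mulf_eq0 (gt_eqF (rho0 p)) orbF sqrf_eq0 => /eqP.
have := H1_dint (ltW K0) hK Hu; rewrite (dint_zero_mean mfin mu r2 mean0) E2 -denE -numE.
rewrite -!EFinM lee_fin -/m => h.
rewrite lee_fin ler_pdivrMr ?mulr_gt0// mulrAC ler_pdivlMr//.
by lra.
Qed.

End weights.
End H1Theory.

(** * A limit of derivatives of functions tending to 0 is 0 *)

Section WeakDerivative.
Context {R : realType}.
Variable n : nat.
Local Notation H := (@half_space R n).
Local Notation BV := (borel 'rV[R]_n).
Local Notation leb := (@leb R n).
Local Notation leb1 := (@lebesgue_measure R).

(** Converts smallness in $L^2$ into smallness in $L^1$ on a set of finite measure, with d absorbing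
    the constant term. *)
Lemma abs_le_sq (x d : R) : 0 < d -> `|x| <= d + x ^+ 2 / d.
Proof.
move=> d0; have [xd|/ltW dx] := lerP `|x| d.
  by apply: le_trans xd _; rewrite lerDl divr_ge0 ?sqr_ge0// ltW.
rewrite -[X in X <= _]add0r; apply: lerD; first exact: ltW.
rewrite ler_pdivlMr// -(real_normK (num_real x)) expr2.
by apply: ler_wpM2l.
Qed.

Lemma pos_dist (s t : R) : Num.max s 0 <= Num.max t 0 + `|s - t|.
Proof.
rewrite ge_max; apply/andP; split; last by rewrite addr_ge0// le_max lexx orbT.
by rewrite -[leLHS](subrK t) addrC lerD ?ler_norm// le_max lexx.
Qed.

(** A cutoff in the i-th coordinate alone, since integration by parts takes place on lines in that
    direction only. *)
Definition cutoff (a b : 'rV[R]_n) (i : 'I_n) (d : R) (x : 'rV[R]_n) : R :=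
  (1 - smooth_step (d^-1 * (x 0 i - a 0 i))) * (1 - smooth_step (d^-1 * (b 0 i - x 0 i))).

Section cutoff.
Variables (a b : 'rV[R]_n) (i : 'I_n) (d : R).
Hypothesis d0 : 0 < d.
Local Notation eta := (cutoff a b i d).

Lemma cutoff01 (x : 'rV[R]_n) : 0 <= eta x <= 1.
Proof.
have h (t : R) : 0 <= 1 - smooth_step t <= 1.
  by rewrite subr_ge0 smooth_step_le1 gerBl smooth_step_ge0.
have /andP[x0 x1] := h (d^-1 * (x 0 i - a 0 i)).
have /andP[y0 y1] := h (d^-1 * (b 0 i - x 0 i)).
by rewrite /cutoff mulr_ge0//= mulr_ile1.
Qed.

Lemma cutoff_eq1 (x : 'rV[R]_n) : a 0 i + 2 * d <= x 0 i <= b 0 i - 2 * d -> eta x = 1.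
Proof.
move=> /andP[h1 h2]; rewrite /cutoff !smooth_step0 ?subr0 ?mulr1//;
  by rewrite mulrC ler_pdivlMr//; lra.
Qed.

Lemma cutoff_left (x : 'rV[R]_n) : x 0 i = a 0 i + d -> eta x = 0.
Proof.
move=> xa; rewrite /cutoff xa smooth_step1 ?subrr ?mul0r//.
by rewrite addrAC subrr add0r mulVf// gt_eqF.
Qed.

Lemma cutoff_right (x : 'rV[R]_n) : x 0 i = b 0 i - d -> eta x = 0.
Proof.
move=> xb; rewrite /cutoff xb [X in _ * (1 - X)]smooth_step1 ?subrr ?mulr0//.
by rewrite opprB addrCA subrr addr0 mulVf// gt_eqF.
Qed.

Lemma Ck_cutoff k : Ck (W := R) k setT eta.
Proof.
have half (s : R) (e : R) j : Ck (W := R) j setT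
    (fun x : 'rV[R]_n => 1 + (-1) * smooth_step (s * x 0 i + e)).
  apply: (Ck_add openT); first exact: (Ck_cst openT).
  apply: (Ck_mul openT); first exact: (Ck_cst openT).
  apply: (Ck_smooth_step (f := fun x => s * x 0 i + e)); first exact: openT.
  move=> l; apply: (Ck_add openT); last exact: (Ck_cst openT).
  by apply: (Ck_mul openT); [exact: (Ck_cst openT)|exact: (Ck_coord openT)].
apply: Ck_eq (Ck_mul openT (half d^-1 (- (d^-1 * a 0 i)) k) (half (- d^-1) (d^-1 * b 0 i) k)) => //.
  exact: openT.
move=> x _; rewrite /cutoff !mulN1r; congr ((1 - smooth_step _) * (1 - smooth_step _)); ring.
Qed.

Lemma cutoff_partial_bounded K : exists2 C : R, 0 < C &
  forall x, H x -> `|x| <= K -> `|partial i eta x| <= C.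
Proof.
have [_ /(_ i)[dE cD]] := Ck_cutoff 1; have cD' x := cD.1 x I.
pose B : set 'rV[R]_n := [set x | `|x| <= K].
have cB : compact B.
  apply: bounded_closed_compact.
    by exists K; split; [exact: num_real|move=> N KN x /= xK; apply: le_trans xK (ltW KN)].
  apply: (@closed_comp _ _ (fun x : 'rV[R]_n => `|x|) [set t | t <= K]); last exact: closed_le.
  by move=> x _; exact: norm_continuous.
have : compact ((fun x => 'D_(delta_mx 0 i) eta x) @` B).
  by apply: continuous_compact => //; apply: continuous_subspaceT => x; exact: cD'.
move=> /(@compact_bounded R R)[C0 [_ hC]]; exists (Num.max 1 (C0 + 1)).
  by rewrite lt_max ltr01.
move=> x Hx xK; rewrite (partialE openT I Hx (dE x I))//.
by apply: hC; [rewrite lt_max ltrDl ltr01 orbT|exists x].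
Qed.

End cutoff.

Section weak_zero.
Variables (V : set 'rV[R]_n) (lo hi : 'rV[R]_n) (i : 'I_n).
Hypotheses (oV : open V) (QV : box lo hi `<=` V `&` H).
Local Notation Q := (box lo hi).

Lemma partial_mul (f e : 'rV[R]_n -> R) x : smooth_on (W := R) (V `&` H) f ->
  (forall k, Ck (W := R) k setT e) -> (V `&` H) x ->
  partial i (fun y => f y * e y) x = partial i f x * e x + f x * partial i e x.
Proof.
move=> sf Ce Ax; have [U [F [oU UV Ux CF fF]]] := smooth_on_ext oV sf Ax.
have [_ Hx] := Ax; have dF := Ck_derivable (i := i) (CF 1%N) Ux.
have de := Ck_derivable (i := i) (Ce 1%N) (I : setT x).
rewrite (partialE oU Ux Hx dF fF) (@partialE _ _ setT e e x i openT I Hx de (fun _ _ _ => erefl)) (fF x Ux Hx).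
rewrite (@partialE _ _ U _ (F * e) x i oU Ux Hx).
- by rewrite deriveM// addrC; congr (_ + _); exact: mulrC.
- exact: derivableM.
- by move=> y Uy Hy; rewrite fF.
Qed.

Lemma box_partial_measurable_fun (f : 'rV[R]_n -> R) : smooth_on (W := R) (V `&` H) f ->
  measurable_fun (Q : set BV) (f : BV -> R) /\
  measurable_fun (Q : set BV) (partial i f : BV -> R).
Proof.
move=> sf; split; (apply: within_continuous_borelR; first exact: measurable_box).
  exact: continuous_subspaceW (smooth_on_within sf).
exact: continuous_subspaceW (smooth_on_within (smooth_on_partial oV i sf)).
Qed.

(** This says that v' has integral 0. Written with positive and negative parts, it can be integrated
    over the other coordinates by Tonelli. *)
Lemma ftc_zero (v v' : R -> R) (s t : R) : s < t -> {within `[s, t], continuous v'} ->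
  derivable_oo_LRcontinuous v s t -> {in `]s, t[, v^`()%classic =1 v'} ->
  v s = 0 -> v t = 0 ->
  (\int[leb1]_(x in `[s, t]) (Num.max (v' x) 0)%:E = \int[leb1]_(x in `[s, t]) (Num.max (- v' x) 0)%:E)%E.
Proof.
move=> st cv' dv vv' vs vt; have := continuous_FTC2 st cv' dv vv'.
rewrite vs vt sube0 => E.
have cpos : {within `[s, t], continuous (fun x => Num.max (v' x) 0)}.
  apply: (within_post (k := fun y : R => Num.max y 0) cv') => y.
  by apply: continuous_max; [exact: cvg_id|exact: cvg_cst].
have cneg : {within `[s, t], continuous (fun x => Num.max (- v' x) 0)}.
  apply: (within_post (k := fun y : R => Num.max (- y) 0) cv') => y.
  by apply: continuous_max; [exact: opp_continuous|exact: cvg_cst].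
have ip : leb1.-integrable `[s, t] (EFin \o (fun x => Num.max (v' x) 0)).
  by apply: continuous_compact_integrable cpos; exact: segment_compact.
have im : leb1.-integrable `[s, t] (EFin \o (fun x => Num.max (- v' x) 0)).
  by apply: continuous_compact_integrable cneg; exact: segment_compact.
have B : (\int[leb1]_(x in `[s, t]) ((Num.max (v' x) 0)%:E - (Num.max (- v' x) 0)%:E) =
    \int[leb1]_(x in `[s, t]) (Num.max (v' x) 0)%:E -
    \int[leb1]_(x in `[s, t]) (Num.max (- v' x) 0)%:E)%E by rewrite integralB_EFin.
have E2 : (\int[leb1]_(x in `[s, t]) ((Num.max (v' x) 0)%:E - (Num.max (- v' x) 0)%:E) = 0)%E.
  rewrite -[RHS]E; apply: eq_integral => x _; rewrite -EFinB; congr (_%:E).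
  by case: (leP (v' x) 0) => h; case: (leP (- v' x) 0) => h'; lra.
have fp : (\int[leb1]_(x in `[s, t]) (Num.max (v' x) 0)%:E)%E \is a fin_num.
  by apply: integrable_fin_num ip.
have fn : (\int[leb1]_(x in `[s, t]) (Num.max (- v' x) 0)%:E)%E \is a fin_num.
  by apply: integrable_fin_num im.
move: B; rewrite E2 -(fineK fp) -(fineK fn) -EFinB => -[] /esym/eqP.
by rewrite subr_eq0 => /eqP ->.
Qed.

Variable z : BV -> R.
Hypothesis mz : measurable_fun setT z.
Variable f : nat -> 'rV[R]_n -> R.
Hypothesis sf : forall j, smooth_on (W := R) (V `&` H) (f j).
Hypothesis f0 : (fun j => \int[leb]_(x in Q) ((f j x) ^+ 2)%:E)%E @ \oo --> 0%E.
Hypothesis fz : (fun j => \int[leb]_(x in Q) ((partial i (f j) x - z x) ^+ 2)%:E)%E @ \oo --> 0%E.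
Local Notation pos t := (Num.max t 0).

(** The function f_j times the cutoff vanishes at both ends of each line, so the positive and
    negative parts of its i-th derivative G have equal integrals. As f_j tends to 0 and its
    derivative to z in $L^2$, G tends to z times the cutoff in $L^1$, and the balance of signs
    passes to z. The derivative of the cutoff, large when d is small, only multiplies f_j. *)
Lemma pos_part_le (a b : 'rV[R]_n) d : 0 < d -> box a b `<=` Q ->
  (\int[leb]_(x in box a b `&` [set x | (a 0 i + 2 * d <= x 0 i <= b 0 i - 2 * d)%R]) (pos (z x))%:E <=
   \int[leb]_(x in box a b) (pos (- z x))%:E)%E.
Proof.
move=> d0 PQ; set P' := _ `&` _; have [st|ts] := ltP (a 0 i + d) (b 0 i - d); last first.
  rewrite (_ : P' = set0) ?integral_set0; first by apply: integral_ge0 => x _; rewrite lee_fin le_max lexx orbT.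
  by apply/seteqP; split => // x [_ /andP[h1 h2]]; lra.
pose J k := if k == i then `[a 0 i + d, b 0 i - d]%classic else `]a 0 k, b 0 k[%classic.
have mJ k : measurable (J k) by rewrite /J; case: ifP => _; exact: measurable_itv.
have mP := measurable_prodI mJ.
have JP : prodI J `<=` box a b.
  move=> x h k; have := h k; rewrite /J; case: eqVneq => [->|_]; rewrite /= in_itv /= => /andP[h1 h2].
    by apply/andP; split; lra.
  by rewrite h1 h2.
have P'J : P' `<=` prodI J.
  move=> x [h hx] k; rewrite /J; case: eqVneq => [->|_]; last by rewrite /= in_itv /=; exact: h.
  by rewrite /= in_itv /=; move: hx => /andP[h1 h2]; apply/andP; split; lra.
set eta := cutoff a b i d.
have e01 x : 0 <= eta x <= 1 := cutoff01 a b i d x.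
have me : measurable_fun setT (eta : BV -> R).
  apply: continuous_borelR => x; exact: (Ck_continuous (Ck_cutoff a b i d 0) I).
pose K := `|a| + `|b|.
have [C C0 hC] := cutoff_partial_bounded a b i d K.
have JK x : prodI J x -> H x /\ `|x| <= K.
  move=> /JP xP; split; first by have [] := QV (PQ _ xP).
  apply/mx_normP; first by rewrite addr_ge0.
  move=> k l; rewrite ord1; have /andP[h1 h2] := xP l.
  have := @mx_norm_coord _ _ _ a 0 l; have := @mx_norm_coord _ _ _ b 0 l.
  rewrite !ler_norml /K => /andP[b1 b2] /andP[a1 a2]; apply/andP; split.
    by have := normr_ge0 b; lra.
  by have := normr_ge0 a; lra.
have Pfin : (leb (prodI J) < +oo)%E.
  apply: leb_prodI_fin => // k; rewrite /J; case: ifP => _.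
    by have -> := @lebesgue_measure_itv R `[a 0 i + d, b 0 i - d]; case: ifP => _; rewrite ?ltry.
  by have -> := @lebesgue_measure_itv R `]a 0 k, b 0 k[; case: ifP => _; rewrite ?ltry.
pose l := fine (leb (prodI J)); have l0 : 0 <= l by exact: fine_ge0.
have lE : leb (prodI J) = l%:E by rewrite /l fineK// ge0_fin_numE.
apply/lee_addgt0Pr => e e0.
(* The parameter d of [abs_le_sq], chosen so that its constant terms integrate to at most e/2; the
   index j then makes the quadratic terms at most e/2. *)
pose dl := e / (4 * (1 + C) * (l + 1)).
have dl0 : 0 < dl by rewrite divr_gt0// !mulr_gt0// ltr_wpDl.
have cmb : (fun j => (2 * C / dl)%:E * \int[leb]_(x in Q) ((f j x) ^+ 2)%:E +
    (2 / dl)%:E * \int[leb]_(x in Q) ((partial i (f j) x - z x) ^+ 2)%:E)%E @ \oo --> 0%E.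
  rewrite -[X in _ --> X](adde0 0%E); apply: cvgeD => //.
    by rewrite -(mule0 (2 * C / dl)%:E); exact: cvgeZl.
  by rewrite -(mule0 (2 / dl)%:E); exact: cvgeZl.
have e2 : (0 < (e / 2)%:E)%E by rewrite lte_fin divr_gt0.
have [j /ltW hj] := cvge_exists_lt cmb e2.
pose fe x := f j x * eta x.
pose G := partial i fe.
have sfe : smooth_on (W := R) (V `&` H) fe.
  apply: smooth_on_mul => //; apply: (smooth_on_Ck openT) => // k; exact: Ck_cutoff.
have JV x : prodI J x -> (V `&` H) x by move=> /JP/PQ/QV.
have GE x : prodI J x -> G x = partial i (f j) x * eta x + f j x * partial i eta x.
  by move=> /JV Vx; rewrite /G partial_mul// => k; exact: Ck_cutoff.
have mQJ (h : BV -> R) : measurable_fun (Q : set BV) h -> measurable_fun (prodI J) h.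
  by apply: measurable_funS; [exact: measurable_box|move=> x /JP/PQ].
have [mf1 mp1] := box_partial_measurable_fun (sf j).
have [mfe mG] := box_partial_measurable_fun sfe.
pose Gr : BV -> R := G \_ (prodI J).
have mGr : measurable_fun setT Gr by apply: (proj1 (measurable_restrictT _ mP)); exact: mQJ.
have GrE x : prodI J x -> Gr x = G x by move=> Jx; rewrite /Gr /restrict /patch mem_set.
have mpos (h : BV -> R) D : measurable_fun D h -> measurable_fun D (fun x => (pos (h x))%:E).
  by move=> mh; apply/measurable_EFinP; apply: measurable_maxr => //; exact: measurable_cst.
have pos0 (t : R) : (0 <= (pos t)%:E)%E by rewrite lee_fin le_max lexx orbT.
(* On each line in direction i there is equality by [ftc_zero]; [slice_le] integrates it over the
   box. *)
have bal : (\int[leb]_(x in prodI J) (pos (Gr x))%:E <= \int[leb]_(x in prodI J) (pos (- Gr x))%:E)%E.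
  apply: (@slice_le _ _ J _ _ i) => //.
  - exact: mpos.
  - by apply: mpos; exact: measurable_funN.
  move=> x Jx; rewrite /J eqxx.
  have up t : `[a 0 i + d, b 0 i - d]%classic t -> prodI J (upd x i t).
    by move=> ht; apply: prodI_upd => //; rewrite /J eqxx.
  have hl t : `[a 0 i + d, b 0 i - d]%classic t -> (V `&` H) (upd x i t) by move=> /up/JV.
  have fe1 : fe (upd x i (a 0 i + d)) = 0.
    by rewrite /fe /eta cutoff_left ?upd_coord ?mulr0.
  have fe2 : fe (upd x i (b 0 i - d)) = 0.
    by rewrite /fe /eta cutoff_right ?upd_coord ?mulr0.
  have E := ftc_zero st (line_partial_continuous oV sfe hl) (line_derivable oV sfe st hl)
    (line_derive1 oV sfe hl) fe1 fe2.
  rewrite le_eqVlt; apply/orP; left; apply/eqP.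
  etransitivity; [etransitivity; [|exact: E]|]; apply: eq_integral => t /set_mem ht; rewrite ?GrE//; exact: up.
have mze : measurable_fun setT (fun x => z x * eta x) by exact: measurable_funM.
pose er x := `|z x * eta x - Gr x|.
have mer : measurable_fun setT (fun x => (er x)%:E).
  by apply/measurable_EFinP; apply: measurableT_comp => //; exact: measurable_funB.
have er0 x : (0 <= (er x)%:E)%E by rewrite lee_fin normr_ge0.
have small : (2%:E * \int[leb]_(x in prodI J) (er x)%:E <= e%:E)%E.
  have [C0' dl0'] := (ltW C0, ltW dl0).
  have cf : 0 <= 2 * C / dl by exact: divr_ge0 (mulr_ge0 (ler0n _ 2) C0') dl0'.
  have cp : 0 <= 2 / dl by exact: divr_ge0 (ler0n _ 2) dl0'.
  have m1 : measurable_fun (prodI J) (fun x => ((f j x) ^+ 2)%:E).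
    by apply/measurable_EFinP; apply: measurable_funX; exact: mQJ.
  have m2 : measurable_fun (prodI J) (fun x => ((partial i (f j) x - z x) ^+ 2)%:E).
    apply/measurable_EFinP; apply: measurable_funX; apply: measurable_funB; first exact: mQJ.
    exact: measurable_funTS.
  have n1 x : prodI J x -> (0 <= ((f j x) ^+ 2)%:E)%E by rewrite lee_fin sqr_ge0.
  have n2 x : prodI J x -> (0 <= ((partial i (f j) x - z x) ^+ 2)%:E)%E by rewrite lee_fin sqr_ge0.
  pose W x := ((2 * C / dl)%:E * ((f j x) ^+ 2)%:E + (2 / dl)%:E * ((partial i (f j) x - z x) ^+ 2)%:E)%E.
  have mW : measurable_fun (prodI J) W by apply: emeasurable_funD; exact: measurable_funeM.
  have W0 x : prodI J x -> (0 <= W x)%E.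
    by move=> Jx; rewrite adde_ge0// mule_ge0 ?n1 ?n2 ?lee_fin.
  have c0 x : prodI J x -> (0 <= cst (2 * (1 + C) * dl)%:E x)%E.
    move=> _; rewrite lee_fin.
    exact: mulr_ge0 (mulr_ge0 (ler0n _ 2) (addr_ge0 ler01 C0')) dl0'.
  have merJ : measurable_fun (prodI J) (fun x => (er x)%:E) by exact: measurable_funTS.
  have e0J x : prodI J x -> (0 <= (er x)%:E)%E by [].
  rewrite -ge0_integralZl_EFin//.
  apply: (@le_trans _ _ (\int[leb]_(x in prodI J) (cst (2 * (1 + C) * dl)%:E x + W x))%E).
    apply: integral_mono => x Jx; first by rewrite mule_ge0 ?lee_fin ?normr_ge0.
    rewrite /W /= -!EFinM -!EFinD lee_fin /er GrE// GE//.
    have -> : z x * eta x - (partial i (f j) x * eta x + f j x * partial i eta x) =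
        (z x - partial i (f j) x) * eta x - f j x * partial i eta x by ring.
    have [Hx xK] := JK x Jx; have /andP[x0 x1] := e01 x; have hCx := hC x Hx xK.
    have t1 : `|(z x - partial i (f j) x) * eta x| <= dl + (partial i (f j) x - z x) ^+ 2 / dl.
      rewrite normrM (ger0_norm x0); apply: (@le_trans _ _ (`|z x - partial i (f j) x|)).
        by rewrite -[leRHS]mulr1; apply: ler_wpM2l.
      by rewrite distrC; exact: abs_le_sq.
    have t2 : `|f j x * partial i eta x| <= (dl + (f j x) ^+ 2 / dl) * C.
      by rewrite normrM; apply: ler_pM => //; exact: abs_le_sq.
    apply: (@le_trans _ _ (2 * (dl + (partial i (f j) x - z x) ^+ 2 / dl + (dl + (f j x) ^+ 2 / dl) * C))).
      by apply: ler_wpM2l => //; apply: le_trans (ler_normB _ _) _; exact: lerD.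
    by rewrite le_eqVlt; apply/orP; left; apply/eqP; field; rewrite gt_eqF.
  rewrite ge0_integralD//.
  have -> : (\int[leb]_(x in prodI J) cst (2 * (1 + C) * dl)%:E x = (2 * (1 + C) * dl * l)%:E)%E.
    have -> : ((2 * (1 + C) * dl * l)%:E = (2 * (1 + C) * dl)%:E * leb (prodI J))%E.
      by rewrite lE -EFinM.
    exact: (integral_cst leb mP).
  apply: (@le_trans _ _ ((e / 2)%:E + (e / 2)%:E)%E); last first.
    by rewrite -EFinD lee_fin -splitr.
  apply: leeD.
    rewrite lee_fin /dl.
    have -> : 2 * (1 + C) * (e / (4 * (1 + C) * (l + 1))) * l = e / 2 * (l / (l + 1)).
      have l1 : 0 < l + 1 by rewrite ltr_wpDl.
      have C1 : 0 < 1 + C by rewrite addr_gt0.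
      by field; rewrite !gt_eqF.
    rewrite -[leRHS]mulr1; apply: ler_wpM2l; first by rewrite divr_ge0 ?ltW.
    by rewrite ler_pdivrMr ?mul1r ?lerDl// ltr_wpDl.
  rewrite /W (ge0_integral_lin2 leb mP cf cp m1 m2 n1 n2); apply: le_trans hj.
  by apply: leeD; (apply: lee_wpmul2l; first by rewrite lee_fin);
    apply: integral_subset => [x /JP/PQ//|x _]; rewrite lee_fin sqr_ge0.
have mposJ (h : BV -> R) : measurable_fun setT h -> measurable_fun (prodI J) (fun x => (pos (h x))%:E).
  by move=> mh; apply: measurable_funTS; exact: mpos.
have merJ : measurable_fun (prodI J) (fun x => (er x)%:E) by exact: measurable_funTS.
apply: (@le_trans _ _ (\int[leb]_(x in prodI J) (pos (z x * eta x))%:E)%E).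
  apply: (@le_trans _ _ (\int[leb]_(x in P') (pos (z x * eta x))%:E)%E).
    apply: integral_mono => x [_ hx]; first exact: pos0.
    by rewrite /eta cutoff_eq1// mulr1.
  by apply: integral_subset => // x _; exact: pos0.
apply: (@le_trans _ _ (\int[leb]_(x in prodI J) (pos (Gr x))%:E + \int[leb]_(x in prodI J) (er x)%:E)%E).
  rewrite -ge0_integralD//; [|exact: mposJ].
  apply: integral_mono => x _; first exact: pos0.
  by rewrite -EFinD lee_fin; exact: pos_dist.
apply: le_trans (leeD bal (lexx _)) _.
apply: (@le_trans _ _ ((\int[leb]_(x in prodI J) (pos (- (z x * eta x)))%:E +
    \int[leb]_(x in prodI J) (er x)%:E) + \int[leb]_(x in prodI J) (er x)%:E)%E).
  apply: leeD => //; rewrite -ge0_integralD//; last by apply: mposJ; exact: measurable_funN.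
  apply: integral_mono => x _; first exact: pos0.
  rewrite -EFinD lee_fin /er distrC -normrN opprD.
  exact: pos_dist.
rewrite -addeA; apply: leeD.
  apply: (@le_trans _ _ (\int[leb]_(x in prodI J) (pos (- z x))%:E)%E).
    apply: integral_mono => x _; first exact: pos0.
    rewrite lee_fin; have /andP[x0 x1] := e01 x; rewrite -mulNr.
    have h0 : 0 <= pos (- z x) by rewrite le_max lexx orbT.
    have h1 : - z x <= pos (- z x) by rewrite le_max lexx.
    move: h0 h1; set w := pos (- z x) => h0 h1.
    rewrite ge_max h0 andbT; apply: le_trans (ler_wpM2r x0 h1) _.
    by rewrite -[leRHS]mulr1; exact: ler_wpM2l.
  by apply: integral_subset => // x _; exact: pos0.
apply: le_trans small; rewrite -[X in (X + _ <= _)%E]mul1e -[X in (_ + X <= _)%E]mul1e.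
by rewrite -ge0_muleDl ?lee01// -EFinD.
Qed.

(** The margin d tends to 0 along 1/(k+1): the shrunk boxes increase to the whole box, and the
    right-hand side does not depend on d. *)
Lemma pos_part_box_le (a b : 'rV[R]_n) : box a b `<=` Q ->
  (\int[leb]_(x in box a b) (pos (z x))%:E <= \int[leb]_(x in box a b) (pos (- z x))%:E)%E.
Proof.
move=> PQ.
have mpz : measurable_fun setT (fun x => pos (z x)).
  by apply: measurable_maxr => //; exact: measurable_cst.
have pz0 x : 0 <= pos (z x) by rewrite le_max lexx orbT.
pose m1 : {measure set BV -> \bar R} := dens leb mpz pz0.
pose I0 (k : nat) := `[a 0 i + 2 * k.+1%:R^-1, b 0 i - 2 * k.+1%:R^-1]%classic.
pose F k : set BV := box a b `&` (fun x : BV => x 0 i) @^-1` I0 k.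
have FE k : F k = box a b `&`
    [set x | a 0 i + 2 * k.+1%:R^-1 <= x 0 i <= b 0 i - 2 * k.+1%:R^-1].
  by apply/seteqP; split => x [Px]; rewrite /I0 /= ?in_itv.
have mF k : measurable (F k).
  apply: measurableI; first exact: measurable_box.
  rewrite -[X in measurable X]setTI; apply: measurable_coord => //.
  exact: measurable_itv.
have UF : \bigcup_k F k = box a b.
  apply/seteqP; split => [x [k _ []]//|x Px].
  have /andP[h1 h2] := Px i.
  pose s := Num.min (x 0 i - a 0 i) (b 0 i - x 0 i).
  have s0 : 0 < s by rewrite lt_min !subr_gt0 h1 h2.
  have hs : s <= x 0 i - a 0 i /\ s <= b 0 i - x 0 i by rewrite !ge_min !lexx orbT.
  have [k' hk'] : exists k', 2 * k'.+1%:R^-1 <= s.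
    have s20 : 0 < s / 2 by rewrite divr_gt0.
    have [k' hk'] := ltr_add_invr (s20 : 0 < s / 2); exists k'.
    by rewrite add0r ltr_pdivlMr// mulrC in hk'; exact: ltW.
  exists k' => //; split => //; rewrite /I0 /= ?in_itv /=; case: hs => h3 h4.
  by apply/andP; split; [rewrite -lerBrDl; exact: le_trans h3|
    rewrite lerBrDr -lerBrDl; exact: le_trans h4].
have nd : nondecreasing_seq F.
  move=> k k' kk'; apply/subsetPset => x [Px]; rewrite /I0 /= ?in_itv /= => /andP[h1 h2].
  split => //; rewrite /I0 /= ?in_itv /=.
  have : k'.+1%:R^-1 <= k.+1%:R^-1 :> R by rewrite lef_pV2 ?posrE ?ltr0n// ler_nat.
  move=> h; apply/andP; split.
    by apply: le_trans h1; rewrite lerD2l ler_wpM2l.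
  by apply: le_trans h2 _; rewrite lerD2l lerN2 ler_wpM2l.
have := nondecreasing_cvg_mu mF _ nd; rewrite UF => /(_ R m1 (measurable_box a b)) cv.
have -> : (\int[leb]_(x in box a b) (pos (z x))%:E = m1 (box a b))%E by [].
rewrite -(cvg_lim _ cv)//; apply: lime_le; first by apply: cvgP cv.
by apply: nearW => k; rewrite /= FE; apply: pos_part_le => //; rewrite invr_gt0 ltr0n.
Qed.

End weak_zero.

Lemma integral_indicM (h : BV -> R) (A Q : set BV) :
  (\int[leb]_(x in A) (h x * \1_Q x)%:E = \int[leb]_(x in A `&` Q) (h x)%:E)%E.
Proof.
rewrite integral_mkcond [RHS]integral_mkcond; apply: eq_integral => x _.
rewrite /restrict /patch in_setI indicE.
by case: (x \in A) => //=; case: (x \in Q); rewrite ?mulr1 ?mulr0.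
Qed.

(** The positive and negative parts of z define two measures that agree on all boxes, hence on all
    Borel sets. Evaluated on the set where z > 0, the second one vanishes, so the positive part is
    null; the negative part is treated in the same way. *)
Lemma weak_zero (V : set 'rV[R]_n) (lo hi : 'rV[R]_n) (i : 'I_n) (z : BV -> R)
    (f : nat -> 'rV[R]_n -> R) : open V -> box lo hi `<=` V `&` H ->
  measurable_fun setT z -> (forall j, smooth_on (W := R) (V `&` H) (f j)) ->
  (\int[leb]_(x in box lo hi) ((z x) ^+ 2)%:E < +oo)%E ->
  (fun j => \int[leb]_(x in box lo hi) ((f j x) ^+ 2)%:E)%E @ \oo --> 0%E ->
  (fun j => \int[leb]_(x in box lo hi) ((partial i (f j) x - z x) ^+ 2)%:E)%E @ \oo --> 0%E ->
  (\int[leb]_(x in box lo hi) `|z x|%:E = 0)%E.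
Proof.
move=> oV QV mz sf zfin f0 fz; set Q := box lo hi in QV zfin f0 fz *.
have mQ : measurable (Q : set BV) by exact: measurable_box.
have mN : measurable_fun setT (fun x => - z x) by exact: measurable_funN.
have sN j : smooth_on (W := R) (V `&` H) (fun x => f j x * -1).
  by apply: smooth_on_mul => //; exact: (smooth_on_cst (W := R)).
have pN j x : Q x -> partial i (fun x => f j x * -1) x = - partial i (f j) x.
  move=> /QV Vx; have [_ Hx] := Vx.
  rewrite (partial_mul i oV (sf j) (fun k => Ck_cst openT k (-1 : R)) Vx).
  rewrite (@partialE _ _ setT (fun=> -1) (fun=> -1) x i openT I Hx _ (fun _ _ _ => erefl)).
    by rewrite derive_cst mulr0 addr0 mulrN1.
  exact: derivable_cst.
have f0N : (fun j => \int[leb]_(x in Q) ((f j x * -1) ^+ 2)%:E)%E @ \oo --> 0%E.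
  have -> : (fun j => \int[leb]_(x in Q) ((f j x * -1) ^+ 2)%:E)%E =
      (fun j => \int[leb]_(x in Q) ((f j x) ^+ 2)%:E)%E.
    by apply/funext => j; apply: eq_integral => x _; rewrite mulrN1 sqrrN.
  exact: f0.
have fzN : (fun j => \int[leb]_(x in Q) ((partial i (fun x => (f j x * -1)%R) x - - z x) ^+ 2)%:E)%E
    @ \oo --> 0%E.
  have -> : (fun j => \int[leb]_(x in Q) ((partial i (fun x => (f j x * -1)%R) x - - z x) ^+ 2)%:E)%E =
      (fun j => \int[leb]_(x in Q) ((partial i (f j) x - z x) ^+ 2)%:E)%E.
    apply/funext => j; apply: eq_integral => x /set_mem Qx.
    by rewrite (pN j x Qx) -opprD sqrrN.
  exact: fz.
have le1 := pos_part_box_le oV QV mz sf f0 fz.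
(* The reverse inequality, from the sequence - f_j and the limit - z. *)
have le2 := pos_part_box_le oV QV mN sN f0N fzN.
have mp (h : BV -> R) : measurable_fun setT h -> measurable_fun setT (fun x => Num.max (h x) 0).
  by move=> mh; apply: measurable_maxr => //; exact: measurable_cst.
have m1 : measurable_fun setT (fun x => Num.max (z x) 0 * \1_Q x).
  by apply: measurable_funM; [exact: mp|exact: measurable_indic].
have m2 : measurable_fun setT (fun x => Num.max (- z x) 0 * \1_Q x).
  by apply: measurable_funM; [exact: mp|exact: measurable_indic].
have p0 (h : BV -> R) x : 0 <= Num.max (h x) 0 * \1_Q x.
  by rewrite mulr_ge0// le_max lexx orbT.
pose mu1 : {measure set BV -> \bar R} := dens leb m1 (p0 z).
pose mu2 : {measure set BV -> \bar R} := dens leb m2 (p0 (fun x => - z x)).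
have E1 A : mu1 A = (\int[leb]_(x in A `&` Q) (Num.max (z x) 0)%:E)%E.
  by rewrite -integral_indicM.
have E2 A : mu2 A = (\int[leb]_(x in A `&` Q) (Num.max (- z x) 0)%:E)%E.
  by rewrite -integral_indicM.
have fin1 : (\int[leb]_(x in Q) (Num.max (z x) 0)%:E < +oo)%E.
  have mz2 : measurable_fun (Q : set BV) (fun x => ((z x) ^+ 2)%:E).
    by apply: measurable_funTS; apply/measurable_EFinP; exact: measurable_funX.
  have z20 x : Q x -> (0 <= ((z x) ^+ 2)%:E)%E by rewrite lee_fin sqr_ge0.
  have c1 (x : BV) : Q x -> (0 <= cst 1%:E x :> \bar R)%E by move=> _; rewrite lee_fin.
  apply: (@le_lt_trans _ _ (\int[leb]_(x in Q) (cst 1%:E x + ((z x) ^+ 2)%:E))%E).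
    apply: integral_mono => x _; first by rewrite lee_fin le_max lexx orbT.
    rewrite -EFinD lee_fin; have := sqr_ge0 (z x - 1); have := sqr_ge0 (z x).
    by case: (leP (z x) 0) => h; nra.
  rewrite ge0_integralD// lte_add_pinfty//.
  rewrite (_ : \int[leb]_(x in Q) cst 1%:E x = 1%:E * leb Q)%E; last exact: integral_cst.
  by rewrite mul1e leb_box_fin.
have eqm A : measurable A -> mu1 A = mu2 A.
  apply: measure_eq_box => a b.
    rewrite E1 E2; rewrite /Q boxI; apply/eqP; rewrite eq_le; apply/andP; split.
      by apply: le1; rewrite -boxI => x [].
    have := le2 (\row_i Num.max (a 0 i) (lo 0 i)) (\row_i Num.min (b 0 i) (hi 0 i)).
    rewrite -!boxI; under [X in (_ -> _ <= X)%E -> _]eq_integral do rewrite opprK.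
    by apply => x [].
  rewrite E1; apply: le_lt_trans fin1; apply: integral_subset; first by move=> x [].
  by move=> x _; rewrite lee_fin le_max lexx orbT.
have mA (h : BV -> R) : measurable_fun setT h -> measurable [set x | 0 < h x].
  move=> mh; rewrite (_ : mkset _ = setT `&` h @^-1` `]0, +oo[%classic).
    by apply: mh => //; exact: measurable_itv.
  by rewrite setTI; apply/seteqP; split => x /=; rewrite in_itv /= andbT.
have restr (h k : BV -> R) : (forall x, h x <= 0 -> k x = 0) -> 
    (\int[leb]_(x in [set x | (0 < h x)%R] `&` Q) (k x)%:E = \int[leb]_(x in Q) (k x)%:E)%E.
  move=> hk; rewrite integral_mkcond [RHS]integral_mkcond; apply: eq_integral => x _.
  rewrite /restrict /patch in_setI; case: (x \in Q); rewrite ?andbF// andbT.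
  by case: ifPn => // /negP nh; rewrite hk// leNgt; apply/negP => h0; apply: nh; rewrite inE.
have I1 : (\int[leb]_(x in Q) (Num.max (z x) 0)%:E = 0)%E.
  rewrite -(@restr z); last by move=> x h; apply/max_idPr.
  rewrite -E1 eqm ?E2; last exact: mA.
  apply: integral0_eq => x [/= zx _]; congr (_%:E); apply/max_idPr.
  by rewrite oppr_le0 ltW.
have I2 : (\int[leb]_(x in Q) (Num.max (- z x) 0)%:E = 0)%E.
  rewrite -(@restr (fun x => - z x)); last by move=> x h; apply/max_idPr.
  rewrite -E2 -eqm ?E1; last exact: mA.
  apply: integral0_eq => x [/= zx _]; congr (_%:E); apply/max_idPr.
  by rewrite -oppr_ge0 ltW.
have mq (h : BV -> R) : measurable_fun setT h -> measurable_fun (Q : set BV) (fun x => (Num.max (h x) 0)%:E).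
  by move=> mh; apply: measurable_funTS; apply/measurable_EFinP; exact: mp.
have pq (h : BV -> R) x : Q x -> (0 <= (Num.max (h x) 0)%:E)%E.
  by rewrite lee_fin le_max lexx orbT.
rewrite (eq_integral (fun x : BV => (Num.max (z x) 0)%:E + (Num.max (- z x) 0)%:E)%E); last first.
  move=> x _; rewrite -EFinD; congr (_%:E); case: (leP 0 (z x)) => h.
    by rewrite ger0_norm// (max_idPr _) ?oppr_le0// addr0.
  by rewrite ltr0_norm// (max_idPl _) ?oppr_ge0 ?ltW// add0r.
rewrite ge0_integralD//; [by rewrite I1 I2 adde0|exact: pq|exact: mq|exact: pq|exact: mq].
Qed.

End WeakDerivative.

(** * Independence of the gradient from the approximation, and the upper bound on lambda_1 *)

Section GradientUniqueness.
Context (R : realType) (n : nat) (M : ptopologicalType).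
Hypothesis M_compact : compact [set: M].
Variables (S : atlas R n M) (g : metric S).
Local Notation H := (@half_space R n).
Local Notation BV := (borel 'rV[R]_n).
Local Notation BM := (borel M).
Local Notation vol := (volume g).

Lemma integral_sq0 d (T : measurableType d) (m : {measure set T -> \bar R}) (D : set T) (z : T -> R) :
  measurable D -> measurable_fun D z -> (\int[m]_(x in D) `|z x|%:E = 0)%E ->
  (\int[m]_(x in D) ((z x) ^+ 2)%:E = 0)%E.
Proof.
move=> mD mz z0; have mzE : measurable_fun D (EFin \o z) by exact/measurable_EFinP.
have /(ae_eq_integral_abs m mD mzE) z0' : (\int[m]_(x in D) `|(EFin \o z) x| = 0)%E by [].
have m2 : measurable_fun D (fun x => ((z x) ^+ 2)%:E).
  by apply/measurable_EFinP; exact: measurable_funX.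
have : (\int[m]_(x in D) `|((z x) ^+ 2)%:E| = 0)%E.
  apply/(ae_eq_integral_abs m mD m2); apply: filterS z0' => x h Dx.
  by have /= [->] := h Dx; rewrite expr0n.
by move=> <-; apply: eq_integral => x _; rewrite /= ger0_norm ?sqr_ge0.
Qed.

Section box.
Variables (c : chart R n M) (p : M) (r L : R).
Hypotheses (Sc : charts S c) (r0 : 0 < r) (L0 : 0 < L).
Hypothesis bI : cbox (fwd c p) r `<=` fwd c @` dom c.
Hypothesis bw : forall x, cbox (fwd c p) r x -> L^-1 <= vdens g c (bwd c x) <= L.
Hypothesis bg : forall x, cbox (fwd c p) r x ->
  forall v, quad (g c (bwd c x)) v <= L * (v *m v^T) 0 0.
Hypothesis bi : forall x, cbox (fwd c p) r x ->
  forall v, quad (invmx (g c (bwd c x))) v <= L * (v *m v^T) 0 0.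
Local Notation Q := (cbox (fwd c p) r).
Local Notation A := (nbox c p r).

(** The i-th component of the covector dual to Y for g. For a gradient it is the i-th partial
    derivative, to which [weak_zero] applies; multiplying by g removes the variable coefficients of
    the gradient. *)
Definition covec (Y : vfield R n M) (i : 'I_n) (q : BM) : R :=
  patch (fun=> 0) (dom c) (fun q => (Y c q *m g c q) 0 i) q.

Lemma measurable_covec Y i : measurable_vfield S Y -> measurable_fun setT (covec Y i).
Proof.
move=> [mY _]; apply: (proj1 (measurable_restrictT _ (measurable_dom c))).
apply: (@eq_measurable_fun _ _ BM R (dom c) (fun q => \sum_k Y c q 0 k * g c q k i)).
  by move=> q _; rewrite mxE.
apply: measurable_sum => k; apply: measurable_funM; first exact: mY.
apply: (@eq_measurable_fun _ _ BM R (dom c) (fun q => g c (bwd c (fwd c q)) k i)).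
  by move=> q /set_mem cq; rewrite fwdK.
apply: within_continuous_borelR; first exact: measurable_dom.
apply: (within_chart (f := fun x => g c (bwd c x) k i)).
by apply: smooth_on_within; have /smooth_on_mxP := gmat_smooth g Sc; exact.
Qed.

Lemma covecE Y i q : dom c q -> covec Y i q = (Y c q *m g c q) 0 i.
Proof. by move=> cq; rewrite /covec /patch mem_set. Qed.

Lemma sum_covec Y q : dom c q -> \sum_i covec Y i q ^+ 2 =
  ((Y c q *m g c q) *m (Y c q *m g c q)^T) 0 0.
Proof.
move=> cq; rewrite [RHS]mxE; apply: eq_bigr => i _; rewrite covecE//.
by set v := _ *m _; rewrite [v^T _ _]mxE expr2.
Qed.

Lemma quad_covec Y q : dom c q -> quad (invmx (g c q)) (Y c q *m g c q) = quad (g c q) (Y c q).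
Proof.
by move=> cq; rewrite -quad_invmx ?mulmxK ?gmat_unit ?gmat_sym.
Qed.

Lemma covec_le Y x : measurable_vfield S Y -> Q x ->
  \sum_i covec Y i (tbwd c x) ^+ 2 <= L * sqnorm g Y (tbwd c x).
Proof.
move=> [_ cY] Qx; rewrite tbwdE; last exact: bI.
have [cx fx] := bwd_img (bI Qx); set q := bwd c x in cx fx *.
rewrite sum_covec// (sqnorm_chart g (c := c)) -?quad_covec//; last first.
  by move=> c1 c2 S1 S2 c1q c2q; exact: cY.
have E1 (v : 'rV[R]_n) : quad 1%:M v = (v *m v^T) 0 0 by rewrite /quad mulmx1.
rewrite -E1 -[X in quad X _ <= _]invmx1; apply: quad_invmx_le => //.
- by rewrite trmx1.
- exact: gmat_sym.
- by move=> v v0; rewrite E1 lt_neqAle eq_sym dot_eq0 v0 dot_ge0.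
- exact: gmat_pos.
- by move=> v; rewrite E1; exact: bg.
Qed.

Lemma sqnorm_le_covec Y x : measurable_vfield S Y -> Q x ->
  sqnorm g Y (tbwd c x) <= L * \sum_i covec Y i (tbwd c x) ^+ 2.
Proof.
move=> [_ cY] Qx; rewrite tbwdE; last exact: bI.
have [cx fx] := bwd_img (bI Qx); set q := bwd c x in cx fx *.
rewrite sum_covec// (sqnorm_chart g (c := c)) -?quad_covec//; last first.
  by move=> c1 c2 S1 S2 c1q c2q; exact: cY.
exact: bi.
Qed.

Lemma covec_gradient u i x : smooth_fun S u -> Q x ->
  covec (gradient g u) i (tbwd c x) = partial i (u \o bwd c) x.
Proof.
move=> su Qx; rewrite tbwdE; last exact: bI.
have [cx fx] := bwd_img (bI Qx); rewrite covecE// gradientE mulmxKV ?gmat_unit//.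
by rewrite mxE fx.
Qed.

Lemma covec_sub X Y i q : covec (fun c q => X c q - Y c q) i q = covec X i q - covec Y i q.
Proof.
by rewrite /covec /patch; case: ifP => _; rewrite ?subr0// mulmxBl !mxE.
Qed.

Lemma integral_hyperplane (f : BV -> \bar R) (i : 'I_n) : measurable_fun setT f ->
  (forall x, 0 <= f x)%E ->
  (\int[leb n]_(x in prodI (fun k => if k == i then [set 0%R] else cside (fwd c p) r k)) f x = 0)%E.
Proof.
move=> mf f0; apply/eqP; rewrite eq_le integral_ge0 ?andbT//.
set J := fun k => _.
apply: (@le_trans _ _ (\int[leb n]_(x in prodI J) (cst 0%E x))%E); last by rewrite integral0.
apply: (@slice_le _ _ J _ _ i) => //.
  by move=> k; rewrite /J; case: ifP => _; [exact: measurable_set1|exact: measurable_cside].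
by move=> x _; rewrite /J eqxx integral_set1 integral0.
Qed.

Lemma covec_zero (Z : vfield R n M) (phi : nat -> M -> R) i : measurable_vfield S Z ->
  (\int[vol]_q (sqnorm g Z q)%:E < +oo)%E -> (forall j, smooth_fun S (phi j)) ->
  (fun j => \int[vol]_q ((phi j q) ^+ 2)%:E)%E @ \oo --> 0%E ->
  (fun j => \int[vol]_q (sqnorm g (fun c q => gradient g (phi j) c q - Z c q) q)%:E)%E @ \oo --> 0%E ->
  (\int[leb n]_(x in Q) ((covec Z i (tbwd c x)) ^+ 2)%:E = 0)%E.
Proof.
move=> mZ Zfin sphi phi0 phiZ.
have mQ := measurable_cbox (fwd c p) r0.
have L0' := ltW L0.
pose z (x : BV) := covec Z i (tbwd c x).
have mz : measurable_fun setT z.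
  by apply: measurableT_comp; [exact: measurable_covec|exact: measurable_tbwd].
apply: integral_sq0 => //; first exact: measurable_funTS.
pose x0 := fwd c p.
(* The open box inside the cut cube. They can differ only on the face where the first coordinate is
   0, a null set. *)
pose lo : 'rV[R]_n := \row_k (if (k == 0%N :> nat) then Num.max 0 (x0 0 k - r) else x0 0 k - r).
pose hi : 'rV[R]_n := \row_k (x0 0 k + r).
have QoQ : box lo hi `<=` Q.
  move=> x h; split => k.
    by move=> k0; have := h k; rewrite !mxE k0 eqxx => /andP[+ _]; rewrite gt_max => /andP[/ltW].
  have := h k; rewrite !mxE => /andP[h1 h2]; rewrite ltr_distl h2 andbT.
  by move: h1; case: ifP => // _; rewrite gt_max => /andP[].
have [V oV EV] := chart_img_all c.
have QV : box lo hi `<=` V `&` H by move=> x /QoQ/bI; rewrite EV.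
have int_le (f : BM -> \bar R) : measurable_fun setT f -> (forall q, 0 <= f q)%E ->
    (\int[leb n]_(x in box lo hi) f (tbwd c x) <= L%:E * \int[vol]_q f q)%E.
  move=> mf f0; apply: (@le_trans _ _ (\int[leb n]_(x in Q) f (tbwd c x))%E).
    exact: integral_subset.
  apply: le_trans (box_integral_le M_compact Sc r0 L0 bI bw mf f0).2 _.
  by apply: lee_wpmul2l; rewrite ?lee_fin//; exact: integral_subset.
have cov1 Y : measurable_vfield S Y -> forall x, Q x ->
    (((covec Y i (tbwd c x)) ^+ 2)%:E <= (L * sqnorm g Y (tbwd c x))%:E)%E.
  move=> mY x Qx; rewrite lee_fin; apply: le_trans (covec_le mY Qx).
  by rewrite (bigD1 i)//= lerDl sumr_ge0// => k _; rewrite sqr_ge0.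
have covI Y : measurable_vfield S Y ->
    (\int[leb n]_(x in box lo hi) ((covec Y i (tbwd c x)) ^+ 2)%:E <=
     (L * L)%:E * \int[vol]_q (sqnorm g Y q)%:E)%E.
  move=> mY; have mS : measurable_fun setT (fun q : BM => (sqnorm g Y q)%:E).
    by apply/measurable_EFinP; exact: measurable_sqnorm.
  have S0 (q : BM) : (0 <= (sqnorm g Y q)%:E)%E by rewrite lee_fin sqnorm_ge0.
  rewrite EFinM -muleA; apply: le_trans (lee_wpmul2l _ (int_le _ mS S0)); last by rewrite lee_fin.
  have mSt : measurable_fun (box lo hi : set BV) (fun x => (sqnorm g Y (tbwd c x))%:E).
    apply: measurable_funTS.
    exact: (measurableT_comp (f := fun q : BM => (sqnorm g Y q)%:E) mS (measurable_tbwd c)).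
  rewrite -ge0_integralZl_EFin//; last exact: measurable_box.
  apply: integral_mono => x Qx; first by rewrite lee_fin sqr_ge0.
  by rewrite -EFinM; apply: cov1 => //; exact: QoQ.
have zero : (\int[leb n]_(x in box lo hi) `|z x|%:E = 0)%E.
  apply: (weak_zero (f := fun j => phi j \o bwd c) (i := i) oV QV mz).
  - by move=> j; rewrite -EV; exact: sphi.
  - by apply: le_lt_trans (covI _ mZ) _; rewrite lte_mul_pinfty ?lee_fin ?mulr_ge0.
  - apply: cvge0_le (cvge0_comb L 0 phi0 phi0) => j; apply/andP; split.
      by apply: integral_ge0 => x _; rewrite lee_fin sqr_ge0.
    rewrite mul0e adde0.
    have mp : measurable_fun setT (fun q : BM => ((phi j q) ^+ 2)%:E).
      by apply/measurable_EFinP; apply: measurable_funX; exact: measurable_smooth (sphi j).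
    have := int_le _ mp (fun q => _); rewrite (eq_integral (fun x : BV => ((phi j \o bwd c) x ^+ 2)%:E)).
      by apply => q; rewrite lee_fin sqr_ge0.
    by move=> x /set_mem Qx; rewrite tbwdE//; apply: bI; exact: QoQ.
  - apply: cvge0_le (cvge0_comb (L * L) 0 phiZ phiZ) => j; apply/andP; split.
      by apply: integral_ge0 => x _; rewrite lee_fin sqr_ge0.
    rewrite mul0e adde0.
    have mD : measurable_vfield S (fun c q => gradient g (phi j) c q - Z c q).
      have := measurable_vfield_comb 1 (-1) (measurable_gradient g (sphi j)) mZ.
      congr (measurable_vfield S _); apply/funext => c'; apply/funext => q.
      by rewrite scale1r scaleN1r.
    have := covI _ mD; congr (_ <= _)%E; apply: eq_integral => x /set_mem /QoQ Qx.
    by rewrite covec_sub covec_gradient.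
have mza : measurable_fun setT (fun x => `|z x|%:E).
  by apply/measurable_EFinP; exact: measurableT_comp.
have za0 x : (0 <= `|z x|%:E)%E by rewrite lee_fin.
apply/eqP; rewrite eq_le integral_ge0 ?andbT//.
(* In dimension 0 there is no first coordinate and the open box is the whole space. *)
have [n0|n0] := posnP n.
  rewrite -zero; apply: integral_subset => // x _ k.
  by exfalso; case: k => k; rewrite [X in (_ < X)%N]n0.
pose i0 : 'I_n := Ordinal n0.
pose N := prodI (fun k => if k == i0 then [set 0%R] else cside x0 r k).
have mN : measurable N.
  apply: measurable_prodI => k; case: ifP => _; [exact: measurable_set1|exact: measurable_cside].
apply: (@le_trans _ _ (\int[leb n]_(x in box lo hi `|` N) `|z x|%:E)%E).
  apply: integral_subset => // x; rewrite cbox_prodI => Qx.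
  have [e|e] := eqVneq (x 0 i0) 0.
    by right => k; case: eqVneq => [->//|_]; exact: Qx.
  left => k; have [/= + kH] := Qx k; rewrite in_itv /= !mxE => /andP[h1 h2].
  rewrite h2 andbT; case: eqP => // k0; rewrite gt_max h1 andbT lt_neqAle kH// andbT eq_sym.
  by rewrite (_ : k = i0)//; apply/val_inj.
apply: (@le_trans _ _ (\int[leb n]_(x in box lo hi) `|z x|%:E + \int[leb n]_(x in N) `|z x|%:E)%E).
  exact: (integral_setU_le _ (measurable_box lo hi) mN mza za0).
by rewrite zero add0e (integral_hyperplane i0 mza za0).
Qed.

Lemma null_gradient_box (Z : vfield R n M) (phi : nat -> M -> R) : measurable_vfield S Z ->
  (\int[vol]_q (sqnorm g Z q)%:E < +oo)%E -> (forall j, smooth_fun S (phi j)) ->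
  (fun j => \int[vol]_q ((phi j q) ^+ 2)%:E)%E @ \oo --> 0%E ->
  (fun j => \int[vol]_q (sqnorm g (fun c q => gradient g (phi j) c q - Z c q) q)%:E)%E @ \oo --> 0%E ->
  (\int[vol]_(q in A) (sqnorm g Z q)%:E = 0)%E.
Proof.
move=> mZ Zfin sphi phi0 phiZ; apply/eqP; rewrite eq_le; apply/andP; split; last first.
  by apply: integral_ge0 => q _; rewrite lee_fin sqnorm_ge0.
have mS : measurable_fun setT (fun q : BM => (sqnorm g Z q)%:E).
  by apply/measurable_EFinP; exact: measurable_sqnorm.
have S0 (q : BM) : (0 <= (sqnorm g Z q)%:E)%E by rewrite lee_fin sqnorm_ge0.
apply: le_trans (box_integral_le M_compact Sc r0 L0 bI bw mS S0).1 _.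
have mQ := measurable_cbox (fwd c p) r0.
have mc i : measurable_fun (Q : set BV) (fun x => ((covec Z i (tbwd c x)) ^+ 2)%:E).
  apply: measurable_funTS; apply/measurable_EFinP; apply: measurable_funX.
  by apply: measurableT_comp; [exact: measurable_covec|exact: measurable_tbwd].
have c0 i x : Q x -> (0 <= ((covec Z i (tbwd c x)) ^+ 2)%:E)%E by rewrite lee_fin sqr_ge0.
have E : (\int[leb n]_(x in Q) \sum_i ((covec Z i (tbwd c x)) ^+ 2)%:E = 0)%E.
  rewrite ge0_integral_sum//; apply: big1 => i _.
  exact: (covec_zero i mZ Zfin sphi phi0 phiZ).
have L0' := ltW L0.
have h : (\int[leb n]_(x in Q) (sqnorm g Z (tbwd c x))%:E <= L%:E *
    \int[leb n]_(x in Q) \sum_i ((covec Z i (tbwd c x)) ^+ 2)%:E)%E.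
  have ms : measurable_fun (Q : set BV) (fun x => \sum_i ((covec Z i (tbwd c x)) ^+ 2)%:E)%E.
    exact: emeasurable_sum.
  have s0 x : Q x -> (0 <= \sum_i ((covec Z i (tbwd c x)) ^+ 2)%:E)%E.
    by move=> Qx; apply: sume_ge0 => i _; exact: c0.
  rewrite -ge0_integralZl_EFin//; apply: integral_mono => x Qx; first exact: S0.
  by rewrite sumEFin -EFinM lee_fin; exact: sqnorm_le_covec.
by apply: le_trans (lee_wpmul2l _ h) _; rewrite ?lee_fin// E !mule0.
Qed.

End box.

(** Closability of the gradient: local vanishing in boxes, then a finite cover of M. *)
Lemma null_gradient (Z : vfield R n M) (phi : nat -> M -> R) : measurable_vfield S Z ->
  (\int[vol]_q (sqnorm g Z q)%:E < +oo)%E -> (forall j, smooth_fun S (phi j)) ->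
  (fun j => \int[vol]_q ((phi j q) ^+ 2)%:E)%E @ \oo --> 0%E ->
  (fun j => \int[vol]_q (sqnorm g (fun c q => gradient g (phi j) c q - Z c q) q)%:E)%E @ \oo --> 0%E ->
  (\int[vol]_q (sqnorm g Z q)%:E = 0)%E.
Proof.
move=> mZ Zfin sphi phi0 phiZ.
have loc p : exists A : set M, [/\ open A, A p & (\int[vol]_(q in A) (sqnorm g Z q)%:E = 0)%E].
  have [c [r [L [Sc cp r0 L0 h]]]] := chart_box g openT (Logic.I : setT p).
  have bI : cbox (fwd c p) r `<=` fwd c @` dom c by move=> x /h[[q [cq _] <-] _ _ _]; exists q.
  exists (nbox c p r); split; [exact: nbox_open|exact: nbox_center|].
  by apply: (null_gradient_box Sc r0 L0 bI _ _ _ mZ Zfin sphi phi0 phiZ) => x /h[].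
have /choice[A hA] := loc.
have oA p : open (A p) by have [] := hA p.
have Ap p : A p p by have [] := hA p.
have [s hs] := finite_cover M_compact oA Ap.
have mA p : measurable (A p : set BM) by apply: borel_open.
have mS : measurable_fun setT (fun q : BM => (sqnorm g Z q)%:E).
  by apply/measurable_EFinP; exact: measurable_sqnorm.
have S0 (q : BM) : (0 <= (sqnorm g Z q)%:E)%E by rewrite lee_fin sqnorm_ge0.
pose U (s : seq M) : set BM := foldr (fun q B => A q `|` B) set0 s.
have UT : [set: BM] `<=` U s.
  move=> q _; have [p ps Apq] := hs q.
  by elim: (s) ps => // a s' IH; rewrite inE => /orP[/eqP <-|/IH ?]; [left|right].
apply/eqP; rewrite eq_le integral_ge0 ?andbT//.
apply: (@le_trans _ _ (\int[vol]_(q in U s) (sqnorm g Z q)%:E)%E); first exact: integral_subset.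
have [_] : measurable (U s) /\ (\int[vol]_(q in U s) (sqnorm g Z q)%:E <= 0)%E; last by [].
elim: (s) => [|p s' [mU IH]]; first by split; [exact: measurable0|rewrite /U /= integral_set0].
change (U (p :: s')) with (A p `|` U s'); split; first exact: measurableU.
apply: le_trans (integral_setU_le _ (mA p) mU mS S0) _.
by have [_ _ ->] := hA p; rewrite add0e.
Qed.

(** The difference Y - X is the limit of gradients of functions tending to v - u, which is 0 almost
    everywhere, so it is null. The triangle inequality for squares gives the factor 2, harmless in
    [lambda1_le]. *)
Lemma gradient_ae_le u v X Y : H1_gradient g u X -> H1_gradient g v Y ->
  {ae vol, forall p, u p = v p} ->
  (\int[vol]_q (sqnorm g X q)%:E <= 2%:E * \int[vol]_q (sqnorm g Y q)%:E)%E.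
Proof.
move=> HX HY uv; have [mu mX _] := HX; have [mv mY _] := HY.
have HW := H1_gradient_comb M_compact 1 (-1) HY HX.
have [_ Wfin] := H1_fin M_compact HW.
have [mw mW [phi [sphi phi0 phiW]]] := HW.
have W0 : (\int[vol]_q (sqnorm g (fun c q => 1 *: Y c q + -1 *: X c q) q)%:E = 0)%E.
  apply: (null_gradient mW Wfin sphi) => //.
  rewrite (_ : (fun j => _) = (fun j => \int[vol]_p ((phi j p - (1 * v p + -1 * u p)) ^+ 2)%:E)%E)//.
  apply/funext => j; have mp := measurable_smooth (sphi j).
  apply: ge0_ae_eq_integral => //.
  - by apply/measurable_EFinP; exact: measurable_funX.
  - by apply/measurable_EFinP; apply: measurable_funX; exact: measurable_funB.
  - by move=> q _; rewrite lee_fin sqr_ge0.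
  - by move=> q _; rewrite lee_fin sqr_ge0.
  by apply: (@filterS _ _ (ae_filter_ringOfSetsType vol) _ _ _ uv) => q e _; rewrite /= e mul1r mulN1r subrr subr0.
have mSX : measurable_fun setT (fun q : BM => (sqnorm g X q)%:E).
  by apply/measurable_EFinP; exact: measurable_sqnorm.
have mSY : measurable_fun [set: BM] (fun q : BM => (sqnorm g Y q)%:E).
  by apply/measurable_EFinP; exact: measurable_sqnorm.
have mSW : measurable_fun [set: BM] (fun q : BM => (sqnorm g (fun c q => 1 *: Y c q + -1 *: X c q) q)%:E).
  by apply/measurable_EFinP; exact: measurable_sqnorm.
have n1 Z (q : BM) : [set: BM] q -> (0 <= (sqnorm g Z q)%:E)%E by rewrite lee_fin sqnorm_ge0.
apply: (@le_trans _ _ (\int[vol]_q (2%:E * (sqnorm g Y q)%:E +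
    2%:E * (sqnorm g (fun c q => 1 *: Y c q + -1 *: X c q) q)%:E))%E).
  apply: integral_mono => q _; first exact: n1.
  rewrite -!EFinM -EFinD lee_fin.
  have := sqnorm_sub_le g X Y q; congr (_ <= _ + 2 * _); congr (sqnorm g _ q).
  by apply/funext => c; apply/funext => q'; rewrite scale1r scaleN1r.
rewrite (ge0_integral_lin2 vol measurableT (ler0n _ 2) (ler0n _ 2) mSY mSW (n1 _) (n1 _)).
by rewrite W0 mule0 adde0.
Qed.

Lemma sqnorm_gradient_cst (a : R) p : sqnorm g (gradient g (fun=> a)) p = 0.
Proof.
have [Sc cp] := chart_atP S p; rewrite (sqnorm_gradient g (@smooth_fun_cst R n M S a) Sc cp).
have -> : dform (fun=> a) (chart_at S p) p = 0.
  apply/rowP => i; rewrite !mxE /partial.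
  under eq_fun do rewrite /= subrr mulr0.
  by rewrite lim_cst.
by rewrite /quad mul0mx mul0mx mxE.
Qed.

(** The test plane is spanned by 1 and h. A combination a0 + a1 h equals a0 on P0 and a0 + a1 on P1,
    and these cannot both be small compared with a1; the energy sees only a1. *)
Lemma lambda1_le (h : M -> R) (P0 P1 : set BM) (v e : R) : smooth_fun S h ->
  measurable P0 -> measurable P1 -> (forall q, P0 q -> h q = 0) -> (forall q, P1 q -> h q = 1) ->
  0 < v -> (v%:E <= vol P0)%E -> (v%:E <= vol P1)%E -> 0 <= e ->
  (energy g h <= e%:E)%E -> (lambda_k g 1 <= (16 * e / v)%:E)%E.
Proof.
move=> sh mP0 mP1 h0 h1 v0 vP0 vP1 e0 he.
pose b (i : 'I_2) : M -> R := if i == ord0 then fun=> 1 else h.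
have sb i : smooth_fun S (b i) by rewrite /b; case: ifP => _ //; exact: smooth_fun_cst.
have bE (a : 'I_2 -> R) p : \sum_i a i * b i p = a ord0 * 1 + a ord_max * h p.
  by rewrite big_ord_recl big_ord1 /b /=; congr (_ + a _ * _); apply/val_inj.
(* A property valid almost everywhere holds at some point of each set of positive volume; used on P0
   and P1 for the independence of 1 and h. *)
have pos_nonnull (P : set BM) (F : BM -> Prop) : measurable P -> (v%:E <= vol P)%E ->
    {ae vol, forall q, F q} -> exists2 q, P q & F q.
  move=> mP vP [N [mN N0 FN]]; apply: contrapT => no.
  have PN : P `<=` N.
    by move=> q Pq; apply: FN => Fq; apply: no; exists q.
  have : (vol P <= vol N)%E by apply: le_measure; rewrite ?inE.
  rewrite N0 => vP0'; have := le_trans vP vP0'; rewrite lee_fin leNgt v0.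
  by [].
pose E : set (M -> R) := [set u | H1 g u /\ exists a : 'I_2 -> R,
  {ae vol, forall p, u p = \sum_i a i * b i p}].
apply: ge_ereal_inf; exists (ereal_sup (rayleigh_values g (fun=> 1) (fun=> 1) E)).
  exists E => //; exists b; split => //.
    by move=> i; exists (gradient g (b i)); exact: H1_gradient_smooth.
  move=> a ae0.
  have [q0 Pq0] := pos_nonnull P0 _ mP0 vP0 ae0.
  have [q1 Pq1] := pos_nonnull P1 _ mP1 vP1 ae0.
  rewrite !bE (h0 _ Pq0) (h1 _ Pq1) !mulr1 mulr0 addr0 => e1 e2 i.
  rewrite e2 add0r in e1.
  by case: (unliftP ord0 i) => [k|] ->; rewrite // (ord1 k) (_ : lift _ _ = ord_max)//; apply/val_inj.
apply: ge_ereal_sup => _ [u [X [[Hu [a ua]] nz HX ->]]].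
rewrite lee_fin; set num := \int[vol]_p _; set den := \int[vol]_p _.
pose w p := a ord0 * 1 + a ord_max * h p.
have sw : smooth_fun S w.
  by apply: smooth_fun_add; apply: smooth_fun_scale => //; exact: smooth_fun_cst.
have uw : {ae vol, forall p, u p = w p} by apply: (@filterS _ _ (ae_filter_ringOfSetsType vol) _ _ _ ua) => p ->; exact: bE.
have [u2 X2] := H1_fin M_compact HX; have [mu mX _] := HX.
have numE : (num%:E = \int[vol]_p (sqnorm g X p)%:E)%E.
  rewrite /num /Rintegral; under eq_integral do rewrite mulr1.
  by rewrite fineK// ge0_fin_numE// integral_ge0// => p _; rewrite lee_fin sqnorm_ge0.
have denE : (den%:E = \int[vol]_p ((u p) ^+ 2)%:E)%E.
  rewrite /den /Rintegral; under eq_integral do rewrite mulr1.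
  by rewrite fineK// ge0_fin_numE// integral_ge0// => p _; rewrite lee_fin sqr_ge0.
set a1 := a ord_max; set a0 := a ord0.
have en : (\int[vol]_q (sqnorm g (gradient g w) q)%:E <= (2 * a1 ^+ 2)%:E * energy g h)%E.
  have me : measurable_fun [set: BM] (fun q => (sqnorm g (gradient g h) q)%:E).
    by apply/measurable_EFinP; exact: measurable_egrad.
  have e0' (q : BM) : [set: BM] q -> (0 <= (sqnorm g (gradient g h) q)%:E)%E.
    by rewrite lee_fin sqnorm_ge0.
  have a10 : 0 <= 2 * a1 ^+ 2 by rewrite mulr_ge0 ?sqr_ge0.
  rewrite /energy -ge0_integralZl_EFin//.
  apply: integral_mono => q _; first by rewrite lee_fin sqnorm_ge0.
  have [Sc cq] := chart_atP S q.
  rewrite -EFinM lee_fin /sqnorm (gradient_comb g a0 a1 (@smooth_fun_cst R n M S 1) sh Sc cq).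
  have := sqnorm_comb_le g (gradient g (fun=> 1)) (gradient g h) a0 a1 q.
  by rewrite sqnorm_gradient_cst mulr0 add0r.
have num_le : num <= 4 * a1 ^+ 2 * e.
  have Hw : H1_gradient g w (gradient g w) by exact: H1_gradient_smooth.
  rewrite -lee_fin numE; have hg := gradient_ae_le HX Hw uw.
  apply: le_trans hg _.
  apply: le_trans (lee_wpmul2l _ en) _; first by rewrite lee_fin.
  rewrite muleA -EFinM; apply: le_trans (lee_wpmul2l _ he) _.
    by rewrite lee_fin; do 2 (apply: mulr_ge0 => //); exact: sqr_ge0.
  by rewrite -EFinM lee_fin le_eqVlt; apply/orP; left; apply/eqP; ring.
(* From a1^2 <= 2 (a0 + a1)^2 + 2 a0^2, each square times v being at most the denominator. With the
   bound 4 a1^2 e on the numerator this gives 16 e / v. *)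
have den_le : v * a1 ^+ 2 / 4 <= den.
  have h1' (P : set BM) k : measurable P -> (v%:E <= vol P)%E -> (forall q, P q -> w q = k) ->
      v * k ^+ 2 <= den.
    move=> mP vP wk; rewrite -lee_fin denE.
    apply: (@le_trans _ _ (\int[vol]_(q in P) ((w q) ^+ 2)%:E)%E).
      rewrite (eq_integral (cst (k ^+ 2)%:E)); last by move=> q /set_mem Pq; rewrite wk.
      by rewrite integral_cst// mulrC EFinM; apply: lee_wpmul2l; rewrite ?lee_fin ?sqr_ge0.
    apply: (@le_trans _ _ (\int[vol]_q ((w q) ^+ 2)%:E)%E).
      by apply: integral_subset => // q _; rewrite lee_fin sqr_ge0.
    rewrite le_eqVlt; apply/orP; left; apply/eqP; apply: ge0_ae_eq_integral => //.
    - by apply/measurable_EFinP; apply: measurable_funX; exact: measurable_smooth sw.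
    - by apply/measurable_EFinP; exact: measurable_funX.
    - by move=> q _; rewrite lee_fin sqr_ge0.
    - by move=> q _; rewrite lee_fin sqr_ge0.
    by apply: (@filterS _ _ (ae_filter_ringOfSetsType vol) _ _ _ uw) => q e' _; rewrite /= e'.
  have d0 := h1' P0 a0 mP0 vP0 (fun q Pq => ltac:(by rewrite /w h0// mulr0 addr0 mulr1)).
  have d1 := h1' P1 (a0 + a1) mP1 vP1 (fun q Pq => ltac:(by rewrite /w h1// !mulr1)).
  have : v * (a1 ^+ 2) <= v * (2 * (a0 + a1) ^+ 2 + 2 * a0 ^+ 2).
    by apply: ler_wpM2l; [exact: ltW|have := sqr_ge0 (2 * a0 + a1); nra].
  by rewrite mulrDr !(mulrCA v 2); lra.
(* Division by 0 gives 0, so the bound also holds in this degenerate case. *)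
have [->|dn0] := eqVneq den 0; first by rewrite invr0 mulr0 divr_ge0 ?mulr_ge0 ?(ltW v0).
have dpos : 0 < den.
  rewrite lt_neqAle eq_sym dn0 /= -lee_fin denE; apply: integral_ge0 => q _.
  by rewrite lee_fin sqr_ge0.
rewrite ler_pdivrMr// mulrAC ler_pdivlMr//.
have : 4 * a1 ^+ 2 * e * v <= 16 * e * den.
  have := ler_wpM2l e0 den_le; lra.
by have := ler_wpM2r (ltW v0) num_le; lra.
Qed.

End GradientUniqueness.

(** * The family of metrics *)

Section WeightedDint.
Context d (T : measurableType d) (R : realType) (m mu : {measure set T -> \bar R}).
Local Open Scope ereal_scope.
Hypotheses (m_fin : m setT < +oo) (mu_fin : mu setT < +oo).
Variable w : T -> R.
Hypotheses (mw : measurable_fun setT w) (w0 : forall x, (0 <= w x)%R).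
Hypothesis muE : forall f : T -> \bar R, measurable_fun setT f -> (forall x, 0 <= f x) ->
  \int[mu]_x f x = \int[m]_x (f x * (w x)%:E).

(** The product weight is split into a part carried by A x A, where a local Poincare inequality is
    used, and a uniform part of size l, left to the global one. *)
Lemma weighted_dint (A : set T) (k l : R) (u : T -> R) : measurable A ->
  (0 <= k)%R -> (0 <= l)%R -> measurable_fun setT u ->
  (forall x y, (w x * w y <= k * (\1_A x * \1_A y) + l)%R) ->
  dint mu setT setT u <= k%:E * dint m A A u + l%:E * dint m setT setT u.
Proof.
move=> mA k0 l0 mu_ hw.
pose D x y := ((u x - u y) ^+ 2)%:E.
have D0 x y : 0 <= D x y by rewrite lee_fin sqr_ge0.
have mD x : measurable_fun setT (D x).
  by apply/measurable_EFinP; apply: measurable_funX; exact: measurable_funB.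
have mI (mm : {measure set T -> \bar R}) B : mm setT < +oo -> measurable B ->
    measurable_fun setT (fun x => \int[mm]_(y in B) D x y).
  by move=> fin mB; exact: (measurable_dist_int (finite_sigma fin) mB mu_).
have I0 (mm : {measure set T -> \bar R}) B x : 0 <= \int[mm]_(y in B) D x y.
  by apply: integral_ge0.
have i1 x : (0 <= \1_A x :> R)%R by [].
rewrite /dint (muE (mI _ _ mu_fin measurableT) (I0 _ _)).
have mF : measurable_fun setT (fun x => (\1_A x)%:E * \int[m]_(y in A) D x y).
  by apply: emeasurable_funM; [apply/measurable_EFinP; exact: measurable_indic|exact: mI].
have F0 x : setT x -> 0 <= (\1_A x)%:E * \int[m]_(y in A) D x y.
  by move=> _; rewrite mule_ge0 ?lee_fin.
have mG : measurable_fun setT (fun x => \int[m]_y D x y) by exact: mI.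
have G0 x : setT x -> 0 <= \int[m]_y D x y by move=> _; exact: I0.
apply: (@le_trans _ _ (\int[m]_x (k%:E * ((\1_A x)%:E * \int[m]_(y in A) D x y) +
    l%:E * \int[m]_y D x y))); last first.
  rewrite (ge0_integral_lin2 m measurableT k0 l0 mF mG F0 G0); apply: leeD => //.
  apply: lee_wpmul2l; first by rewrite lee_fin.
  rewrite [leRHS]integral_mkcond; apply: integral_mono => x _; first exact: F0.
  rewrite /restrict /patch indicE; case: ifP => _; rewrite ?mul1e ?mul0e//.
apply: integral_mono => x _; first by rewrite mule_ge0 ?lee_fin ?I0.
have mDw : measurable_fun setT (fun y => D x y * (w y)%:E).
  by apply: emeasurable_funM => //; exact/measurable_EFinP.
have Dw0 y : setT y -> 0 <= D x y * (w y)%:E.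
  by move=> _; apply: mule_ge0; [exact: D0|rewrite lee_fin].
have wx := w0 x.
rewrite (muE (mD x) (D0 x)) muleC -ge0_integralZl_EFin//.
have mDA : measurable_fun setT (fun y => (\1_A y)%:E * D x y).
  by apply: emeasurable_funM => //; apply/measurable_EFinP; exact: measurable_indic.
have DA0 y : setT y -> 0 <= (\1_A y)%:E * D x y.
  by move=> _; apply: mule_ge0; [rewrite lee_fin|exact: D0].
have kx : (0 <= k * \1_A x)%R by rewrite mulr_ge0.
apply: (@le_trans _ _ (\int[m]_y ((k * \1_A x)%:E * ((\1_A y)%:E * D x y) + l%:E * D x y))).
  apply: integral_mono => y _.
    by apply: mule_ge0; [rewrite lee_fin|exact: Dw0].
  rewrite /D -!EFinM -EFinD lee_fin.
  have := ler_wpM2r (sqr_ge0 (u x - u y)) (hw x y).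
  set dd := ((u x - u y) ^+ 2)%R; set a := \1_A x; set b := \1_A y; lra.
rewrite (ge0_integral_lin2 m measurableT kx l0 mDA (mD x) DA0 (fun y _ => D0 x y)).
apply: leeD => //; rewrite EFinM -muleA; apply: lee_wpmul2l; first by rewrite lee_fin.
apply: lee_wpmul2l; first by rewrite lee_fin.
rewrite [leRHS]integral_mkcond; apply: integral_mono => y _; first exact: DA0.
by rewrite /restrict /patch indicE; case: ifP => _; rewrite ?mul1e ?mul0e.
Qed.

End WeightedDint.

Lemma mul_shift_le (R : realType) (x y e : R) : 0 <= x -> 0 <= y -> x <= 1 -> y <= 1 ->
  0 <= e -> e <= 1 -> (x + e) * (y + e) <= x * y + 3 * e.
Proof. by move=> *; nra. Qed.

(** * Lower bounds for the extremal eigenvalues of a metric compared with g *)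

Section Comparison.
Context (R : realType) (n : nat) (M : ptopologicalType).
Hypothesis M_compact : compact [set: M].
Variables (S : atlas R n M) (g G : metric S).
Local Notation BM := (borel M).
Variables (r : M -> R) (R1 C4 CP : R).
Hypotheses (cr : continuous r) (r_gt0 : forall p, 0 < r p) (r_le : forall p, r p <= R1).
Hypothesis rE : forall c p, charts S c -> dom c p ->
  Num.sqrt (\det (G c p)) = r p * Num.sqrt (\det (g c p)).
Hypotheses (C4_gt0 : 0 < C4) (CP_ge0 : 0 <= CP).
Hypothesis gG : forall c p, charts S c -> dom c p ->
  forall v, quad (G c p) v <= C4 * quad (g c p) v.
Hypothesis poin : forall u, smooth_fun S u ->
  (dint (volume g) setT setT u <= CP%:E * energy g u)%E.
Hypothesis volG : volume G [set: M] = 1%E.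

Let R1_ge0 : 0 <= R1. Proof. exact: le_trans (ltW (r_gt0 point)) (r_le point). Qed.
Let mr : measurable_fun [set: BM] (r : BM -> R). Proof. exact: continuous_borelR. Qed.
Let r_ge0 p : 0 <= r p. Proof. exact: ltW. Qed.
Let fing : (volume g [set: BM] < +oo)%E. Proof. exact: volume_fin. Qed.

Lemma integral_comparison (A : set BM) (f : BM -> \bar R) : measurable A ->
  measurable_fun setT f -> (forall p, 0 <= f p)%E ->
  (\int[volume G]_(p in A) f p = \int[volume g]_(p in A) (f p * (r p)%:E))%E.
Proof. exact: (volume_density M_compact mr r_ge0 rE). Qed.

Lemma egrad_comparison u p : smooth_fun S u ->
  sqnorm g (gradient g u) p <= C4 * sqnorm G (gradient G u) p.
Proof. by move=> su; apply: sqnorm_gradient_le => // c Sc cp; exact: gG. Qed.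

Lemma dens_comparison (rho : BM -> R) (mrho : measurable_fun setT rho)
    (rho0 : forall p, 0 <= rho p) (f : BM -> \bar R) : measurable_fun setT f ->
  (forall p, 0 <= f p)%E ->
  (\int[dens (volume G) mrho rho0]_p f p = \int[volume g]_p (f p * (rho p * r p)%:E))%E.
Proof.
move=> mf f0; rewrite ge0_integral_densT// integral_comparison//.
- by apply: eq_integral => p _; rewrite EFinM muleA.
- by apply: emeasurable_funM => //; exact/measurable_EFinP.
- by move=> p; rewrite mule_ge0 ?lee_fin.
Qed.

Let m1 : measurable_fun [set: BM] ((fun=> 1) : BM -> R). Proof. exact: measurable_cst. Qed.
Let one_ge0 (p : BM) : 0 <= (fun=> 1 : R) p. Proof. exact: ler01. Qed.

Lemma continuous_div (f : M -> R) (s : R) : continuous f -> (forall p, f p != 0) ->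
  continuous (fun p => s / f p).
Proof.
move=> cf f0 p; apply: cvgM; first exact: cvg_cst.
by apply: cvgV => //; exact: cf.
Qed.

(** With sigma = s / r the energy weighted by sigma v_G is s times the integral against v_g, where
    the Poincare inequality of g is available. No lower bound on r enters the constant, so the neck
    does no harm. *)
Lemma mu_star2_ge :
  (((2 * (R1 ^+ 2 * CP * C4 * fine (volume g [set: M]) + 1))^-1)%:E <= mu_star2 G 1)%E.
Proof.
set V0 := fine (volume g [set: M]); have fV : volume g [set: BM] = V0%:E by rewrite /V0 fineK// fin_meas.
have V0p : 0 < V0.
  by rewrite -lte_fin -fV; exact: (volume_open_gt0 M_compact g openT (Logic.I : setT (point : M))).
(* The value that makes sigma have mean 1 for the volume of G, which is 1. *)
pose s := V0^-1; have s0 : 0 < s by rewrite invr_gt0.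
pose sigma p := s / r p.
have sg0 p : 0 < sigma p by rewrite divr_gt0.
have csg : continuous sigma by apply: continuous_div => // p; rewrite gt_eqF.
have msg : measurable_fun [set: BM] (sigma : BM -> R) by exact: continuous_borelR.
have [B B0 hB] := continuous_bounded M_compact csg.
have sB p : sigma p <= Num.max 1 B.
  by apply: le_trans (ler_norm _) _; apply: le_trans (hB p) _; rewrite le_max lexx orbT.
have oB (p : BM) : (fun=> 1 : R) p <= Num.max 1 B by rewrite le_max lexx.
have sr p : sigma p * r p = s by rewrite divfK// gt_eqF.
have nsg : normalized_density G sigma.
  split => //; rewrite volG /= invr1 mul1r /Rintegral.
  rewrite integral_comparison//; last 2 first.
  - exact/measurable_EFinP.
  - by move=> p; rewrite lee_fin ltW.
  rewrite (eq_integral (cst s%:E)); last by move=> p _; rewrite -EFinM sr.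
  by rewrite integral_cst// fV -EFinM /= mulVf// gt_eqF.
apply: le_trans (ereal_sup_ubound _); last by exists sigma.
(* R1^2 bounds the two densities in the double integral, CP is the Poincare constant of g, C4
   compares the gradients and V0 undoes s; adding 1 makes K positive. *)
set K := R1 ^+ 2 * CP * C4 * V0 + 1.
have K0 : 0 < K.
  by rewrite /K ltr_wpDl// !mulr_ge0 ?sqr_ge0// ltW.
have := @mu1_ge R n M M_compact S G (fun=> 1) sigma (Num.max 1 B) m1 one_ge0 msg
  (fun p => ltW (sg0 p)) oB sB K K0 (fun=> ltr01).
have dT : dens (volume G) m1 one_ge0 setT = 1%E.
  have E : (\int[volume G]_(p in [set: BM]) (1 : R)%:E = 1%:E * volume G [set: BM])%E :=
    integral_cst (volume G) measurableT 1%:E.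
  by rewrite /dens E mul1e; exact: volG.
have dlt : (dens (volume G) m1 one_ge0 setT < +oo)%E by rewrite dT ltry.
rewrite dT mul1r; apply => phi sphi.
have mphi := measurable_smooth sphi.
have hw (x y : BM) : (1 * r x) * (1 * r y) <= R1 ^+ 2 * (\1_(setT : set BM) x * \1_(setT : set BM) y) + 0.
  by rewrite !indicT /= !mul1r !mulr1 addr0 expr2; apply: ler_pM.
have mone : measurable_fun [set: BM] (fun p => 1 * r p).
  by rewrite (_ : (fun p => _) = r)//; apply/funext => p; rewrite mul1r.
apply: le_trans (weighted_dint (m := volume g) fing _ mone _ (dens_comparison m1 one_ge0)
  measurableT (sqr_ge0 R1) (lexx 0) mphi hw) _.
- exact: dlt.
- by move=> p; rewrite mul1r.
rewrite mul0e adde0; apply: le_trans (lee_wpmul2l _ (poin sphi)) _.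
  by rewrite lee_fin sqr_ge0.
have meg : measurable_fun [set: BM] (fun p : BM => (sqnorm G (gradient G phi) p * sigma p)%:E).
  by apply/measurable_EFinP; apply: measurable_funM => //; exact: measurable_egrad.
have e0 (p : BM) : (0 <= (sqnorm G (gradient G phi) p * sigma p)%:E)%E.
  by rewrite lee_fin mulr_ge0 ?sqnorm_ge0// ltW.
rewrite integral_comparison//.
have meG : measurable_fun [set: BM] (fun p : BM => (sqnorm G (gradient G phi) p)%:E).
  by apply/measurable_EFinP; exact: measurable_egrad.
have eG0 (p : BM) : [set: BM] p -> (0 <= (sqnorm G (gradient G phi) p)%:E)%E by rewrite lee_fin sqnorm_ge0.
rewrite (eq_integral (fun p : BM => s%:E * (sqnorm G (gradient G phi) p)%:E)%E); last first.
  by move=> p _; rewrite -!EFinM -mulrA sr mulrC.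
have s0' := ltW s0.
rewrite ge0_integralZl_EFin//.
have en : (energy g phi <= C4%:E * \int[volume g]_p (sqnorm G (gradient G phi) p)%:E)%E.
  have C40 := ltW C4_gt0.
  rewrite -ge0_integralZl_EFin//; apply: integral_mono => p _; first by rewrite lee_fin sqnorm_ge0.
  by rewrite -EFinM lee_fin; exact: egrad_comparison.
apply: le_trans (lee_wpmul2l _ (lee_wpmul2l _ en)) _; rewrite ?lee_fin ?sqr_ge0//.
rewrite !muleA -!EFinM; apply: lee_wpmul2r; first exact: integral_ge0.
rewrite lee_fin /K mulrDl mul1r.
have -> : R1 ^+ 2 * CP * C4 * V0 * s = R1 ^+ 2 * CP * C4.
  by rewrite -mulrA /s mulfV ?mulr1// gt_eqF.
by rewrite lerDl ltW.
Qed.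

Variables (A : set BM) (b : M -> R) (CA r0 beta w : R).
Hypotheses (mA : measurable A) (sb : smooth_fun S b) (b01 : forall p, 0 <= b p <= 1)
  (bA : forall p, ~ A p -> b p = 0).
Hypotheses (CA_ge0 : 0 <= CA) (r0_gt0 : 0 < r0) (beta_gt0 : 0 < beta) (w_gt0 : 0 < w).
Hypothesis poinA : forall u, smooth_fun S u ->
  (dint (volume g) A A u <= CA%:E * \int[volume g]_(q in A) (sqnorm g (gradient g u) q)%:E)%E.
Hypothesis rA : forall p, A p -> r0 <= r p.
Hypothesis rw : forall p, w <= r p.
Hypothesis bbeta : (beta%:E <= \int[volume g]_p (b p)%:E)%E.

(** The density is a (b + e), with b supported in A, where r >= r0. Returning from the energy of g
    to that of G costs 1 / r0 on A but 1 / w on M, and w degenerates with eta. The global inequality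
    is used only with a weight of order e, and e <= w compensates the loss without any passage to
    the limit. *)
Lemma mu_star_ge :
  (((2 * ((r0 * beta)^-1 ^+ 2 * (R1 ^+ 2 * CA * C4 / r0 + 3 * R1 ^+ 2 * CP * C4) + 1))^-1)%:E
    <= mu_star G 1)%E.
Proof.
set a0 := (r0 * beta)^-1.
(* At most w, so that e / w <= 1 below; at most 1, so that the quadratic terms in e are of order e.
   It is positive, as densities must be. *)
pose e := Num.min 1 w; have e0 : 0 < e by rewrite lt_min ltr01.
have e1 : e <= 1 by rewrite ge_min lexx.
have ew : e <= w by rewrite ge_min lexx orbT.
have b0 p : 0 <= b p by have /andP[] := b01 p.
have b1 p : b p <= 1 by have /andP[] := b01 p.
have cb := smooth_fun_continuous sb.
have mb : measurable_fun [set: BM] (b : BM -> R) by exact: measurable_smooth sb.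
have mbe : measurable_fun [set: BM] ((fun p => b p + e) : BM -> R).
  by apply: measurable_funD => //; exact: measurable_cst.
have be0 p : 0 < b p + e by rewrite ltr_wpDl.
pose I0 := (\int[volume G]_p (b p + e)%:E)%E.
have I0le : (I0 <= (1 + e)%:E)%E.
  apply: (@le_trans _ _ ((1 + e)%:E * volume G [set: BM])%E); last first.
    by rewrite (_ : volume G [set: BM] = 1%E)// mule1.
  apply: integral_cst_le => //; first by rewrite lee_fin addr_ge0// ltW.
    by move=> p _; rewrite lee_fin ltW.
  by move=> p _; rewrite lee_fin; have := b1 p; lra.
have I0ge : ((r0 * beta)%:E <= I0)%E.
  rewrite /I0 integral_comparison//; last 2 first.
  - exact/measurable_EFinP.
  - by move=> p; rewrite lee_fin ltW.
  have r00 := ltW r0_gt0.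
  have mbE : measurable_fun [set: BM] (fun p => (b p)%:E) by exact/measurable_EFinP.
  have bE0 (p : BM) : [set: BM] p -> (0 <= (b p)%:E)%E by rewrite lee_fin.
  rewrite EFinM; apply: le_trans (lee_wpmul2l _ bbeta) _; first by rewrite lee_fin.
  rewrite -ge0_integralZl_EFin//; apply: integral_mono => p _.
    by rewrite mule_ge0 ?lee_fin.
  rewrite -!EFinM lee_fin; have [Ap|nAp] := pselect (A p); last first.
    by rewrite (bA nAp) mulr0 mulr_ge0 ?add0r// ltW.
  rewrite mulrC; apply: ler_pM => //; last exact: rA.
  by rewrite lerDl ltW.
have fI : I0 \is a fin_num.
  rewrite ge0_fin_numE; first by apply: le_lt_trans I0le _; rewrite ltry.
  by apply: le_trans I0ge; rewrite lee_fin mulr_ge0// ltW.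
have IE : I0 = (fine I0)%:E by rewrite fineK.
have Ige : r0 * beta <= fine I0 by rewrite -lee_fin -IE.
have rb0 : 0 < r0 * beta by rewrite mulr_gt0.
have Ip : 0 < fine I0 by exact: lt_le_trans Ige.
(* The normalising factor, bounded by a0 independently of e and w because b alone has integral at
   least r0 beta for the volume of G. *)
pose a := (fine I0)^-1; have ap : 0 < a by rewrite invr_gt0.
have aa0 : a <= a0 by rewrite /a /a0 lef_pV2 ?posrE.
pose rho p := a * (b p + e).
have rho0 p : 0 < rho p by rewrite mulr_gt0.
have crho : continuous rho.
  move=> p; apply: cvgM; first exact: cvg_cst.
  by apply: cvgD; [exact: cb|exact: cvg_cst].
have mrho : measurable_fun [set: BM] (rho : BM -> R) by exact: continuous_borelR.
have rhoI : (\int[volume G]_p (rho p)%:E = 1)%E.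
  under eq_integral do rewrite EFinM.
  have ap' := ltW ap.
  rewrite ge0_integralZl_EFin//; last 2 first.
  - by move=> p _; rewrite lee_fin ltW.
  - exact/measurable_EFinP.
  by rewrite -/I0 IE -EFinM mulVf// gt_eqF.
have nrho : normalized_density G rho.
  by split => //; rewrite volG /= invr1 mul1r /Rintegral rhoI.
apply: le_trans (ereal_sup_ubound _); last by exists rho.
set K := a0 ^+ 2 * _ + 1.
have a00 : 0 < a0 by rewrite invr_gt0.
have r0' := ltW r0_gt0. have C40 := ltW C4_gt0.
have R12 : 0 <= R1 ^+ 2 by rewrite sqr_ge0.
have k1 : 0 <= R1 ^+ 2 * CA * C4 / r0 by rewrite divr_ge0// !mulr_ge0.
have k2 : 0 <= 3 * R1 ^+ 2 * CP * C4 by rewrite !mulr_ge0.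
have K0 : 0 < K.
  by rewrite /K ltr_wpDl// mulr_ge0 ?sqr_ge0// addr_ge0.
have rhoB p : rho p <= Num.max 1 (a * 2).
  rewrite le_max; apply/orP; right; apply: ler_wpM2l; first exact: ltW.
  by rewrite -[2]/(1 + 1); apply: lerD.
have oB (p : BM) : (fun=> 1 : R) p <= Num.max 1 (a * 2) by rewrite le_max lexx.
have rho0' (p : BM) : 0 <= rho p by rewrite ltW.
have densT : dens (volume G) mrho rho0' setT = 1%E by rewrite /dens rhoI.
have := @mu1_ge R n M M_compact S G rho (fun=> 1) (Num.max 1 (a * 2)) mrho rho0' m1 one_ge0
  rhoB oB K K0 rho0.
have -> : fine (dens (volume G) mrho rho0' setT) = 1 by rewrite densT.
rewrite mul1r; apply => phi sphi.
have mphi := measurable_smooth sphi.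
pose k := a0 ^+ 2 * R1 ^+ 2.
have kp : 0 <= k by rewrite mulr_ge0 ?sqr_ge0.
have a2 : a * a <= a0 ^+ 2 by rewrite expr2; apply: ler_pM => //; exact: ltW.
have hw (x y : BM) : (rho x * r x) * (rho y * r y) <= k * (\1_A x * \1_A y) + k * (3 * e).
  have bi p : b p <= \1_A p.
    by rewrite indicE; have [Ap|nAp] := pselect (A p); [rewrite mem_set|rewrite (bA nAp)].
  rewrite -mulrDr mulrACA; apply: (@le_trans _ _ (rho x * rho y * R1 ^+ 2)).
    apply: ler_wpM2l; first by rewrite mulr_ge0.
    by rewrite expr2; apply: ler_pM.
  have -> : rho x * rho y * R1 ^+ 2 = a * a * R1 ^+ 2 * ((b x + e) * (b y + e)).
    by rewrite /rho; ring.
  apply: ler_pM.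
  - by apply: mulr_ge0 => //; apply: mulr_ge0; exact: ltW.
  - by apply: mulr_ge0; exact: ltW.
  - exact: ler_wpM2r.
  have bb : b x * b y <= \1_A x * \1_A y by apply: ler_pM.
  apply: (@le_trans _ _ (b x * b y + 3 * e)); last by rewrite lerD2r.
  exact: mul_shift_le (b0 x) (b0 y) (b1 x) (b1 y) (ltW e0) e1.
have mwt : measurable_fun [set: BM] (fun p => rho p * r p) by exact: measurable_funM.
have ke : 0 <= k * (3 * e) by rewrite mulr_ge0// mulr_ge0// ltW.
have wt0 (p : BM) : 0 <= rho p * r p by rewrite mulr_ge0.
have muf : (dens (volume G) mrho rho0' setT < +oo)%E by rewrite densT ltry.
apply: le_trans (weighted_dint (m := volume g) fing muf mwt wt0
  (dens_comparison mrho rho0') mA kp ke mphi hw) _.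
have meG : measurable_fun [set: BM] (fun p : BM => (sqnorm G (gradient G phi) p)%:E).
  by apply/measurable_EFinP; exact: measurable_egrad.
have eG0 (p : BM) : (0 <= (sqnorm G (gradient G phi) p)%:E)%E by rewrite lee_fin sqnorm_ge0.
set X := (\int[volume G]_p (sqnorm G (gradient G phi) p)%:E)%E.
have -> : (\int[volume G]_p (sqnorm G (gradient G phi) p * 1)%:E = X)%E.
  by apply: eq_integral => p _; rewrite mulr1.
have X0 : (0 <= X)%E by apply: integral_ge0.
(* The change from the energy of g to that of G on a set where r >= z; used on A with r0 and on M
   with w. *)
have back (B : set BM) (z : R) : measurable B -> 0 < z -> (forall p, B p -> z <= r p) ->
    (\int[volume g]_(p in B) (sqnorm g (gradient g phi) p)%:E <= (C4 / z)%:E * X)%E.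
  move=> mB z0 zr.
  have cz : 0 <= C4 / z by rewrite divr_ge0// ltW.
  apply: (@le_trans _ _ ((C4 / z)%:E * \int[volume G]_(p in B) (sqnorm G (gradient G phi) p)%:E)%E); last first.
    by apply: lee_wpmul2l; rewrite ?lee_fin//; exact: integral_subset.
  rewrite integral_comparison//.
  have mBf : measurable_fun B (fun p => (sqnorm G (gradient G phi) p)%:E * (r p)%:E)%E.
    by apply: measurable_funTS; apply: emeasurable_funM => //; exact/measurable_EFinP.
  have Bf0 p : B p -> (0 <= (sqnorm G (gradient G phi) p)%:E * (r p)%:E)%E.
    by move=> _; rewrite mule_ge0 ?lee_fin ?sqnorm_ge0.
  rewrite -ge0_integralZl_EFin//; apply: integral_mono => p Bp; first by rewrite lee_fin sqnorm_ge0.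
  rewrite -!EFinM lee_fin; apply: le_trans (egrad_comparison p sphi) _.
  rewrite -mulrA; apply: ler_wpM2l => //; rewrite mulrCA.
  rewrite -[leLHS]mulr1; apply: ler_wpM2l; first exact: sqnorm_ge0.
  by rewrite mulrC ler_pdivlMr// mul1r; exact: zr.
have tA : (dint (volume g) A A phi <= (CA * (C4 / r0))%:E * X)%E.
  apply: le_trans (poinA sphi) _; rewrite EFinM -muleA; apply: lee_wpmul2l; rewrite ?lee_fin//.
  exact: back.
have tT : (dint (volume g) setT setT phi <= (CP * (C4 / w))%:E * X)%E.
  apply: le_trans (poin sphi) _; rewrite EFinM -muleA; apply: lee_wpmul2l; rewrite ?lee_fin//.
  by apply: back.
apply: le_trans (leeD (lee_wpmul2l _ tA) (lee_wpmul2l _ tT)) _; rewrite ?lee_fin//.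
rewrite !muleA -!EFinM -ge0_muleDl; last 2 first.
- by rewrite lee_fin mulr_ge0// mulr_ge0// divr_ge0.
- by rewrite lee_fin mulr_ge0// mulr_ge0// divr_ge0// ltW.
rewrite -EFinD; apply: lee_wpmul2r => //; rewrite lee_fin /K.
apply: (@le_trans _ _ (a0 ^+ 2 * (R1 ^+ 2 * CA * C4 / r0 + 3 * R1 ^+ 2 * CP * C4))); last by rewrite lerDl.
have -> : k * (3 * e) * (CP * (C4 / w)) = a0 ^+ 2 * (3 * R1 ^+ 2 * CP * C4) * (e / w).
  by rewrite /k; field; rewrite gt_eqF.
have -> : k * (CA * (C4 / r0)) = a0 ^+ 2 * (R1 ^+ 2 * CA * C4 / r0).
  by rewrite /k; field; rewrite gt_eqF.
rewrite [in leRHS]mulrDr lerD2l -[leRHS]mulr1; apply: ler_wpM2l.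
  by rewrite mulr_ge0 ?sqr_ge0.
by rewrite ler_pdivrMr// mul1r.
Qed.

End Comparison.

(** * The test function and the profile of the neck *)

Section Bottleneck.
Context (R : realType) (n : nat) (M : ptopologicalType).
Hypotheses (M_hausdorff : hausdorff_space M) (n_gt0 : (0 < n)%N).
Variable S : atlas R n M.
Local Notation H := (@half_space R n).

Lemma chart_preimage_open (c : chart R n M) (W : set 'rV[R]_n) : open W ->
  open (dom c `&` fwd c @^-1` W).
Proof.
move=> oW; have [V oV ->] := within_open_preimage (@fwd_continuous _ _ _ c) oW.
by apply: openI => //; exact: dom_open.
Qed.

Lemma dform_locally_cst (f : M -> R) (a : R) (U : set M) (c : chart R n M) p :
  open U -> U p -> dom c p -> (forall q, U q -> f q = a) -> dform f c p = 0.
Proof.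
move=> oU Up cp fa; have [V oV EV] := chart_img_open c oU.
apply/rowP => i; rewrite !mxE.
have Vp : (V `&` H) (fwd c p) by rewrite -EV; exists p.
rewrite (@partial_eq R n V _ (cst a) _ i oV Vp); last first.
  by move=> y; rewrite -EV => -[q [cq Uq] <-]; rewrite /= fwdK// fa.
rewrite /partial (_ : (fun x => _) = cst 0); first exact: lim_cst.
by apply/funext => x; rewrite subrr mulr0.
Qed.

Lemma half_space_fwd (c : chart R n M) p : dom c p -> H (fwd c p).
Proof.
move=> cp; have [V oV EV] := chart_img_all c.
by have : (V `&` H) (fwd c p); [rewrite -EV; exists p|case].
Qed.

Lemma continuous_scaled_sqdist (x0 : 'rV[R]_n) (a : R) :
  continuous (fun x => a * sqdist x0 x).
Proof.
move=> x; apply: (@continuousM R 'rV[R]_n (cst a) (sqdist x0)); first exact: cst_continuous.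
exact: (Ck_continuous (Ck_sqdist x0 0%N openT)).
Qed.

Lemma open_sqdist_lt (x0 : 'rV[R]_n) (a b : R) : open [set x | a * sqdist x0 x < b].
Proof.
have := (continuousP _).1 (@continuous_scaled_sqdist x0 a) _ (@open_lt _ b); apply.
Qed.

Lemma open_sqdist_gt (x0 : 'rV[R]_n) (a b : R) : open [set x | b < a * sqdist x0 x].
Proof.
have := (continuousP _).1 (@continuous_scaled_sqdist x0 a) _ (@open_gt _ b); apply.
Qed.

(* In a chart around a point, with [s = a |x - x0|^2]: [h] is [1] for [s <= 1]
   and [0] for [s >= 2], and [k] vanishes on the transition zone
   [1 <= s <= 2], the future neck, but is [1] for [s < 1/2] and [s > 4]. *)
Lemma bottleneck_exists (c : chart R n M) p : charts S c -> dom c p ->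
  exists (h k : M -> R) (P0 P1 : set M),
  [/\ [/\ smooth_fun S h, smooth_fun S k & forall q, 0 <= k q <= 2],
      [/\ open P0, open P1, P0 !=set0 & P1 !=set0],
      forall q, P0 q -> h q = 0 /\ k q = 1,
      forall q, P1 q -> h q = 1 /\ k q = 1 &
      forall q, k q = 0 \/ forall c', charts S c' -> dom c' q -> dform h c' q = 0].
Proof.
move=> Sc cp; have [r r0 rO] := chart_sqdist cp openT (Logic.I : setT p).
set x0 := fwd c p in rO.
(* The ball of squared radius r inside the chart corresponds to s <= 8. The widest bump below
   vanishes from s = 4 on, which leaves room for P0 between 4 and 8. *)
pose a := 8 / r; have a0 : 0 < a by rewrite divr_gt0.
have ar : a * r = 8 by rewrite /a divfK// gt_eqF.
have Kc x : H x -> sqdist x0 x <= r -> (fwd c @` dom c) x.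
  by move=> Hx /(rO _ Hx)[q [cq _] <-]; exists q.
pose B s := scaled_bump x0 (a * s).
have B1 s x : a * sqdist x0 x * s <= 1 -> B s x = 1.
  by move=> ?; rewrite /B /scaled_bump smooth_step1// mulrAC.
have B0 s x : 2 <= a * sqdist x0 x * s -> B s x = 0.
  by move=> ?; rewrite /B /scaled_bump smooth_step0// mulrAC.
have B01 s x : 0 <= B s x <= 1 by rewrite smooth_step_ge0 smooth_step_le1.
have k0 s x : 2^-1 <= s -> r <= sqdist x0 x -> B s x = 0.
  move=> hs hr; apply: B0.
  have : 8 <= a * sqdist x0 x by rewrite -ar ler_pM2l.
  by move=> h8; nra.
have smB s : 2^-1 <= s -> smooth_fun S (chart_ext c (B s)).
  by move=> hs; apply: chart_ext_smooth Kc (fun x => k0 s x hs) _ => // j; exact: Ck_scaled_bump.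
have vB s q : 2^-1 <= s -> ~ dom c q ->
    exists U : set M, [/\ open U, U q & forall q', U q' -> chart_ext c (B s) q' = 0].
  by move=> hs; apply: (chart_ext_vanish M_hausdorff r0 Kc (fun x => k0 s x hs)).
have s1 : 2^-1 <= 1 :> R by lra.
have s2 : 2^-1 <= 2 :> R by lra.
have e01 s q : 0 <= chart_ext c (B s) q <= 1.
  by rewrite /chart_ext; case: asboolP => _; rewrite ?B01// lexx ler01.
pose h := chart_ext c (B 1).
(* [B 2] falls from 1 to 0 for s between 1/2 and 1, and [B 2^-1] for s between 2 and 4; in between
   both terms of k vanish. *)
pose k q := chart_ext c (B 2) q + (1 + -1 * chart_ext c (B 2^-1) q).
have kE q : dom c q -> k q = B 2 (fwd c q) + (1 - B 2^-1 (fwd c q)).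
  by move=> cq; rewrite /k !chart_extE// mulN1r.
have hE q : dom c q -> h q = B 1 (fwd c q) by move=> cq; rewrite /h chart_extE.
exists h, k, (dom c `&` fwd c @^-1` [set x | 4 < a * sqdist x0 x]),
  (dom c `&` fwd c @^-1` [set x | a * sqdist x0 x < 2^-1]); split.
- split; first exact: smB.
    apply: smooth_fun_add; first exact: smB.
    apply: smooth_fun_add; first exact: smooth_fun_cst.
    by apply: smooth_fun_scale; exact: smB.
  move=> q; rewrite /k mulN1r; have /andP[? ?] := e01 2 q; have /andP[? ?] := e01 2^-1 q.
  by apply/andP; split; lra.
- split; [exact/chart_preimage_open/open_sqdist_gt|exact/chart_preimage_open/open_sqdist_lt| |].
    (* A point of P0: moving from x0 in the positive first direction stays in the half-space, and
       this step reaches the value 6, between 4 and 8. A first coordinate exists as n > 0. *)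
    pose s := Num.sqrt (6 / a).
    have s_ge0 : 0 <= s by rewrite sqrtr_ge0.
    have ss : s ^+ 2 = 6 / a by rewrite sqr_sqrtr// ltW// divr_gt0.
    pose i0 := Ordinal n_gt0.
    pose y := x0 + s *: delta_mx 0 i0.
    have Hy : H y.
      move=> i /eqP i_0; rewrite !mxE eqxx /= addr_ge0//; last by rewrite mulr_ge0.
      by apply: half_space_fwd => //; exact/eqP.
    have sy : sqdist x0 y = 6 / a.
      rewrite /sqdist (bigD1 i0)//= big1 => [|i ii0].
        by rewrite !mxE !eqxx /= mulr1 addr0 addrAC subrr add0r.
      by rewrite !mxE eqxx (negbTE ii0) /= mulr0 addr0 subrr expr0n.
    have syr : sqdist x0 y <= r.
      by rewrite sy ler_pdivrMr// mulrC ar ler_nat.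
    have [q cq fq] := Kc y Hy syr; exists q; split => //=.
    by rewrite fq sy mulrC divfK ?gt_eqF// ltr_nat.
  by exists p; split => //=; rewrite sqdistxx mulr0 invr_gt0.
- move=> q [cq /= lt]; rewrite hE// kE// !B0 ?subr0 ?add0r//; lra.
- move=> q [cq /= lt]; rewrite hE// kE// !B1 ?subrr ?addr0//; lra.
- move=> q; have [cq|ncq] := pselect (dom c q); last first.
    have [U [oU Uq hU]] := vB 1 q s1 ncq.
    by right => c' Sc' c'q; exact: (dform_locally_cst oU Uq c'q hU).
  have [lt1|ge1] := ltP (a * sqdist x0 (fwd c q)) 1.
    right => c' Sc' c'q.
    apply: (@dform_locally_cst h 1 (dom c `&` fwd c @^-1` [set x | a * sqdist x0 x < 1])) => //.
      exact/chart_preimage_open/open_sqdist_lt.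
    by move=> q' [cq' /= lt]; rewrite hE// B1// mulr1 ltW.
  have [lt2|ge2] := ltP 2 (a * sqdist x0 (fwd c q)).
    right => c' Sc' c'q.
    apply: (@dform_locally_cst h 0 (dom c `&` fwd c @^-1` [set x | 2 < a * sqdist x0 x])) => //.
      exact/chart_preimage_open/open_sqdist_gt.
    by move=> q' [cq' /= lt]; rewrite hE// B0// mulr1 ltW.
  left; rewrite kE// B0; last by lra.
  by rewrite B1 ?subrr ?addr0//; lra.
Qed.

End Bottleneck.

Lemma root_exists (R : realType) (n : nat) (x : R) : (0 < n)%N -> 0 < x ->
  exists2 t : R, 0 < t & t ^+ n = x.
Proof.
move=> n0 x0; exists (x `^ n%:R^-1); first exact: powR_gt0.
rewrite -powR_mulrn ?powR_ge0// -powRrM mulVf ?powRr1//; first exact: ltW.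
by rewrite pnatr_eq0 -lt0n.
Qed.

(** * Bounds on the density of the warped metric *)

Section Density.
Context (R : realType).
Implicit Types x y t e b K : R.

Lemma density_scale n t x y : (0 < n)%N -> 0 < t ->
  (t * x) ^+ n.-1 * Num.sqrt ((t * x) ^+ 2 + t ^+ 2 * y) =
  t ^+ n * (x ^+ n.-1 * Num.sqrt (x ^+ 2 + y)).
Proof.
case: n => // n _ t0; rewrite /= !exprMn -mulrDr sqrtrM ?sqr_ge0// sqrtr_sqr gtr0_norm// [t ^+ n.+1]exprSr.
by set s := Num.sqrt _; ring.
Qed.

Lemma density_le n x b y K : 0 <= x -> x <= b -> 0 <= y -> y <= K ->
  x ^+ n * Num.sqrt (x ^+ 2 + y) <= b ^+ n * Num.sqrt (b ^+ 2 + K).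
Proof.
move=> x0 xb y0 yK; have b0 := le_trans x0 xb.
apply: ler_pM; rewrite ?exprn_ge0 ?sqrtr_ge0//; first by rewrite lerXn2r.
by apply: ler_wsqrtr; apply: lerD => //; rewrite lerXn2r.
Qed.

Lemma density_ge n e x y : 0 <= e -> e <= x -> 0 <= y ->
  e ^+ n.+1 <= x ^+ n * Num.sqrt (x ^+ 2 + y).
Proof.
move=> e0 ex y0; have x0 := le_trans e0 ex.
rewrite exprSr; apply: ler_pM; rewrite ?exprn_ge0//; first by rewrite lerXn2r.
apply: le_trans ex _; rewrite -[leLHS]ger0_norm// -sqrtr_sqr; apply: ler_wsqrtr.
by rewrite lerDl.
Qed.

(** The successor in the exponent is where dimension at least 2 enters: it leaves one factor e,
    which makes the energy of the test function small. *)
Lemma neck_density_le n e y K : 0 <= e -> e <= 1 -> 0 <= y -> y <= K ->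
  e ^+ n.+1 * Num.sqrt (e ^+ 2 + y) <= e * Num.sqrt (1 + K).
Proof.
move=> e0 e1 y0 yK; apply: ler_pM; rewrite ?exprn_ge0 ?sqrtr_ge0//.
  by apply: ler_iXnr.
by apply: ler_wsqrtr; apply: lerD => //; rewrite expr_le1.
Qed.

(** Bounds on t are read off from bounds on t^n without extracting roots of the bounds: either t <=
    1 or t <= t^n. *)
Lemma root_le n t b : (0 < n)%N -> t ^+ n <= b -> t <= Num.max 1 b.
Proof.
move=> n0 tb; rewrite le_max; have [//|t1] := leP t 1; apply/orP; right.
by apply: le_trans tb; apply: ler_eXnr => //; exact: ltW.
Qed.

Lemma root_ge n t b : (0 < n)%N -> 0 <= t -> b <= t ^+ n -> Num.min 1 b <= t.
Proof.
move=> n0 t0 bt; rewrite ge_min; have [//|t1] := leP 1 t; apply/orP; right.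
by apply: le_trans bt _; apply: ler_iXnr => //; exact: ltW.
Qed.

End Density.

Section GradientScale.
Context (R : realType) (n : nat) (M : ptopologicalType) (S : atlas R n M) (g : metric S).

Lemma sqnorm_gradient_scale (f : M -> R) t p : smooth_fun S f ->
  sqnorm g (gradient g (fun q => t * f q)) p = t ^+ 2 * sqnorm g (gradient g f) p.
Proof.
move=> sf; have [c [Sc cp]] := charts_cover S p.
rewrite (sqnorm_gradient g sf Sc cp) (sqnorm_gradient g (smooth_fun_scale t sf) Sc cp).
have -> : (fun q => t * f q) = (fun q => t * f q + 0 * f q).
  by apply/funext => q; rewrite mul0r addr0.
rewrite (dform_comb t 0 sf sf Sc cp) scale0r addr0.
by rewrite /quad linearZ /= -scalemxAr -!scalemxAl scalerA mxE expr2.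
Qed.

Lemma sqnorm_gradient_dform0 (f : M -> R) p : smooth_fun S f ->
  (forall c, charts S c -> dom c p -> dform f c p = 0) -> sqnorm g (gradient g f) p = 0.
Proof.
move=> sf f0; have [c [Sc cp]] := charts_cover S p.
by rewrite (sqnorm_gradient g sf Sc cp) (f0 c Sc cp) /quad !mul0mx mxE.
Qed.

End GradientScale.

(** * The normalised warped metric and its uniform constants *)

Section Warped.
Context (R : realType) (n : nat) (M : ptopologicalType).
Hypotheses (n_ge2 : (2 <= n)%N) (M_compact : compact [set: M]).
Variables (S : atlas R n M) (g : metric S).
Local Notation BM := (borel M).
Variables (h k : M -> R) (P0 P1 : set BM).
Hypotheses (sh : smooth_fun S h) (sk : smooth_fun S k) (k02 : forall q, 0 <= k q <= 2).
Hypotheses (oP0 : open (P0 : set M)) (oP1 : open (P1 : set M)).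
Hypotheses (nP0 : P0 !=set0) (nP1 : P1 !=set0).
Hypotheses (hP0 : forall q, P0 q -> h q = 0 /\ k q = 1) (hP1 : forall q, P1 q -> h q = 1 /\ k q = 1).
Hypothesis neck : forall q, k q = 0 \/
  forall c, charts S c -> dom c q -> dform h c q = 0.

Let n_gt0 : (0 < n)%N. Proof. exact: ltnW. Qed.

(* [g_eta] is [t^2 ((eta + (1 - eta) k)^2 g + dh dh)]: its density with respect
   to [g] is at most of order [eta] where [dh] does not vanish, and its gradient
   satisfies [|dh| <= 1 / t], so [h] is a test function of energy [O(eta)]. *)
Lemma warped_metric : exists C3 R1 C4 r0 : R, [/\ 0 <= C3, 0 < C4 & 0 < r0] /\
  forall eta, 0 < eta <= 1 -> exists (G : metric S) (r : M -> R) (w : R),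
  [/\ [/\ continuous r, forall p, 0 < r p, forall p, r p <= R1,
        forall p, P1 p -> r0 <= r p & 0 < w /\ forall p, w <= r p],
      forall c p, charts S c -> dom c p ->
        Num.sqrt (\det (G c p)) = r p * Num.sqrt (\det (g c p)),
      forall c p, charts S c -> dom c p -> forall v, quad (G c p) v <= C4 * quad (g c p) v,
      volume G [set: M] = 1%E &
      (lambda_k G 1 <= (C3 * eta)%:E)%E].
Proof.
pose q p := sqnorm g (gradient g h) p.
have cq : continuous q := smooth_fun_continuous (smooth_sqnorm_gradient g sh).
have [K K0 hK] := continuous_bounded M_compact cq.
have q0 p : 0 <= q p by exact: sqnorm_ge0.
have qK p : q p <= K by exact: le_trans (ler_norm _) (hK p).
have mP0 : measurable P0 by exact: borel_open.
have mP1 : measurable P1 by exact: borel_open.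
have fing := volume_fin M_compact g.
have [p0 P0p] := nP0; have [p1 P1p] := nP1.
pose V0 := fine (volume g [set: BM]).
pose v0 := fine (volume g P0); pose v1 := fine (volume g P1).
have fV : volume g [set: BM] = V0%:E by rewrite /V0 fineK// fin_meas.
have fv0 : volume g P0 = v0%:E by rewrite /v0 fineK// fin_meas.
have fv1 : volume g P1 = v1%:E by rewrite /v1 fineK// fin_meas.
have v0p : 0 < v0 by rewrite -lte_fin -fv0; exact: (volume_open_gt0 M_compact g oP0 P0p).
have v1p : 0 < v1 by rewrite -lte_fin -fv1; exact: (volume_open_gt0 M_compact g oP1 P1p).
have V0p : 0 < V0 by rewrite -lte_fin -fV; exact: (volume_open_gt0 M_compact g openT (Logic.I : setT p1)).
(* Upper bound for the density before rescaling, since the conformal factor [th0] is at most 2 and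
   |dh|^2 at most K. *)
pose C1 := 2 ^+ n.-1 * Num.sqrt (2 ^+ 2 + K).
have C1p : 0 < C1.
  by rewrite mulr_gt0 ?exprn_gt0// sqrtr_gt0 addr_gt0// exprn_gt0.
pose z := (C1 * V0)^-1.
have zp : 0 < z by rewrite invr_gt0 mulr_gt0.
(* Bounds for the scaling factor t, uniform in eta: t^n is the inverse of the unscaled volume, which
   lies between v1 and C1 V0. *)
pose T0 := Num.min 1 z; pose T1 := Num.max 1 v1^-1.
have T0p : 0 < T0 by rewrite lt_min ltr01.
have T1p : 0 < T1 by rewrite lt_max ltr01.
pose vm := Num.min v0 v1 * z.
have vmp : 0 < vm by rewrite mulr_gt0// lt_min v0p.
(* Bound on the energy density of h per unit of eta: the first factor bounds |dh|^2 after rescaling,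
   v1^-1 bounds t^n, and the square root comes from the density on the neck. *)
pose C2 := (T0 ^+ 2)^-1 * (v1^-1 * Num.sqrt (1 + K)).
have C20 : 0 <= C2 by rewrite !mulr_ge0 ?invr_ge0 ?sqrtr_ge0 ?exprn_ge0// ltW.
pose C4 := T1 ^+ 2 * (2 ^+ 2 + K).
have C4p : 0 < C4 by rewrite mulr_gt0 ?exprn_gt0// addr_gt0// exprn_gt0.
exists (16 * (C2 * V0) / vm), (v1^-1 * C1), C4, z; split.
  by split => //; rewrite divr_ge0 ?(ltW vmp)// mulr_ge0// mulr_ge0// ltW.
move=> eta /andP[eta0 eta1].
pose th0 p := eta + (1 - eta) * k p.
have eta1' : 0 <= 1 - eta by rewrite subr_ge0.
have th0_ge p : eta <= th0 p.
  by rewrite lerDl mulr_ge0//; have /andP[] := k02 p.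
have th0_le p : th0 p <= 2.
  have /andP[_ k2] := k02 p; have := ler_wpM2l eta1' k2; rewrite /th0.
  set x := (1 - eta) * k p; lra.
have th0_gt0 p : 0 < th0 p by exact: lt_le_trans (th0_ge p).
have sth0 : smooth_fun S th0.
  apply: smooth_fun_add; first exact: smooth_fun_cst.
  exact: smooth_fun_scale.
pose D p := th0 p ^+ n.-1 * Num.sqrt (th0 p ^+ 2 + q p).
have cth0 : continuous th0 := smooth_fun_continuous sth0.
have cD : continuous D.
  move=> p; apply: cvgM; first exact: (continuous_comp (cth0 p) (@exprn_continuous _ _ _)).
  apply: (@continuous_comp _ _ _ (fun p => th0 p ^+ 2 + q p) Num.sqrt); last exact: sqrt_continuous.
  apply: cvgD; last exact: cq.
  exact: (continuous_comp (cth0 p) (@exprn_continuous _ _ _)).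
have D_le p : D p <= C1 by apply: density_le => //; exact: ltW.
have D_ge p : eta ^+ n <= D p.
  by rewrite -[in leLHS](prednK n_gt0); apply: density_ge => //; exact: ltW.
have D_ge1 p : k p = 1 -> 1 <= D p.
  move=> kp; rewrite -[leLHS](expr1n _ n.-1.+1); apply: density_ge => //.
  by rewrite /th0 kp mulr1 addrC subrK.
have D_gt0 p : 0 < D p by apply: lt_le_trans (D_ge p); exact: exprn_gt0.
have mD : measurable_fun [set: BM] (fun p : BM => (D p)%:E).
  by apply/measurable_EFinP; exact: continuous_borelR.
have D0 (p : BM) : [set: BM] p -> (0 <= (D p)%:E)%E by move=> _; rewrite lee_fin ltW.
pose ID := (\int[volume g]_p (D p)%:E)%E.
have ID_le : (ID <= (C1 * V0)%:E)%E.
  rewrite EFinM; apply: integral_cst_le => //.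
  - by rewrite lee_fin ltW.
  - by move=> p _; rewrite lee_fin.
  - by rewrite -fV.
have ge_meas (A : set BM) : measurable A -> (forall p, A p -> 1 <= D p) ->
    (volume g A <= \int[volume g]_(p in A) (D p)%:E)%E.
  move=> mA hA; have E : (\int[volume g]_(p in A) (1 : R)%:E = 1%:E * volume g A)%E :=
    integral_cst (volume g) mA 1%:E.
  rewrite -[leLHS]mul1e -E; apply: integral_mono => p Ap; rewrite lee_fin//.
  exact: hA.
have ID_ge : (v1%:E <= ID)%E.
  rewrite -fv1; apply: le_trans (ge_meas _ mP1 _) _.
    by move=> p /hP1[_ ?]; exact: D_ge1.
  exact: integral_subset.
have fID : ID \is a fin_num.
  rewrite ge0_fin_numE; first by apply: le_lt_trans ID_le _; rewrite ltry.
  by apply: le_trans ID_ge; rewrite lee_fin ltW.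
pose V := fine ID; have EV : ID = V%:E by rewrite fineK.
have V_ge : v1 <= V by rewrite -lee_fin -EV.
have V_le : V <= C1 * V0 by rewrite -lee_fin -EV.
have Vp : 0 < V by exact: lt_le_trans V_ge.
have V1p : 0 < V^-1 by rewrite invr_gt0.
have [t t0 tn] := root_exists n_gt0 V1p.
have tn_le : t ^+ n <= v1^-1 by rewrite tn lef_pV2 ?posrE.
have tn_ge : z <= t ^+ n by rewrite tn /z lef_pV2 ?posrE// mulr_gt0.
have t_le : t <= T1 by exact: root_le tn_le.
have t_ge : T0 <= t by apply: root_ge tn_ge => //; exact: ltW.
have tn0 : 0 < t ^+ n by rewrite exprn_gt0.
have th_gt0 p : 0 < t * th0 p by rewrite mulr_gt0.
(* Scaling both the factor and h by t amounts to multiplying the whole metric by t^2. *)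
pose G := warp g (smooth_fun_scale t sth0) th_gt0 (smooth_fun_scale t sh).
pose r p := t ^+ n * D p.
have rE c p : charts S c -> dom c p ->
    Num.sqrt (\det (G c p)) = r p * Num.sqrt (\det (g c p)).
  move=> Sc cp; rewrite /G sqrt_det_warp//; congr (_ * _).
  by rewrite sqnorm_gradient_scale// density_scale.
have cr : continuous r.
  by move=> p; apply: cvgM; [exact: cvg_cst|exact: cD].
have r_gt0 p : 0 < r p by rewrite mulr_gt0.
have mr : measurable_fun [set: BM] (r : BM -> R) by exact: continuous_borelR.
have r_ge0 (p : BM) : 0 <= r p by exact: ltW.
have density (A : set BM) f : measurable A -> measurable_fun [set: BM] f ->
    (forall p, (0 <= f p)%E) ->
    (\int[volume G]_(p in A) f p = \int[volume g]_(p in A) (f p * (r p)%:E))%E.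
  exact: (volume_density M_compact mr r_ge0 rE).
have volG (A : set BM) : measurable A ->
    volume G A = ((t ^+ n)%:E * \int[volume g]_(p in A) (D p)%:E)%E.
  move=> mA; have E : (\int[volume G]_(p in A) (1 : R)%:E = 1%:E * volume G A)%E :=
    integral_cst (volume G) mA 1%:E.
  rewrite -[LHS]mul1e -E density//; have tn0' := ltW tn0.
  have mDA : measurable_fun A (fun p : BM => (D p)%:E) by exact: measurable_funTS.
  have D0A (p : BM) : A p -> (0 <= (D p)%:E)%E by move=> _; exact: D0.
  by rewrite -ge0_integralZl_EFin//; apply: eq_integral => p _; rewrite mul1e EFinM.
have volG_ge (A : set BM) v : measurable A -> (forall p, A p -> k p = 1) ->
    volume g A = v%:E -> Num.min v0 v1 <= v -> (vm%:E <= volume G A)%E.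
  move=> mA hA Av mv; rewrite volG//.
  apply: (@le_trans _ _ ((t ^+ n)%:E * volume g A)%E); last first.
    apply: lee_wpmul2l; first by rewrite lee_fin ltW.
    by apply: ge_meas => // p /hA; exact: D_ge1.
  rewrite Av -EFinM lee_fin /vm mulrC; apply: ler_pM => //; first exact: ltW.
  by rewrite le_min !ltW.
(* This lower bound on r tends to 0 with eta, which is why it is given separately for each eta and
   stays out of the constants. *)
exists G, r, (t ^+ n * eta ^+ n); split.
- split => //.
  + by move=> p; apply: ler_pM => //; exact: ltW.
  + move=> p /hP1[_ kp]; rewrite -[leLHS]mulr1; apply: ler_pM => //; first exact: ltW.
    exact: D_ge1.
  + split; first by rewrite mulr_gt0// exprn_gt0.
    by move=> p; rewrite /r ler_pM2l.
- exact: rE.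
- move=> c p Sc cp v; apply: le_trans (@quad_warp_le R n M S g _ _ (smooth_fun_scale t sth0) th_gt0
    (smooth_fun_scale t sh) c p v Sc cp) _.
  apply: ler_wpM2r.
    have [->|v_neq0] := eqVneq v 0; first by rewrite /quad !mul0mx mxE.
    by apply/ltW/gmat_pos.
  rewrite sqnorm_gradient_scale// exprMn -mulrDr; apply: ler_pM; rewrite ?addr_ge0 ?exprn_ge0 ?(ltW t0)//.
  + exact: ltW.
  + by rewrite lerXn2r// nnegrE ltW.
  + by apply: lerD => //; rewrite lerXn2r// nnegrE ltW.
- by rewrite (volG [set: BM] measurableT) -/ID EV tn -EFinM mulVf// gt_eqF.
have e_ge0 : 0 <= C2 * eta * V0.
  by apply: mulr_ge0; [apply: mulr_ge0 => //|]; exact: ltW.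
have -> : 16 * (C2 * V0) / vm * eta = 16 * (C2 * eta * V0) / vm.
  by ring.
apply: (lambda1_le M_compact sh mP0 mP1) => //.
- by move=> p /hP0[].
- by move=> p /hP1[].
- by apply: volG_ge fv0 _ => //; [move=> p /hP0[]|rewrite ge_min lexx].
- by apply: volG_ge fv1 _ => //; [move=> p /hP1[]|rewrite ge_min lexx orbT].
rewrite /energy density//; last 2 first.
- by apply/measurable_EFinP; exact: measurable_egrad.
- by move=> p; rewrite lee_fin sqnorm_ge0.
rewrite EFinM; apply: integral_cst_le => //; last by rewrite -fV.
- by rewrite lee_fin mulr_ge0// ltW.
- by move=> p _; rewrite mule_ge0 ?lee_fin ?sqnorm_ge0.
move=> p _; rewrite -EFinM lee_fin.
(* Off the neck dh vanishes; on it [th0] is exactly eta. *)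
have [kp|df] := neck p; last first.
  by rewrite sqnorm_gradient_dform0// mul0r mulr_ge0// ltW.
have gle : sqnorm G (gradient G h) p <= (T0 ^+ 2)^-1.
  have := sqnorm_gradient_warp g (smooth_fun_scale t sth0) th_gt0 (smooth_fun_scale t sh) p.
  rewrite -/G sqnorm_gradient_scale// => le1.
  rewrite -[leRHS]mul1r ler_pdivlMr ?exprn_gt0// mulrC; apply: le_trans le1.
  by apply: ler_wpM2r; [exact: sqnorm_ge0|rewrite lerXn2r// nnegrE ltW].
rewrite /C2 -!mulrA; apply: ler_pM => //; first exact: sqnorm_ge0.
apply: ler_pM => //; [exact: ltW|exact: ltW|].
have tp : th0 p = eta by rewrite /th0 kp mulr0 addr0.
rewrite /D tp mulrC [leRHS]mulrC mulrC.
have -> : n.-1 = n.-2.+1 by rewrite prednK// -ltnS prednK.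
by apply: neck_density_le => //; exact: ltW.
Qed.

End Warped.

(** * Uniform constants for the whole family *)

Section Family.
Context (R : realType) (n : nat) (M : ptopologicalType).
Hypotheses (M_hausdorff : hausdorff_space M) (M_compact : compact [set: M]).
Hypothesis M_connected : connected [set: M].
Variable S : atlas R n M.
Local Notation BM := (borel M).

(** The lower side of the squeeze giving the limit in the second claim. The general bound [mu1_ge]
    with both weights equal to 1 already yields it. *)
Lemma lambda1_ge0 (g : metric S) : (0 <= lambda_k g 1)%E.
Proof.
have [C C0 hC] := global_poincare M_compact g M_connected.
have m1 : measurable_fun [set: BM] ((fun=> 1) : BM -> R) by exact: measurable_cst.
have i0 (p : BM) : 0 <= (fun=> 1 : R) p by exact: ler01.
have i1 (p : BM) : (fun=> 1 : R) p <= 1 by exact: lexx.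
have K0 : 0 < C + 1 by rewrite ltr_wpDl.
have dfin := dens_fin M_compact g m1 i0 i1.
have := @mu1_ge R n M M_compact S g _ _ 1 m1 i0 m1 i0 i1 i1 (C + 1) K0 (fun=> ltr01).
move=> H; apply: le_trans (H _).
  by rewrite lee_fin divr_ge0// ?fine_ge0// mulr_ge0// ltW.
move=> phi sphi; have mphi := measurable_smooth sphi.
have hw (x y : BM) : 1 * 1 <= 1 * (\1_(setT : set BM) x * \1_(setT : set BM) y) + 0 :> R.
  by rewrite !indicT /= !mulr1 addr0.
apply: le_trans (weighted_dint (m := volume g) (volume_fin M_compact g) dfin m1 i0
  (ge0_integral_densT (volume g) m1 i0) measurableT ler01 (lexx 0) mphi hw) _.
rewrite mul0e adde0 mul1e; apply: le_trans (hC phi sphi) _.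
have -> : (\int[volume g]_p (sqnorm g (gradient g phi) p * 1)%:E = energy g phi)%E.
  by apply: eq_integral => p _; rewrite mulr1.
apply: lee_wpmul2r; last by rewrite lee_fin lerDl.
by apply: integral_ge0 => p _; rewrite lee_fin sqnorm_ge0.
Qed.

Hypothesis n_ge2 : (2 <= n)%N.

(** One family of metrics serves both claims, with the smaller of the two lower bounds as A. The
    base metric, the bottleneck, the ball for rho and the Poincare constants are all fixed before
    e. *)
Lemma small_lambda1_metric : exists2 A : R, 0 < A &
  forall e, 0 < e -> exists G : metric S,
  [/\ volume G [set: M] = 1%E, (lambda_k G 1 <= e%:E)%E,
      (A%:E <= mu_star G 1)%E & (A%:E <= mu_star2 G 1)%E].
Proof.
have [g] := metric_exists M_hausdorff M_compact S.
have [c [Sc cp]] := charts_cover S point.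
have [h [k [P0 [P1 [[sh sk k02] [oP0 oP1 nP0 nP1] hP0 hP1 neck]]]]] :=
  bottleneck_exists M_hausdorff (ltnW n_ge2) Sc cp.
have [C3 [R1 [C4 [r0 [[C30 C40 r00] fam]]]]] :=
  warped_metric n_ge2 M_compact g sh sk k02 oP0 oP1 nP0 nP1 hP0 hP1 neck.
have [CP CP0 poin] := global_poincare M_compact g M_connected.
have [p1 P1p] := nP1.
have [A [CA [oA Ap AP1 CA0 poinA]]] := poincare_nbhd M_compact g oP1 P1p.
have [c1 [Sc1 c1p]] := charts_cover S p1.
have [b [sb b01 bp bA _]] := bump_exists M_hausdorff Sc1 c1p oA Ap.
have b0 q : 0 <= b q by have /andP[] := b01 q.
have fing := volume_fin M_compact g.
have mb : measurable_fun [set: BM] (b : BM -> R) by exact: measurable_smooth sb.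
have cb := smooth_fun_continuous sb.
(* [b] exceeds [b p1 / 2] on an open set, so it has a positive integral *)
pose O := [set q : M | b p1 / 2 < b q].
have oO : open O by have := (continuousP _).1 cb _ (@open_gt _ (b p1 / 2)); apply.
have Op1 : O p1 by rewrite /O /= ltr_pdivrMr// ltr_pMr// ltr1n.
have mO : measurable (O : set BM) by exact: borel_open.
pose vO := fine (volume g (O : set BM)).
have fO : volume g (O : set BM) = vO%:E by rewrite /vO fineK// fin_meas.
have vOp : 0 < vO by rewrite -lte_fin -fO; exact: (volume_open_gt0 M_compact g oO Op1).
pose beta := b p1 / 2 * vO.
have beta0 : 0 < beta by rewrite mulr_gt0// divr_gt0.
have bbeta : (beta%:E <= \int[volume g]_p (b p)%:E)%E.
  rewrite /beta EFinM -fO.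
  have E : (\int[volume g]_(p in (O : set BM)) (b p1 / 2)%:E = (b p1 / 2)%:E * volume g (O : set BM))%E :=
    integral_cst (volume g) mO (b p1 / 2)%:E.
  rewrite -E; apply: le_trans (@integral_subset _ BM _ (volume g) O setT _ _ _) => //; last first.
    by move=> q _; rewrite lee_fin.
  apply: integral_mono => q Oq; rewrite lee_fin; last exact: ltW.
  by rewrite divr_ge0// ltW.
have V00 : 0 <= fine (volume g [set: M]) by exact: fine_ge0.
have R10 : 0 <= R1.
  (* The sign of R1 follows from the member eta = 1 of the family, as R1 bounds a positive
     function. *)
  have h1 : 0 < 1 :> R by []. have [|G [r [w [[_ rp rl _ _] _ _ _ _]]]] := fam 1.
    by rewrite ltr01 lexx.
  exact: le_trans (ltW (rp p1)) (rl p1).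
have R12 : 0 <= R1 ^+ 2 by rewrite sqr_ge0.
have C40' := ltW C40. have r00' := ltW r00.
pose A1 := (2 * ((r0 * beta)^-1 ^+ 2 * (R1 ^+ 2 * CA * C4 / r0 + 3 * R1 ^+ 2 * CP * C4) + 1))^-1.
pose A2 := (2 * (R1 ^+ 2 * CP * C4 * fine (volume g [set: M]) + 1))^-1.
have A1p : 0 < A1.
  have t1 : 0 <= R1 ^+ 2 * CA * C4 / r0 by rewrite divr_ge0// !mulr_ge0.
  have t2 : 0 <= 3 * R1 ^+ 2 * CP * C4 by rewrite !mulr_ge0.
  rewrite invr_gt0 mulr_gt0// ltr_wpDl// mulr_ge0 ?sqr_ge0//.
  by rewrite addr_ge0.
have A2p : 0 < A2.
  rewrite invr_gt0 mulr_gt0// ltr_wpDl// mulr_ge0 ?V00//.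
  by rewrite !mulr_ge0.
exists (Num.min A1 A2); first by rewrite lt_min A1p.
(* Then C3 eta <= e; C3 + 1 avoids dividing by a possibly vanishing C3, and the minimum keeps eta in
   the range of the family. *)
move=> e e0; pose eta := Num.min 1 (e / (C3 + 1)).
have C31 : 0 < C3 + 1 by rewrite ltr_wpDl.
have eta01 : 0 < eta <= 1.
  by rewrite lt_min ltr01 divr_gt0//= ge_min lexx.
have [G [r [w [[cr rp rl rP1 [w0 wr]] rE gG vG lG]]]] := fam eta eta01.
exists G; split => //.
- apply: le_trans lG _; rewrite lee_fin.
  apply: (@le_trans _ _ ((C3 + 1) * (e / (C3 + 1)))); last by rewrite mulrC divfK// gt_eqF.
  apply: ler_pM => //; first by have /andP[/ltW] := eta01.
    by rewrite lerDl.
  by rewrite ge_min lexx orbT.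
- apply: (@le_trans _ _ A1%:E); first by rewrite lee_fin ge_min lexx.
  have mA : measurable (A : set BM) by exact: borel_open.
  apply: (@mu_star_ge R n M M_compact S g G r R1 C4 CP cr rp rl rE C40 CP0 gG poin vG
    A b CA r0 beta w mA sb b01 bA CA0 r00 beta0 w0 poinA _ wr bbeta).
  by move=> p /AP1; exact: rP1.
- apply: (@le_trans _ _ A2%:E); first by rewrite lee_fin ge_min lexx orbT.
  exact: (@mu_star2_ge R n M M_compact S g G r R1 C4 CP cr rp rl rE C40 CP0 gG poin vG).
Qed.

End Family.

Theorem proposition5p2 (R : realType) (n : nat) (n_ge2 : (2 <= n)%N)
    (M : ptopologicalType) (M_hausdorff : hausdorff_space M)
    (M_compact : compact [set: M]) (M_connected : connected [set: M])
    (S : atlas R n M) :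
  (exists (g : R -> metric S) (A : R), 0 < A /\
    forall e : R, 0 < e < 1 ->
      [/\ volume (g e) [set: M] = 1%E,
          (lambda_k (g e) 1 <= e%:E)%E &
          (A%:E <= mu_star (g e) 1)%E]) /\
  (exists (g : R -> metric S) (A : R), 0 < A /\
    [/\ forall e : R, 0 < e < 1 -> volume (g e) [set: M] = 1%E,
        lambda_k (g e) 1 @[e --> 0^'+] --> 0%E &
        forall e : R, 0 < e < 1 -> (A%:E <= mu_star2 (g e) 1)%E]).
Proof.
have [A A0 fam] := small_lambda1_metric M_hausdorff M_compact M_connected S n_ge2.
have [g0] := metric_exists M_hausdorff M_compact S.
(* A family indexed by all reals is required; for e <= 0, where nothing is claimed, it takes the
   value g0. *)
have [e|g hg] := @choice R (metric S) (fun e G => 0 < e ->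
    [/\ volume G [set: M] = 1%E, (lambda_k G 1 <= e%:E)%E,
      (A%:E <= mu_star G 1)%E & (A%:E <= mu_star2 G 1)%E]).
  by have [/fam[G hG]|_] := ltP 0 e; [exists G|exists g0].
split; exists g, A; split => //.
  by move=> e /andP[/hg[]].
split; [by move=> e /andP[/hg[]]| |by move=> e /andP[/hg[]]].
apply: (@squeeze_cvge _ _ _ _ (cst 0%E) _ (fun e : R => e%:E)).
- near=> e; have e0 : 0 < e by near: e; exact: nbhs_right_gt.
  by rewrite lambda1_ge0//=; have [] := hg e e0.
- exact: cvg_cst.
- by apply: cvg_EFin; [exact: nearW|exact: cvg_at_right_filter cvg_id].
Unshelve. all: by end_near. Qed.
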